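(* There exist smooth strongly polyconvex functions $F\colon\mathbb M^{2\times 2}\to\mathbb R$ (of the form $F(A)=\frac{\nu}{2}|A|^2+G(A,\det A)$ with $\nu>0$ and $G\colon\mathbb M^{2\times2}\times\mathbb R\to\mathbb R$ convex) with the following property. Let $\Omega\subset\mathbb R^2$ be a bounded domain and $T>0$. For every $\phi\in C^1_0(\Omega;\mathbb R^2)$ there is $\epsilon_0>0$ such that for every $\epsilon$ with $|\epsilon|<\epsilon_0$ the initial-boundary value problem $$\partial_t u=\operatorname{div} DF(Du)\ \text{ in }\Omega_T,\qquad u|_{\partial'\Omega_T}=0$$ possesses infinitely many Lipschitz weak solutions $u\colon\Omega_T\to\mathbb R^2$ satisfying $u(x,T)=\epsilon\phi(x)$ for $x\in\Omega$ and such that $Du$ is continuous at no point of $\Omega_T$.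
   Context: $\mathbb M^{2\times 2}$ is the space of real $2\times 2$ matrices with inner product $A:B=\operatorname{tr}(A^TB)$ and norm $|A|$. For $F\in C^1$, $DF(A)=(\partial F(A)/\partial A^i_k)$. $\Omega_T=\Omega\times(0,T)$ and $\partial'\Omega_T=(\Omega\times\{0\})\cup(\partial\Omega\times(0,T))$ is the parabolic boundary. For $u\colon\Omega_T\to\mathbb R^2$, $Du=(\partial u^i/\partial x_k)$ is the spatial Jacobian and for a matrix field $w$, $(\operatorname{div} w)^i=\sum_{k}\partial w^i_k/\partial x_k$. A Lipschitz function $u\colon\Omega_T\to\mathbb R^2$ is a weak solution of $\partial_t u=\operatorname{div}DF(Du)$ if $$\int_\Omega (u\cdot\varphi)\big|_{t=0}^{t=T}\,dx=\int_{\Omega_T}\big(u\cdot\partial_t\varphi-DF(Du):D\varphi\big)\,dx\,dt$$ for all $\varphi\in C^1([0,T];C^\infty_c(\Omega;\mathbb R^2))$, with $u(\cdot,0),u(\cdot,T)$ taken in the trace sense; the boundary condition $u|_{\partial'\Omega_T}=0$ is in the trace sense. *)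

(* Defs.v *)
From HB Require Import structures.
From mathcomp Require Import all_boot all_order all_algebra.
From mathcomp Require Import all_classical all_reals all_analysis.
Set Implicit Arguments. Unset Strict Implicit. Unset Printing Implicit Defensive.
Import Order.TTheory GRing.Theory Num.Theory.
Import numFieldNormedType.Exports.
Local Open Scope classical_set_scope.
Local Open Scope ring_scope.

Section Defs.
Variable R : realType.

Definition leb2 := ((@lebesgue_measure R) \x (@lebesgue_measure R))%E.
Definition leb3 := (leb2 \x (@lebesgue_measure R))%E.

Fixpoint iter_deriv (V W : normedModType R) (f : V -> W) (vs : seq V)
  : V -> W :=
  match vs with
  | [::] => f
  | v :: vs' => fun x => 'D_v (iter_deriv f vs') x
  end.

Definition smooth (V W : normedModType R) (f : V -> W) : Prop :=
  forall vs : seq V, continuous (iter_deriv f vs) /\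
    forall (v x : V), derivable (iter_deriv f vs) x v.

Definition convex_fun2 (G : 'M[R]_2 -> R -> R) : Prop :=
  forall (A B : 'M[R]_2) (s t l : R), 0 <= l <= 1 ->
    G (l *: A + (1 - l) *: B) (l * s + (1 - l) * t)
      <= l * G A s + (1 - l) * G B t.

Definition frob2 (A : 'M[R]_2) : R := \tr (A^T *m A).

Definition strongly_polyconvex (F : 'M[R]_2 -> R) : Prop :=
  exists nu : R, 0 < nu /\ exists G : 'M[R]_2 -> R -> R,
    convex_fun2 G /\ forall A, F A = nu / 2 * frob2 A + G A (\det A).

Definition DF (F : 'M[R]_2 -> R) (A : 'M[R]_2) : 'M[R]_2 :=
  \matrix_(i < 2, k < 2) 'D_(delta_mx i k) F A.

Definition mdot (A B : 'M[R]_2) : R := \tr (A^T *m B).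

Definition bounded_domain (Om : set (R * R)) : Prop :=
  open Om /\ connected Om /\ Om !=set0 /\
  exists M : R, forall x, Om x -> `|x.1| <= M /\ `|x.2| <= M.

Definition e2 (k : 'I_2) : R * R := if k == ord0 then (1, 0) else (0, 1).

Definition C1_0 (Om : set (R * R)) (phi : R * R -> 'rV[R]_2) : Prop :=
  continuous phi /\
  (forall k : 'I_2, (forall x, derivable phi x (e2 k)) /\
       continuous (fun x => 'D_(e2 k) phi x)) /\
  exists K : set (R * R), compact K /\ K `<=` Om /\
    forall x, ~ K x -> phi x = 0.

Definition OmT (Om : set (R * R)) (T : R) : set ((R * R) * R) :=
  [set z | Om z.1 /\ 0 < z.2 < T].

Definition ex (k : 'I_2) : (R * R) * R := (e2 k, 0).
Definition et : (R * R) * R := (0, 1).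

Definition Dx (u : (R * R) * R -> 'rV[R]_2) (z : (R * R) * R) : 'M[R]_2 :=
  \matrix_(i < 2, k < 2) 'D_(ex k) (fun w => u w 0 i) z.

Definition dotv (a b : 'rV[R]_2) : R := \sum_(i < 2) a 0 i * b 0 i.

(* test functions phi in C^1([0,T]; C_c^infty(Omega; R^2)), realised as
   functions on R^2 x R: every spatial derivative d_x^alpha phi exists, is
   continuous, is differentiable in t with continuous t-derivative, and
   phi(., t) vanishes outside a fixed compact K of Omega for t in [0,T]. *)
Definition test_fun (Om : set (R * R)) (T : R)
    (phi : (R * R) * R -> 'rV[R]_2) : Prop :=
  (forall ks : seq 'I_2,
     let psi := iter_deriv phi (map ex ks) in
     continuous psi /\
     (forall k z, derivable psi z (ex k)) /\
     (forall z, derivable psi z et) /\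
     continuous (fun z => 'D_et psi z)) /\
  exists K : set (R * R), compact K /\ K `<=` Om /\
    forall z, ~ K z.1 -> 0 <= z.2 <= T -> phi z = 0.

Definition lipschitz_on (A : set ((R * R) * R)) (u : (R * R) * R -> 'rV[R]_2)
  : Prop :=
  exists L : R, forall z w, A z -> A w -> `|u z - u w| <= L * `|z - w|.

(* A Lipschitz weak solution of  u_t = div DF(Du)  in Omega_T.  The function
   u is given on the closure of Omega_T (a Lipschitz function on Omega_T has a
   unique Lipschitz extension to the closure; its values on the boundary are
   the traces). *)
Definition lip_weak_solution (F : 'M[R]_2 -> R) (Om : set (R * R)) (T : R)
    (u : (R * R) * R -> 'rV[R]_2) : Prop :=
  lipschitz_on (closure (OmT Om T)) u /\
  forall phi, test_fun Om T phi ->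
    ((\int[leb2]_(x in Om) (dotv (u (x, T)) (phi (x, T)))%:E)
     - (\int[leb2]_(x in Om) (dotv (u (x, 0)) (phi (x, 0)))%:E))%E
    = (\int[leb3]_(z in OmT Om T)
          (dotv (u z) ('D_et phi z) - mdot (DF F (Dx u z)) (Dx (fun w => phi w) z))%:E)%E.

Definition zero_on_parabolic_boundary (Om : set (R * R)) (T : R)
    (u : (R * R) * R -> 'rV[R]_2) : Prop :=
  (forall x, Om x -> u (x, 0) = 0) /\
  (forall x t, (closure Om `\` Om) x -> 0 < t < T -> u (x, t) = 0).

Definition Du_nowhere_continuous (Om : set (R * R)) (T : R)
    (u : (R * R) * R -> 'rV[R]_2) : Prop :=
  forall g : (R * R) * R -> 'M[R]_2,
    {ae leb3, forall z, OmT Om T z -> g z = Dx u z} ->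
    forall z, OmT Om T z -> ~ {for z, continuous g}.

End Defs.

(* Main.v *)
(** The equation is solved by convex integration.  Put [q] for the primitive of [u_t] in [x_2] and look for a
    pair [(u, eta)]; with [A = Du] and [N = D eta + q (x) e_1], rotating the rows of [N] by a quarter turn gives
    a matrix [sigma] with [div sigma = u_t], so [u] is a weak solution as soon as [sigma = DF(A)] almost
    everywhere.

    [F] is chosen so that [DF(A) = 8 A + B_i] near five matrices [X_i] which, together with the values of [DF],
    form a T_5 configuration.  Since [tau = sigma - 8 A] is then constant on each piece of the graph of [DF],
    from every state there is, for every direction, a wave-cone segment ending on a given piece; the loop of
    five segments survives perturbations (a contraction argument) and sweeps out an open set [U] of states.
    Polyconvexity is achieved by taking a smooth maximum of five functions, affine in [(A, det A)] up to a
    truncated quadratic; the strict separation of the affine parts at the [X_i] is a finite list of rational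
    inequalities.

    Every state of [U] splits along a wave-cone direction into states of [U] closer to the graph.  Laying
    such splittings on a fine grid of cells changes [(u, eta)] arbitrarily little and increases the energy
    [int |d_2 (u, eta)|^2] by a fixed proportion of the distance to the graph; as the energy is bounded, the
    gradients converge in L^1 and the limit lies on the graph.  The averages of the barycentric coordinates
    of [tau] over boxes hardly change in the limit and stay below 1, so [Du] cannot stay near a single [X_i],
    which would be forced by continuity at a point. *)

Require Import Defs.
From HB Require Import structures.
From mathcomp Require Import all_boot all_order all_algebra.
From mathcomp Require Import all_classical all_reals all_analysis.
From mathcomp Require Import measurable_realfun ring lra zify.
Set Implicit Arguments. Unset Strict Implicit. Unset Printing Implicit Defensive.
Import Order.TTheory GRing.Theory Num.Theory.
Import numFieldNormedType.Exports.
Local Open Scope classical_set_scope.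
Local Open Scope ring_scope.

(** * Product measures and C^1 functions *)

(** The obstacle is that [q] is a line integral of the time derivative, hence nonlocal. It is tamed
    by keeping the time derivatives of all perturbations uniformly small: they oscillate in space
    alone, time is a parameter, a state is a 4 x 2 matrix, and the wave cone consists of products of
    a column [a] with a row [(t, 1)]. The entry 1 is why the energy may look at the second column
    only, the one to which [q] does not contribute. A segment towards a given piece exists for every
    direction because, along the wave cone, [A] moves parallel to [(t, 1)] and [sigma] orthogonally
    to it: a prescribed change of [tau] splits uniquely into these two parts. Closing the loop in
    [A] is then four equations for five slopes. With one slope frozen, the loop is fixed by five
    weights up to a factor; together with a translation of [A] this gives 4 + 4 parameters, the
    dimension of the space of states. Both the L^1 size of a perturbation and the distance to the
    graph are bounded linearly by the variance [p * (1 - p)] of the splittings, which the energy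
    gain controls. A bounded energy thus makes both summable, and convergence is obtained
    directly. *)

Notation mu1 := (@lebesgue_measure _).
Notation mu2 R := ((@lebesgue_measure R) \x (@lebesgue_measure R))%E.
Notation mu3 R := ((@lebesgue_measure R \x @lebesgue_measure R) \x @lebesgue_measure R)%E.

Section product_measurability.
Context {R : realType}.
Notation mR := (measurableTypeR R).
Notation Z := ((R * R) * R)%type.

(** The product sigma-algebra is generated by rectangles, so an open set is exhausted by countably
    many of them: the squares with rational centre and radius that it contains. *)
Lemma open_measurable2 (A : set (R * R)) : open A -> measurable (A : set (mR * mR)).
Proof.
move=> oA.
pose F (q : rat * rat * rat) : set (mR * mR) :=
  if pselect (ball (ratr q.1.1 : R) (ratr q.2) `*` ball (ratr q.1.2 : R) (ratr q.2) `<=` A)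
  then ball (ratr q.1.1 : R) (ratr q.2) `*` ball (ratr q.1.2 : R) (ratr q.2) else set0.
have -> : A = \bigcup_q F q.
  apply/seteqP; split => [x Ax|x [q _]]; last first.
    by rewrite /F; case: pselect => //= sub /sub.
  have : nbhs x A by rewrite nbhsE; exists A.
  move/nbhs_ballP => [e /= e0 be].
  have e4 : 0 < e / 4 by rewrite divr_gt0.
  have [r /[!in_itv]/= /andP[r1 r2]] := @rat_in_itvoo R (e/4) (e/2) ltac:(lra).
  have [p /[!in_itv]/= /andP[p1 p2]] := @rat_in_itvoo R (x.1 - e/4) (x.1 + e/4) ltac:(lra).
  have [q /[!in_itv]/= /andP[q1 q2]] := @rat_in_itvoo R (x.2 - e/4) (x.2 + e/4) ltac:(lra).
  exists ((p, q), r) => //; rewrite /F /=.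
  have Bx : (ball (ratr p : R) (ratr r) `*` ball (ratr q : R) (ratr r)) x.
    split; rewrite /ball/= ltr_norml; lra.
  case: pselect => //; case=> y [] y1 y2; apply: be.
  move: y1 y2; rewrite /ball/= !ltr_norml => y1 y2.
  by split; rewrite /ball /= ltr_norml; lra.
apply: countable_bigcupT_measurable => [|q]; first exact: countableP.
rewrite /F; case: pselect => [sub|sub] /=; last exact: measurable0.
by apply: measurableX; exact: measurable_ball.
Qed.

Lemma open_measurable3 (A : set Z) : open A -> measurable (A : set ((mR * mR) * mR)).
Proof.
move=> oA.
pose F (q : rat * rat * rat * rat) : set ((mR * mR) * mR) :=
  let B := ball ((ratr q.1.1.1 : R), (ratr q.1.1.2 : R)) (ratr q.2) `*` ball (ratr q.1.2 : R) (ratr q.2) in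
  if pselect (B `<=` A) then B else set0.
have -> : A = \bigcup_q F q.
  apply/seteqP; split => [x Ax|x [q _]]; last first.
    by rewrite /F; case: pselect => //= sub /sub.
  have : nbhs x A by rewrite nbhsE; exists A.
  move/nbhs_ballP => [e /= e0 be].
  have e4 : 0 < e / 4 by rewrite divr_gt0.
  have [r /[!in_itv]/= /andP[r1 r2]] := @rat_in_itvoo R (e/4) (e/2) ltac:(lra).
  have [p /[!in_itv]/= /andP[p1 p2]] := @rat_in_itvoo R (x.1.1 - e/4) (x.1.1 + e/4) ltac:(lra).
  have [q /[!in_itv]/= /andP[q1 q2]] := @rat_in_itvoo R (x.1.2 - e/4) (x.1.2 + e/4) ltac:(lra).
  have [s /[!in_itv]/= /andP[s1 s2]] := @rat_in_itvoo R (x.2 - e/4) (x.2 + e/4) ltac:(lra).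
  exists (((p, q), s), r) => //; rewrite /F /=.
  have Bx : (ball ((ratr p : R), (ratr q : R)) (ratr r) `*` ball (ratr s : R) (ratr r)) x.
    by split; [split; rewrite /ball/= ltr_norml; lra|rewrite /ball/= ltr_norml; lra].
  case: pselect => //; case=> y [] [] y1 y2 y3; apply: be.
  move: y1 y2 y3; rewrite /ball/= !ltr_norml => y1 y2 y3.
  by split; [split|]; rewrite /ball /= ltr_norml; lra.
apply: countable_bigcupT_measurable => [|q]; first exact: countableP.
rewrite /F; case: pselect => [sub|sub] /=; last exact: measurable0.
by apply: measurableX; [apply: open_measurable2; exact: ball_open|exact: measurable_ball].
Qed.

Lemma continuous_measurable2 (f : R * R -> R) : continuous f ->
  measurable_fun [set: mR * mR] (f : mR * mR -> mR).
Proof.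
move=> /continuousP cf; apply: (measurability _ (RGenOpens.measurableE R)).
move=> _ [_ [a [b ->] <-]]; rewrite setTI; apply: open_measurable2.
by apply: cf; exact: interval_open.
Qed.

Lemma continuous_measurable3 (f : Z -> R) : continuous f ->
  measurable_fun [set: (mR * mR) * mR] (f : (mR * mR) * mR -> mR).
Proof.
move=> /continuousP cf; apply: (measurability _ (RGenOpens.measurableE R)).
move=> _ [_ [a [b ->] <-]]; rewrite setTI; apply: open_measurable3.
by apply: cf; exact: interval_open.
Qed.

End product_measurability.

Section fubini_rectangle.
Context d1 d2 (T1 : measurableType d1) (T2 : measurableType d2) {R : realType}.
Variable m1 : {sigma_finite_measure set T1 -> \bar R}.
Variable m2 : {sigma_finite_measure set T2 -> \bar R}.
Variables (A : set T1) (B : set T2).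
Hypotheses (mA : measurable A) (mB : measurable B).
Variable f : T1 * T2 -> \bar R.
Hypothesis fi : ((m1 \x m2)%E).-integrable (A `*` B) f.
Local Open Scope ereal_scope.

Lemma integral_setX12 :
  \int[(m1 \x m2)%E]_(z in A `*` B) f z = \int[m1]_(x in A) \int[m2]_(y in B) f (x, y).
Proof.
have mAB : measurable (A `*` B) by exact: measurableX.
rewrite [LHS]integral_mkcond -integral12_prod_meas1; last by apply/(integrable_mkcond _ mAB).
rewrite [RHS]integral_mkcond; apply: eq_integral => x _.
rewrite /fubini_F patchE; case: ifPn => [xA|xA].
  rewrite [RHS]integral_mkcond; apply: eq_integral => y _; rewrite !patchE.
  by rewrite in_setX xA.
by apply: integral0_eq => y _; rewrite patchE in_setX (negbTE xA).
Qed.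

Lemma integral_setX21 :
  \int[(m1 \x m2)%E]_(z in A `*` B) f z = \int[m2]_(y in B) \int[m1]_(x in A) f (x, y).
Proof.
have mAB : measurable (A `*` B) by exact: measurableX.
rewrite [LHS]integral_mkcond -integral21_prod_meas1; last by apply/(integrable_mkcond _ mAB).
rewrite [RHS]integral_mkcond; apply: eq_integral => y _.
rewrite /fubini_G patchE; case: ifPn => [yB|yB].
  rewrite [RHS]integral_mkcond; apply: eq_integral => x _; rewrite !patchE.
  by rewrite in_setX yB andbT.
by apply: integral0_eq => x _; rewrite patchE in_setX (negbTE yB) andbF.
Qed.

End fubini_rectangle.

Section bounded_integrable.
Context d (T : measurableType d) {R : realType} (m : {measure set T -> \bar R}).

Lemma bounded_integrable (D : set T) (f : T -> R) (C : R) : measurable D ->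
  (m D < +oo)%E -> measurable_fun D f -> (forall z, D z -> `|f z| <= C) ->
  m.-integrable D (EFin \o f).
Proof.
move=> mD fD mf fC; apply: measurable_bounded_integrable => //.
by exists C; split; rewrite ?num_real// => y Cy z Dz; exact: le_trans (fC _ Dz) (ltW Cy).
Qed.

Lemma normr_Rintegral_le (D : set T) (f : T -> R) (C : R) : measurable D ->
  (m D < +oo)%E -> measurable_fun D f -> (forall z, D z -> `|f z| <= C) ->
  `|\int[m]_(z in D) f z| <= C * fine (m D).
Proof.
move=> mD fD mf fC.
have fi := bounded_integrable mD fD mf fC.
rewrite (le_trans (le_normr_Rintegral mD fi))//.
rewrite -Rintegral_cst//; apply: le_Rintegral => //=.
- exact: integrable_norm fi.
- apply: (@bounded_integrable _ _ `|C|) => // z _.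
Qed.
End bounded_integrable.

Lemma continuous_pairf (T U V : topologicalType) (f : T -> U) (g : T -> V) (x : T) :
  {for x, continuous f} -> {for x, continuous g} -> {for x, continuous (fun y => (f y, g y))}.
Proof. by move=> cf cg; apply: (cvg_pair cf cg). Qed.

(** * Coordinate lines and partial derivatives *)

Section partial_derivatives.
Context {R : realType}.
Notation Z := ((R * R) * R)%type.

Definition dir (k : 'I_3) : Z :=
  if k == 0 :> nat then ((1, 0), 0) else if k == 1 :> nat then ((0, 1), 0) else ((0, 0), 1).

Definition co (k : 'I_3) (z : Z) : R :=
  if k == 0 :> nat then z.1.1 else if k == 1 :> nat then z.1.2 else z.2.

Definition upd (k : 'I_3) (z : Z) (s : R) : Z :=
  if k == 0 :> nat then ((s, z.1.2), z.2) else
  if k == 1 :> nat then ((z.1.1, s), z.2) else (z.1, s).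

Lemma upd_co k z : upd k z (co k z) = z.
Proof. by case: z k => -[x y] t [[|[|[|//]]] ik]. Qed.

Lemma co_upd k z s : co k (upd k z s) = s.
Proof. by case: k => -[|[|[|//]]] ik. Qed.

Lemma Z_eq (z w : Z) : z.1.1 = w.1.1 -> z.1.2 = w.1.2 -> z.2 = w.2 -> z = w.
Proof. by case: z w => -[? ?] ? [[? ?] ?] /= -> -> ->. Qed.

Lemma updD k z s h : upd k z (h + s) = h *: dir k + upd k z s.
Proof.
rewrite /upd /dir; case: ifP => _; [|case: ifP => _];
by apply: Z_eq => /=; rewrite ?scaler0 ?add0r// [h *: _]mulr1.
Qed.

Lemma continuous_upd k z : continuous (upd k z).
Proof.
move=> s; case: k => -[|[|[|//]]] ik; rewrite /upd/=.
- apply: (@continuous_pairf _ _ _ (fun r : R => (r, z.1.2)) (fun=> z.2)); last exact: cvg_cst.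
  by apply: (@continuous_pairf _ _ _ (fun r : R => r) (fun=> z.1.2)); [exact: cvg_id|exact: cvg_cst].
- apply: (@continuous_pairf _ _ _ (fun r : R => (z.1.1, r)) (fun=> z.2)); last exact: cvg_cst.
  by apply: (@continuous_pairf _ _ _ (fun=> z.1.1) (fun r : R => r)); [exact: cvg_cst|exact: cvg_id].
- by apply: (@continuous_pairf _ _ _ (fun=> z.1) (fun r : R => r)); [exact: cvg_cst|exact: cvg_id].
Qed.

Lemma continuous_co k : continuous (co k).
Proof.
move=> z; case: k => -[|[|[|//]]] ik; rewrite /co/=.
- by apply: (@cvg_comp _ _ _ fst fst); [exact: cvg_fst|exact: cvg_fst].
- by apply: (@cvg_comp _ _ _ fst snd); [exact: cvg_fst|exact: cvg_snd].
- exact: cvg_snd.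
Qed.

(** By [updD] both difference quotients are the same function of the increment, so one-variable
    calculus applies on every coordinate line. *)
Lemma is_derive_upd k (f : Z -> R) z s d :
  is_derive (upd k z s) (dir k) f d <-> is_derive s 1 (fun r => f (upd k z r)) d.
Proof.
have E : (fun h : R => h^-1 *: (f (h *: dir k + upd k z s) - f (upd k z s))) =
         (fun h : R => h^-1 *: (f (upd k z (h *: 1 + s)) - f (upd k z s))).
  by apply/funext => h; rewrite -updD [h *: 1]mulr1.
have Ed : derivable f (upd k z s) (dir k) = derivable (fun r => f (upd k z r)) s 1.
  by rewrite /derivable /= E.
have ED : 'D_(dir k) f (upd k z s) = 'D_1 (fun r => f (upd k z r)) s.
  by rewrite /derive /= E.
by split => -[df <-]; apply: DeriveDef; [rewrite -Ed|rewrite ED|rewrite Ed|rewrite -ED].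
Qed.

Lemma derive_upd k (f : Z -> R) z s : derivable f (upd k z s) (dir k) ->
  is_derive s 1 (fun r => f (upd k z r)) ('D_(dir k) f (upd k z s)).
Proof. by move=> df; apply/is_derive_upd; exact: DeriveDef. Qed.

(** Partial derivatives along the three axes suffice, since all later arguments restrict to
    coordinate lines. *)
Definition C1 (f : Z -> R) := continuous f /\
  forall k, (forall z, derivable f z (dir k)) /\ continuous (fun z => 'D_(dir k) f z).

Lemma C1c f : C1 f -> continuous f. Proof. by case. Qed.
Lemma C1d f k z : C1 f -> derivable f z (dir k). Proof. by move=> [_ /(_ k)[]]. Qed.
Lemma C1Dc f k (Cf : C1 f) : continuous (fun z => 'D_(dir k) f z).
Proof. by case: Cf => _ /(_ k)[]. Qed.

Lemma C1P (f : Z -> R) (df : 'I_3 -> Z -> R) : continuous f ->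
  (forall k z, is_derive z (dir k) f (df k z)) -> (forall k, continuous (df k)) -> C1 f.
Proof.
move=> cf fd cdf; split=> // k; split=> [z|]; first by have [] := fd k z.
rewrite (_ : (fun z => _) = df k); first exact: cdf.
by apply/funext => z; have [_ ->] := fd k z.
Qed.

Lemma C1_is_derive f k z : C1 f -> is_derive z (dir k) f ('D_(dir k) f z).
Proof. by move=> Cf; apply: DeriveDef => //; exact: C1d. Qed.

Lemma C1_cst (c : R) : C1 (fun=> c).
Proof.
apply: (@C1P _ (fun _ _ => 0)); first exact: cst_continuous.
by move=> k; exact: cst_continuous.
Qed.

Lemma C1D f g : C1 f -> C1 g -> C1 (fun z => f z + g z).
Proof.
move=> Cf Cg; apply: (@C1P _ (fun k z => 'D_(dir k) f z + 'D_(dir k) g z)).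
- by move=> z; apply: cvgD; [exact: C1c|exact: C1c].
- by move=> k z; apply: is_deriveD; exact: C1_is_derive.
- by move=> k z; apply: cvgD; exact: C1Dc.
Qed.

Lemma C1M f g : C1 f -> C1 g -> C1 (fun z => f z * g z).
Proof.
move=> Cf Cg; apply: (@C1P _ (fun k z => f z *: 'D_(dir k) g z + g z *: 'D_(dir k) f z)).
- by move=> z; apply: cvgM; [exact: C1c|exact: C1c].
- by move=> k z; apply: is_deriveM; exact: C1_is_derive.
- by move=> k z; apply: cvgD; apply: cvgM; (try exact: C1c); exact: C1Dc.
Qed.

Lemma C1Z c f : C1 f -> C1 (fun z => c * f z).
Proof. by move=> Cf; apply: C1M => //; exact: C1_cst. Qed.

Lemma C1_sum (I : Type) (r : seq I) (P : pred I) (F : I -> Z -> R) :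
  (forall i, C1 (F i)) -> C1 (fun z => \sum_(i <- r | P i) F i z).
Proof.
move=> CF; elim: r => [|i r IH].
  by under [fun z => _]eq_fun do rewrite big_nil; exact: C1_cst.
under [fun z => _]eq_fun do rewrite big_cons.
by case: (P i) => //; exact: C1D.
Qed.

Lemma deriveDC1 f g k z : C1 f -> C1 g ->
  'D_(dir k) (fun z => f z + g z) z = 'D_(dir k) f z + 'D_(dir k) g z.
Proof. by move=> Cf Cg; rewrite (@deriveD _ _ _ f g)//; exact: C1d. Qed.

Lemma deriveMC1 f g k z : C1 f -> C1 g ->
  'D_(dir k) (fun z => f z * g z) z = f z * 'D_(dir k) g z + g z * 'D_(dir k) f z.
Proof. by move=> Cf Cg; rewrite (@deriveM _ _ f g)//; exact: C1d. Qed.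

Lemma deriveZC1 c f k z : C1 f ->
  'D_(dir k) (fun z => c * f z) z = c * 'D_(dir k) f z.
Proof.
move=> Cf; rewrite deriveMC1//; last exact: C1_cst.
by rewrite derive_cst mulr0 addr0.
Qed.

Lemma derive_sumC1 (I : Type) (r : seq I) (P : pred I) (F : I -> Z -> R) k z :
  (forall i, C1 (F i)) ->
  'D_(dir k) (fun z => \sum_(i <- r | P i) F i z) z = \sum_(i <- r | P i) 'D_(dir k) (F i) z.
Proof.
move=> CF; elim: r => [|i r IH].
  rewrite big_nil; under [fun z => _]eq_fun do rewrite big_nil; exact: derive_cst.
rewrite big_cons; under [fun z => _]eq_fun do rewrite big_cons.
case: (P i) => //; rewrite deriveDC1 ?IH//; exact: C1_sum.
Qed.

Definition lin (a : 'I_3 -> R) (z : Z) : R :=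
  a (@Ordinal 3 0 isT) * z.1.1 + a (@Ordinal 3 1 isT) * z.1.2 + a (@Ordinal 3 2 isT) * z.2.

Lemma continuous_lin a : continuous (lin a).
Proof.
move=> z; rewrite /lin; apply: cvgD; first apply: cvgD.
- by apply: cvgM; [exact: cvg_cst|exact: (@continuous_co (@Ordinal 3 0 isT))].
- by apply: cvgM; [exact: cvg_cst|exact: (@continuous_co (@Ordinal 3 1 isT))].
- by apply: cvgM; [exact: cvg_cst|exact: (@continuous_co (@Ordinal 3 2 isT))].
Qed.

Lemma lin_upd a k z s : lin a (upd k z s) = lin a z + a k * (s - co k z).
Proof.
rewrite /lin /upd /co.
case: k => -[|[|[|//]]] ik /=.
- by rewrite (_ : Ordinal ik = @Ordinal 3 0 isT); [ring|exact/val_inj].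
- by rewrite (_ : Ordinal ik = @Ordinal 3 1 isT); [ring|exact/val_inj].
- by rewrite (_ : Ordinal ik = @Ordinal 3 2 isT); [ring|exact/val_inj].
Qed.

Lemma is_derive_lin (h h' : R -> R) a k z :
  (forall s : R, is_derive s 1 h (h' s)) ->
  is_derive z (dir k) (fun z => h (lin a z)) (a k * h' (lin a z)).
Proof.
move=> dh; rewrite -{1}(upd_co k z); apply/is_derive_upd.
have -> : (fun r => h (lin a (upd k z r))) = h \o (fun r => lin a z + a k * (r - co k z)).
  by apply/funext => r /=; rewrite lin_upd.
have dl : is_derive (co k z) 1 (fun r => lin a z + a k * (r - co k z)) (a k).
  by apply: is_derive_eq; rewrite !(scale0r, addr0, add0r, oppr0, scaler0) ?[_ *: 1]mulr1 mul1r.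
have := @is_derive1_comp R h (fun r => lin a z + a k * (r - co k z)) (co k z) (h' (lin a z)) (a k).
rewrite subrr mulr0 addr0 mulrC; apply => //; exact: dh.
Qed.

Lemma C1_lin (h h' : R -> R) a : (forall s : R, is_derive s 1 h (h' s)) -> continuous h' ->
  C1 (fun z => h (lin a z)).
Proof.
move=> dh ch'.
have ch : continuous h.
  by move=> s; apply/differentiable_continuous/derivable1_diffP; have [] := dh s.
apply: (@C1P _ (fun k z => a k * h' (lin a z))) => [z|k z|k z].
- exact: (continuous_comp (@continuous_lin a z) (ch _)).
- exact: is_derive_lin.
- apply: cvgM; first exact: cvg_cst.
  exact: (continuous_comp (@continuous_lin a z) (ch' _)).
Qed.

Lemma FTC_upd (f : Z -> R) k z (a b : R) : C1 f -> a <= b ->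
  \int[lebesgue_measure]_(s in `[a, b]) 'D_(dir k) f (upd k z s) = f (upd k z b) - f (upd k z a).
Proof.
move=> Cf; rewrite le_eqVlt => /predU1P[->|ab].
  by rewrite set_itv1 Rintegral_set1 subrr.
have dg (s : R) : is_derive s 1 (fun r => f (upd k z r)) ('D_(dir k) f (upd k z s)).
  by apply: derive_upd; exact: C1d.
have cg : continuous (fun r => f (upd k z r)).
  by move=> s; apply/differentiable_continuous/derivable1_diffP; have [] := dg s.
have cD : continuous (fun r : R => 'D_(dir k) f (upd k z r)).
  move=> r; apply: (@continuous_comp R Z R (upd k z) (fun w => 'D_(dir k) f w) r).
    exact: continuous_upd.
  exact: C1Dc.
rewrite /Rintegral (@continuous_FTC2 _ _ (fun r => f (upd k z r)))//.
- exact: continuous_subspaceT.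
- split => [s _||]; first by have [] := dg s.
  + by apply: cvg_at_right_filter; exact: cg.
  + by apply: cvg_at_left_filter; exact: cg.
- by move=> s _; rewrite derive1E; have [_ ->] := dg s.
Qed.

Lemma upd_lipschitz (f : Z -> R) k z (a b C : R) : (forall z, derivable f z (dir k)) ->
  (forall s, Num.min a b <= s <= Num.max a b -> `|'D_(dir k) f (upd k z s)| <= C) ->
  `|f (upd k z b) - f (upd k z a)| <= C * `|b - a|.
Proof.
move=> df.
wlog ab : a b / a < b => [H|].
  have [ab|ba|->] := ltgtP a b; first by move=> bnd; apply: H => // s; rewrite /Num.min /Num.max ab; exact: bnd.
    by move=> bnd; rewrite distrC [`|b - a|]distrC; apply: H => // s; rewrite /Num.min /Num.max ba; exact: bnd.
  by rewrite !subrr !normr0 mulr0.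
move=> bnd.
have dg (s : R) : is_derive s 1 (fun r => f (upd k z r)) ('D_(dir k) f (upd k z s)).
  exact: derive_upd.
have [c cab ->] := @MVT R (fun r => f (upd k z r)) (fun s => 'D_(dir k) f (upd k z s)) a b ab
  (fun s _ => dg s) (continuous_subspaceT (fun s => differentiable_continuous
    ((derivable1_diffP _ _).1 (@ex_derive _ _ _ _ _ _ _ (dg s))))).
rewrite normrM ler_wpM2r// bnd//.
by move: cab; rewrite in_itv/= /Num.min /Num.max ab => /andP[/ltW-> /ltW->].
Qed.

End partial_derivatives.

(** * One-dimensional profiles *)

Section one_dim.
Context {R : realType}.
Implicit Types (f F : R -> R) (s a b : R).

Lemma is_derive_continuous f f' : (forall s : R, is_derive s 1 f (f' s)) -> continuous f.
Proof. by move=> df s; apply/differentiable_continuous/derivable1_diffP; have [] := df s. Qed.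

Lemma is_derive_near f g (s d : R) : (\forall r \near s, f r = g r) ->
  is_derive s 1 g d -> is_derive s 1 f d.
Proof.
by move=> fg dg; apply: near_eq_is_derive dg; near do apply/esym. Unshelve. all: by end_near.
Qed.

Lemma derive_diff_cst f g : (forall s : R, is_derive s 1 f (g s)) ->
  forall a b, (forall r : R, a <= r <= b -> g r = 0) -> a <= b -> f a = f b.
Proof.
move=> df a b g0; rewrite le_eqVlt => /predU1P[->//|ab].
have [c cab] := @MVT R f g a b ab (fun s _ => df s) (continuous_subspaceT (is_derive_continuous df)).
rewrite g0 ?mul0r => [/eqP|]; first by rewrite subr_eq0 => /eqP.
by move: cab; rewrite in_itv/= => /andP[/ltW-> /ltW->].
Qed.

Lemma derive_lipschitz f g (C : R) : (forall s : R, is_derive s 1 f (g s)) ->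
  (forall s, `|g s| <= C) -> forall a b, `|f a - f b| <= C * `|a - b|.
Proof.
move=> df gC a b; wlog ab : a b / a < b => [H|].
  have [ab|ba|->] := ltgtP a b; [exact: H| |by rewrite !subrr !normr0 mulr0].
  by rewrite distrC [`|a - b|]distrC; exact: H.
have [c _ fab] := @MVT R f g a b ab (fun s _ => df s) (continuous_subspaceT (is_derive_continuous df)).
by rewrite distrC fab normrM [`|a - b|]distrC ler_wpM2r.
Qed.

Lemma antiderivative_left f a : continuous f -> (forall s, s <= a -> f s = 0) ->
  exists F, forall s : R, is_derive s 1 F (f s).
Proof.
move=> cf f0; pose F s := \int[lebesgue_measure]_(t in `[a - 1, s]) f t.
exists F => s; have [sa|sa] := ltP s a.
  rewrite f0; last exact: ltW.
  apply: (@is_derive_near _ (cst 0)).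
  near=> r; rewrite /F /= (@eq_Rintegral _ _ _ _ _ (cst 0)); first by rewrite Rintegral_cst ?mul0r.
  move=> t; rewrite inE/= in_itv/= => /andP[_ tr]; rewrite f0// (le_trans tr)//.
  by apply/ltW; near: r; exact: lt_nbhsl.
have as' : a - 1 < s by rewrite (lt_le_trans _ sa)// ltrBlDr ltrDl.
have fi : lebesgue_measure.-integrable `[a - 1, s + 1] (EFin \o f).
  apply: continuous_compact_integrable; first exact: segment_compact.
  exact: continuous_subspaceT.
have ss1 : s < s + 1 by rewrite ltrDl.
have [|dF FE] := @continuous_FTC1_closed R f (a - 1) s (s + 1) ss1 fi as'; first exact: cf.
by apply: DeriveDef; [exact: dF|rewrite -derive1E; exact: FE].
Unshelve. all: by end_near. Qed.

(** Integrating from a fixed left endpoint covers only functions that vanish far to the left. So [f]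
    is written as the constant [f 0] plus one part living on each half-line, and the negative part
    is reflected. *)
Lemma antiderivative f : continuous f -> exists F, forall s : R, is_derive s 1 F (f s).
Proof.
move=> cf.
have c1 : continuous (fun s => f (Num.max s 0) - f 0).
  move=> s; apply: cvgB; last exact: cvg_cst.
  apply: (@continuous_comp _ _ _ (fun s : R => Num.max s 0) f); last exact: cf.
  by apply: continuous_max; [exact: cvg_id|exact: cvg_cst].
have c2 : continuous (fun s => f (Num.min (- s) 0) - f 0).
  move=> s; apply: cvgB; last exact: cvg_cst.
  apply: (@continuous_comp _ _ _ (fun s : R => Num.min (- s) 0) f); last exact: cf.
  by apply: continuous_min; [exact: opp_continuous|exact: cvg_cst].
have [|F1 d1] := @antiderivative_left _ 0 c1.
  by move=> s s0; rewrite max_r// subrr.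
have [|F2 d2] := @antiderivative_left _ 0 c2.
  by move=> s s0; rewrite min_r ?subrr// oppr_ge0.
exists (fun s => F1 s - F2 (- s) + f 0 * s) => s.
have d3 : is_derive s 1 (fun r => F2 (- r)) (- (f (Num.min s 0) - f 0)).
  have := @is_derive1_comp R F2 (fun r => - r) s (f (Num.min s 0) - f 0) (-1).
  rewrite mulrN1; apply; by have := d2 (- s); rewrite opprK.
have := d1 s => d1s.
apply: is_derive_eq; rewrite /GRing.scale/=.
have [s0|s0] := leP s 0.
  by ring.
by ring.
Qed.

(** Distance from [y] to the nearest even integer: the triangle wave of period 2. *)
Definition tri (y : R) : R := `|y - 2 * (Num.floor ((y + 1) / 2))%:~R|.

Lemma tri_le y (n : int) : tri y <= `|y - 2 * n%:~R|.
Proof.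
rewrite /tri; set m := Num.floor _.
have /andP[] := real_floor_itv (num_real ((y + 1) / 2)); rewrite -/m intrD => m1 m2.
have tm : `|y - 2 * m%:~R| <= 1 by rewrite ler_norml; lra.
have [<-//|mn] := eqVneq m n.
have [nm|nm] := leP (n + 1) m.
  have : (n%:~R + 1 : R) <= m%:~R by rewrite (_ : _ + 1 = (n + 1)%:~R) ?ler_int// intrD.
  move=> nm'; rewrite (@ger0_norm _ (y - 2 * n%:~R)); first by rewrite ler_norml; lra.
  lra.
have : (m%:~R + 1 : R) <= n%:~R.
  by rewrite (_ : _ + 1 = (m + 1)%:~R) ?ler_int ?intrD//; move: mn nm; lia.
by move=> nm'; rewrite (@ler0_norm _ (y - 2 * n%:~R)); [rewrite ler_norml; lra|lra].
Qed.

Lemma tri_lip y y' : `|tri y - tri y'| <= `|y - y'|.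
Proof.
have H a b : tri a <= tri b + `|a - b|.
  rewrite (le_trans (tri_le a (Num.floor ((b + 1) / 2))))// /tri.
  set m := (Num.floor _)%:~R; have -> : a - 2 * m = (b - 2 * m) + (a - b) by ring.
  exact: ler_normD.
by rewrite ler_norml; have := H y y'; have := H y' y; rewrite (distrC y'); lra.
Qed.

Lemma continuous_tri : continuous tri.
Proof.
move=> y; apply/cvgrPdist_le => e e0; near=> y'.
by rewrite (le_trans (tri_lip _ _))//; near: y'; apply: cvgr_dist_le.
Unshelve. all: by end_near. Qed.

Lemma tri_id y : -1 <= y <= 1 -> tri y = `|y|.
Proof.
move=> y1; apply/eqP; rewrite eq_le; apply/andP; split.
  by have := tri_le y 0; rewrite mulr0 subr0.
rewrite /tri; set m := Num.floor _.
have [->|m0] := eqVneq m 0; first by rewrite mulr0 subr0.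
have [m1|m1] := ltP m 0.
  have : (m%:~R : R) <= -1 by rewrite (_ : -1 = (-1)%:~R) ?ler_int; [lia|rewrite rmorphN].
  by move=> ?; rewrite [leRHS]ger0_norm ?ler_norml; lra.
have : 1 <= (m%:~R : R) by rewrite (_ : 1 = 1%:~R)// ler_int; lia.
by move=> ?; rewrite [leRHS]ler0_norm ?ler_norml; lra.
Qed.

Lemma tri_per y (n : int) : tri (y + 2 * n%:~R) = tri y.
Proof.
have H a (k : int) : tri (a + 2 * k%:~R) <= tri a.
  rewrite (le_trans (tri_le _ (Num.floor ((a + 1) / 2) + k)))// /tri intrD.
  by rewrite (_ : _ - _ = a - 2 * (Num.floor ((a + 1) / 2))%:~R)//; ring.
apply/eqP; rewrite eq_le H/=.
have := H (y + 2 * n%:~R) (- n).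
by rewrite rmorphN/= mulrN addrK.
Qed.

(** Piecewise linear step, climbing from 0 to 1 on [[c, c + e]]. Composed with [tri] it gives a
    continuous periodic profile which takes the values 0 and 1 except on a fraction [e] of each
    period. *)
Definition ramp (c e v : R) : R := (Num.max (v - c) 0 - Num.max (v - c - e) 0) / e.

Lemma ramp01 c e v : 0 < e -> 0 <= ramp c e v <= 1.
Proof.
move=> e0; rewrite /ramp ler_pdivlMr// ler_pdivrMr// mul0r mul1r.
by have [|] := leP (v - c) 0; have [|] := leP (v - c - e) 0; lra.
Qed.

Lemma ramp1 c e v : 0 < e -> c + e <= v -> ramp c e v = 1.
Proof.
move=> e0 cv; rewrite /ramp !max_l; [|lra|lra].
by rewrite (_ : _ - _ = e) ?divff ?gt_eqF//; ring.
Qed.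

Lemma ramp0 c e v : v <= c -> 0 < e -> ramp c e v = 0.
Proof. by move=> cv e0; rewrite /ramp !max_r; [rewrite subrr mul0r|lra|lra]. Qed.

Lemma continuous_maxB (c : R) : continuous (fun y : R => Num.max (y - c) 0).
Proof.
move=> y; apply: (@continuous_max R R (fun y : R => y - c) (cst 0)); last exact: cvg_cst.
by apply: cvgB; [exact: cvg_id|exact: cvg_cst].
Qed.

Lemma continuous_ramp c e : continuous (ramp c e).
Proof.
have -> : ramp c e = (fun v => (Num.max (v - c) 0 - Num.max (v - (c + e)) 0) / e).
  by apply/funext => v; rewrite /ramp opprD addrA.
move=> v; apply: cvgM; last exact: cvg_cst.
by apply: cvgB; exact: continuous_maxB.
Qed.

Lemma is_derive_maxsq (s : R) : is_derive s 1 (fun r => Num.max r 0 ^+ 2) (2 * Num.max s 0).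
Proof.
have [s0|s0|->] := ltgtP s 0.
- rewrite mulr0; apply: (@is_derive_near _ (cst 0)).
  near=> r; rewrite max_r ?expr0n//=; apply/ltW; near: r; exact: lt_nbhsl.
- apply: (@is_derive_near _ (fun r => r * r)).
    near=> r; rewrite max_l ?expr2//; apply/ltW; near: r; exact: lt_nbhsr.
  by apply: is_derive_eq; rewrite /GRing.scale /=; ring.
- rewrite mulr0.
  have E0 : (fun h : R => h^-1 *: (Num.max (h *: (1 : R) + 0 : R) 0 ^+ 2 - Num.max (0 : R) 0 ^+ 2)) =
            (fun h => h^-1 * Num.max h 0 ^+ 2).
    by apply/funext => h; rewrite maxxx expr0n/= subr0 addr0 [h *: 1]mulr1.
  have E : (fun h : R => h^-1 *: (Num.max (h *: (1 : R) + 0 : R) 0 ^+ 2 - Num.max (0 : R) 0 ^+ 2)) @ 0^' --> (0 : R).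
    rewrite E0; apply/cvgrPdist_le => e e0; near=> h.
    rewrite sub0r normrN normrM normrX normfV.
    have h0 : h != 0 by near: h; exact: nbhs_dnbhs_neq.
    have : `|Num.max h 0| <= `|h| by rewrite /Num.max; case: ifP => _; rewrite ?normr0.
    move=> mh; rewrite ler_pdivrMl ?normr_gt0// expr2.
    rewrite (le_trans (ler_pM _ _ mh mh))// ler_wpM2l//.
    by near: h; exact: dnbhs0_le.
  by apply: DeriveDef; [apply/cvg_ex; exists 0|apply/cvg_lim].
Unshelve. all: by end_near. Qed.

Lemma is_derive_maxsqB (c s : R) :
  is_derive s 1 (fun r => Num.max (r - c) 0 ^+ 2) (2 * Num.max (s - c) 0).
Proof.
have := @is_derive1_comp R (fun r => Num.max r 0 ^+ 2) (fun r => r - c) s (2 * Num.max (s - c) 0) 1.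
rewrite mulr1; apply; first exact: is_derive_maxsq.
by apply: is_derive_eq; rewrite subr0.
Qed.

Definition ramp_prim (c e v : R) : R :=
  (2 * e)^-1 * (Num.max (v - c) 0 ^+ 2 - Num.max (v - (c + e)) 0 ^+ 2).

Lemma is_derive_ramp_prim c e (s : R) : 0 < e -> is_derive s 1 (ramp_prim c e) (ramp c e s).
Proof.
move=> e0; have := is_derive_maxsqB c s; have := is_derive_maxsqB (c + e) s => d1 d2.
apply: is_derive_eq; rewrite /ramp opprD addrA /GRing.scale/=.
by field; rewrite gt_eqF.
Qed.

(** The number [1 - c - e / 2] is the mean of [ramp c e] over [[0, 1]], hence of the even periodic
    function [ramp c e \o tri] over a period. Subtracting it makes the primitive periodic and
    therefore bounded. *)
Lemma ramp_tri_prim c e : 0 < e -> 0 <= c -> c + e <= 1 ->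
  exists2 F : R -> R, forall s : R, is_derive s 1 F (ramp c e (tri s) - (1 - c - e / 2)) &
  forall s, `|F s| <= 2.
Proof.
move=> e0 c0 ce1; set m := 1 - c - e / 2.
pose f s := ramp c e (tri s) - m.
have cf : continuous f.
  move=> s; apply: cvgB; last exact: cvg_cst.
  apply: (@continuous_comp _ _ _ tri (ramp c e)); first exact: continuous_tri.
  exact: continuous_ramp.
have [F0 dF0] := antiderivative cf.
pose F s := F0 s - F0 0.
have dF (s : R) : is_derive s 1 F (f s).
  by have := dF0 s => ?; apply: is_derive_eq; rewrite subr0.
have fb s : `|f s| <= 1.
  by rewrite /f ler_norml; have := ramp01 c (tri s) e0; rewrite /m; lra.
have g1 : ramp_prim c e 1 = m.
  by rewrite /ramp_prim !max_l; [rewrite /m; field; rewrite gt_eqF|lra|lra].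
have g0 : ramp_prim c e 0 = 0.
  by rewrite /ramp_prim !max_r; [rewrite subrr mulr0|lra|lra].
(* On [[0, 1]] [tri] is the identity, so [F] differs by a constant from [ramp_prim c e s - m * s],
   which is 0 at both ends. The interval [[-1, 0]] is handled by reflection. *)
have F1 : F 1 = F 0.
  have d (s : R) : is_derive s 1 (fun s => F s - (ramp_prim c e s - m * s)) (f s - (ramp c e s - m)).
    have := dF s; have := is_derive_ramp_prim c s e0 => ? ?.
    by apply: is_derive_eq; rewrite /GRing.scale/=; ring.
  have := derive_diff_cst d (a := 0) (b := 1).
  move=> /(_ _ ler01); rewrite g1 g0 !mulr0 !subr0 mulr1 subrr subr0; move=> -> // r r01.
  by rewrite /f tri_id ?ger0_norm ?subrr//; lra.
have FN1 : F (-1) = F 0.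
  have d (s : R) : is_derive s 1 (fun s => F s + (ramp_prim c e (- s) - m * (- s))) (f s - (ramp c e (- s) - m)).
    have := dF s; have := is_derive_ramp_prim c (- s) e0 => d1 d2.
    have d3 : is_derive s 1 (fun r => ramp_prim c e (- r)) (- ramp c e (- s)).
      have := @is_derive1_comp R (ramp_prim c e) (fun r => - r) s (ramp c e (- s)) (-1).
      by rewrite mulrN1; apply => //; apply: is_derive_eq.
    by apply: is_derive_eq; rewrite /GRing.scale/=; ring.
  have := derive_diff_cst d (a := -1) (b := 0).
  rewrite opprK oppr0 g1 g0 mulr1 !mulr0 subrr !subr0 !addr0; apply; last lra.
  by move=> r r01; rewrite /f tri_id ?ler0_norm ?subrr//; lra.
have Fper s (n : int) : F (s + 2 * n%:~R) = F s.
  have d (n' : int) (s' : R) : is_derive s' 1 (fun r => F (r + 2 * n'%:~R) - F r) 0.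
    have d1 : is_derive s' 1 (fun r => F (r + 2 * n'%:~R)) (f s').
      have := @is_derive1_comp R F (fun r => r + 2 * n'%:~R) s' (f s') 1.
      rewrite mulr1; apply; last by apply: is_derive_eq; rewrite addr0.
      by have := dF (s' + 2 * n'%:~R); rewrite /f tri_per.
    by have := dF s' => ?; apply: is_derive_eq; rewrite subrr.
  have cst' (n' : int) a b : F (a + 2 * n'%:~R) - F a = F (b + 2 * n'%:~R) - F b.
    wlog ab : a b / a <= b => [H|].
      by have [/H//|/ltW/H->] := leP a b.
    exact: (derive_diff_cst (d n') (fun _ _ => erefl) ab).
  have stp a : F (a + 2) = F a.
    have := cst' 1 a (-1); rewrite mulr1 FN1 (_ : -1 + 2 = 1) ?F1 ?subrr; [|lra].
    by move=> /eqP; rewrite subr_eq0 => /eqP.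
  have nn (k : nat) a : F (a + 2 * k%:R) = F a.
    elim: k => [|k IH]; first by rewrite mulr0 addr0.
    by rewrite (_ : a + _ = (a + 2 * k%:R) + 2) ?stp// -addn1 natrD; ring.
  case: n => k; first exact: nn.
  by rewrite NegzE rmorphN/= -(nn k.+1 (s + _)) mulrN subrK.
exists F => // s.
set n := Num.floor ((s + 1) / 2).
have /andP[] := real_floor_itv (num_real ((s + 1) / 2)); rewrite -/n intrD => n1 n2.
rewrite -(Fper s (- n)) rmorphN/= mulrN.
have := derive_lipschitz dF fb (s - 2 * n%:~R) 0.
rewrite /F subrr subr0 mul1r subr0 => /le_trans; apply.
by rewrite ler_norml; lra.
Qed.

(* A C^1 step, with second derivative 4 on ]0,1/2[ and -4 on ]1/2,1[. *)
Definition stp (y : R) : R :=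
  2 * (Num.max (y - 0) 0 ^+ 2) - 4 * (Num.max (y - 2^-1) 0 ^+ 2) + 2 * (Num.max (y - 1) 0 ^+ 2).
Definition stp' (y : R) : R :=
  4 * Num.max (y - 0) 0 - 8 * Num.max (y - 2^-1) 0 + 4 * Num.max (y - 1) 0.

Lemma is_derive_stp (s : R) : is_derive s 1 stp (stp' s).
Proof.
have := is_derive_maxsqB 0 s; have := is_derive_maxsqB 2^-1 s; have := is_derive_maxsqB 1 s => d1 d2 d3.
by apply: is_derive_eq; rewrite /stp' /GRing.scale/=; ring.
Qed.

Lemma continuous_stp' : continuous stp'.
Proof.
move=> y; apply: cvgD; first apply: cvgB; by apply: cvgM; [exact: cvg_cst|exact: continuous_maxB].
Qed.

Lemma stp_le0 y : y <= 0 -> stp y = 0.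
Proof. by move=> y0; rewrite /stp !max_r; [ring|lra|lra|lra]. Qed.

Lemma stp_ge1 y : 1 <= y -> stp y = 1.
Proof. by move=> y0; rewrite /stp !max_l; [field|lra|lra|lra]. Qed.

Lemma stp01 y : 0 <= stp y <= 1.
Proof.
have [y0|y0] := leP y 0; first by rewrite stp_le0// lexx ler01.
have [y1|y1] := leP 1 y; first by rewrite stp_ge1// lexx ler01.
rewrite /stp max_l ?(@max_r _ _ (y - 1)); [|lra|lra].
have [y2|y2] := leP (y - 2^-1) 0; [nra|nra].
Qed.

Lemma stp'_le y : `|stp' y| <= 2.
Proof.
rewrite /stp' ler_norml.
have [|] := leP (y - 0) 0; have [|] := leP (y - 2^-1) 0; have [|] := leP (y - 1) 0; lra.
Qed.

End one_dim.

(** * Boxes and cells *)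

Section boxes.
Context {R : realType}.
Notation Z := ((R * R) * R)%type.
Notation mR := (measurableTypeR R).

Definition L2 : {measure set (mR * mR) -> \bar R} := [the measure _ _ of mu2 R].
Definition L3 : {measure set ((mR * mR) * mR) -> \bar R} := [the measure _ _ of mu3 R].

Lemma L2E (A B : set mR) : measurable A -> measurable B ->
  L2 (A `*` B) = (lebesgue_measure A * lebesgue_measure B)%E.
Proof. by move=> mA mB; exact: product_measure1E. Qed.

Lemma L3E (A : set (mR * mR)) (B : set mR) : measurable A -> measurable B ->
  L3 (A `*` B) = (L2 A * lebesgue_measure B)%E.
Proof. by move=> mA mB; exact: product_measure1E. Qed.

Lemma integral_L2_12 (A B : set mR) (f : mR * mR -> \bar R) : measurable A -> measurable B ->
  L2.-integrable (A `*` B) f ->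
  (\int[L2]_(z in A `*` B) f z = \int[mu1]_(x in A) \int[mu1]_(y in B) f (x, y))%E.
Proof. by move=> mA mB fi; exact: integral_setX12. Qed.

Lemma integral_L2_21 (A B : set mR) (f : mR * mR -> \bar R) : measurable A -> measurable B ->
  L2.-integrable (A `*` B) f ->
  (\int[L2]_(z in A `*` B) f z = \int[mu1]_(y in B) \int[mu1]_(x in A) f (x, y))%E.
Proof. by move=> mA mB fi; exact: integral_setX21. Qed.

(** Fubini for [L3] views it as a product with first factor [L2], which must be sigma-finite; the
    squares of an exhausting sequence of the line serve. *)
Lemma sigma_finite_L2 : sigma_finite setT L2.
Proof.
have /sigma_finiteP[F [TF ndF Foo]] := sigma_finiteT (@lebesgue_measure R).
exists (fun n => F n `*` F n).
  rewrite -setXTT TF predeqE => -[x y]; split.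
    move=> [/= [n _ Fnx] [k _ Gky]]; exists (maxn n k) => //; split.
    - by move: x Fnx; exact/subsetPset/ndF/leq_maxl.
    - by move: y Gky; exact/subsetPset/ndF/leq_maxr.
  by move=> [n _ []/= ? ?]; split; exists n.
move=> k; have [? ?] := Foo k.
split; first exact: measurableX.
by rewrite L2E// lte_mul_pinfty// ge0_fin_numE.
Qed.

Definition L2f : set (mR * mR) -> \bar R := mu2 R.
HB.instance Definition _ := Measure.copy L2f L2.
HB.instance Definition _ := Measure_isSigmaFinite.Build _ _ _ L2f sigma_finite_L2.
Definition L2s : {sigma_finite_measure set (mR * mR)%type -> \bar R} := L2f.

Lemma integral_L3_12 (A : set (mR * mR)) (B : set mR) (f : (mR * mR) * mR -> \bar R) :
  measurable A -> measurable B -> L3.-integrable (A `*` B) f ->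
  (\int[L3]_(z in A `*` B) f z = \int[L2]_(x in A) \int[mu1]_(y in B) f (x, y))%E.
Proof.
move=> mA mB fi; exact (@integral_setX12 _ _ _ _ R L2s (@lebesgue_measure R) A B mA mB f fi).
Qed.

Lemma integral_L3_21 (A : set (mR * mR)) (B : set mR) (f : (mR * mR) * mR -> \bar R) :
  measurable A -> measurable B -> L3.-integrable (A `*` B) f ->
  (\int[L3]_(z in A `*` B) f z = \int[mu1]_(y in B) \int[L2]_(x in A) f (x, y))%E.
Proof.
move=> mA mB fi; exact (@integral_setX21 _ _ _ _ R L2s (@lebesgue_measure R) A B mA mB f fi).
Qed.

Notation d0 := (@Ordinal 3 0 isT).
Notation d1 := (@Ordinal 3 1 isT).
Notation d2 := (@Ordinal 3 2 isT).

Definition cseg (c r : R) : set mR := [set` `[c - r, c + r]].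
Definition box (c : Z) (r : R) : set ((mR * mR) * mR) :=
  (cseg c.1.1 r `*` cseg c.1.2 r) `*` cseg c.2 r.

Lemma csegE (c r y : R) : cseg c r y <-> `|y - c| <= r.
Proof. by rewrite /cseg /= in_itv/= ler_norml; split=> [/andP[? ?]|/andP[? ?]]; apply/andP; split; lra. Qed.

Lemma boxP c r z : box c r z <-> forall k, `|co k z - co k c| <= r.
Proof.
split=> [[[/csegE h0 /csegE h1] /csegE h2] [[|[|[|//]]] ik]//|H].
by split; [split|]; apply/csegE; [exact: (H d0)|exact: (H d1)|exact: (H d2)].
Qed.

Lemma box_norm c r z : box c r z <-> `|z - c| <= r.
Proof.
rewrite boxP; split=> [H|H k].
  rewrite !prod_normE/= !ge_max.
  by rewrite (H d0) (H d1) (H d2).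
move: H; rewrite !prod_normE/= !ge_max.
by move=> /andP[/andP[h0 h1] h2]; case: k => -[|[|[|//]]] ik.
Qed.

Lemma measurable_cseg c r : measurable (cseg c r).
Proof. exact: measurable_itv. Qed.

Lemma measurable_box c r : measurable (box c r).
Proof. by apply: measurableX; [apply: measurableX|]; exact: measurable_cseg. Qed.
Hint Resolve measurable_cseg measurable_box : core.

Lemma lebesgue_cseg c r : 0 <= r -> lebesgue_measure (cseg c r) = (2 * r)%:E.
Proof.
move=> r0; rewrite /cseg lebesgue_measure_itv/= lte_fin; case: ltP => h.
  by congr EFin; ring.
by congr EFin; lra.
Qed.

Lemma leb_box c r : 0 <= r -> L3 (box c r) = ((2 * r) ^+ 3)%:E.
Proof.
move=> r0; rewrite /box L3E//; last exact: measurableX.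
rewrite L2E// !lebesgue_cseg// -!EFinM; congr EFin; ring.
Qed.

Lemma leb_box_lty c r : 0 <= r -> (L3 (box c r) < +oo)%E.
Proof. by move=> r0; rewrite leb_box// ltry. Qed.

Lemma compact_box c r : compact (box c r : set Z).
Proof.
by apply: compact_setX; [apply: compact_setX|]; exact: segment_compact.
Qed.

Lemma cont_box_bounded (f : Z -> R) c r : continuous f ->
  exists C : R, forall z, box c r z -> `|f z| <= C.
Proof.
move=> cf; have := @compact_bounded R R (f @` box c r).
have ci : compact (f @` (box c r : set Z)).
  by apply: continuous_compact; [exact: continuous_subspaceT|exact: compact_box].
move=> /(_ ci)[M [_ HM]]; exists (M + 1) => z bz.
by apply: (HM (M + 1)); [rewrite ltrDl|exists z].
Qed.

Lemma cont_box_integrable (f : Z -> R) c r : 0 <= r -> continuous f ->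
  (L3).-integrable (box c r) (EFin \o f).
Proof.
move=> r0 cf; have [C HC] := cont_box_bounded c r cf.
apply: (bounded_integrable _ (leb_box_lty c r0) _ HC) => //.
by apply: measurable_funTS; exact: continuous_measurable3.
Qed.

Lemma cont_box_subset_integrable (f : Z -> R) c r (D : set ((mR * mR) * mR)) :
  measurable D -> D `<=` box c r -> 0 <= r -> continuous f ->
  (L3).-integrable D (EFin \o f).
Proof.
move=> mD Db r0 cf; apply: (@integrableS _ _ _ _ (box c r)) => //.
exact: cont_box_integrable.
Qed.

(** The integral along direction [k] is made the innermost one, time being the outermost; only the
    sign of the inner integral matters. The two estimates that follow apply this to a constant minus
    [f], then to [f] and its opposite. *)
Lemma box_integral_ge0 (f : Z -> R) c r (k : 'I_3) : (k < 2)%N -> 0 <= r -> continuous f ->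
  (forall z, box c r z ->
     0 <= \int[lebesgue_measure]_(s in cseg (co k c) r) f (upd k z s)) ->
  0 <= \int[L3]_(z in box c r) f z.
Proof.
move=> k2 r0 cf H; rewrite /Rintegral fine_ge0//.
have fi := cont_box_integrable c r0 cf.
rewrite integral_L3_21//; last exact: measurableX.
apply: integral_ge0 => t tc.
have cft : continuous (fun x : R * R => f (x, t)).
  move=> x; apply: (@continuous_comp _ _ _ (fun x : R * R => (x, t)) f); last exact: cf.
  by apply: (@continuous_pairf _ _ _ (fun x : R * R => x) (fun=> t)); [exact: cvg_id|exact: cvg_cst].
have fti : L2.-integrable (cseg c.1.1 r `*` cseg c.1.2 r) (fun x => (f (x, t))%:E).
  have [C HC] := cont_box_bounded c r cf.
  apply: (@bounded_integrable _ _ _ L2 _ (fun x => f (x, t)) C).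
  - exact: measurableX.
  - by rewrite L2E// !lebesgue_cseg// -EFinM ltry.
  - by apply: measurable_funTS; exact: continuous_measurable2.
  - by move=> x xc; apply: HC; split.
have slice (g : R -> R) (C y : R) : continuous g -> 0 <= \int[lebesgue_measure]_(s in cseg y r) g s ->
    (0 <= \int[lebesgue_measure]_(s in cseg y r) (g s)%:E)%E.
  move=> cg H'; have gi : lebesgue_measure.-integrable (cseg y r) (EFin \o g).
    by apply: continuous_compact_integrable; [exact: segment_compact|exact: continuous_subspaceT].
  move: H'; rewrite /Rintegral => H'.
  have /fineK <- : (\int[lebesgue_measure]_(s in cseg y r) (g s)%:E)%E \is a fin_num.
    exact: integrable_fin_num.
  by rewrite lee_fin.
have csl (z : Z) : continuous (fun s => f (upd k z s)).
  move=> s; apply: (@continuous_comp _ _ _ (upd k z) f); [exact: continuous_upd|exact: cf].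
case: k k2 H csl => -[|[|//]] ik _ H csl.
- rewrite integral_L2_21//.
  apply: integral_ge0 => y yc.
  apply: (slice (fun s => f ((s, y), t)) 0 c.1.1); first exact: (csl ((c.1.1, y), t)).
  have := H ((c.1.1, y), t); apply; split => //; split => //.
  by apply/csegE; rewrite subrr normr0.
- rewrite integral_L2_12//.
  apply: integral_ge0 => y yc.
  apply: (slice (fun s => f ((y, s), t)) 0 c.1.2); first exact: (csl ((y, c.1.2), t)).
  have := H ((y, c.1.2), t); apply; split => //; split => //.
  by apply/csegE; rewrite subrr normr0.
Qed.

Lemma cont_cseg_integrable (g : R -> R) y r : continuous g ->
  lebesgue_measure.-integrable (cseg y r) (EFin \o g).
Proof.
by move=> cg; apply: continuous_compact_integrable; [exact: segment_compact|exact: continuous_subspaceT].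
Qed.

Lemma box_integral_le (f : Z -> R) c r (k : 'I_3) b : (k < 2)%N -> 0 < r -> continuous f ->
  (forall z, box c r z ->
     \int[lebesgue_measure]_(s in cseg (co k c) r) f (upd k z s) <= b) ->
  \int[L3]_(z in box c r) f z <= b * (2 * r) ^+ 2.
Proof.
move=> k2 r0 cf H.
have csl (z : Z) : continuous (fun s => f (upd k z s)).
  move=> s; apply: (@continuous_comp _ _ _ (upd k z) f); [exact: continuous_upd|exact: cf].
have := @box_integral_ge0 (fun z => b / (2 * r) - f z) c r k k2 (ltW r0).
rewrite RintegralB//; [|exact: cont_box_integrable (ltW r0) (@cst_continuous _ _ _)|
  exact: cont_box_integrable (ltW r0) cf].
rewrite Rintegral_cst; last exact: measurable_box.
rewrite leb_box; last exact: ltW.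
move=> /= K.
rewrite -subr_ge0 (_ : b * _ = b / (2 * r) * (2 * r) ^+ 3); last by field; rewrite gt_eqF.
apply: K => [z|z bz]; first by apply: cvgB; [exact: cvg_cst|exact: cf].
rewrite RintegralB//; [|exact: cont_cseg_integrable (@cst_continuous _ _ _)|exact: cont_cseg_integrable].
rewrite Rintegral_cst; last exact: measurable_cseg.
rewrite [fine _](_ : _ = 2 * r); last exact: (congr1 fine (lebesgue_cseg _ (ltW r0))).
rewrite /= subr_ge0 (_ : b / _ * _ = b); first exact: H.
by field; rewrite gt_eqF.
Qed.

Lemma box_integral_norm_le (f : Z -> R) c r (k : 'I_3) b : (k < 2)%N -> 0 < r -> continuous f ->
  (forall z, box c r z ->
     `|\int[lebesgue_measure]_(s in cseg (co k c) r) f (upd k z s)| <= b) ->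
  `|\int[L3]_(z in box c r) f z| <= b * (2 * r) ^+ 2.
Proof.
move=> k2 r0 cf H; rewrite ler_norml; apply/andP; split; last first.
  by apply: (box_integral_le k2 r0 cf) => z /H; rewrite ler_norml => /andP[].
rewrite lerNl; have := @box_integral_le (fun z => -1 * f z) c r k b k2 r0.
rewrite RintegralZl//; last exact: cont_box_integrable (ltW r0) cf.
rewrite mulN1r; apply.
  by move=> z; apply: cvgM; [exact: cvg_cst|exact: cf].
move=> z /H; rewrite RintegralZl//; last first.
  apply: cont_cseg_integrable => s.
  by apply: (@continuous_comp _ _ _ (upd k z) f); [exact: continuous_upd|exact: cf].
by rewrite mulN1r ler_norml lerNl => /andP[].
Qed.

(** Integrating a derivative along its own direction leaves boundary values only. So uniformly small
    perturbations barely change averages of gradients, however large the gradients are. *)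
Lemma box_integral_derive (f : Z -> R) c r (k : 'I_3) C : (k < 2)%N -> 0 < r -> C1 f ->
  (forall z, `|f z| <= C) ->
  `|\int[L3]_(z in box c r) 'D_(dir k) f z| <= 2 * C * (2 * r) ^+ 2.
Proof.
move=> k2 r0 Cf fC; apply: (box_integral_norm_le k2 r0); first exact: C1Dc.
move=> z bz; rewrite /cseg FTC_upd//; last lra.
by rewrite (le_trans (ler_normB _ _))// mulr_natl mulr2n lerD.
Qed.

Lemma box_integral_bound (f : Z -> R) c r C : 0 < r -> continuous f ->
  (forall z, box c r z -> `|f z| <= C) ->
  `|\int[L3]_(z in box c r) f z| <= C * (2 * r) ^+ 3.
Proof.
move=> r0 cf fC.
have := @normr_Rintegral_le _ _ R L3 (box c r) f C (measurable_box c r) (leb_box_lty c (ltW r0)).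
rewrite leb_box; last exact: ltW.
apply => //; by apply: measurable_funTS; exact: continuous_measurable3.
Qed.

End boxes.
#[global] Hint Resolve measurable_cseg measurable_box : core.

(** * The oscillating profile on one cube *)

Section cell.
Context {R : realType}.
Notation Z := ((R * R) * R)%type.
Notation mR := (measurableTypeR R).
Notation L3 := (@L3 R).
Notation d0 := (@Ordinal 3 0 isT).
Notation d1 := (@Ordinal 3 1 isT).
Notation d2 := (@Ordinal 3 2 isT).

Lemma cutoff1 (c r q : R) : 0 < r -> 0 < q -> exists w w' : R -> R,
  [/\ forall s : R, is_derive s 1 w (w' s), continuous w', forall y, 0 <= w y <= 1,
   forall y, r <= `|y - c| -> w y = 0 /\ w' y = 0 &
   [/\ forall y, `|y - c| <= (1 - q) * r -> w y = 1 & exists C, forall y, `|w' y| <= C]].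
Proof.
move=> r0 q0; have qr : 0 < q * r by rewrite mulr_gt0.
pose A y := (r - (y - c)) / (q * r); pose B y := (r + (y - c)) / (q * r).
have dA (s : R) : is_derive s 1 (fun y => stp (A y)) (- (q * r)^-1 * stp' (A s)).
  have := @is_derive1_comp R stp A s (stp' (A s)) (- (q * r)^-1).
  have -> : stp' (A s) * - (q * r)^-1 = - (q * r)^-1 * stp' (A s) by ring.
  apply; first exact: is_derive_stp.
  by rewrite /A; apply: is_derive_eq; rewrite /GRing.scale/=; ring.
have dB (s : R) : is_derive s 1 (fun y => stp (B y)) ((q * r)^-1 * stp' (B s)).
  have := @is_derive1_comp R stp B s (stp' (B s)) ((q * r)^-1).
  have -> : stp' (B s) * (q * r)^-1 = (q * r)^-1 * stp' (B s) by ring.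
  apply; first exact: is_derive_stp.
  by rewrite /B; apply: is_derive_eq; rewrite /GRing.scale/=; ring.
have cA : continuous A.
  move=> y; apply: cvgM; last exact: cvg_cst.
  by apply: cvgB; [exact: cvg_cst|apply: cvgB; [exact: cvg_id|exact: cvg_cst]].
have cB : continuous B.
  move=> y; apply: cvgM; last exact: cvg_cst.
  by apply: cvgD; [exact: cvg_cst|apply: cvgB; [exact: cvg_id|exact: cvg_cst]].
have csA : continuous (fun y => stp (A y)) by exact: is_derive_continuous dA.
have csB : continuous (fun y => stp (B y)) by exact: is_derive_continuous dB.
have stp'0 (y : R) : y <= 0 -> stp' y = 0.
  by move=> y0; rewrite /stp' !max_r; [ring|lra|lra|lra].
exists (fun y => stp (A y) * stp (B y)).
exists (fun y => stp (A y) * ((q * r)^-1 * stp' (B y)) + stp (B y) * (- (q * r)^-1 * stp' (A y))).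
split.
- by move=> s; have := dA s; have := dB s => ? ?; apply: is_derive_eq.
- have cB' : continuous (fun y => stp' (B y)).
    by move=> y; apply: (@continuous_comp _ _ _ B stp'); [exact: cB|exact: continuous_stp'].
  have cA' : continuous (fun y => stp' (A y)).
    by move=> y; apply: (@continuous_comp _ _ _ A stp'); [exact: cA|exact: continuous_stp'].
  move=> y; apply: cvgD; apply: cvgM.
  - exact: csA.
  - by apply: cvgM; [exact: cvg_cst|exact: cB'].
  - exact: csB.
  - by apply: cvgM; [exact: cvg_cst|exact: cA'].
- move=> y; have /andP[a1 a2] := stp01 (A y); have /andP[b1 b2] := stp01 (B y).
  by rewrite mulr_ge0//= mulr_ile1.
- move=> y; rewrite ler_normr => /orP[h|h].
    have A0 : A y <= 0 by rewrite /A ler_pdivrMr// mul0r; lra.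
    by rewrite (stp_le0 A0) (stp'0 _ A0) !(mul0r, mulr0, addr0).
  have B0 : B y <= 0 by rewrite /B ler_pdivrMr// mul0r; lra.
  by rewrite (stp_le0 B0) (stp'0 _ B0) !(mul0r, mulr0, addr0).
split.
- move=> y; rewrite ler_norml => h.
  have A1 : 1 <= A y by rewrite /A ler_pdivlMr// mul1r; lra.
  have B1 : 1 <= B y by rewrite /B ler_pdivlMr// mul1r; lra.
  by rewrite (stp_ge1 A1) (stp_ge1 B1) mulr1.
- exists (2 * (q * r)^-1 + 2 * (q * r)^-1) => y.
  have i0 : 0 <= (q * r)^-1 by rewrite invr_ge0 ltW.
  have H a b : `|stp a * ((q * r)^-1 * stp' b)| <= 2 * (q * r)^-1.
    rewrite normrM normrM (ger0_norm i0).
    have /andP[h1 h2] := stp01 a; rewrite (ger0_norm h1).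
    rewrite -[leRHS]mul1r; apply: ler_pM => //; first by rewrite mulr_ge0.
    by rewrite mulrC ler_wpM2r// stp'_le.
  rewrite (le_trans (ler_normD _ _))// lerD//.
  by rewrite mulNr mulrN normrN.
Qed.

Definition e_ (k : 'I_3) : 'I_3 -> R := fun j => (j == k)%:R.

Lemma lin_e k z : lin (e_ k) z = co k z.
Proof.
rewrite /lin /e_ /co; case: k => -[|[|[|//]]] ik; rewrite /eq_op/=.
all: by rewrite ?(mul1r, mul0r, addr0, add0r).
Qed.

Lemma cutoff3 (c : Z) (r q : R) : 0 < r -> 0 < q -> exists X : Z -> R,
  [/\ C1 X, forall z, 0 <= X z <= 1,
   forall z, (exists k, r <= `|co k z - co k c|) -> X z = 0 /\ forall j, 'D_(dir j) X z = 0 &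
   [/\ forall z, box c ((1 - q) * r) z -> X z = 1 &
       exists C, forall j z, `|'D_(dir j) X z| <= C]].
Proof.
move=> r0 q0.
have /boolp.choice[w /boolp.choice[w' H]] : forall k : 'I_3, exists w w' : R -> R,
  [/\ forall s : R, is_derive s 1 w (w' s), continuous w', forall y, 0 <= w y <= 1,
   forall y, r <= `|y - co k c| -> w y = 0 /\ w' y = 0 &
   [/\ forall y, `|y - co k c| <= (1 - q) * r -> w y = 1 & exists C, forall y, `|w' y| <= C]].
  by move=> k; exact: cutoff1.
pose W k z := w k (co k z).
have WE k : W k = fun z => w k (lin (e_ k) z) by apply/funext => z; rewrite lin_e.
have CW k : C1 (W k).
  by rewrite WE; have [h1 h2 _ _ _] := H k; exact: C1_lin h1 h2.
have DW k j z : 'D_(dir j) (W k) z = e_ k j * w' k (co k z).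
  have [h1 _ _ _ _] := H k.
  by have := @is_derive_lin R _ _ (e_ k) j z h1; rewrite -WE lin_e => -[_ ->].
pose X z := W d0 z * W d1 z * W d2 z.
have DX j z : 'D_(dir j) X z = W d0 z * W d1 z * 'D_(dir j) (W d2) z +
    W d2 z * (W d0 z * 'D_(dir j) (W d1) z + W d1 z * 'D_(dir j) (W d0) z).
  by rewrite (@deriveMC1 _ (fun z => W d0 z * W d1 z) (W d2))//; [rewrite deriveMC1|exact: C1M].
exists X; split.
- by apply: C1M => //; exact: C1M.
- move=> z; have [_ _ h0 _ _] := H d0; have [_ _ h1 _ _] := H d1; have [_ _ h2 _ _] := H d2.
  have := h0 (co d0 z); have := h1 (co d1 z); have := h2 (co d2 z); rewrite /X /W => /andP[a1 a2] /andP[b1 b2] /andP[e1 e2].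
  by rewrite !mulr_ge0//= mulr_ile1 ?mulr_ge0// mulr_ile1.
- move=> z [k hk].
  have [_ _ _ /(_ _ hk)[w0 w'0] _] := H k.
  have {w0}W0 : W k z = 0 by [].
  have {w'0}D0 j : 'D_(dir j) (W k) z = 0 by rewrite DW w'0 mulr0.
  have k3 : k = d0 \/ k = d1 \/ k = d2.
    case: k {hk W0 D0} => -[|[|[|//]]] ik; [left|right; left|right; right]; exact/val_inj.
  split=> [|j]; rewrite ?DX /X; move: W0 D0; case: k3 => [->|[->|->]] W0 D0;
    by rewrite ?W0 ?D0 !(mul0r, mulr0, addr0).
split.
- move=> z /boxP bz; rewrite /X /W.
  have Hk k : w k (co k z) = 1 by have [_ _ _ _ [+ _]] := H k; apply; exact: bz.
  by rewrite !Hk !mulr1.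
- have /boolp.choice[C HC] : forall k : 'I_3, exists C, forall y, `|w' k y| <= C.
    by move=> k; have [_ _ _ _ []] := H k.
  have C0 k : 0 <= C k by exact: le_trans (HC k 0).
  have DWC k j z : `|'D_(dir j) (W k) z| <= C k.
    by rewrite DW /e_ normrM; case: (j == k); rewrite ?normr1 ?normr0 ?mul1r ?mul0r.
  have W1 k z : `|W k z| <= 1.
    by have [_ _ + _ _] := H k => /(_ (co k z))/andP[? ?]; rewrite ger0_norm.
  exists (C d2 + (C d1 + C d0)) => j z; rewrite DX.
  have M1 (a b D : R) : `|a| <= 1 -> `|b| <= D -> `|a * b| <= D.
    by move=> a1 bD; rewrite normrM -[D]mul1r; apply: ler_pM.
  rewrite (le_trans (ler_normD _ _))// lerD//.
    exact: (M1 _ _ _ (M1 _ _ _ (W1 _ _) (W1 _ _)) (DWC _ _ _)).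
  apply: (M1 _ _ _ (W1 _ _)); rewrite (le_trans (ler_normD _ _))// lerD//.
    exact: (M1 _ _ _ (W1 _ _) (DWC _ _ _)).
  exact: (M1 _ _ _ (W1 _ _) (DWC _ _ _)).
Qed.

(** On [[- p, 1 - p]] the product [(k + p) * (1 - p - k)] vanishes only at the two end values, so it
    measures the failure of [k] to be two-valued. Cutting off by [X] changes it by
    [(1 - X) * (k * b)] with [|k * b| <= 1]. *)
Lemma two_valued_cut (X k p T : R) : 0 <= X <= 1 -> - p <= k <= 1 - p -> 0 < p -> p < 1 ->
  (k + p) * (1 - p - k) <= T -> (X * k + p) * (1 - p - X * k) <= T + (1 - X).
Proof.
move=> /andP[X0 X1] /andP[k0 k1] p0 p1 kT.
have /andP[h1 h2] : - p <= X * k <= 1 - p by apply/andP; split; nra.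
pose b := (1 - p - k) - (p + X * k).
have b1 : `|b| <= 1 by rewrite /b ler_norml; lra.
have k2 : `|k| <= 1 by rewrite ler_norml; lra.
have kb : -1 <= k * b.
  have : `|k * b| <= 1 by rewrite normrM mulr_ile1.
  by rewrite ler_norml => /andP[].
have -> : (X * k + p) * (1 - p - X * k) = (k + p) * (1 - p - k) - (1 - X) * (k * b).
  by rewrite /b; ring.
have : 0 <= (1 - X) * (k * b + 1) by rewrite mulr_ge0//; lra.
lra.
Qed.

Lemma sqr_cut (x : R) : 0 <= x <= 1 -> x * (1 - x) <= x.
Proof. by move=> /andP[? ?]; nra. Qed.

Lemma cube_gap (q : R) : 0 < q -> q <= 2^-1 -> 1 - (1 - q) ^+ 3 <= 3 * q.
Proof. by move=> ? ?; nra. Qed.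

Lemma cut_itv (X k p : R) : 0 <= X <= 1 -> 0 < p -> p < 1 -> - p <= k <= 1 - p ->
  - p <= X * k <= 1 - p.
Proof. by move=> /andP[? ?] ? ? /andP[? ?]; apply/andP; split; nra. Qed.

(** [w] is a plane wave of high frequency [N] and wave vector [(x1, x2, 0)], cut off near the faces.
    The spatial gradient is [k * (x1, x2)] up to an error of order [1 / N], where [k] is nearly
    two-valued. The wave vector has no time component, so the time derivative comes from the cut-off
    alone and is of order [1 / N]. Since [x2] is not 0, [k] is nearly a multiple of a derivative of
    a function vanishing on the faces; hence its small mean. *)
Lemma cell_profile (x1 x2 p : R) (c : Z) (r e : R) :
  x2 != 0 -> 0 < p < 1 -> 0 < r -> 0 < e ->
  exists w k : Z -> R,
  [/\ C1 w, continuous k,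
    (forall z, (exists j, r <= `|co j z - co j c|) ->
       [/\ w z = 0, k z = 0 & forall j, 'D_(dir j) w z = 0]),
    [/\ forall z, `|w z| <= e, forall z, `|'D_(dir d2) w z| <= e,
        forall z, `|'D_(dir d0) w z - x1 * k z| <= e &
        forall z, `|'D_(dir d1) w z - x2 * k z| <= e] &
    [/\ forall z, - p <= k z <= 1 - p,
        `|\int[L3]_(z in box c r) k z| <= e &
        \int[L3]_(z in box c r) ((k z + p) * (1 - p - k z)) <= e]].
Proof.
move=> x20 /andP[p0 p1] r0 e0.
pose V := (2 * r) ^+ 3.
have V0 : 0 < V by rewrite exprn_gt0// mulr_gt0.
(* [q]: relative width of the cut-off layer; [s]: relative width of the ramps. *)
have [q [q0 q1 qV]] : exists q : R, [/\ 0 < q, q < 1 & V - (2 * ((1 - q) * r)) ^+ 3 <= e / 3].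
  pose q := Num.min (2^-1) (e / (9 * V + 1)).
  have D0 : 0 < 9 * V + 1 by lra.
  exists q; rewrite /q lt_min invr_gt0 ltr0n divr_gt0// gt_min invf_lt1 ?ltr1n//; split => //.
  rewrite -/q; have q0 : 0 < q by rewrite /q lt_min invr_gt0 ltr0n divr_gt0.
  have q2 : q <= 2^-1 by rewrite /q ge_min lexx.
  have qe : q * (9 * V + 1) <= e by rewrite -ler_pdivlMr// /q ge_min lexx orbT.
  have -> : (2 * ((1 - q) * r)) ^+ 3 = (1 - q) ^+ 3 * V by rewrite /V; ring.
  have /(ler_wpM2r (ltW V0)) := cube_gap q0 q2.
  by rewrite mulrBl mul1r; move: qe; lra.
pose s := Num.min (Num.min (p) (1 - p) / 2) (e / (3 * V)).
have s0 : 0 < s by rewrite /s !lt_min !divr_gt0 ?mulr_gt0 ?lt_min ?p0 ?subr_gt0.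
have sp : s <= p / 2 /\ s <= (1 - p) / 2.
  rewrite /s; split; rewrite ge_min; apply/orP; left; rewrite ler_pM2r// ?invr_gt0//.
    by rewrite ge_min lexx.
  by rewrite ge_min lexx orbT.
have sV : s * V <= e / 3.
  have : s <= e / (3 * V) by rewrite /s ge_min lexx orbT.
  rewrite -(ler_pM2r V0) => /le_trans; apply.
  by rewrite le_eqVlt; apply/orP; left; apply/eqP; field; rewrite gt_eqF.
(* With this starting point the mean of the ramp along the wave is exactly [p], so that [k0] has
   mean zero. *)
pose cc := 1 - p - s / 2.
have [F dF Fb] : exists2 F : R -> R, forall y : R, is_derive y 1 F (ramp cc s (tri y) - (1 - cc - s / 2)) & forall y, `|F y| <= 2.
  by apply: ramp_tri_prim => //; rewrite /cc; lra.
have [G dG Gb] : exists2 F : R -> R, forall y : R, is_derive y 1 F (ramp (cc + s) s (tri y) - (1 - (cc + s) - s / 2)) & forall y, `|F y| <= 2.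
  by apply: ramp_tri_prim => //; rewrite /cc; lra.
have pE : 1 - cc - s / 2 = p by rewrite /cc; field.
have [X [CX X01 Xout [Xin [CD HCD]]]] := cutoff3 c r0 q0.
have CD0 : 0 <= CD by exact: le_trans (HCD d0 0).
pose k0 y := ramp cc s (tri y) - p.
have ck0 : continuous k0.
  move=> y; apply: cvgB; last exact: cvg_cst.
  by apply: (@continuous_comp _ _ _ tri (ramp cc s)); [exact: continuous_tri|exact: continuous_ramp].
pose S := 4 * (2 * r) ^+ 2 / `|x2|.
have S0 : 0 <= S by rewrite /S divr_ge0// mulr_ge0// exprn_ge0// mulr_ge0// ltW.
(* The second bound pays for the mean of [k]: the error in [x2 * k], integrated over volume [V] and
   divided by [|x2|], must not exceed [e]. *)
pose e' := Num.min e (e * `|x2| / V).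
have e'0 : 0 < e' by rewrite /e' lt_min e0 divr_gt0// mulr_gt0// normr_gt0.
have [N N0 [N1 [N2 N3]]] : exists2 N : R, 0 < N & 2 <= N * e /\ 2 * CD <= N * e' /\ 2 * S <= N * (e / 3).
  pose N := 2 / e + (2 * CD) / e' + 2 * S / (e / 3).
  have a1 : 0 < 2 / e by rewrite divr_gt0.
  have a2 : 0 <= 2 * CD / e' by rewrite divr_ge0 ?mulr_ge0// ltW.
  have a3 : 0 <= 2 * S / (e / 3) by rewrite divr_ge0 ?mulr_ge0// ltW// divr_gt0.
  exists N; first by rewrite /N; lra.
  split; [|split].
  - by rewrite -ler_pdivrMr// /N; lra.
  - by rewrite -ler_pdivrMr// /N; lra.
  - by rewrite -ler_pdivrMr ?divr_gt0// /N; lra.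
pose a : 'I_3 -> R := fun j => N * (if j == 0 :> nat then x1 else if j == 1 :> nat then x2 else 0).
pose hh y := N^-1 * F y.
have dh (y : R) : is_derive y 1 hh (N^-1 * k0 y).
  have := dF y; rewrite pE -/(k0 y) => ?.
  by rewrite /hh; apply: is_derive_eq.
have ch' : continuous (fun y => N^-1 * k0 y).
  by move=> y; apply: cvgM; [exact: cvg_cst|exact: ck0].
pose h z := hh (lin a z).
have Ch : C1 h by exact: C1_lin dh ch'.
have Dh j z : 'D_(dir j) h z = N^-1 * a j * k0 (lin a z).
  by have [_ ->] := @is_derive_lin R hh _ a j z dh; ring.
have hb z : `|h z| <= 2 / N.
  by rewrite /h /hh normrM normfV (gtr0_norm N0) mulrC ler_wpM2r ?invr_ge0 ?Fb// ltW.
have k0b y : - p <= k0 y <= 1 - p.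
  by rewrite /k0; have := ramp01 cc (tri y) s0; lra.
have ckl : continuous (fun z => k0 (lin a z)).
  by move=> z; apply: (@continuous_comp _ _ _ (lin a) k0); [exact: continuous_lin|exact: ck0].
pose w z := X z * h z.
pose k z := X z * k0 (lin a z).
have Cw : C1 w by exact: C1M.
have ck : continuous k.
  by move=> z; apply: cvgM; [exact: C1c|exact: ckl].
have Dw j z : 'D_(dir j) w z = N^-1 * a j * k z + h z * 'D_(dir j) X z.
  by rewrite /w deriveMC1// Dh /k; ring.
have hDX j z : `|h z * 'D_(dir j) X z| <= e'.
  rewrite normrM (le_trans (ler_pM _ _ (hb z) (HCD j z)))//.
  by rewrite mulrAC ler_pdivrMr// [leRHS]mulrC.
have e'e : e' <= e by rewrite /e' ge_min lexx.
have Na j : N^-1 * a j = if j == 0 :> nat then x1 else if j == 1 :> nat then x2 else 0.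
  by rewrite /a mulrA mulVf ?mul1r// gt_eqF.
have kb z : - p <= k z <= 1 - p.
  by rewrite /k; exact: cut_itv.
have wout z : (exists j, r <= `|co j z - co j c|) ->
     [/\ w z = 0, k z = 0 & forall j, 'D_(dir j) w z = 0].
  move=> /Xout[X0 DX0]; rewrite /w /k X0 !mul0r; split => // j.
  by rewrite Dw DX0 /k X0 mul0r !mulr0 addr0.
have wk2 z : `|'D_(dir d1) w z - x2 * k z| <= e'.
  by rewrite Dw Na /= addrC addKr.
exists w, k; split => //.
  split => [z|z|z|z].
  - rewrite /w normrM; have /andP[X0 X1] := X01 z; rewrite (ger0_norm X0).
    rewrite -[e]mul1r ler_pM// (le_trans (hb z))// ler_pdivrMr// mulrC//.
  - by rewrite Dw Na /= mul0r add0r (le_trans (hDX _ _)).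
  - by rewrite Dw Na /= addrC addKr (le_trans (hDX _ _)).
  - exact: le_trans (wk2 z) e'e.
split => //.
- have cDw : continuous (fun z => 'D_(dir d1) w z) by exact: C1Dc.
  have E : \int[L3]_(z in box c r) ('D_(dir d1) w z - x2 * k z) = - (x2 * \int[L3]_(z in box c r) k z).
    have cx : continuous (fun z => x2 * k z) by move=> z; apply: cvgM; [exact: cvg_cst|exact: ck].
    rewrite RintegralB//; [|exact: cont_box_integrable (ltW r0) cDw|exact: cont_box_integrable (ltW r0) cx].
    rewrite RintegralZl//; last exact: cont_box_integrable (ltW r0) ck.
    suff -> : \int[L3]_(z in box c r) 'D_(dir d1) w z = 0 by rewrite sub0r.
    apply/eqP; rewrite -normr_le0.
    have := @box_integral_norm_le R _ c r d1 0 isT r0 cDw; rewrite mul0r; apply => z bz.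
    rewrite /cseg FTC_upd//; last lra.
    have [|-> _ _] := wout (upd d1 z (co d1 c + r)).
      by exists d1; rewrite co_upd addrC addKr ger0_norm// ltW.
    have [|-> _ _] := wout (upd d1 z (co d1 c - r)).
      by exists d1; rewrite co_upd addrC addKr normrN ger0_norm// ltW.
    by rewrite subrr normr0.
  have cE : continuous (fun z => 'D_(dir d1) w z - x2 * k z).
    by move=> z; apply: cvgB; [exact: cDw|apply: cvgM; [exact: cvg_cst|exact: ck]].
  have := @box_integral_bound R _ c r e' r0 cE (fun z _ => wk2 z).
  rewrite E normrN normrM -/V => h1.
  have h2 : e' * V <= e * `|x2| by rewrite -ler_pdivlMr// /e' ge_min lexx orbT.
  by rewrite -(@ler_pM2l _ `|x2|) ?normr_gt0// (le_trans h1)// [leRHS]mulrC.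
(* [T] dominates the defect of the uncut wave. Up to [cc + s] the second ramp vanishes and
   [x * (1 - x) <= x]; beyond, the first ramp is 1 and the defect is 0. Its mean is [s], as both
   ramps have bounded centred primitives. *)
- pose T z := ramp cc s (tri (lin a z)) - ramp (cc + s) s (tri (lin a z)).
  have cT : continuous T.
    have cr (u : R) : continuous (fun z : Z => ramp u s (tri (lin a z))).
      move=> z; apply: (@continuous_comp _ _ _ (lin a) (fun y => ramp u s (tri y))); first exact: continuous_lin.
      by apply: (@continuous_comp _ _ _ tri (ramp u s)); [exact: continuous_tri|exact: continuous_ramp].
    by move=> z; apply: cvgB; exact: cr.
  have cX : continuous (fun z => 1 - X z) by move=> z; apply: cvgB; [exact: cvg_cst|exact: C1c].
  have cB : continuous (fun z => (k z + p) * (1 - p - k z)).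
    move=> z; apply: cvgM; first by apply: cvgD; [exact: ck|exact: cvg_cst].
    by apply: cvgB; [exact: cvg_cst|exact: ck].
  have cTX : continuous (fun z => T z + (1 - X z)) by move=> z; apply: cvgD; [exact: cT|exact: cX].
  have le1 : \int[L3]_(z in box c r) ((k z + p) * (1 - p - k z)) <= \int[L3]_(z in box c r) (T z + (1 - X z)).
    apply: le_Rintegral => //; [exact: cont_box_integrable (ltW r0) cB|exact: cont_box_integrable (ltW r0) cTX|].
    move=> z _.
    have B0 : (k0 (lin a z) + p) * (1 - p - k0 (lin a z)) <= T z.
      rewrite /k0 /T subrK; set y := tri _.
      have -> : 1 - p - (ramp cc s y - p) = 1 - ramp cc s y by ring.
      have [y1|y1] := leP y (cc + s).
        by rewrite (ramp0 y1 s0) subr0 sqr_cut// ramp01.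
      rewrite (ramp1 s0 (ltW y1)) subrr mulr0 subr_ge0.
      by have /andP[] := ramp01 (cc + s) y s0.
    by rewrite /k; apply: two_valued_cut.
  rewrite (le_trans le1)// RintegralD//; [|exact: cont_box_integrable (ltW r0) cT|exact: cont_box_integrable (ltW r0) cX].
  have T1 : \int[L3]_(z in box c r) T z <= 2 * (e / 3).
    pose P z := (N * x2)^-1 * (F (lin a z) - G (lin a z)).
    have dFG (y : R) : is_derive y 1 (fun y => (N * x2)^-1 * (F y - G y))
        ((N * x2)^-1 * (ramp cc s (tri y) - ramp (cc + s) s (tri y) - s)).
      have := dF y; have := dG y => ? ?; apply: is_derive_eq.
      by rewrite /GRing.scale/=; congr (_ * _); field.
    have cFG : continuous (fun y => (N * x2)^-1 * (ramp cc s (tri y) - ramp (cc + s) s (tri y) - s)).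
      have cr (u : R) : continuous (fun y : R => ramp u s (tri y)).
        by move=> y; apply: (@continuous_comp _ _ _ tri (ramp u s)); [exact: continuous_tri|exact: continuous_ramp].
      move=> y; apply: cvgM; first exact: cvg_cst.
      by apply: cvgB; [apply: cvgB; exact: cr|exact: cvg_cst].
    have CP : C1 P by exact: C1_lin dFG cFG.
    have DP z : 'D_(dir d1) P z = T z - s.
      have [_ ->] := @is_derive_lin R _ _ a d1 z dFG; rewrite /a/= /T; field.
      by rewrite x20 gt_eqF.
    have Pb z : `|P z| <= 4 / (N * `|x2|).
      have i0 : 0 <= (N * `|x2|)^-1 by rewrite invr_ge0 mulr_ge0// ltW.
      rewrite /P normrM normfV normrM (gtr0_norm N0) mulrC (ler_wpM2r i0)//.
      by rewrite (le_trans (ler_normB _ _))//; have := Fb (lin a z); have := Gb (lin a z); lra.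
    have := @box_integral_derive R P c r d1 _ isT r0 CP Pb.
    have -> : \int[L3]_(z in box c r) 'D_(dir d1) P z = \int[L3]_(z in box c r) (T z - s).
      by apply: eq_Rintegral => z _; exact: DP.
    have cs : continuous (fun _ : Z => s) by exact: cst_continuous.
    rewrite RintegralB//; [|exact: cont_box_integrable (ltW r0) cT|exact: cont_box_integrable (ltW r0) cs].
    rewrite Rintegral_cst; last exact: measurable_box.
    rewrite leb_box; last exact: ltW.
    rewrite /= -/V ler_norml => /andP[_ h1].
    have : 2 * (4 / (N * `|x2|)) * (2 * r) ^+ 2 = 2 * S / N.
      by rewrite /S; field; rewrite normr_eq0 x20 gt_eqF.
    move=> h2; rewrite h2 in h1.
    have h3 : 2 * S / N <= e / 3 by rewrite ler_pdivrMr// [leRHS]mulrC.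
    by move: h1 h3 sV; clear; lra.
  have X1 : \int[L3]_(z in box c r) (1 - X z) <= e / 3.
    pose b := box c ((1 - q) * r).
    have bb : b `<=` box c r.
      by move=> z /boxP bz; apply/boxP => j; rewrite (le_trans (bz j))// ler_piMl; lra.
    have bE : box c r = b `|` (box c r `\` b) by rewrite setDUK.
    have mb : measurable b by exact: measurable_box.
    have mD : measurable (box c r `\` b) by exact: measurableD.
    rewrite bE Rintegral_setU//; last 2 first.
    - by rewrite -bE; exact: cont_box_integrable (ltW r0) cX.
    - by apply/disj_setPS => z [bz [_]].
    have -> : \int[L3]_(z in b) (1 - X z) = \int[L3]_(z in b) 0.
      by apply: eq_Rintegral => z; rewrite inE => bz; rewrite Xin// subrr.
    rewrite Rintegral_cst// mul0r add0r.
    have LD : L3 (box c r `\` b) = (V - (2 * ((1 - q) * r)) ^+ 3)%:E.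
      rewrite measureD//; last by apply: leb_box_lty; exact: ltW.
      have -> : box c r `&` b = b by apply/setIidPr.
      rewrite EFinB; congr (_ - _)%E; first exact: leb_box (ltW r0).
      by apply: leb_box; rewrite mulr_ge0 ?subr_ge0//; exact: ltW.
    have Dlt : (L3 (box c r `\` b) < +oo)%E by rewrite LD ltry.
    have := @normr_Rintegral_le _ _ R L3 (box c r `\` b) (fun z => 1 - X z) 1 mD Dlt.
    rewrite LD/= mul1r ler_norml => h1.
    have h2 : measurable_fun (box c r `\` b) (fun z => 1 - X z).
      by apply: measurable_funTS; exact: continuous_measurable3.
    have h3 z : (box c r `\` b) z -> `|1 - X z| <= 1.
      by move=> _; have := X01 z; rewrite ler_norml; clear; lra.
    by have /andP[_ h4] := h1 h2 h3; exact: le_trans h4 qV.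
  by move: T1 X1; clear; lra.
Qed.

End cell.

(** * Dyadic cells and partitions subordinate to a gauge *)

Section dyadic.
Context {R : realType}.
Notation Z := ((R * R) * R)%type.
Notation mR := (measurableTypeR R).
Notation L3 := (@L3 R).
Notation d0 := (@Ordinal 3 0 isT).
Notation d1 := (@Ordinal 3 1 isT).
Notation d2 := (@Ordinal 3 2 isT).

Definition mesh (n : nat) : R := 2^-1 ^+ n.

Lemma mesh_gt0 n : 0 < mesh n. Proof. by rewrite exprn_gt0// invr_gt0. Qed.
Hint Resolve mesh_gt0 : core.

Lemma meshS n : mesh n = 2 * mesh n.+1.
Proof. by rewrite /mesh exprS mulrA divff ?mul1r. Qed.

Lemma mesh_small (e : R) : 0 < e -> exists n, mesh n < e.
Proof.
move=> e0; have := @cvg_expr R 2^-1; rewrite ger0_norm ?invr_ge0// invf_lt1// ltr1n => /(_ isT).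
move=> /cvgrPdist_lt/(_ _ e0)[n _ /(_ n (leqnn n))].
by rewrite /= sub0r normrN ger0_norm ?exprn_ge0 ?invr_ge0// => h; exists n.
Qed.

Definition cellidx (n : nat) (z : Z) : {ffun 'I_3 -> int} := [ffun i => Num.floor (co i z / mesh n)].

Lemma cellidxP n z i (k : int) :
  (Num.floor (co i z / mesh n) = k) <-> (k%:~R * mesh n <= co i z < (k%:~R + 1) * mesh n).
Proof.
split=> [<-|/andP[h1 h2]].
  have /andP[] := real_floor_itv (num_real (co i z / mesh n)).
  by rewrite intrD ler_pdivlMr// ltr_pdivrMr// => -> ->.
by apply: floor_def; rewrite intrD ler_pdivlMr// ltr_pdivrMr// h1 h2.
Qed.

Lemma cellidx_step n z z' : cellidx n.+1 z = cellidx n.+1 z' -> cellidx n z = cellidx n z'.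
Proof.
move=> /ffunP E; apply/ffunP => i; have := E i; rewrite !ffunE => {}E.
apply/cellidxP; set k := Num.floor (co i z' / mesh n).
set l := Num.floor (co i z' / mesh n.+1) in E.
have /andP[k1 k2] : k%:~R * mesh n <= co i z' < (k%:~R + 1) * mesh n by apply/cellidxP.
have /andP[l1 l2] : l%:~R * mesh n.+1 <= co i z' < (l%:~R + 1) * mesh n.+1 by apply/cellidxP.
have /andP[m1 m2] : l%:~R * mesh n.+1 <= co i z < (l%:~R + 1) * mesh n.+1 by apply/cellidxP.
rewrite meshS in k1 k2 *.
have h0 := mesh_gt0 n.+1.
have a1 : 2 * k%:~R < (l%:~R + 1 : R) by rewrite -(ltr_pM2r h0); lra.
have a2 : (l%:~R : R) < 2 * k%:~R + 2 by rewrite -(ltr_pM2r h0); lra.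
have b1 : (2 * k < l + 1)%R by rewrite -(ltr_int R) !rmorphD/= rmorphM.
have b2 : (l < 2 * k + 2)%R by rewrite -(ltr_int R) !rmorphD/= rmorphM.
have c1 : 2 * k%:~R <= (l%:~R : R).
  have -> : 2 * k%:~R = (2 * k)%:~R :> R by rewrite rmorphM.
  by rewrite ler_int; lia.
have c2 : (l%:~R : R) <= 2 * k%:~R + 1.
  have -> : 2 * k%:~R + 1 = (2 * k + 1)%:~R :> R by rewrite rmorphD rmorphM.
  by rewrite ler_int; lia.
apply/andP; split; nra.
Qed.

Lemma cellidx_nest n m z z' : (n <= m)%N -> cellidx m z = cellidx m z' -> cellidx n z = cellidx n z'.
Proof.
move=> nm; rewrite -(subnK nm); elim: (m - n)%N => [|j IH]; first by rewrite add0n.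
by rewrite addSn => /cellidx_step.
Qed.

Definition ccen (n : nat) (k : {ffun 'I_3 -> int}) : Z :=
  (((k d0)%:~R * mesh n + mesh n / 2, (k d1)%:~R * mesh n + mesh n / 2), (k d2)%:~R * mesh n + mesh n / 2).

Lemma co_ccen n k i : co i (ccen n k) = (k i)%:~R * mesh n + mesh n / 2.
Proof.
case: i => -[|[|[|//]]] ik; rewrite /co /ccen/=; congr (_ %:~R * _ + _); congr (k _); exact/val_inj.
Qed.

Definition cell (n : nat) (k : {ffun 'I_3 -> int}) : set ((mR * mR) * mR) := [set z | cellidx n z = k].

Lemma cell_box n k : cell n k `<=` box (ccen n k) (mesh n / 2).
Proof.
move=> z /ffunP zk; apply/boxP => i; have := zk i; rewrite ffunE => /cellidxP.
by rewrite co_ccen ler_norml => /andP[? ?]; lra.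
Qed.

Lemma obox_cell n k z : (forall i, `|co i z - co i (ccen n k)| < mesh n / 2) -> cell n k z.
Proof.
move=> H; apply/ffunP => i; rewrite ffunE; apply/cellidxP; have := H i.
by rewrite co_ccen ltr_norml => /andP[? ?]; apply/andP; split; lra.
Qed.

Lemma cellE n k : cell n k =
  ([set` `[(k d0)%:~R * mesh n, ((k d0)%:~R + 1) * mesh n[] `*`
   [set` `[(k d1)%:~R * mesh n, ((k d1)%:~R + 1) * mesh n[]) `*`
   [set` `[(k d2)%:~R * mesh n, ((k d2)%:~R + 1) * mesh n[].
Proof.
apply/seteqP; split=> z; rewrite /cell /=.
  move=> /ffunP H; have H' i := H i.
  by rewrite !in_itv/=; split; [split|]; [have := H' d0|have := H' d1|have := H' d2];
    rewrite ffunE => /cellidxP.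
rewrite !in_itv/= => -[[h0 h1] h2]; apply/ffunP => i; rewrite ffunE; apply/cellidxP.
case: i => -[|[|[|//]]] ik; rewrite /co/=.
- by rewrite (_ : Ordinal ik = d0)//; exact/val_inj.
- by rewrite (_ : Ordinal ik = d1)//; exact/val_inj.
- by rewrite (_ : Ordinal ik = d2)//; exact/val_inj.
Qed.

Lemma measurable_cell n k : measurable (cell n k).
Proof. by rewrite cellE; apply: measurableX; [apply: measurableX|]; exact: measurable_itv. Qed.
Hint Resolve measurable_cell : core.

Lemma L3_cell n k : L3 (cell n k) = L3 (box (ccen n k) (mesh n / 2)).
Proof.
have h0 := mesh_gt0 n.
rewrite leb_box; last by rewrite divr_ge0// ltW.
rewrite cellE L3E; [|by apply: measurableX; exact: measurable_itv|exact: measurable_itv].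
rewrite L2E; [|exact: measurable_itv|exact: measurable_itv].
have E (a : int) : lebesgue_measure [set` `[a%:~R * mesh n, (a%:~R + 1) * mesh n[] = (mesh n)%:E.
  rewrite lebesgue_measure_itv/= lte_fin ltr_pM2r// ltrDl ltr01 -EFinD; congr EFin; ring.
by rewrite !E -!EFinM; congr EFin; field.
Qed.

(* Among the dyadic cells fine with respect to the gauge, the maximal ones partition [O]. *)
Lemma gauge_cells (O : set Z) (g : Z -> R) (e : R) :
  open O -> (L3 O < +oo)%E -> (forall z, O z -> 0 < g z) -> 0 < e ->
  exists s : seq (nat * {ffun 'I_3 -> int}),
  [/\ uniq s,
      forall j, j \in s -> box (ccen j.1 j.2) (mesh j.1 / 2) `<=` O /\
        exists2 z, cell j.1 j.2 z & forall y, box (ccen j.1 j.2) (mesh j.1 / 2) y -> `|y - z| < g z,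
      forall i j, i \in s -> j \in s -> i != j -> cell i.1 i.2 `&` cell j.1 j.2 = set0 &
      (L3 (O `\` \bigcup_(j in [set` s]) cell j.1 j.2) <= e%:E)%E].
Proof.
move=> oO fO g0 e0.
pose ok (j : nat * {ffun 'I_3 -> int}) := box (ccen j.1 j.2) (mesh j.1 / 2) `<=` O /\
   exists2 z, cell j.1 j.2 z & forall y, box (ccen j.1 j.2) (mesh j.1 / 2) y -> `|y - z| < g z.
pose okb j : bool := `[< ok j >].
have ex z : O z -> exists n, okb (n, cellidx n z).
  move=> Oz; have : nbhs z O by rewrite nbhsE; exists O.
  move=> /nbhs_ballP[r /= r0 rO].
  have [n nh] : exists n, mesh n < Num.min r (g z) by apply: mesh_small; rewrite lt_min r0 g0.
  move: nh; rewrite lt_min => /andP[nr ng].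
  have bz y : box (ccen n (cellidx n z)) (mesh n / 2) y -> `|y - z| <= mesh n.
    have /cell_box/box_norm h1 : cell n (cellidx n z) z by [].
    move=> /box_norm h2; rewrite (_ : y - z = (y - ccen n (cellidx n z)) - (z - ccen n (cellidx n z))).
      by rewrite (le_trans (ler_normB _ _))//; lra.
    by rewrite opprB addrA subrK.
  exists n; apply/asboolP; split=> [y /bz yz|].
    by apply: rO; rewrite -ball_normE/= distrC; lra.
  by exists z => // y /bz /=; lra.
(* A cell is kept when it is admissible and no coarser cell containing it is. Dyadic cells are
   nested, so the ancestors may be read off at the centre of the cell. *)
pose mx (j : nat * {ffun 'I_3 -> int}) :=
  okb j && [forall i : 'I_j.1, ~~ okb (nat_of_ord i, [ffun a => Num.floor (co a (ccen j.1 j.2) / mesh i)])].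
have ccell j : cell j.1 j.2 (ccen j.1 j.2).
  by apply: obox_cell => i; rewrite subrr normr0 divr_gt0.
have mxP j z : cell j.1 j.2 z -> mx j <-> okb j /\ forall n, (n < j.1)%N -> ~~ okb (n, cellidx n z).
  move=> jz; have E n : (n < j.1)%N -> cellidx n z = [ffun a => Num.floor (co a (ccen j.1 j.2) / mesh n)].
    move=> nj; rewrite -[RHS]/(cellidx n (ccen j.1 j.2)).
    by apply: (cellidx_nest (ltnW nj)); rewrite jz; exact/esym/ccell.
  split=> [/andP[okj /forallP H]|[okj H]].
    by split=> // n nj; rewrite E//; exact: (H (Ordinal nj)).
  by apply/andP; split => //; apply/forallP => i; rewrite -E; [exact: H|exact: ltn_ord].
pose Q (m : nat) : set ((mR * mR) * mR) :=
  if pickle_inv m is Some j then (if mx j then cell j.1 j.2 else set0) else set0.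
have QO m : Q m `<=` O.
  rewrite /Q; case: pickle_inv => [j|]; last by move=> z.
  case: ifP => mj z; last by case.
  move=> zj.
  have /asboolP[jO _] : `[< ok j >] by case/andP: mj.
  exact/jO/cell_box.
have mQ m : measurable (Q m).
  by rewrite /Q; case: pickle_inv => [j|]; [case: ifP|].
have OE : O = \bigcup_m Q m.
  apply/seteqP; split=> [z Oz|z [m _ /QO]//].
  case: (ex_minnP (ex z Oz)) => n okn nmin; pose j := (n, cellidx n z).
  exists (pickle j) => //; rewrite /Q pickleK_inv.
  have -> : mx j.
    apply/(mxP j z) => //; split => // n' n'n; apply/negP => /nmin.
    by rewrite leqNgt n'n.
  by [].
have mxdisj i j : mx i -> mx j -> i != j -> cell i.1 i.2 `&` cell j.1 j.2 = set0.
  move=> mi mj ij; rewrite -subset0 => z [zi zj].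
  have [oi Hi] := (mxP i z zi).1 mi; have [oj Hj] := (mxP j z zj).1 mj.
  move: ij; have [ij|ij|ij] := ltngtP i.1 j.1.
  - have := Hj _ ij; rewrite (_ : (i.1, cellidx i.1 z) = i) ?oi//.
    by rewrite [RHS]surjective_pairing -zi.
  - have := Hi _ ij; rewrite (_ : (j.1, cellidx j.1 z) = j) ?oj//.
    by rewrite [RHS]surjective_pairing -zj.
  - by move=> /eqP[]; rewrite (surjective_pairing i) (surjective_pairing j) -zi -zj ij.
have Qdisj : trivIset setT Q.
  apply/trivIsetP => m m' _ _ mm'; rewrite /Q.
  case E: (pickle_inv m) => [i|]; last by rewrite set0I.
  case E' : (pickle_inv m') => [j|]; last by rewrite setI0.
  case: ifP => mi; last by rewrite set0I.
  case: ifP => mj; last by rewrite setI0.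
  apply: mxdisj => //; apply: contra mm' => /eqP ij.
  have := @pickle_invK (nat * {ffun 'I_3 -> int})%type m.
  have := @pickle_invK (nat * {ffun 'I_3 -> int})%type m'.
  by rewrite E E'/= ij => -> ->.
(* The maximal cells form a countable partition of [O]; continuity of the measure from above along
   the remainders shows that finitely many of them cover all but measure [e]. *)
pose D n : set ((mR * mR) * mR) := O `\` \big[setU/set0]_(m < n) Q m.
have mO : measurable (O : set ((mR * mR) * mR)) by rewrite OE; exact: bigcup_measurable.
have mD n : measurable (D n).
  by apply: measurableD => //; apply: bigsetU_measurable.
have cD : (L3 \o D) n @[n --> \oo] --> L3 (\bigcap_n D n).
  apply: nonincreasing_cvg_mu => //.
  - by apply: le_lt_trans fO; apply: le_measure; rewrite ?inE//; apply: subDsetl.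
  - exact: bigcap_measurableType.
  - apply/nonincreasing_seqP => n; apply/subsetPset; apply: setDS.
    by rewrite big_ord_recr/=; exact: subsetUl.
have D0 : \bigcap_n D n = set0.
  rewrite -subset0 => z Dz; have [Oz _] := Dz 0%N I.
  have [m _ Qm] : (\bigcup_m Q m) z by rewrite -OE.
  have [_] := Dz m.+1 I; apply.
  by rewrite big_ord_recr/=; right.
rewrite D0 measure0 in cD.
have [n Dn] : exists n, (L3 (D n) <= e%:E)%E.
  have /fine_cvgP[[n1 _ H1] /cvgrPdist_lt/(_ _ e0)[n2 _ H2]] := cD.
  have /= := H2 (maxn n1 n2) (leq_maxr _ _); have /= := H1 (maxn n1 n2) (leq_maxl _ _).
  move=> fi; rewrite sub0r normrN => h; exists (maxn n1 n2); rewrite -(fineK fi) lee_fin.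
  by rewrite (le_trans (ler_norm _))// ltW.
exists [seq j <- pmap pickle_inv (iota 0 n) | mx j]; split.
- by apply: filter_uniq; apply: (pmap_uniq (@pickle_invK _)); exact: iota_uniq.
- by move=> j; rewrite mem_filter => /andP[/andP[oj _] _]; exact: (@asboolW (ok j)).
- by move=> i j; rewrite !mem_filter => /andP[mi _] /andP[mj _]; exact: mxdisj.
- apply: le_trans Dn; apply: le_measure; rewrite ?inE//.
    apply: measurableD => //; apply: fin_bigcup_measurable => [|j _]; [exact: finite_seq|exact: measurable_cell].
  apply: setDS => z; rewrite -bigcup_mkord => -[m /= mn]; rewrite /Q.
  case E: (pickle_inv m) => [j|]//; case: ifP => // mj zj; exists j => //=.
  rewrite mem_filter mj/= mem_pmap; apply/mapP; exists m; last by rewrite E.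
  by rewrite mem_iota.
Qed.

End dyadic.

(** * Uniform margins and the primitive of the time derivative *)

Section states.
Context {R : realType}.
Notation Z := ((R * R) * R)%type.
Notation mR := (measurableTypeR R).
Notation L3 := (@L3 R).
Notation d0 := (@Ordinal 3 0 isT).
Notation d1 := (@Ordinal 3 1 isT).
Notation d2 := (@Ordinal 3 2 isT).

Lemma cvg_dist0 (f : Z -> R) z : {for z, continuous f} <->
  forall e, 0 < e -> exists2 d, 0 < d & forall y, `|y - z| < d -> `|f y - f z| < e.
Proof.
split=> [cf e e0|H].
  have /cvgrPdist_lt/(_ _ e0)/nbhs_ballP[d /= dp H] := cf.
  by exists d => // y yz; rewrite distrC; apply: (H y); rewrite -ball_normE/= distrC.
apply/cvgrPdist_lt => e e0; have [d dp H'] := H e e0.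
have : nbhs (z : Z) [set y | `|f z - f y| < e].
  apply/nbhs_ballP; exists d => //= y; rewrite -ball_normE/= distrC => /H'.
  by rewrite distrC.
by [].
Qed.

Lemma box_unif_continuous (h : Z -> R) c r e : continuous h -> 0 < e ->
  exists2 d, 0 < d & forall x y, box c r x -> `|y - x| < d -> `|h y - h x| < e.
Proof.
move=> ch e0.
have /compact_near_coveringP/(_ R (0^'+) (fun d x => forall y, `|y - x| < d -> `|h y - h x| < e)) :=
  @compact_box R c r.
move=> /(_ _)[|d /= dp H].
  move=> x _; have [d dp H] := (cvg_dist0 h x).1 (ch x) _ (divr_gt0 e0 (ltr0n R 2)).
  exists ([set y | `|y - x| < d / 2], [set t | t < d / 2]).
    split => /=; last by apply: nbhs_right_lt; rewrite divr_gt0.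
    by apply/nbhs_ballP; exists (d / 2) => /=; [rewrite divr_gt0|move=> y; rewrite -ball_normE/= distrC].
  move=> [x' t] [/= x't td] y yx'.
  have h1 : `|h x' - h x| < e / 2 by apply: H; move: x't dp; clear; lra.
  have h2 : `|h y - h x| < e / 2.
    apply: H; rewrite (_ : y - x = (y - x') + (x' - x)); last by rewrite addrA subrK.
    by rewrite (le_lt_trans (ler_normD _ _))//; move: yx' td x't; clear; lra.
  rewrite (_ : h y - h x' = (h y - h x) - (h x' - h x)); last by ring.
  by rewrite (le_lt_trans (ler_normB _ _))//; move: h1 h2; clear; lra.
exists (d / 2); first by rewrite divr_gt0.
move=> x y bx xy; apply: (H (d / 2)) => //=; rewrite ?sub0r ?normrN ?gtr0_norm ?divr_gt0//.
by rewrite ltr_pdivrMr// mulr_natr mulr2n ltrDl.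
Qed.

Notation st := ('I_4 -> 'I_2 -> R).

Definition st_open (U : set st) := forall P, U P ->
  exists2 m, 0 < m & forall Q, (forall i k, `|Q i k - P i k| < m) -> U Q.

(** Compactness of [A] turns the margins given by openness at each point of the image into a single
    one. *)
Lemma st_tube (T : topologicalType) (A : set T) (f : T -> st) (U : set st) :
  compact A -> (forall i k, continuous (fun x => f x i k)) -> st_open U -> (forall x, A x -> U (f x)) ->
  exists2 m, 0 < m & forall x Q, A x -> (forall i k, `|Q i k - f x i k| < m) -> U Q.
Proof.
move=> cA cf oU AU.
have /compact_near_coveringP/(_ R (0^'+)
  (fun d x => forall Q, (forall i k, `|Q i k - f x i k| < d) -> U Q)) := cA.
move=> /(_ _)[|d /= dp H].
  move=> x Ax; have [m m0 H] := oU _ (AU x Ax).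
  have m2 : 0 < m / 2 by rewrite divr_gt0.
  exists ([set y | forall i k, `|f y i k - f x i k| < m / 2], [set t | t < m / 2]).
    split => /=; last exact: nbhs_right_lt.
    have : \forall y \near x, forall i k, `|f y i k - f x i k| < m / 2.
      apply: filter_forall => i; apply: filter_forall => k.
      have /cvgrPdist_lt/(_ _ m2) := cf i k x.
      by apply: filterS => y; rewrite distrC.
    by [].
  move=> [x' t] [/= x't td] Q Qx'; apply: H => i k.
  rewrite (_ : _ - _ = (Q i k - f x' i k) + (f x' i k - f x i k)); last by ring.
  by rewrite (le_lt_trans (ler_normD _ _))//; move: (Qx' i k) td (x't i k); clear; lra.
exists (d / 2); first by rewrite divr_gt0.
move=> x Q Ax xQ; apply: (H (d / 2) _ _ x Ax Q xQ) => //=; rewrite ?sub0r ?normrN ?gtr0_norm ?divr_gt0//.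
by rewrite ltr_pdivrMr// mulr_natr mulr2n ltrDl.
Qed.

Lemma FTC_itv (G g : R -> R) (a b : R) : (forall s : R, is_derive s 1 G (g s)) -> continuous g -> a <= b ->
  \int[lebesgue_measure]_(s in `[a, b]) g s = G b - G a.
Proof.
move=> dG cg; rewrite le_eqVlt => /predU1P[->|ab].
  by rewrite set_itv1 Rintegral_set1 subrr.
have cG := is_derive_continuous dG.
rewrite /Rintegral (@continuous_FTC2 _ _ G)//.
- exact: continuous_subspaceT.
- split => [s _||]; first by have [] := dG s.
  + by apply: cvg_at_right_filter; exact: cG.
  + by apply: cvg_at_left_filter; exact: cG.
- by move=> s _; rewrite derive1E; have [_ ->] := dG s.
Qed.

Lemma derive_bound (G g : R -> R) (a b C : R) : (forall s : R, is_derive s 1 G (g s)) ->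
  (forall s, Num.min a b <= s <= Num.max a b -> `|g s| <= C) -> `|G b - G a| <= C * `|b - a|.
Proof.
move=> dG.
wlog ab : a b / a < b => [H|].
  have [ab|ba|->] := ltgtP a b; first by move=> bnd; apply: H => // s; rewrite /Num.min /Num.max ab; exact: bnd.
    by move=> bnd; rewrite distrC [`|b - a|]distrC; apply: H => // s; rewrite /Num.min /Num.max ba; exact: bnd.
  by rewrite !subrr !normr0 mulr0.
move=> bnd.
have [c cab ->] := @MVT R G g a b ab (fun s _ => dG s) (continuous_subspaceT (is_derive_continuous dG)).
rewrite normrM ler_wpM2r// bnd//.
by move: cab; rewrite in_itv/= /Num.min /Num.max ab => /andP[/ltW-> /ltW->].
Qed.

Variable B : R.
Hypothesis B0 : 0 < B.

(** The function [q], started at the face [x_2 = - B], outside the domain. Below that face the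
    interval is empty and the value is 0, which is why differentiability in [x_2] is claimed only
    above it. *)
Definition qq (f : Z -> R) (z : Z) : R :=
  \int[lebesgue_measure]_(s in `[- B, co d1 z]) 'D_(dir d2) f (upd d1 z s).

Lemma continuous_Dt_upd (f : Z -> R) (z : Z) : C1 f -> continuous (fun s : R => 'D_(dir d2) f (upd d1 z s)).
Proof.
move=> Cf s; apply: (@continuous_comp R Z R (upd d1 z) (fun w => 'D_(dir d2) f w) s).
  exact: continuous_upd.
exact: C1Dc.
Qed.

Arguments continuous_Dt_upd {f} z _ _.

Lemma qqE f z (G : R -> R) : C1 f -> (forall s : R, is_derive s 1 G ('D_(dir d2) f (upd d1 z s))) ->
  qq f z = G (Num.max (co d1 z) (- B)) - G (- B).
Proof.
move=> Cf dG; rewrite /qq.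
have cg := continuous_Dt_upd z Cf.
case: (leP (- B) (co d1 z)) => h; first by rewrite (FTC_itv dG cg).
by rewrite set_itv_ge ?Rintegral_set0 ?subrr// bnd_simp -ltNge.
Qed.

Lemma qq_derive f z s : C1 f -> - B < s ->
  is_derive s 1 (fun r => qq f (upd d1 z r)) ('D_(dir d2) f (upd d1 z s)).
Proof.
move=> Cf Bs; have [G dG] := antiderivative (continuous_Dt_upd z Cf).
apply: (@is_derive_near _ _ (fun r => G r - G (- B))).
  have : \forall r \near s, - B < r by exact: lt_nbhsr.
  apply: filterS => r Br; rewrite (@qqE _ _ G)//.
  by rewrite co_upd max_l// ltW.
have dG' := dG s; apply: is_derive_eq.
by rewrite subr0.
Qed.

Lemma upd_norm k (z z' : Z) s : `|upd k z s - upd k z' s| <= `|z - z'|.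
Proof.
case: k => -[|[|[|//]]] ik; rewrite /upd/= !prod_normE/= !ge_max ?subrr ?normr0 !le_max ?lexx ?normr_ge0 ?orbT//.
Qed.

Lemma co_norm k (z : Z) : `|co k z| <= `|z|.
Proof.
by case: k => -[|[|[|//]]] ik; rewrite /co/= !prod_normE/= !le_max ?lexx ?orbT.
Qed.

Lemma coB k (z z' : Z) : co k (z - z') = co k z - co k z'.
Proof. by case: k => -[|[|[|//]]] ik. Qed.

Lemma normZ_le (z : Z) C : (forall k, `|co k z| <= C) -> `|z| <= C.
Proof.
move=> H; rewrite !prod_normE/= !ge_max.
by rewrite (H d0) (H d1) (H d2).
Qed.

Lemma co_upd_neq k l (z : Z) s : k != l -> co k (upd l z s) = co k z.
Proof. by case: k l => -[|[|[|//]]] ik [[|[|[|//]]] il]. Qed.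

Lemma upd_box (k : 'I_3) (z : Z) s C : `|z| <= C -> `|s| <= C -> box 0 C (upd k z s).
Proof.
move=> zC sC; apply/box_norm; rewrite subr0; apply: normZ_le => l.
have [<-|kl] := eqVneq k l; first by rewrite co_upd.
by rewrite co_upd_neq ?(le_trans (co_norm _ _))// eq_sym.
Qed.

(** Both the upper limit and the integrand depend on the point. Moving the limit costs a local bound
    of the time derivative, moving the integrand its uniform continuity on a large box; each gets
    half of [e]. *)
Lemma continuous_qq f : C1 f -> continuous (qq f).
Proof.
move=> Cf z0; apply/cvg_dist0 => e e0.
pose C0 := `|z0| + 1 + B.
have cD : continuous (fun z => 'D_(dir d2) f z) by exact: C1Dc.
have [C HC] := cont_box_bounded 0 C0 cD.
pose C' := `|C| + 1.
have C'0 : 0 < C' by rewrite ltr_wpDl.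
pose e' := e / 2 / (C0 + B).
have C00 : 0 < C0 by rewrite /C0; have := normr_ge0 z0; move: B0; clear; lra.
have CB0 : 0 < C0 + B by move: C00 B0; clear; lra.
have e'0 : 0 < e' by rewrite !divr_gt0.
have [d dp Hd] := box_unif_continuous 0 C0 cD e'0.
pose r := Num.min (Num.min 1 d) (e / 2 / C').
exists r; first by rewrite !lt_min ltr01 dp !divr_gt0.
move=> z; rewrite !lt_min => /andP[/andP[zz1 zzd] zzC].
have [G dG] := antiderivative (continuous_Dt_upd z Cf).
have [G0 dG0] := antiderivative (continuous_Dt_upd z0 Cf).
rewrite (qqE Cf dG) (qqE Cf dG0).
set m := Num.max (co d1 z) _; set m0 := Num.max (co d1 z0) _.
have zn : `|z| <= `|z0| + 1.
  by rewrite -[z](subrK z0) (le_trans (ler_normD _ _))// addrC lerD2l ltW.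
have cz := le_trans (co_norm d1 z) zn.
have cz0 : `|co d1 z0| <= `|z0| by exact: co_norm.
have mm : `|m - m0| <= `|z - z0|.
  apply: le_trans (co_norm d1 (z - z0)); rewrite coB /m /m0.
  case: (leP (co d1 z)); case: (leP (co d1 z0)); rewrite ?subrr ?normr0 ?normr_ge0// => h1 h2.
  - by rewrite !ler0_norm; move: h1 h2; clear; lra.
  - by rewrite !ger0_norm; move: h1 h2; clear; lra.
have mC : `|m| <= C0.
  rewrite /m /C0; case: (leP (co d1 z) (- B)) => _; rewrite ?normrN ?(gtr0_norm B0); first by rewrite lerDr addr_ge0.
  by rewrite (le_trans cz)// lerDl ltW.
have m0C : `|m0| <= C0.
  rewrite /m0 /C0; case: (leP (co d1 z0) (- B)) => _; rewrite ?normrN ?(gtr0_norm B0); first by rewrite lerDr addr_ge0.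
  by rewrite (le_trans cz0)// -addrA lerDl addr_ge0// ltW.
have Bm0 : - B <= m0 by rewrite /m0 le_max lexx orbT.
have sC a b s : `|a| <= C0 -> `|b| <= C0 -> Num.min a b <= s <= Num.max a b -> `|s| <= C0.
  rewrite !ler_norml ge_min le_max => /andP[? ?] /andP[? ?] /andP[/orP[]? /orP[]?]; apply/andP; split; lra.
have h1 : `|G m - G m0| <= C' * `|m - m0|.
  apply: (derive_bound dG) => s /(sC _ _ _ m0C mC) s0.
  apply: le_trans (HC _ _) _; last by rewrite /C' (le_trans (ler_norm _))// lerDl.
  by apply: upd_box => //; move: zn B0; rewrite /C0; clear; lra.
have dGG (s : R) : is_derive s 1 (fun s => G s - G0 s) ('D_(dir d2) f (upd d1 z s) - 'D_(dir d2) f (upd d1 z0 s)).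
  exact: is_deriveB.
have h2 : `|(G m0 - G0 m0) - (G (- B) - G0 (- B))| <= e' * `|m0 - - B|.
  apply: (derive_bound dGG) => s /(sC _ _ _) s0; apply/ltW/Hd.
    apply: upd_box; first by rewrite /C0; move: B0; clear; lra.
    apply: s0 => //; rewrite normrN gtr0_norm// /C0; have := normr_ge0 z0; move: B0; clear; lra.
  exact: le_lt_trans (upd_norm _ _ _ _) zzd.
have h3 : e' * `|m0 - - B| <= e / 2.
  rewrite /e' -mulrA ler_piMr ?divr_ge0 ?(ltW e0)// mulrC ler_pdivrMr// mul1r opprK.
  by rewrite (le_trans (ler_normD _ _))// lerD// gtr0_norm.
have h4 : C' * `|m - m0| < e / 2.
  by rewrite mulrC -ltr_pdivlMr// (le_lt_trans mm).
rewrite (_ : _ - _ = (G m - G m0) + ((G m0 - G0 m0) - (G (- B) - G0 (- B)))); last by ring.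
rewrite (le_lt_trans (ler_normD _ _))//; move: h1 h2 h3 h4; clear; lra.
Qed.

(** The nonlocal term is controlled by the supremum of the time derivative and by nothing else, so
    all perturbations must be slow in time. *)
Lemma qq_bound f C z : C1 f -> (forall z, `|'D_(dir d2) f z| <= C) -> co d1 z <= B ->
  `|qq f z| <= C * (2 * B).
Proof.
move=> Cf fC zB; have [G dG] := antiderivative (continuous_Dt_upd z Cf).
rewrite (qqE Cf dG); apply: (le_trans (derive_bound dG (fun s _ => fC _))).
rewrite ler_wpM2l ?(le_trans _ (fC z))// ger0_norm.
  by rewrite opprK mulr2n mulrDl mul1r lerD2r ge_max zB; move: B0; clear; lra.
by rewrite subr_ge0 le_max lexx orbT.
Qed.

Lemma qqD f g z : C1 f -> C1 g -> qq (fun z => f z + g z) z = qq f z + qq g z.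
Proof.
move=> Cf Cg.
have [G dG] := antiderivative (continuous_Dt_upd z Cf).
have [H dH] := antiderivative (continuous_Dt_upd z Cg).
have dGH (s : R) : is_derive s 1 (fun s => G s + H s) ('D_(dir d2) (fun z => f z + g z) (upd d1 z s)).
  by rewrite deriveDC1//; exact: is_deriveD.
rewrite (qqE Cf dG) (qqE Cg dH) (qqE (C1D Cf Cg) dGH); ring.
Qed.

End states.

(** * Integrals over finite families of cells *)

Section cells.
Context {R : realType}.
Notation Z := ((R * R) * R)%type.
Notation mR := (measurableTypeR R).
Notation L3 := (@L3 R).
Notation d0 := (@Ordinal 3 0 isT).
Notation d1 := (@Ordinal 3 1 isT).
Notation d2 := (@Ordinal 3 2 isT).

Lemma seq_min_gt0 (T : eqType) (s : seq T) (f : T -> R) : (forall j, j \in s -> 0 < f j) ->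
  exists2 e, 0 < e & forall j, j \in s -> e <= f j.
Proof.
elim: s => [|a s IH] H; first by exists 1.
have [|e e0 He] := IH; first by move=> j js; apply: H; rewrite inE js orbT.
exists (Num.min e (f a)); first by rewrite lt_min e0 H// inE eqxx.
by move=> j; rewrite inE ge_min => /predU1P[->|/He ->//]; rewrite lexx orbT.
Qed.

Lemma sum_supp (T : eqType) (s : seq T) (C : T -> set Z) (F : T -> Z -> R) z :
  uniq s -> (forall i j, i \in s -> j \in s -> i != j -> C i `&` C j = set0) ->
  (forall i, i \in s -> ~ C i z -> F i z = 0) ->
  (forall j, j \in s -> C j z -> \sum_(i <- s) F i z = F j z) /\
  ((forall j, j \in s -> ~ C j z) -> \sum_(i <- s) F i z = 0).
Proof.
move=> us dC F0; split=> [j js Cj|nC]; last first.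
  by rewrite big_seq big1// => i is_; apply: F0 => //; exact: nC.
rewrite (bigD1_seq j)//= big_seq_cond big1 ?addr0// => i /andP[is_ ij].
apply: F0 => // Ci; have : (C i `&` C j) z by [].
by rewrite dC.
Qed.

(** The points of [N] closer than [mesh n] to the complement form open sets decreasing to the empty
    set, because [N] is open. This will isolate the points which lie in the good region although the
    reference point of their cell does not. *)
Lemma near_complement_small (N : set Z) e : open N -> (L3 N < +oo)%E -> 0 < e ->
  exists2 r, 0 < r & exists D : set ((mR * mR) * mR),
  [/\ measurable D, (L3 D <= e%:E)%E & forall y z, N y -> ~ N z -> `|y - z| < r -> D y].
Proof.
move=> oN fN e0.
pose D n : set ((mR * mR) * mR) := [set y | N y /\ exists2 z, ~ N z & `|y - z| < @mesh R n].
have mN : measurable (N : set ((mR * mR) * mR)) by exact: open_measurable3.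
have mD n : measurable (D n).
  apply: open_measurable3.
  rewrite (_ : D n = N `&` \bigcup_(z in ~` N) ball z (@mesh R n)).
    by apply: openI => //; apply: bigcup_open => z _; exact: ball_open.
  apply/seteqP; split=> y [Ny [z Nz yz]]; split => //; exists z => //.
    by rewrite -ball_normE/= distrC.
  by move: yz; rewrite -ball_normE/= distrC.
have cD : (L3 \o D) n @[n --> \oo] --> L3 (\bigcap_n D n).
  apply: nonincreasing_cvg_mu => //.
  - by apply: le_lt_trans fN; apply: le_measure; rewrite ?inE// => y [].
  - exact: bigcap_measurableType.
  - apply/nonincreasing_seqP => n; apply/subsetPset => y [Ny [z Nz yz]]; split => //; exists z => //.
    by rewrite meshS (lt_trans yz)// mulr2n mulrDl mul1r ltrDl mesh_gt0.
have D0 : \bigcap_n D n = set0.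
  rewrite -subset0 => y Dy; have [Ny _] := Dy 0%N I.
  have : nbhs (y : Z) N by rewrite nbhsE; exists N.
  move=> /nbhs_ballP[r /= r0 rN]; have [n nr] := mesh_small r0.
  have [_ [z Nz yz]] := Dy n I; apply: Nz; apply: rN.
  by rewrite -ball_normE/= (lt_trans yz).
rewrite D0 measure0 in cD.
have [n Dn] : exists n, (L3 (D n) <= e%:E)%E.
  have /fine_cvgP[[n1 _ H1] /cvgrPdist_lt/(_ _ e0)[n2 _ H2]] := cD.
  have /= := H2 (maxn n1 n2) (leq_maxr _ _); have /= := H1 (maxn n1 n2) (leq_maxl _ _).
  move=> fi; rewrite sub0r normrN => h; exists (maxn n1 n2); rewrite -(fineK fi) lee_fin.
  by rewrite (le_trans (ler_norm _))// ltW.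
by exists (@mesh R n); [exact: mesh_gt0|exists (D n); split => // y z Ny Nz yz; split => //; exists z].
Qed.

Lemma integrable_cst (A : set ((mR * mR) * mR)) (c : R) : measurable A -> (L3 A < +oo)%E ->
  L3.-integrable A (EFin \o (fun=> c)).
Proof. by move=> mA fA; apply: (@bounded_integrable _ _ _ L3 A (fun=> c) `|c| mA fA). Qed.

(** Induction on the list, removing one cell at a time from [O]; what no cell covers is charged at
    the rate [c]. *)
Lemma cells_integral_le (T : eqType) (s : seq T) (C : T -> set ((mR * mR) * mR))
    (O : set ((mR * mR) * mR)) (f : Z -> R) (A : T -> R) c :
  uniq s -> (forall j, measurable (C j)) -> measurable O -> L3.-integrable O (EFin \o f) ->
  (L3 O < +oo)%E ->
  (forall j, j \in s -> C j `<=` O) ->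
  (forall i j, i \in s -> j \in s -> i != j -> C i `&` C j = set0) ->
  (forall j, j \in s -> \int[L3]_(z in C j) f z <= A j) ->
  (forall z, O z -> (forall j, j \in s -> ~ C j z) -> f z <= c) ->
  \int[L3]_(z in O) f z <= \sum_(j <- s) A j + c * fine (L3 (O `\` \bigcup_(j in [set` s]) C j)).
Proof.
move=> + mC; elim: s O => [|a s IH] O /=.
  move=> _ mO fi fO _ _ _ fc; rewrite big_nil add0r.
  rewrite (_ : O `\` _ = O); last by rewrite set_nil bigcup_set0 setD0.
  rewrite -(Rintegral_cst L3 mO); apply: le_Rintegral => //.
    by apply: integrable_cst.
  by move=> z Oz; exact: fc.
move=> /andP[as_ us] mO fi fO CO dC fA fc.
have Ca : C a `<=` O by apply: CO; rewrite inE eqxx.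
have mOa : measurable (O `\` C a) by exact: measurableD.
rewrite big_cons -(setDUK Ca) Rintegral_setU//; last 2 first.
- by rewrite setDUK.
- by rewrite /disj_set setDIK.
rewrite -addrA lerD//; first by apply: fA; rewrite inE eqxx.
have := IH (O `\` C a) us mOa; rewrite setDUK//.
rewrite (_ : O `\` C a `\` _ = O `\` \bigcup_(j in [set` a :: s]) C j); last first.
  rewrite setDDl; congr (_ `\` _); apply/seteqP; split=> z.
    by move=> [Caz|[j js Cj]]; [exists a|exists j] => //=; rewrite inE ?eqxx//; apply/orP; right.
  by move=> [j /=]; rewrite inE => /predU1P[->|js] Cj; [left|right; exists j].
apply.
- by apply: integrableS fi => //; exact: subDsetl.
- by apply: le_lt_trans fO; apply: le_measure; rewrite ?inE//; exact: subDsetl.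
- move=> j js z Cz; split; first by apply: (CO j) => //; rewrite inE js orbT.
  move=> Caz; have : (C a `&` C j) z by [].
  by rewrite dC ?inE ?eqxx ?js ?orbT//; apply: contraNneq as_ => ->.
- by move=> i j is_ js; apply: dC; rewrite inE ?is_ ?js orbT.
- by move=> j js; apply: fA; rewrite inE js orbT.
- move=> z [Oz nCa] H; apply: fc => // j; rewrite inE => /predU1P[->//|]; exact: H.
Qed.

Lemma cell_box_integral n k (h : Z -> R) : continuous h ->
  \int[L3]_(z in cell n k) h z = \int[L3]_(z in box (ccen n k) (mesh n / 2)) h z.
Proof.
move=> ch; have r0 : 0 <= mesh n / 2 :> R by rewrite divr_ge0// ltW// mesh_gt0.
have mc : measurable (@cell R n k) by exact: measurable_cell.
have mb := @measurable_box R (ccen n k) (mesh n / 2).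
rewrite -[in RHS](setDUK (@cell_box R n k)) Rintegral_setU//; first last.
- by rewrite /disj_set setDIK.
- by rewrite setDUK; [exact: cont_box_integrable|exact: cell_box].
- exact: measurableD.
rewrite [X in _ + X](_ : _ = 0) ?addr0//.
rewrite /Rintegral (null_set_integral _ _ _)//=.
- exact: measurableD.
- apply/measurable_EFinP; apply: measurable_funTS; exact: continuous_measurable3.
- have : (L3 (box (ccen n k) (mesh n / 2)) =
    L3 (cell n k) + L3 (box (ccen n k) (mesh n / 2) `\` cell n k))%E.
    rewrite -measureU//; [by rewrite setDUK//; exact: cell_box|exact: measurableD|by rewrite setDIK].
  rewrite -L3_cell.
  have : (L3 (cell n k) < +oo)%E by rewrite L3_cell leb_box_lty.
  have : (0 <= L3 (box (ccen n k) (mesh n / 2) `\` cell n k))%E by [].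
  have : (0 <= L3 (cell n k))%E by [].
  rewrite -[mu3 R _]/(L3 (box (ccen n k) (mesh n / 2) `\` cell n k)).
  case: (L3 (cell n k)) => [a| |]//; case: (L3 (_ `\` _)) => [b| |]//.
  rewrite -EFinD => _ _ _ [ab]; congr EFin; move: ab; clear; lra.
Qed.

(** A pointwise bound that is affine in [kk] and in its defect integrates to its constant term,
    because the other two integrals are at most [e]. The energy and the L^1 estimates are both
    brought to this form. *)
Lemma cell_integral_le n k (f kk : Z -> R) p e al be ga : continuous kk -> 0 < e ->
  L3.-integrable (cell n k) (EFin \o f) ->
  `|\int[L3]_(z in box (ccen n k) (mesh n / 2)) kk z| <= e ->
  \int[L3]_(z in box (ccen n k) (mesh n / 2)) ((kk z + p) * (1 - p - kk z)) <= e ->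
  0 <= ga ->
  (forall z, cell n k z -> f z <= al + be * kk z + ga * ((kk z + p) * (1 - p - kk z))) ->
  \int[L3]_(z in cell n k) f z <= al * (@mesh R n) ^+ 3 + (`|be| + ga) * e.
Proof.
move=> ck e0 fi ke Be ga0 fle.
have r0 : 0 <= mesh n / 2 :> R by rewrite divr_ge0// ltW// mesh_gt0.
have mc : measurable (@cell R n k) by exact: measurable_cell.
have mb := @measurable_box R (ccen n k) (mesh n / 2).
pose h1 z := be * kk z; pose h2 z := ga * ((kk z + p) * (1 - p - kk z)).
have ckk : continuous (fun z => (kk z + p) * (1 - p - kk z)).
  move=> z; apply: cvgM; first by apply: cvgD; [exact: ck|exact: cvg_cst].
  by apply: cvgB; [exact: cvg_cst|exact: ck].
have c1 : continuous h1 by move=> z; apply: cvgM; [exact: cvg_cst|exact: ck].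
have c2 : continuous h2 by move=> z; apply: cvgM; [exact: cvg_cst|exact: ckk].
have c3 : continuous (fun z => al + h1 z) by move=> z; apply: cvgD; [exact: cvg_cst|exact: c1].
have ch : continuous (fun z => al + h1 z + h2 z) by move=> z; apply: cvgD; [exact: c3|exact: c2].
apply: (@le_trans _ _ (\int[L3]_(z in cell n k) (al + h1 z + h2 z))).
  apply: le_Rintegral => //.
  by apply: (cont_box_subset_integrable mc (@cell_box R n k)).
rewrite cell_box_integral//.
have i0 := cont_box_integrable (ccen n k) r0 (@cst_continuous Z R al).
have i1 := cont_box_integrable (ccen n k) r0 c1.
have i2 := cont_box_integrable (ccen n k) r0 c2.
have i3 := cont_box_integrable (ccen n k) r0 c3.
rewrite RintegralD// RintegralD//.
rewrite RintegralZl//; last exact: cont_box_integrable.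
rewrite RintegralZl//; last exact: cont_box_integrable.
rewrite Rintegral_cst//.
have -> : fine (L3 (box (ccen n k) (mesh n / 2))) = @mesh R n ^+ 3.
  by rewrite leb_box//=; congr (_ ^+ _); rewrite mulrC divfK.
rewrite -addrA lerD2l mulrDl lerD//; last by rewrite ler_wpM2l.
by rewrite (le_trans (ler_norm _))// normrM ler_wpM2l.
Qed.

Lemma cell_markov n k (kk : Z -> R) p e th : continuous kk -> 0 < th ->
  (forall z, - p <= kk z <= 1 - p) ->
  \int[L3]_(z in box (ccen n k) (mesh n / 2)) ((kk z + p) * (1 - p - kk z)) <= e ->
  let A := cell n k `&` [set z | th <= (kk z + p) * (1 - p - kk z)] in
  measurable A /\ (L3 A <= (e / th)%:E)%E.
Proof.
move=> ck th0 kb Be A.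
have r0 : 0 <= mesh n / 2 :> R by rewrite divr_ge0// ltW// mesh_gt0.
have mc : measurable (@cell R n k) by exact: measurable_cell.
have mb := @measurable_box R (ccen n k) (mesh n / 2).
have ckk : continuous (fun z => (kk z + p) * (1 - p - kk z)).
  move=> z; apply: cvgM; first by apply: cvgD; [exact: ck|exact: cvg_cst].
  by apply: cvgB; [exact: cvg_cst|exact: ck].
have mA : measurable A.
  apply: measurableI => //; rewrite (_ : [set _ | _] = ~` [set z | (kk z + p) * (1 - p - kk z) < th]).
    apply: measurableC; apply: open_measurable3.
    exact: (open_comp (fun z _ => ckk z) (@open_lt R th)).
  by apply/seteqP; split=> z /=; rewrite leNgt => /negP.
have Ab : A `<=` box (ccen n k) (mesh n / 2) by move=> z [/cell_box].
have fA : (L3 A < +oo)%E.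
  by apply: le_lt_trans (leb_box_lty (ccen n k) r0); apply: le_measure; rewrite ?inE.
have iA := cont_box_subset_integrable mA Ab r0 ckk.
split => //; rewrite -(@fineK _ (L3 A)); last by rewrite ge0_fin_numE.
rewrite lee_fin ler_pdivlMr// mulrC -(Rintegral_cst L3 mA).
apply: (le_trans _ Be); apply: (@le_trans _ _ (\int[L3]_(z in A) ((kk z + p) * (1 - p - kk z)))).
  by apply: le_Rintegral => //; [exact: integrable_cst|move=> z []].
rewrite -[leRHS](congr1 (fun X => \int[L3]_(z in X) ((kk z + p) * (1 - p - kk z))) (setDUK Ab)) Rintegral_setU//; first last.
- by rewrite /disj_set setDIK.
- by rewrite setDUK//; exact: cont_box_integrable.
- exact: measurableD.
rewrite lerDl; apply: Rintegral_ge0 => z _.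
by have /andP[k1 k2] := kb z; apply: mulr_ge0; move: k1 k2; clear; lra.
Qed.

End cells.

(** * Splitting states and the perturbation step *)

Section step.
Context {R : realType}.
Notation Z := ((R * R) * R)%type.
Notation mR := (measurableTypeR R).
Notation L3 := (@L3 R).
Notation d0 := (@Ordinal 3 0 isT).
Notation d1 := (@Ordinal 3 1 isT).
Notation d2 := (@Ordinal 3 2 isT).
Notation k0 := (@Ordinal 2 0 isT).
Notation k1 := (@Ordinal 2 1 isT).
Notation st := ('I_4 -> 'I_2 -> R).

Lemma near_st (T : topologicalType) (f : T -> st) (x : T) m : (forall i k, continuous (fun x => f x i k)) ->
  0 < m -> \forall y \near x, forall i k, `|f y i k - f x i k| < m.
Proof.
move=> cf m0; apply: filter_forall => i; apply: filter_forall => k.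
have /cvgrPdist_lt/(_ _ m0) := cf i k x.
by apply: filterS => y; rewrite distrC.
Qed.

Lemma continuous_bigsum (T : topologicalType) (I : Type) (r : seq I) (F : I -> T -> R) :
  (forall i, continuous (F i)) -> continuous (fun z => \sum_(i <- r) F i z).
Proof.
move=> cF; elim: r => [|i r IH] z.
  by under eq_fun do rewrite big_nil; exact: cvg_cst.
under eq_fun do rewrite big_cons.
by apply: cvgD; [exact: cF|exact: IH].
Qed.

Definition wd (k : 'I_2) : 'I_3 := widen_ord (isT : (2 <= 3)%N) k.

Lemma wd0 : wd k0 = d0. Proof. exact: val_inj. Qed.
Lemma wd1 : wd k1 = d1. Proof. exact: val_inj. Qed.

(** [Tc] selects which primitives enter which row. It is later specialised to [Tcs], which adds the
    primitive of row [j] to row [j + 2]. *)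
Definition qs (B : R) (Tc : 'I_4 -> 'I_4 -> R) (W : 'I_4 -> Z -> R) (z : Z) (i : 'I_4) : R :=
  \sum_(j < 4) Tc i j * qq B (W j) z.

Lemma qsD B Tc W V z i : (forall i, C1 (W i)) -> (forall i, C1 (V i)) ->
  qs B Tc (fun i z => W i z + V i z) z i = qs B Tc W z i + qs B Tc V z i.
Proof.
move=> CW CV; rewrite /qs -big_split/=; apply: eq_bigr => j _.
by rewrite -mulrDr; have -> := qqD B z (CW j) (CV j).
Qed.

(* The state of [W]: rows 0, 1 of a state are [Du], rows 2, 3 are [D eta + q (x) e_1]. *)
Definition St (B : R) (Tc : 'I_4 -> 'I_4 -> R) (W : 'I_4 -> Z -> R) (z : Z) : st := fun i k =>
  'D_(dir (wd k)) (W i) z + (if k == k0 then qs B Tc W z i else 0).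

(** What convex integration asks of a set [U] of states, [d] playing the role of the distance to the
    graph. A splitting along the product of [a] and [x] with weights [1 - p] and [p] has variance
    [p * (1 - p)], and on [M] this variance dominates [d]. Both ends of every splitting lie in [M],
    so after one step almost every point is in [M] and the next step is efficient. The lower bound
    on [(a i * x k1) ^+ 2] makes the second column alone feel the splitting. *)
Record splittable (U M : set st) (d : st -> R) (c K : R) : Prop := Splittable {
  sp_c : 0 < c;
  sp_K : 0 < K;
  sp_oU : st_open U;
  sp_oM : st_open M;
  sp_MU : M `<=` U;
  sp_bU : forall P i k, U P -> `|P i k| <= K;
  sp_d : forall P e, 0 < e -> exists2 m, 0 < m & forall Q, (forall i k, `|Q i k - P i k| < m) -> `|d Q - d P| < e;
  sp_dU : forall P, U P -> 0 <= d P <= K;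
  sp_split : forall P, U P -> exists (a : 'I_4 -> R) (x : 'I_2 -> R) (p : R),
    [/\ forall i, `|a i| <= K, forall k, `|x k| <= K, x k1 != 0 & c <= \sum_i (a i * x k1) ^+ 2] /\
    [/\ 0 < p < 1, forall g, - p <= g <= 1 - p -> U (fun i k => P i k + g * (a i * x k)),
        M (fun i k => P i k + (- p) * (a i * x k)), M (fun i k => P i k + (1 - p) * (a i * x k)) &
        M P -> c * d P <= p * (1 - p)]}.

Variables (U M : set st) (d : st -> R) (c K : R).
Hypothesis oc : splittable U M d c K.

Record cdata := CData {ca : 'I_4 -> R; cx : 'I_2 -> R; cp : R; cm : R; ct : R}.

Record good (e : R) (P : st) (D : cdata) : Prop := Good {
  gd_U0 : U P;
  gd_a : forall i, `|ca D i| <= K;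
  gd_x : forall k, `|cx D k| <= K;
  gd_x2 : cx D k1 != 0;
  gd_v : c <= \sum_i (ca D i * cx D k1) ^+ 2;
  gd_p : 0 < cp D < 1;
  gd_m : 0 < cm D;
  gd_me : cm D <= e;
  gd_t : 0 < ct D;
  gd_U : forall g Q, - cp D <= g <= 1 - cp D ->
    (forall i k, `|Q i k - (P i k + g * (ca D i * cx D k))| < cm D) -> U Q;
  gd_M : forall g Q, - cp D <= g <= 1 - cp D -> (g + cp D) * (1 - cp D - g) < ct D ->
    (forall i k, `|Q i k - (P i k + g * (ca D i * cx D k))| < cm D) -> M Q;
  gd_d : forall Q, (forall i k, `|Q i k - P i k| < cm D) -> `|d Q - d P| < e;
  gd_s : M P -> c * d P <= cp D * (1 - cp D)}.

Lemma split_good e P : 0 < e -> U P -> exists D, good e P D.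
Proof.
move=> e0 UP; have [c0 K0] := (sp_c oc, sp_K oc).
have [a [x [p [[aK xK x20 cv] [p01 Useg M0 M1 sM]]]]] := sp_split oc UP.
have [r1 r10 H1] := sp_oM oc M0; have [r2 r20 H2] := sp_oM oc M1.
have [m1 m10 Hm1] : exists2 m, 0 < m & forall g Q, - p <= g <= 1 - p ->
    (forall i k, `|Q i k - (P i k + g * (a i * x k))| < m) -> U Q.
  have cf i k : continuous (fun g : R => P i k + g * (a i * x k)).
    by move=> g; apply: cvgD; [exact: cvg_cst|apply: cvgM; [exact: cvg_id|exact: cvg_cst]].
  have [m m0 H] := st_tube (@segment_compact R (- p) (1 - p)) cf (sp_oU oc)
    (fun g gp => Useg g ltac:(by move: gp; rewrite /= in_itv)).
  by exists m => // g Q gp; apply: H; rewrite /= in_itv.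
have [m2 m20 Hm2] := sp_d oc P e0.
pose r := Num.min r1 r2.
have r0 : 0 < r by rewrite lt_min r10.
pose m := Num.min (Num.min m1 m2) (Num.min e (r / 2)).
have m0 : 0 < m by rewrite !lt_min m10 m20 e0 divr_gt0.
have mm1 : m <= m1 by rewrite !ge_min lexx.
have mm2 : m <= m2 by rewrite !ge_min lexx orbT.
have me : m <= e by rewrite !ge_min lexx !orbT.
have mr : m <= r / 2 by rewrite !ge_min lexx !orbT.
(* The factors [g + p] and [1 - p - g] add up to 1, so one of them is at least 1/2; a defect below
   [t] puts [g] within [2 * t] of an end value, which moves the state by at most [2 * t * (K * K)],
   that is half of [r]. *)
pose t := r / (4 * (K * K + 1)).
have KK : 0 < 4 * (K * K + 1) by nra.
have t0 : 0 < t by rewrite divr_gt0.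
have tK : 2 * t * (K * K) <= r / 2.
  by rewrite /t mulrA mulrAC ler_pdivrMr//; nra.
exists (CData a x p m t); split => //=.
- by move=> g Q gp HQ; apply: (Hm1 g) => // i k; exact: lt_le_trans (HQ i k) mm1.
- move=> g Q /andP[g1 g2] gt HQ.
  have axK i k : `|a i * x k| <= K * K by rewrite normrM ler_pM.
  have dev (h : R) i k : `|g - h| <= 2 * t -> `|Q i k - (P i k + h * (a i * x k))| < r.
    move=> gh.
    rewrite (_ : _ - _ = (Q i k - (P i k + g * (a i * x k))) + (g - h) * (a i * x k)); last by ring.
    rewrite (le_lt_trans (ler_normD _ _))//.
    have : `|(g - h) * (a i * x k)| <= 2 * t * (K * K) by rewrite normrM ler_pM.
    by move: (HQ i k) mr tK; clear -oc; lra.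
  have [g3|g3] := leP (g + p) (2^-1).
    apply: H1 => i k; apply: (lt_le_trans (dev (- p) i k _)); last by rewrite /r ge_min lexx.
    rewrite opprK ger0_norm; last by move: g1; clear -oc; lra.
    by move: g1 g3 gt; clear -oc; nra.
  apply: H2 => i k; apply: (lt_le_trans (dev (1 - p) i k _)); last by rewrite /r ge_min lexx orbT.
  rewrite ler0_norm; last by move: g2; clear -oc; lra.
  by move: g2 g3 gt; clear -oc; nra.
- by move=> Q HQ; apply: Hm2 => i k; exact: lt_le_trans (HQ i k) mm2.
Qed.

(** Here [s] is a state entry and [q] its frozen value on the cell, [y] the increment and [v * k]
    its model. The change of the square is compared with that of the model, with an error linear in
    [e]. *)
Lemma energy_pt (s q y v k e : R) : `|s - q| <= e -> `|y - v * k| <= e -> `|v| <= K * K -> `|k| <= 1 ->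
  `|q| <= K -> 0 <= e <= 1 -> 
  `|(2 * s * y + y ^+ 2) - (2 * q * (v * k) + v ^+ 2 * k ^+ 2)| <= (4 * (K * K) + 2 * K + 3) * e.
Proof.
move=> sq yv vK k1 qK /andP[e0 e1].
rewrite (_ : _ - _ = 2 * (s - q) * y + 2 * q * (y - v * k) + (y - v * k) * (y + v * k)); last by ring.
have vk : `|v * k| <= K * K by rewrite normrM -[K * K]mulr1 ler_pM.
have yK : `|y| <= K * K + 1.
  by rewrite -[y](subrK (v * k)) (le_trans (ler_normD _ _))//; move: yv vk e1; clear -oc; lra.
have h1 : `|2 * (s - q) * y| <= 2 * e * (K * K + 1).
  by rewrite normrM ler_pM// normrM gtr0_norm// ler_wpM2l.
have h2 : `|2 * q * (y - v * k)| <= 2 * K * e.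
  by rewrite normrM ler_pM// normrM gtr0_norm// ler_wpM2l.
have h3 : `|(y - v * k) * (y + v * k)| <= e * (2 * (K * K) + 1).
  rewrite normrM ler_pM// (le_trans (ler_normD _ _))//; move: yK vk; clear -oc; lra.
rewrite (le_trans (ler_normD _ _))//.
have := ler_normD (2 * (s - q) * y) (2 * q * (y - v * k)).
by move: h1 h2 h3; clear -oc; lra.
Qed.

Variables (B : R) (Tc : 'I_4 -> 'I_4 -> R).
Hypothesis B0 : 0 < B.
Hypothesis Tc1 : forall i j, `|Tc i j| <= 1.

Local Notation S := (St B Tc).

Lemma continuous_St W : (forall i, C1 (W i)) -> forall i k, continuous (fun z => S W z i k).
Proof.
move=> CW i k z; apply: cvgD; first exact: C1Dc.
case: (k == k0); last exact: cvg_cst.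
apply: (@continuous_bigsum _ _ _ (fun j z => Tc i j * qq B (W j) z)) => j {}z.
by apply: cvgM; [exact: cvg_cst|exact: continuous_qq].
Qed.

Lemma StD W V z i k : (forall i, C1 (W i)) -> (forall i, C1 (V i)) ->
  S (fun i z => W i z + V i z) z i k = S W z i k + S V z i k.
Proof.
move=> CW CV; rewrite /St.
have -> := @deriveDC1 R (W i) (V i) (wd k) z (CW i) (CV i).
case: (k == k0); last by rewrite !addr0.
by have -> := @qsD B Tc W V z i CW CV; exact: addrACA.
Qed.

(** The constant collects four entries of a row of [Tc], each at most 1, times the length [2 * B] of
    the line segment. *)
Lemma St_bound V C z i k : (forall i, C1 (V i)) -> (forall i z, `|'D_(dir d2) (V i) z| <= C) ->
  co d1 z <= B -> `|S V z i k - 'D_(dir (wd k)) (V i) z| <= 8 * B * C.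
Proof.
move=> CV VC zB; rewrite /St addrC addKr.
have C0 : 0 <= C by exact: le_trans (VC i z).
case: (k == k0); last by rewrite normr0 !mulr_ge0// ltW.
apply: (le_trans (ler_norm_sum _ _ _)).
apply: (@le_trans _ _ (\sum_(j < 4) C * (2 * B))); last first.
  by rewrite sumr_const card_ord -mulr_natl; move: C0 B0; clear -oc B0; nra.
apply: ler_sum => j _; rewrite normrM -[C * _]mul1r ler_pM//.
exact: qq_bound.
Qed.

Variable O : set Z.
Hypothesis oO : open O.
Hypothesis OB : O `<=` (box 0 B : set Z).

Lemma mO : measurable (O : set ((mR * mR) * mR)).
Proof. exact: open_measurable3. Qed.

Lemma L3O : (L3 O < +oo)%E.
Proof.
have B0' := ltW B0.
apply: le_lt_trans (leb_box_lty 0 B0'); apply: le_measure; rewrite ?inE//; exact: mO.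
Qed.

Notation idx := (nat * {ffun 'I_3 -> int})%type.
Notation cl j := (@cell R j.1 j.2).

(** The full record of one perturbation: finitely many cells [s], on cell [j] the reference state
    [P j], its splitting [D j] and the profile [kk j]. [Dr] is the small set of points whose state
    is in [M] while the reference state of their cell is not. *)
Record pert (e1 : R) (W W' : 'I_4 -> Z -> R) (s : seq idx) (D : idx -> cdata) (P : idx -> st)
    (kk : idx -> Z -> R) (e : R) (Dr : set ((mR * mR) * mR)) : Prop := Pert {
  pt_C1 : forall i, C1 (W' i);
  pt_W : forall i z, `|W' i z - W i z| <= e1;
  pt_Wt : forall i z, `|'D_(dir d2) (W' i) z - 'D_(dir d2) (W i) z| <= e1;
  pt_O : forall i z, ~ O z -> W' i z = W i z;
  pt_s : uniq s;
  pt_cO : forall j, j \in s -> cl j `<=` O;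
  pt_disj : forall i j, i \in s -> j \in s -> i != j -> cl i `&` cl j = set0;
  pt_rest : (L3 (O `\` \bigcup_(j in [set` s]) cl j) <= e1%:E)%E;
  pt_good : forall j, j \in s -> good e1 (P j) (D j);
  pt_kc : forall j, j \in s -> continuous (kk j);
  pt_k : forall j z, j \in s -> - cp (D j) <= kk j z <= 1 - cp (D j);
  pt_ki : forall j, j \in s -> `|\int[L3]_(z in box (ccen j.1 j.2) (mesh j.1 / 2)) kk j z| <= e;
  pt_Bi : forall j, j \in s -> \int[L3]_(z in box (ccen j.1 j.2) (mesh j.1 / 2))
     ((kk j z + cp (D j)) * (1 - cp (D j) - kk j z)) <= e;
  pt_e : 0 < e;
  pt_em : forall j, j \in s -> e <= e1 * (@mesh R j.1) ^+ 3;
  pt_et : forall j, j \in s -> e <= e1 * ct (D j) * (@mesh R j.1) ^+ 3;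
  pt_S : forall j z i k, j \in s -> cl j z -> `|S W z i k - P j i k| < cm (D j) / 2;
  pt_d : forall j z i k, j \in s -> cl j z ->
    `|S W' z i k - S W z i k - ca (D j) i * cx (D j) k * kk j z| < cm (D j) / 2;
  pt_d0 : forall z i k, box 0 B z -> (forall j, j \in s -> ~ cl j z) -> `|S W' z i k - S W z i k| <= e1;
  pt_U : forall z, box 0 B z -> U (S W' z);
  pt_Dr : measurable Dr;
  pt_Drm : (L3 Dr <= e1%:E)%E;
  pt_nM : forall j z, j \in s -> ~ M (P j) -> cl j z -> M (S W z) -> Dr z}.


(** The gauge at [z] is chosen so fine that on a cell tagged by [z] the state stays within the
    margin of a splitting at [f z]; [gauge_cells] then supplies the cells. *)
Lemma cells_exist (f : Z -> st) e1 : (forall i k, continuous (fun z => f z i k)) ->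
  (forall z, box 0 B z -> U (f z)) -> 0 < e1 ->
  exists (s : seq idx) (D : idx -> cdata) (P : idx -> st) (Dr : set ((mR * mR) * mR)),
  [/\ [/\ uniq s, forall j, j \in s -> cl j `<=` O &
      forall i j, i \in s -> j \in s -> i != j -> cl i `&` cl j = set0],
      (L3 (O `\` \bigcup_(j in [set` s]) cl j) <= e1%:E)%E,
      forall j, j \in s -> good e1 (P j) (D j),
      forall j z i k, j \in s -> cl j z -> `|f z i k - P j i k| < cm (D j) / 2 &
      [/\ measurable Dr, (L3 Dr <= e1%:E)%E &
        forall j z, j \in s -> ~ M (P j) -> cl j z -> M (f z) -> Dr z]].
Proof.
move=> cf fU e10.
pose N : set Z := [set z | O z /\ M (f z)].
have oN : open N.
  rewrite openE => z [Oz Mz]; rewrite /interior.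
  have [m m0 Hm] := sp_oM oc Mz.
  have : \forall y \near z, O y /\ forall i k, `|f y i k - f z i k| < m.
    apply: filterI; first by move: oO; rewrite openE => /(_ z Oz).
    exact: (near_st _ cf m0).
  by apply: filterS => y [Oy Hy]; split; [exact: Oy|exact: (Hm _ Hy)].
have fN : (L3 N < +oo)%E.
  by apply: le_lt_trans L3O; apply: le_measure; rewrite ?inE; [exact: open_measurable3|exact: mO|move=> z []].
have [r r0 [Dr [mDr eDr HDr]]] := near_complement_small oN fN e10.
have /choice[Df HDf] z : exists D : cdata, O z -> good e1 (f z) D.
  have [Oz|nOz] := pselect (O z); last by exists (CData (fun=> 0) (fun=> 0) 0 0 0).
  by have [D HD] := split_good e10 (fU z (OB Oz)); exists D.
(* Half of the margin [cm] is spent on freezing the state on the cell, the other half is left for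
   the error of the perturbation. The bound [t <= r] is what places the mismatched points in
   [Dr]. *)
have /choice[g Hg] z : exists t : R, O z -> [/\ 0 < t, t <= r &
    forall y, `|y - z| < t -> forall i k, `|f y i k - f z i k| < cm (Df z) / 2].
  have [Oz|nOz] := pselect (O z); last by exists 0.
  have m0 : 0 < cm (Df z) / 2 by rewrite divr_gt0// (gd_m (HDf z Oz)).
  have : \forall y \near z, forall i k, `|f y i k - f z i k| < cm (Df z) / 2.
    exact: (near_st _ cf m0).
  move=> /nbhs_ballP[t /= t0 Ht]; exists (Num.min t r) => _; split.
  - by rewrite lt_min t0.
  - by rewrite ge_min lexx orbT.
  - by move=> y; rewrite lt_min => /andP[yt _]; apply: Ht; rewrite -ball_normE/= distrC.
have [s [us sO sdisj srest]] := gauge_cells oO L3O (fun z Oz => let: And3 g0 _ _ := Hg z Oz in g0) e10.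
have /choice[tg Htg] (j : idx) : exists z : Z, j \in s -> O z /\
    forall y, box (ccen j.1 j.2) (mesh j.1 / 2) y -> `|y - z| < g z.
  have [js|js] := boolP (j \in s); last by exists 0.
  have [bO [z zc Hz]] := sO j js; exists z => _; split => //; exact/bO/cell_box.
have cO j : j \in s -> cl j `<=` O by move=> js z /cell_box zb; have [bO _] := sO j js; exact: bO.
exists s, (fun j => Df (tg j)), (fun j => f (tg j)), Dr; split => //.
- by move=> j js; apply: HDf; have [] := Htg j js.
- move=> j z i k js cz; have [Ot Ht] := Htg j js; have [_ _ H] := Hg _ Ot.
  by apply: H; apply: Ht; exact: cell_box.
- split => // j z js nM cz Mz; have [Ot Ht] := Htg j js; have [_ gr _] := Hg _ Ot.
  apply: (HDr z (tg j)); first by split; [exact: (cO j js)|exact: Mz].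
    by case=> _ /nM.
  by apply: lt_le_trans gr; apply: Ht; exact: cell_box.
Qed.

(** On each cell the multiple [ca (D j) i] of the scalar profile is added to row [i]. The profiles
    have disjoint supports up to null faces, where they and their derivatives vanish, so at each
    point at most one of them acts locally. *)
Lemma pert_exists W e1 : (forall i, C1 (W i)) -> (forall z, box 0 B z -> U (S W z)) ->
  0 < e1 -> exists W' s D P kk e Dr, pert e1 W W' s D P kk e Dr.
Proof.
move=> CW WU e10.
have cS := continuous_St CW.
have K0 := sp_K oc.
have [mu mu0 Hmu] := st_tube (@compact_box R 0 B) cS (sp_oU oc) WU.
have [s [D [P [Dr [[us cO sdisj] srest gD fP [mDr eDr HDr]]]]]] := cells_exist cS WU e10.
(* Profiles of size [e] change a state, beyond the intended splitting, by at most [K * e] through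
   the local gradient and [8 * B * K * e] through the primitives of the time derivatives. *)
pose C2 := K + 8 * B * K.
have C20 : 0 < C2 by rewrite /C2 addr_gt0// !mulr_gt0.
have [e e0 He] : exists2 e, 0 < e & [/\ C2 * e <= e1, C2 * e < mu &
   forall j, j \in s -> [/\ C2 * e < cm (D j) / 2, e <= e1 * (@mesh R j.1) ^+ 3 &
     e <= e1 * ct (D j) * (@mesh R j.1) ^+ 3]].
  pose f j := Num.min (Num.min (cm (D j) / 4 / C2) (e1 * (@mesh R j.1) ^+ 3)) (e1 * ct (D j) * (@mesh R j.1) ^+ 3).
  have [|e e0 He] := @seq_min_gt0 R _ s f.
    move=> j js; have gj := gD j js.
    have mh := @mesh_gt0 R j.1.
    by rewrite !lt_min !divr_gt0 ?(gd_m gj)// ?mulr_gt0 ?exprn_gt0// (gd_t gj).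
  exists (Num.min e (Num.min (e1 / C2) (mu / 2 / C2))); first by rewrite !lt_min e0 !divr_gt0.
  set e' := Num.min _ _.
  have h1 : e' <= e by rewrite /e' ge_min lexx.
  have h2 : e' <= e1 / C2 by rewrite /e' !ge_min lexx !orbT.
  have h3 : e' <= mu / 2 / C2 by rewrite /e' !ge_min lexx !orbT.
  split.
  - by rewrite mulrC -ler_pdivlMr.
  - by move: h3; rewrite ler_pdivlMr// mulrC => h3; rewrite (le_lt_trans h3)// ltr_pdivrMr// mulr_natr mulr2n ltrDl.
  - move=> j js; have := He j js; rewrite !le_min => /andP[/andP[a1 a2] a3].
    split; [|exact: le_trans h1 _|exact: le_trans h1 _].
    have : e' <= cm (D j) / 4 / C2 by exact: le_trans h1 _.
    have := gd_m (gD j js).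
    by rewrite ler_pdivlMr// mulrC; clear -oc B0; lra.
have [e1a e1b Hej] := He.
have /choice[w Hw] (j : idx) : exists w : (Z -> R) * (Z -> R), j \in s ->
  [/\ C1 w.1, continuous w.2,
    (forall z, (exists l, mesh j.1 / 2 <= `|co l z - co l (ccen j.1 j.2)|) ->
       [/\ w.1 z = 0, w.2 z = 0 & forall l, 'D_(dir l) w.1 z = 0]),
    [/\ forall z, `|w.1 z| <= e, forall z, `|'D_(dir d2) w.1 z| <= e,
        forall z, `|'D_(dir d0) w.1 z - cx (D j) k0 * w.2 z| <= e &
        forall z, `|'D_(dir d1) w.1 z - cx (D j) k1 * w.2 z| <= e] &
    [/\ forall z, - cp (D j) <= w.2 z <= 1 - cp (D j),
        `|\int[L3]_(z in box (ccen j.1 j.2) (mesh j.1 / 2)) w.2 z| <= e &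
        \int[L3]_(z in box (ccen j.1 j.2) (mesh j.1 / 2))
           ((w.2 z + cp (D j)) * (1 - cp (D j) - w.2 z)) <= e]].
  have [js|js] := boolP (j \in s); last by exists (fun=> 0, fun=> 0).
  have gj := gD j js.
  have [|w [k Hwk]] := cell_profile (cx (D j) k0) (ccen j.1 j.2) (gd_x2 gj) (gd_p gj) _ e0 (r := mesh j.1 / 2).
    by rewrite divr_gt0// mesh_gt0.
  by exists (w, k).
pose V i z := \sum_(j <- s) (if j \in s then ca (D j) i * (w j).1 z else 0).
pose W' i z := W i z + V i z.
have CF i j : C1 (fun z => if j \in s then ca (D j) i * (w j).1 z else 0).
  case js : (j \in s); last exact: C1_cst.
  by apply: C1Z; have [] := Hw j js.
have CV i : C1 (V i) by apply: C1_sum => j; exact: CF.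
have CW' i : C1 (W' i) by exact: C1D.
have off j z : j \in s -> ~ cl j z -> exists l, mesh j.1 / 2 <= `|co l z - co l (ccen j.1 j.2)|.
  move=> js ncl; apply: contrapT => /forallNP H; apply: ncl; apply: obox_cell => l.
  by rewrite ltNge; apply/negP; exact: H.
have DVE i k z : 'D_(dir k) (V i) z = \sum_(j <- s) ca (D j) i * 'D_(dir k) (w j).1 z.
  rewrite /V derive_sumC1//; rewrite big_seq [RHS]big_seq; apply: eq_bigr => j js.
  rewrite js deriveZC1//; by have [] := Hw j js.
have DVs i k z : (forall j, j \in s -> cl j z -> 'D_(dir k) (V i) z = ca (D j) i * 'D_(dir k) (w j).1 z) /\
    ((forall j, j \in s -> ~ cl j z) -> 'D_(dir k) (V i) z = 0).
  rewrite DVE; apply: (sum_supp us sdisj (F := fun j z => ca (D j) i * 'D_(dir k) (w j).1 z)).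
  by move=> j js nc; have [_ _ H _ _] := Hw j js; have [_ _ ->] := H z (off j z js nc); rewrite mulr0.
have Vs i z : (forall j, j \in s -> cl j z -> V i z = ca (D j) i * (w j).1 z) /\
    ((forall j, j \in s -> ~ cl j z) -> V i z = 0).
  have -> : V i z = \sum_(j <- s) ca (D j) i * (w j).1 z.
    by rewrite /V big_seq [RHS]big_seq; apply: eq_bigr => j ->.
  apply: (sum_supp us sdisj (F := fun j z => ca (D j) i * (w j).1 z)).
  by move=> j js nc; have [_ _ H _ _] := Hw j js; have [-> _ _] := H z (off j z js nc); rewrite mulr0.
have K0e : 0 <= K * e by rewrite mulr_ge0// ltW.
have C2E : C2 * e = K * e + 8 * B * (K * e) by rewrite /C2; ring.
have KC : K * e <= C2 * e.
  by apply: ler_wpM2r; [exact: ltW|rewrite /C2 lerDl !mulr_ge0// ltW].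
have Ve i z : `|V i z| <= K * e.
  have [[j js cj]|nc] := pselect (exists2 j, j \in s & cl j z).
    rewrite ((Vs i z).1 j js cj); have [_ _ _ [H _ _ _] _] := Hw j js.
    by rewrite normrM ler_pM// (gd_a (gD j js)).
  rewrite (Vs i z).2; last by move=> j js cj; apply: nc; exists j.
  by rewrite normr0.
have Vte i z : `|'D_(dir d2) (V i) z| <= K * e.
  have [[j js cj]|nc] := pselect (exists2 j, j \in s & cl j z).
    rewrite ((DVs i d2 z).1 j js cj); have [_ _ _ [_ H _ _] _] := Hw j js.
    by rewrite normrM ler_pM// (gd_a (gD j js)).
  rewrite (DVs i d2 z).2; last by move=> j js cj; apply: nc; exists j.
  by rewrite normr0.
have SE z i k : S W' z i k - S W z i k = S V z i k.
  by rewrite /W' (StD _ _ _ CW CV) addrC addKr.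
have boxB z : box 0 B z -> co d1 z <= B.
  by move=> /boxP/(_ d1); rewrite subr0; apply: le_trans; exact: ler_norm.
have SV z i k : box 0 B z -> `|S V z i k - 'D_(dir (wd k)) (V i) z| <= 8 * B * (K * e).
  by move=> /boxB zB; apply: St_bound.
have dS0 z i k : box 0 B z -> (forall j, j \in s -> ~ cl j z) -> `|S V z i k| <= C2 * e.
  move=> zb nc; have := SV z i k zb; rewrite (DVs i (wd k) z).2// subr0 => h.
  by apply: le_trans h _; rewrite C2E lerDr.
have dS j z i k : j \in s -> cl j z -> `|S V z i k - ca (D j) i * cx (D j) k * (w j).2 z| <= C2 * e.
  move=> js cz; have zb := OB (cO j js z cz).
  have := SV z i k zb; rewrite ((DVs i (wd k) z).1 j js cz) => h.
  have [_ _ _ [_ _ H0 H1] _] := Hw j js.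
  have h2 : `|ca (D j) i * 'D_(dir (wd k)) (w j).1 z - ca (D j) i * cx (D j) k * (w j).2 z| <= K * e.
    rewrite -mulrA -mulrBr normrM ler_pM// ?(gd_a (gD j js))//.
    case: k {h} => -[|[|//]] ik.
      by have -> : Ordinal ik = k0; [exact: val_inj|rewrite wd0; exact: H0].
    by have -> : Ordinal ik = k1; [exact: val_inj|rewrite wd1; exact: H1].
  rewrite -(subrK (ca (D j) i * 'D_(dir (wd k)) (w j).1 z) (S V z i k)) -addrA.
  by rewrite (le_trans (ler_normD _ _))// C2E [leRHS]addrC; exact: (lerD h h2).
have k_in j z : j \in s -> - cp (D j) <= (w j).2 z <= 1 - cp (D j).
  by move=> js; have [_ _ _ _ [H _ _]] := Hw j js.
exists W', s, D, P, (fun j => (w j).2), e, Dr; split.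
- exact: CW'.
- by move=> i z; rewrite /W' addrC addKr (le_trans (Ve i z))// (le_trans KC).
- move=> i z; have -> := @deriveDC1 R (W i) (V i) d2 z (CW i) (CV i).
  rewrite addrC addKr.
  by rewrite (le_trans (Vte i z))// (le_trans KC).
- move=> i z nO; rewrite /W' (Vs i z).2 ?addr0// => j js cz; apply: nO; exact: (cO j js).
- exact: us.
- exact: cO.
- exact: sdisj.
- exact: srest.
- exact: gD.
- by move=> j js; have [] := Hw j js.
- by move=> j z js; exact: k_in.
- by move=> j js; have [_ _ _ _ []] := Hw j js.
- by move=> j js; have [_ _ _ _ []] := Hw j js.
- exact: e0.
- by move=> j js; have [] := Hej j js.
- by move=> j js; have [] := Hej j js.
- exact: fP.
- move=> j z i k js cz; rewrite SE; apply: (le_lt_trans (dS j z i k js cz)).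
  by have [] := Hej j js.
- by move=> z i k zb nc; rewrite SE; apply: (le_trans (dS0 z i k zb nc)).
- move=> z zb; have [[j js cj]|nc] := pselect (exists2 j, j \in s & cl j z).
    apply: (gd_U (gD j js) (k_in j z js)) => i k.
    have h1 := fP j z i k js cj; have h2 := dS j z i k js cj; have [h3 _ _] := Hej j js.
    move: h1 h2 h3; rewrite -SE.
    move: (S W' z i k) (S W z i k) (P j i k) (ca (D j) i) (cx (D j) k) ((w j).2 z) (cm (D j)) (C2 * e).
    move=> a1 a2 a3 a4 a5 a6 a7 a8 h1 h2 h3.
    rewrite (_ : _ - _ = (a2 - a3) + (a1 - a2 - a4 * a5 * a6)); last by ring.
    rewrite (le_lt_trans (ler_normD _ _))//; move: h1 h2 h3; clear -oc B0; lra.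
  (* Off the cells the state changes through the nonlocal term only, and the uniform margin [mu] of
     the old states absorbs this. *)
  apply: (Hmu z) => // i k; rewrite SE; apply: le_lt_trans e1b; apply: dS0 => //.
  by move=> j js cj; apply: nc; exists j.
- exact: mDr.
- exact: eDr.
- exact: HDr.
Qed.

End step.

(** * Energy, L^1 and distance estimates for one perturbation *)

Section step_estimates.
Context {R : realType}.
Notation Z := ((R * R) * R)%type.
Notation mR := (measurableTypeR R).
Notation L3 := (@L3 R).
Notation d0 := (@Ordinal 3 0 isT).
Notation d1 := (@Ordinal 3 1 isT).
Notation d2 := (@Ordinal 3 2 isT).
Notation k0 := (@Ordinal 2 0 isT).
Notation k1 := (@Ordinal 2 1 isT).
Notation st := ('I_4 -> 'I_2 -> R).
Notation idx := (nat * {ffun 'I_3 -> int})%type.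
Notation cl j := (@cell R j.1 j.2).

Lemma Rint_le_cst (A : set ((mR * mR) * mR)) (f : Z -> R) (C : R) : measurable A -> (L3 A < +oo)%E ->
  L3.-integrable A (EFin \o f) -> (forall z, A z -> f z <= C) ->
  \int[L3]_(z in A) f z <= C * fine (L3 A).
Proof.
move=> mA fA fi fC; rewrite -(Rintegral_cst L3 mA); apply: le_Rintegral => //.
exact: integrable_cst.
Qed.

Lemma seq_union_le (T : eqType) (s : seq T) (A : T -> set ((mR * mR) * mR)) (a : T -> R) :
  (forall j, j \in s -> measurable (A j) /\ (L3 (A j) <= (a j)%:E)%E) ->
  measurable (\bigcup_(j in [set` s]) A j) /\
  (L3 (\bigcup_(j in [set` s]) A j) <= (\sum_(j <- s) a j)%:E)%E.
Proof.
elim: s => [|i s IH] H.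
  by rewrite set_nil bigcup_set0 measure0 big_nil; split.
have [|mU lU] := IH; first by move=> j js; apply: H; rewrite inE js orbT.
have [mi li] := H i (mem_head _ _).
have E : \bigcup_(j in [set` i :: s]) A j = A i `|` \bigcup_(j in [set` s]) A j.
  apply/seteqP; split=> z.
    by move=> [j /=]; rewrite inE => /predU1P[->|js] Cj; [left|right; exists j].
  by move=> [Caz|[j js Cj]]; [exists i|exists j] => //=; rewrite inE ?eqxx//; apply/orP; right.
rewrite E; split; first exact: measurableU.
rewrite big_cons EFinD; apply: (le_trans (measureU2 _ mi mU)); exact: leeD.
Qed.

Lemma le_fine (x : \bar R) a : (0 <= x)%E -> (x <= a%:E)%E -> fine x <= a.
Proof. by move=> x0 xa; rewrite -lee_fin fineK// ge0_fin_numE// (le_lt_trans xa) ?ltry. Qed.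

Lemma sum_sqrB (a b : 'I_4 -> R) : - (\sum_(i < 4) a i ^+ 2 - \sum_(i < 4) b i ^+ 2) =
  \sum_(i < 4) - (2 * b i * (a i - b i) + (a i - b i) ^+ 2).
Proof. by rewrite -sumrB -sumrN; apply: eq_bigr => i _; ring. Qed.

Lemma CF_ge0 (K : R) : 0 < K ->
  0 <= 4 * (4 * (K * K) + 2 * K + 3) + 8 * (K * (K * K)) + 8 * ((K * K) * (K * K)).
Proof.
move=> K0; have h1 : 0 < K * K by rewrite mulr_gt0.
have h2 : 0 < K * (K * K) by rewrite mulr_gt0.
have h3 : 0 < K * K * (K * K) by rewrite mulr_gt0.
by move: h1 h2 h3; lra.
Qed.

Lemma ar_cell (a b x e C y : R) : a <= b ->
  4 * C * e - b + (8 * x + 8 * y) * e <= - a + (4 * C + 8 * x + 8 * y) * e.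
Proof. by lra. Qed.

Lemma ar_rest (K s y : R) : - (K * 1) <= s * y -> 0 <= y ^+ 2 -> - (2 * s * y + y ^+ 2) <= 2 * K.
Proof. by lra. Qed.

Lemma ar_sum4 (K : R) : \sum_(i < 4) 2 * K <= 8 * K.
Proof. by rewrite sumr_const card_ord -mulr_natl; lra. Qed.

Lemma ar_fin (Ib Ig F Kr Pc Sm K V e : R) : Ib <= K * (F + e) -> Ig <= Sm + Kr -> Kr <= K * e ->
  Sm <= Pc + V * e -> Ib + Ig <= Pc + (V + 2 * K) * e + K * F.
Proof. by lra. Qed.

Lemma ar_s2 (x y z e : R) : z <= e -> y <= x + z -> 0 <= y -> - e <= x.
Proof. by lra. Qed.

Lemma ar_s3 (I P F V K c E a e1 eps : R) : 0 < c -> I <= P / c + (V + 2 * K) * e1 + K * F ->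
  c * P <= E + a * e1 -> (a + c ^+ 2 * (V + 2 * K)) * e1 <= eps -> c ^+ 2 * I <= E + c ^+ 2 * K * F + eps.
Proof.
move=> c0 HI HP He.
apply: (@le_trans _ _ (c ^+ 2 * (P / c + (V + 2 * K) * e1 + K * F))); first by rewrite ler_wpM2l// sqr_ge0.
have -> : c ^+ 2 * (P / c + (V + 2 * K) * e1 + K * F) = c * P + c ^+ 2 * (V + 2 * K) * e1 + c ^+ 2 * K * F.
  by field; rewrite gt_eqF.
by move: HP He; rewrite mulrDl; lra.
Qed.

Lemma ar_s4 (I P V k c E a e1 eps : R) : 0 < c -> 0 < k -> I <= 2 * k * P + ((1 + k) * V + 1) * e1 ->
  c * P <= E + a * e1 -> (2 * k * a + c * ((1 + k) * V + 1)) * e1 <= eps -> c * I <= 2 * k * E + eps.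
Proof.
move=> c0 k0 HI HP He.
apply: (@le_trans _ _ (c * (2 * k * P + ((1 + k) * V + 1) * e1))); first by rewrite ler_wpM2l// ltW.
have h : 2 * k * (c * P) <= 2 * k * (E + a * e1) by rewrite ler_wpM2l// mulr_ge0// ltW.
by move: h He; lra.
Qed.

Lemma ar_opp (x y z : R) : - x <= - y + z -> y <= x + z.
Proof. by lra. Qed.

(** The identity [k ^+ 2 = p * (1 - p) + (1 - 2 * p) * k - (k + p) * (1 - p - k)] extracts the
    variance of a two-valued profile from the square. The remaining terms are linear in [k] or in
    the defect, and both have small integrals. *)
Lemma energy_cell (K k p e : R) (s q y v : 'I_4 -> R) : (forall i, `|s i - q i| <= e) ->
  (forall i, `|y i - v i * k| <= e) -> (forall i, `|v i| <= K * K) -> `|k| <= 1 ->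
  (forall i, `|q i| <= K) -> 0 <= e <= 1 ->
  \sum_(i < 4) - (2 * s i * y i + y i ^+ 2) <=
  4 * (4 * (K * K) + 2 * K + 3) * e - (\sum_(i < 4) v i ^+ 2) * (p * (1 - p)) +
  (- (\sum_(i < 4) 2 * q i * v i) - (\sum_(i < 4) v i ^+ 2) * (1 - 2 * p)) * k +
  (\sum_(i < 4) v i ^+ 2) * ((k + p) * (1 - p - k)).
Proof.
move=> sq yv vK k1 qK e01; set CE := 4 * (K * K) + 2 * K + 3.
apply: (@le_trans _ _ (\sum_(i < 4) (CE * e - (2 * q i * v i * k + v i ^+ 2 * k ^+ 2)))).
  apply: ler_sum => i _; have := energy_pt (sq i) (yv i) (vK i) k1 (qK i) e01.
  rewrite -/CE ler_norml => /andP[+ _]; clear; lra.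
rewrite sumrB sumr_const card_ord -mulr_natl big_split/= -!mulr_suml.
move: (\sum_(i < 4) 2 * q i * v i) (\sum_(i < 4) v i ^+ 2) CE => a1 a2 a3; clear; lra.
Qed.

Lemma energy_coef (K p : R) (q v : 'I_4 -> R) : 0 < K -> 0 < p < 1 -> (forall i, `|v i| <= K * K) ->
  (forall i, `|q i| <= K) ->
  `|- (\sum_(i < 4) 2 * q i * v i) - (\sum_(i < 4) v i ^+ 2) * (1 - 2 * p)| + \sum_(i < 4) v i ^+ 2 <=
  8 * (K * (K * K)) + 8 * ((K * K) * (K * K)).
Proof.
move=> K0 /andP[p0 p1] vK qK; set vv := \sum_(i < 4) v i ^+ 2.
have vv0 : 0 <= vv by apply: sumr_ge0 => i _; exact: sqr_ge0.
have vvK : vv <= 4 * ((K * K) * (K * K)).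
  rewrite /vv; apply: (@le_trans _ _ (\sum_(i < 4) (K * K) * (K * K))); last first.
    by rewrite sumr_const card_ord mulr_natl.
  by apply: ler_sum => i _; rewrite -real_normK ?num_real// expr2 ler_pM.
have h1 : `|\sum_(i < 4) 2 * q i * v i| <= 8 * (K * (K * K)).
  apply: (le_trans (ler_norm_sum _ _ _)); apply: (@le_trans _ _ (\sum_(i < 4) 2 * (K * (K * K)))); last first.
    by rewrite sumr_const card_ord -mulr_natl; clear; lra.
  by apply: ler_sum => i _; rewrite !normrM gtr0_norm// -mulrA ler_wpM2l// ler_pM.
have h2 : `|vv * (1 - 2 * p)| <= vv * 1.
  rewrite normrM ger0_norm//; apply: ler_wpM2l => //; rewrite ler_norml; apply/andP.
  by split; move: p0 p1; clear; lra.
have := ler_normB (- \sum_(i < 4) 2 * q i * v i) (vv * (1 - 2 * p)); rewrite normrN.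
by move: h1 h2 vvK; clear; lra.
Qed.

Variables (U M : set st) (d : st -> R) (c K : R).
Hypothesis oc : splittable U M d c K.
Variables (B : R) (Tc : 'I_4 -> 'I_4 -> R).
Hypothesis B0 : 0 < B.
Hypothesis Tc1 : forall i j, `|Tc i j| <= 1.
Variable O : set Z.
Hypothesis oO : open O.
Hypothesis OB : O `<=` (box 0 B : set Z).
Local Notation S := (St B Tc).

Lemma cont_O_integrable (f : Z -> R) : continuous f -> L3.-integrable O (EFin \o f).
Proof. by move=> cf; apply: (cont_box_subset_integrable (mO oO) OB (ltW B0) cf). Qed.

Lemma cont_O_sub_integrable (A : set ((mR * mR) * mR)) (f : Z -> R) : measurable A -> A `<=` O ->
  continuous f -> L3.-integrable A (EFin \o f).
Proof. by move=> mA AO cf; apply: integrableS (cont_O_integrable cf) => //; exact: mO. Qed.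

Lemma O_integral_oppB (f g : Z -> R) : continuous f -> continuous g ->
  \int[L3]_(z in O) - (f z - g z) = - (\int[L3]_(z in O) f z - \int[L3]_(z in O) g z).
Proof.
move=> cf cg; have [i1 i2] := (cont_O_integrable cf, cont_O_integrable cg).
have i3 : L3.-integrable O (EFin \o (fun z => f z - g z)).
  by apply: cont_O_integrable => z; apply: cvgB; [exact: cf|exact: cg].
rewrite -(RintegralB (mO oO) i1 i2).
transitivity (\int[L3]_(z in O) (-1 * (f z - g z))).
  by apply: eq_Rintegral => z _; rewrite mulN1r.
by rewrite (RintegralZl _ (mO oO) i3) mulN1r.
Qed.

Lemma L3_subO (A : set ((mR * mR) * mR)) : measurable A -> A `<=` O -> (L3 A < +oo)%E.
Proof.
by move=> mA AO; apply: le_lt_trans (L3O B0 oO OB); apply: le_measure; rewrite ?inE//; exact: mO.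
Qed.

Definition Mset (W : 'I_4 -> Z -> R) : set Z := [set z | O z /\ M (S W z)].

Lemma open_Mset W : (forall i, C1 (W i)) -> open (Mset W).
Proof.
move=> CW; rewrite openE => z [Oz Mz]; rewrite /interior.
have [m m0 Hm] := sp_oM oc Mz.
have : \forall y \near z, O y /\ forall i k, `|S W y i k - S W z i k| < m.
  apply: filterI; first by move: oO; rewrite openE => /(_ z Oz).
  exact: (near_st _ (@continuous_St R B Tc B0 W CW) m0).
by apply: filterS => y [Oy Hy]; split; [exact: Oy|exact: (Hm _ Hy)].
Qed.

Lemma continuous_dSt (f : Z -> st) : (forall i k, continuous (fun z => f z i k)) ->
  continuous (fun z => d (f z)).
Proof.
move=> cf z; apply/cvg_dist0 => e e0; have [m m0 Hm] := sp_d oc (f z) e0.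
have /nbhs_ballP[r /= r0 Hr] := near_st z cf m0.
exists r => // y yz; apply: Hm; apply: Hr.
by rewrite -ball_normE/= distrC.
Qed.

Definition En (W : 'I_4 -> Z -> R) : R := \int[L3]_(z in O) \sum_(i < 4) (S W z i k1) ^+ 2.

Lemma continuous_en W : (forall i, C1 (W i)) -> continuous (fun z => \sum_(i < 4) (S W z i k1) ^+ 2).
Proof.
move=> CW; apply: (@continuous_bigsum R _ _ _ (fun i z => S W z i k1 ^+ 2)) => i z.
have h := @continuous_St R B Tc B0 W CW i k1.
by under eq_fun do rewrite expr2; apply: cvgM; exact: h.
Qed.

Section with_pert.
Variables (W W' : 'I_4 -> Z -> R) (e1 e : R) (s : seq idx) (D : idx -> @cdata R) (P : idx -> st)
    (kk : idx -> Z -> R) (Dr : set ((mR * mR) * mR)).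
Hypothesis pt : pert U M d c K B Tc O e1 W W' s D P kk e Dr.
Hypothesis CW : forall i, C1 (W i).
Hypothesis WU : forall z, box 0 B z -> U (S W z).
Hypothesis e10 : 0 < e1.
Hypothesis e11 : e1 <= 1.

Let V := fine (L3 O).
Let Vj (j : idx) := (@mesh R j.1) ^+ 3.
Let pp j := cp (D j) * (1 - cp (D j)).
(** The total variance of the profiles, the common quantity through which the energy gain, the L^1
    change and the distance to the graph are compared. *)
Let Pi := \sum_(j <- s) pp j * Vj j.

Let V0 : 0 <= V. Proof. exact: fine_ge0. Qed.
Let Vj0 j : 0 < Vj j. Proof. by rewrite exprn_gt0// mesh_gt0. Qed.
Let pp0 j : j \in s -> 0 <= pp j.
Proof. by move=> js; have /andP[h1 h2] := gd_p (pt_good pt js); rewrite mulr_ge0 ?ltW// subr_gt0. Qed.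
Let Pi0 : 0 <= Pi.
Proof. by rewrite /Pi big_seq sumr_ge0// => j js; rewrite mulr_ge0// ?pp0// ltW. Qed.

Let L3cl j : fine (L3 (cl j)) = Vj j.
Proof.
rewrite L3_cell leb_box; last by rewrite divr_ge0// ltW// mesh_gt0.
by rewrite /= /Vj; congr (_ ^+ _); rewrite mulrC divfK.
Qed.

Let rest := O `\` \bigcup_(j in [set` s]) cl j.
Let restP z : O z -> (forall j, j \in s -> ~ cl j z) -> rest z.
Proof. by move=> Oz nc; split => // -[j /= js]; exact: nc. Qed.

Let rest0 : 0 <= fine (L3 rest). Proof. exact: fine_ge0. Qed.
Let rest1 : fine (L3 rest) <= e1. Proof. exact: le_fine (pt_rest pt). Qed.

Let sumVj : \sum_(j <- s) Vj j <= V.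
Proof.
have mc j : measurable (cl j) by exact: measurable_cell.
have := @cells_integral_le R _ s (fun j => cl j) O (fun=> -1) (fun j => - Vj j) 0 (pt_s pt) mc (mO oO)
  (integrable_cst (-1) (mO oO) (L3O B0 oO OB)) (L3O B0 oO OB) (pt_cO pt) (pt_disj pt).
rewrite mul0r addr0 sumrN Rintegral_cst; last exact: mO.
rewrite mulN1r lerN2; apply=> [j js|z _ _]; last by rewrite oppr_le0.
by rewrite Rintegral_cst ?L3cl ?mulN1r//; exact: mc.
Qed.

Let cellint (f : Z -> R) (al be ga b : R) j : j \in s -> continuous f -> 0 <= ga -> `|be| + ga <= b ->
  (forall z, cl j z -> f z <= al + be * kk j z + ga * ((kk j z + cp (D j)) * (1 - cp (D j) - kk j z))) ->
  \int[L3]_(z in cl j) f z <= (al + b * e1) * Vj j.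
Proof.
move=> js cf ga0 bb fle.
have mc : measurable (cl j) by exact: measurable_cell.
have := cell_integral_le (pt_kc pt js) (pt_e pt) (cont_O_sub_integrable mc (pt_cO pt js) cf)
  (pt_ki pt js) (pt_Bi pt js) ga0 fle.
move=> /le_trans; apply; rewrite -/(Vj j) [leRHS]mulrDl lerD2l -[leRHS]mulrA.
apply: ler_pM => //; first by rewrite addr_ge0.
  exact: ltW (pt_e pt).
exact: pt_em pt _ js.
Qed.

Let total (f : Z -> R) (al : idx -> R) (b C : R) : continuous f -> 0 <= C -> 0 <= b ->
  (forall j, j \in s -> \int[L3]_(z in cl j) f z <= (al j + b * e1) * Vj j) ->
  (forall z, O z -> (forall j, j \in s -> ~ cl j z) -> f z <= C) ->
  \int[L3]_(z in O) f z <= \sum_(j <- s) al j * Vj j + (b * V + C) * e1.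
Proof.
move=> cf C0 b0 fal fC.
have mc j : measurable (cl j) by exact: measurable_cell.
have := cells_integral_le (pt_s pt) mc (mO oO) (cont_O_integrable cf) (L3O B0 oO OB) (pt_cO pt) (pt_disj pt) fal fC.
move=> /le_trans; apply.
under eq_bigr do rewrite mulrDl.
rewrite big_split/= -addrA lerD2l -mulr_sumr mulrDl; apply: lerD; last exact: ler_wpM2l.
by rewrite mulrAC; apply: ler_wpM2r; [exact: ltW|exact: ler_wpM2l].
Qed.

Let CE := 4 * (K * K) + 2 * K + 3.
Let CF := 4 * CE + 8 * (K * (K * K)) + 8 * ((K * K) * (K * K)).

Let K0 : 0 < K. Proof. exact: sp_K oc. Qed.
Let c0 : 0 < c. Proof. exact: sp_c oc. Qed.
Let CW' := pt_C1 pt.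
Let dl i k z := S W' z i k - S W z i k.
Let cdl i k : continuous (dl i k).
Proof.
by move=> z; apply: cvgB; [exact: (@continuous_St R B Tc B0 W' CW')|exact: (@continuous_St R B Tc B0 W CW)].
Qed.

Let axK j i k : j \in s -> `|ca (D j) i * cx (D j) k| <= K * K.
Proof. by move=> js; have g := pt_good pt js; rewrite normrM ler_pM// ?(gd_a g)// (gd_x g). Qed.

Let kk1 j z : j \in s -> `|kk j z| <= 1.
Proof.
move=> js; have /andP[h1 h2] := pt_k pt z js; have /andP[p0 p1] := gd_p (pt_good pt js).
by rewrite ler_norml; apply/andP; split; move: h1 h2 p0 p1; lra.
Qed.

Let cme j : j \in s -> cm (D j) / 2 <= e1.
Proof.
move=> js; have g := pt_good pt js.
by move: (gd_me g) (gd_m g); lra.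
Qed.

(** The cross term between state and increment nearly integrates to zero, since the state is almost
    frozen on a cell and the profile has almost zero mean. The square contributes at least [c] times
    the variance. *)
Lemma pert_energy : c * Pi <= En W' - En W + (CF * V + 8 * K) * e1.
Proof.
pose f z := - (\sum_(i < 4) (S W' z i k1) ^+ 2 - \sum_(i < 4) (S W z i k1) ^+ 2).
have cf : continuous f.
  by move=> z; apply: cvgN; apply: cvgB; exact: continuous_en.
have fE : \int[L3]_(z in O) f z = - (En W' - En W).
  exact: (O_integral_oppB (continuous_en CW') (continuous_en CW)).
have fz z : f z = \sum_(i < 4) - (2 * S W z i k1 * dl i k1 z + dl i k1 z ^+ 2).
  exact: (sum_sqrB (fun i => S W' z i k1) (fun i => S W z i k1)).
have SK z i : O z -> `|S W z i k1| <= K by move=> Oz; exact: (sp_bU oc _ _ (WU (OB Oz))).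
have := @total f (fun j => - (c * pp j)) CF (8 * K) cf.
rewrite fE => H.
have {}H : - (En W' - En W) <= \sum_(j <- s) - (c * pp j) * Vj j + (CF * V + 8 * K) * e1.
  apply: H.
  - by rewrite mulr_ge0// ltW.
  - exact: CF_ge0.
  - move=> j js.
    have g := pt_good pt js.
    pose v i := ca (D j) i * cx (D j) k1.
    pose vv := \sum_(i < 4) v i ^+ 2.
    have vvc : c <= vv by exact: gd_v g.
    have vK i : `|v i| <= K * K by exact: axK.
    have PK i : `|P j i k1| <= K by exact: (sp_bU oc _ _ (gd_U0 g)).
    have vv0 : 0 <= vv by rewrite (le_trans (ltW c0)).
    have h := @cellint f (4 * CE * e1 - vv * pp j) _ vv _ j js cf vv0 (energy_coef K0 (gd_p g) vK PK).
    apply: le_trans (h _) _.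
      move=> z cz; rewrite fz.
      apply: (@energy_cell K (kk j z) (cp (D j)) e1 (fun i => S W z i k1) (fun i => P j i k1)
        (fun i => dl i k1 z) v).
      - by move=> i; exact: (ltW (lt_le_trans (pt_S pt i k1 js cz) (cme js))).
      - by move=> i; exact: (ltW (lt_le_trans (pt_d pt i k1 js cz) (cme js))).
      - exact: vK.
      - exact: kk1.
      - exact: PK.
      - by rewrite (ltW e10) e11.
    rewrite ler_pM2r//.
    have h1 : c * pp j <= vv * pp j by apply: ler_wpM2r; [exact: pp0|].
    exact: ar_cell h1.
  - move=> z Oz nc; rewrite fz.
    apply: le_trans (ar_sum4 K).
    apply: ler_sum => i _.
    have h1 := pt_d0 pt i k1 (OB Oz) nc; have h2 := SK z i Oz.
    have h3 : `|S W z i k1 * dl i k1 z| <= K * 1.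
      by rewrite normrM ler_pM// (le_trans h1).
    have h4 : 0 <= dl i k1 z ^+ 2 by rewrite sqr_ge0.
    by move: h3; rewrite ler_norml => /andP[h3 _]; exact: ar_rest.
move: H; rewrite (eq_bigr (fun j => - (c * (pp j * Vj j)))); last by move=> j _; rewrite mulNr mulrA.
by rewrite sumrN -mulr_sumr -/Pi; exact: ar_opp.
Qed.

(** On [[- p, 1 - p]] the convex function [|q|] lies below its chord
    [(1 - 2 * p) * q + 2 * p * (1 - p)]. So the mean of the modulus is at most twice the variance,
    without the square root that Cauchy-Schwarz would give; this is what makes the increments
    summable. *)
Lemma pert_L1 i k : \int[L3]_(z in O) `|S W' z i k - S W z i k| <=
  2 * (K * K) * Pi + ((1 + K * K) * V + 1) * e1.
Proof.
have cf : continuous (fun z => `|dl i k z|) by move=> z; apply: cvg_norm; exact: cdl.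
have := @total (fun z => `|dl i k z|) (fun j => 2 * (K * K) * pp j) (1 + K * K) 1 cf ler01.
have -> : \sum_(j <- s) 2 * (K * K) * pp j * Vj j = 2 * (K * K) * Pi.
  by rewrite /Pi mulr_sumr; apply: eq_bigr => j _; exact/esym/mulrA.
apply.
- by rewrite addr_ge0// mulr_ge0// ltW.
- move=> j js; have g := pt_good pt js.
  have h := @cellint (fun z => `|dl i k z|) (2 * (K * K) * pp j + e1) (K * K * (1 - 2 * cp (D j))) 0 (K * K) j js cf.
  apply: le_trans (h _ _ _) _ => //.
  + rewrite addr0 normrM -[leRHS]mulr1; apply: ler_pM => //.
      by rewrite ger0_norm// mulr_ge0// ltW.
    have /andP[p0 p1] := gd_p g; rewrite ler_norml; apply/andP.
    by split; move: p0 p1; lra.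
  + move=> z cz; have h1 := lt_le_trans (pt_d pt i k js cz) (cme js).
    have /andP[h2 h3] := pt_k pt z js; have /andP[p0 p1] := gd_p g.
    set q := kk j z in h1 h2 h3 *; rewrite /pp; set p := cp (D j) in h2 h3 p0 p1 *.
    have ax := axK i k js; rewrite -/(dl i k z) in h1.
    have h4 : `|ca (D j) i * cx (D j) k * q| <= K * K * ((1 - 2 * p) * q + 2 * p * (1 - p)).
      rewrite normrM ler_pM// ler_norml; apply/andP; split; move: h2 h3 p0 p1; nra.
    have h5 : `|dl i k z| <= e1 + K * K * ((1 - 2 * p) * q + 2 * p * (1 - p)).
      rewrite -[dl i k z](subrK (ca (D j) i * cx (D j) k * q)).
      by rewrite (le_trans (ler_normD _ _))// lerD// ltW.
    by move: h5; lra.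
  + rewrite ler_pM2r//; lra.
- move=> z Oz nc; exact: le_trans (pt_d0 pt i k (OB Oz) nc) e11.
Qed.

(** Off [bad] the reference state is in [M], where the variance of its splitting dominates [d]. On
    [bad] the crude bound [d <= K] is used. *)
Lemma pert_d : \int[L3]_(z in O) d (S W z) <=
  Pi / c + (V + 2 * K) * e1 + K * fine (L3 (O `\` Mset W)).
Proof.
have cd : continuous (fun z => d (S W z)) by apply: continuous_dSt; exact: (@continuous_St R B Tc B0 W CW).
have mM : measurable (Mset W : set ((mR * mR) * mR)) by apply: open_measurable3; exact: open_Mset.
pose bad : set ((mR * mR) * mR) := (O `\` Mset W) `|` (O `&` Dr).
have mO := mO oO.
have mOM : measurable (O `\` Mset W : set ((mR * mR) * mR)) by exact: measurableD.
have mODr : measurable (O `&` Dr : set ((mR * mR) * mR)) by apply: measurableI => //; exact: pt_Dr pt.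
have mbad : measurable bad by exact: measurableU.
have badO : bad `<=` O by move=> z [[]|[]].
have mG : measurable (O `\` bad) by exact: measurableD.
have dK z : O z -> d (S W z) <= K by move=> /OB/WU/(sp_dU oc)/andP[].
have badV : fine (L3 bad) <= fine (L3 (O `\` Mset W)) + e1.
  apply: le_fine => //; rewrite EFinD fineK; last by rewrite ge0_fin_numE// L3_subO//; exact: subDsetl.
  apply: (le_trans (measureU2 _ mOM mODr)); apply: leeD => //.
  apply: le_trans (pt_Drm pt); apply: le_measure; rewrite ?inE; [exact: mODr|exact: pt_Dr pt|exact: subIsetr].
have -> : \int[L3]_(z in O) d (S W z) =
    \int[L3]_(z in bad) d (S W z) + \int[L3]_(z in O `\` bad) d (S W z).
  rewrite -{1}(setDUK badO) Rintegral_setU//.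
  - by rewrite setDUK//; exact: cont_O_integrable.
  - by rewrite /disj_set setDIK.
have h1 : \int[L3]_(z in bad) d (S W z) <= K * (fine (L3 (O `\` Mset W)) + e1).
  apply: (@le_trans _ _ (K * fine (L3 bad))); last by rewrite ler_wpM2l// ltW.
  apply: Rint_le_cst => //; [exact: L3_subO|exact: cont_O_sub_integrable|by move=> z /badO/dK].
have mC j : measurable (cl j `\` bad) by apply: measurableD => //; exact: measurable_cell.
have h2 : \int[L3]_(z in O `\` bad) d (S W z) <= \sum_(j <- s) (pp j / c + e1) * Vj j +
   K * fine (L3 (O `\` bad `\` \bigcup_(j in [set` s]) (cl j `\` bad))).
  apply: (cells_integral_le (C := fun j => cl j `\` bad) (pt_s pt) mC mG).
  - by apply: cont_O_sub_integrable => //; exact: subDsetl.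
  - by apply: L3_subO => //; exact: subDsetl.
  - by move=> j js; apply: setSD; exact: pt_cO pt _ js.
  - move=> i j is_ js ij; rewrite -subset0 => z [[zi _] [zj _]].
    by have : (cl i `&` cl j) z by []; rewrite (pt_disj pt is_ js ij).
  - move=> j js; have g := pt_good pt js.
    have a0 : 0 <= pp j / c + e1 by apply: addr_ge0; [apply: divr_ge0; [exact: pp0|exact: ltW]|exact: ltW].
    have clO : cl j `\` bad `<=` O by move=> z [/(pt_cO pt js)].
    apply: (@le_trans _ _ ((pp j / c + e1) * fine (L3 (cl j `\` bad)))).
      apply: Rint_le_cst => //; [exact: L3_subO|exact: cont_O_sub_integrable|].
      move=> z [cz nbad]; have Oz := pt_cO pt js cz.
      have Mz : M (S W z).
        by apply: contrapT => nM; apply: nbad; left; split => // -[].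
      have [MP|nMP] := pselect (M (P j)); last first.
        by exfalso; apply: nbad; right; split => //; exact: pt_nM pt _ _ js nMP cz Mz.
      have := gd_s g MP; rewrite mulrC -ler_pdivlMr// -/(pp j).
      have : `|d (S W z) - d (P j)| < e1.
        apply: (gd_d g) => i k; apply: lt_le_trans (pt_S pt i k js cz) _.
        by move: (gd_m g); lra.
      rewrite ltr_norml => /andP[_].
      by move: (d (S W z)) (d (P j)) (pp j / c) => ? ? ?; lra.
    rewrite ler_wpM2l// -L3cl fine_le// ?ge0_fin_numE//; [exact: L3_subO| |].
      by apply: L3_subO; [exact: measurable_cell|exact: pt_cO pt _ js].
    by apply: le_measure; rewrite ?inE; [exact: mC|exact: measurable_cell|exact: subDsetl].
  - by move=> z [/dK].
have h3 : fine (L3 (O `\` bad `\` \bigcup_(j in [set` s]) (cl j `\` bad))) <= e1.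
  apply: le_fine => //; apply: le_trans (pt_rest pt); apply: le_measure; rewrite ?inE.
  - apply: measurableD => //; apply: fin_bigcup_measurable => [|j _]; [exact: finite_seq|exact: mC].
  - by apply: measurableD => //; apply: fin_bigcup_measurable => [|j _]; [exact: finite_seq|exact: measurable_cell].
  - by move=> z [[Oz nb] nU]; split => // -[j js cj]; apply: nU; exists j.
have h4 : K * fine (L3 (O `\` bad `\` \bigcup_(j in [set` s]) (cl j `\` bad))) <= K * e1.
  by rewrite ler_wpM2l// ltW.
have h5 : \sum_(j <- s) (pp j / c + e1) * Vj j <= Pi / c + V * e1.
  under eq_bigr do rewrite mulrDl.
  rewrite big_split/= -mulr_sumr /Pi mulr_suml; apply: lerD.
    by apply: ler_sum => j _; rewrite mulrAC.
  by rewrite mulrC ler_wpM2r// ltW.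
exact: ar_fin h1 h2 h4 h5.
Qed.

(** By the Chebyshev estimate [cell_markov] the defect is below [ct] outside a small set, and there
    the new state is near an end of the segment, hence in [M]. *)
Lemma pert_bad : (L3 (O `\` Mset W') <= ((1 + V) * e1)%:E)%E.
Proof.
pose A j := cl j `&` [set z | ct (D j) <= (kk j z + cp (D j)) * (1 - cp (D j) - kk j z)].
have HA j : j \in s -> measurable (A j) /\ (L3 (A j) <= (e1 * Vj j)%:E)%E.
  move=> js; have g := pt_good pt js.
  have [mA lA] := cell_markov (pt_kc pt js) (gd_t g) (fun z => pt_k pt z js) (pt_Bi pt js).
  split => //; apply: le_trans lA _; rewrite lee_fin ler_pdivrMr ?(gd_t g)//.
  by rewrite mulrAC; exact: pt_et pt _ js.
have [mUA lUA] := seq_union_le HA.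
have mrest : measurable rest.
  by apply: measurableD; [exact: mO|apply: fin_bigcup_measurable => [|j _]; [exact: finite_seq|exact: measurable_cell]].
have mM : measurable (Mset W' : set ((mR * mR) * mR)) by apply: open_measurable3; exact: open_Mset.
apply: (@le_trans _ _ (L3 (rest `|` \bigcup_(j in [set` s]) A j))).
  apply: le_measure; rewrite ?inE; [by apply: measurableD => //; exact: mO|exact: measurableU|].
  move=> z [Oz nM]; have [[j js cj]|nc] := pselect (exists2 j, j \in s & cl j z); last first.
    by left; apply: restP => // j js cj; apply: nc; exists j.
  right; exists j => //; split => //=; rewrite leNgt; apply/negP => lt.
  apply: nM; split => //; have g := pt_good pt js.
  apply: (gd_M g (pt_k pt z js) lt) => i k.
  have h1 := pt_S pt i k js cj; have h2 := pt_d pt i k js cj.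
  move: h1 h2.
  move: (S W' z i k) (S W z i k) (P j i k) (ca (D j) i) (cx (D j) k) (kk j z) (cm (D j)).
  move=> a1 a2 a3 a4 a5 a6 a7 h1 h2.
  rewrite (_ : _ - _ = (a2 - a3) + (a1 - a2 - a4 * a5 * a6)); last by ring.
  by rewrite (le_lt_trans (ler_normD _ _))//; move: h1 h2; lra.
apply: (@le_trans _ _ (L3 rest + L3 (\bigcup_(j in [set` s]) A j))%E); first exact: measureU2.
rewrite mulrDl mul1r EFinD; apply: leeD; first exact: pt_rest pt.
apply: le_trans lUA _; rewrite lee_fin -mulr_sumr mulrC ler_wpM2r// ltW//.
Qed.

End with_pert.

(** Eliminating the variance between the estimates bounds both the distance to the graph before the
    step and the L^1 change by the energy gain, up to [eps] and the measure of the part outside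
    [M]. *)
Lemma step W eps : (forall i, C1 (W i)) -> (forall z, box 0 B z -> U (S W z)) -> 0 < eps ->
  exists W', [/\ forall i, C1 (W' i), forall z, box 0 B z -> U (S W' z),
     forall i z, `|W' i z - W i z| <= eps,
     forall i z, `|'D_(dir d2) (W' i) z - 'D_(dir d2) (W i) z| <= eps &
     forall i z, ~ O z -> W' i z = W i z] /\
   [/\ (L3 (O `\` Mset W') <= eps%:E)%E,
     - eps <= En W' - En W,
     c ^+ 2 * \int[L3]_(z in O) d (S W z) <= En W' - En W + c ^+ 2 * K * fine (L3 (O `\` Mset W)) + eps &
     forall i k, c * \int[L3]_(z in O) `|S W' z i k - S W z i k| <= 2 * (K * K) * (En W' - En W) + eps].
Proof.
move=> CW WU eps0; have [c0 K0] := (sp_c oc, sp_K oc).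
pose V := fine (L3 O); have V0 : 0 <= V by exact: fine_ge0.
pose CE := 4 * (K * K) + 2 * K + 3.
pose CF := 4 * CE + 8 * (K * (K * K)) + 8 * ((K * K) * (K * K)).
pose a := CF * V + 8 * K.
have KK : 0 < K * K by rewrite mulr_gt0.
have CF0 : 0 <= CF by exact: CF_ge0.
have a0 : 0 <= a by rewrite /a addr_ge0// mulr_ge0// ltW.
pose b2 := 2 * (K * K) * a + c * ((1 + K * K) * V + 1).
pose b3 := a + c ^+ 2 * (V + 2 * K).
have b20 : 0 <= b2 by rewrite /b2 !addr_ge0// ?mulr_ge0// ?addr_ge0// ?mulr_ge0// ?addr_ge0// ?ltW.
have b30 : 0 <= b3 by rewrite /b3 !addr_ge0// ?mulr_ge0// ?addr_ge0// ?mulr_ge0// ?exprn_ge0// ltW.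
(* [D] majorises every constant that multiplies [e1] in the final inequalities. *)
pose D := 1 + V + a + b2 + b3.
have D0 : 1 <= D by rewrite /D; move: V0 a0 b20 b30; clear -oc; lra.
have Dp : 0 < D by rewrite (lt_le_trans ltr01).
pose e1 := Num.min 1 (eps / D).
have e10 : 0 < e1 by rewrite lt_min ltr01 divr_gt0.
have e11 : e1 <= 1 by rewrite ge_min lexx.
have De : D * e1 <= eps by rewrite mulrC -ler_pdivlMr// ge_min lexx orbT.
have sml x : 0 <= x -> x <= D -> x * e1 <= eps.
  by move=> x0 xD; apply: le_trans De; rewrite ler_wpM2r// ltW.
have e1e : e1 <= eps by rewrite -[e1]mul1r sml.
have [W' [s [Dd [P [kk [e [Dr pt]]]]]]] := pert_exists oc B0 Tc1 oO OB CW WU e10.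
have H1 := pert_energy pt CW WU e10 e11; have H2 := pert_L1 pt CW e10 e11.
have H3 := pert_d pt CW WU e10; have H4 := pert_bad pt e10.
move: H1 H2 H3 H4; rewrite -/V -/CE -/CF -/a.
set Pi := \sum_(j <- s) _ => H1 H2 H3 H4.
have Pi0 : 0 <= Pi.
  rewrite /Pi big_seq sumr_ge0// => j js; have /andP[p0 p1] := gd_p (pt_good pt js).
  by rewrite !mulr_ge0 ?exprn_ge0 ?(ltW (mesh_gt0 _))// ltW// subr_gt0.
have cPi : 0 <= c * Pi by rewrite mulr_ge0// ltW.
exists W'; split.
  split; [exact: pt_C1 pt|exact: pt_U pt| | |exact: pt_O pt].
  - by move=> i z; exact: le_trans (pt_W pt i z) e1e.
  - by move=> i z; exact: le_trans (pt_Wt pt i z) e1e.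
have aD : a * e1 <= eps by apply: sml => //; rewrite /D; move: V0 b20 b30; clear -oc; lra.
split.
- apply: le_trans H4 _; rewrite lee_fin; apply: sml; first by rewrite addr_ge0.
  by rewrite /D; move: a0 b20 b30; clear -oc; lra.
- exact: ar_s2 aD H1 cPi.
- have b3D : b3 * e1 <= eps by apply: sml => //; rewrite /D; move: V0 a0 b20; clear -oc; lra.
  exact: ar_s3 c0 H3 H1 b3D.
- move=> i k.
  have b2D : b2 * e1 <= eps by apply: sml => //; rewrite /D; move: V0 a0 b30; clear -oc; lra.
  exact: ar_s4 c0 KK (H2 i k) H1 b2D.
Qed.

End step_estimates.

(** * Iteration and passage to the limit *)

Section iteration.
Context {R : realType}.
Notation Z := ((R * R) * R)%type.
Notation mR := (measurableTypeR R).
Notation L3 := (@L3 R).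
Notation d0 := (@Ordinal 3 0 isT).
Notation d1 := (@Ordinal 3 1 isT).
Notation d2 := (@Ordinal 3 2 isT).
Notation k0 := (@Ordinal 2 0 isT).
Notation k1 := (@Ordinal 2 1 isT).
Notation st := ('I_4 -> 'I_2 -> R).

Lemma summable_cvg (u b : nat -> R) : (forall n, 0 <= b n) -> (forall n, `|u n.+1 - u n| <= b n) ->
  (\sum_(n <oo) (b n)%:E < +oo)%E -> cvgn u /\ b @ \oo --> 0.
Proof.
move=> b0 ub bfin.
have cb : cvgn (series b).
  apply: nondecreasing_is_cvgn.
    by apply: nondecreasing_series => n _ _; exact: b0.
  exists (fine (\sum_(n <oo) (b n)%:E)) => _ [n _ <-].
  have fin : (\sum_(n <oo) (b n)%:E)%E \is a fin_num.
    by rewrite ge0_fin_numE// nneseries_ge0// => i _ _; rewrite lee_fin.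
  rewrite -lee_fin fineK// /series/= -sumEFin.
  by apply: nneseries_lim_ge => i _; rewrite lee_fin.
split; last exact: cvg_series_cvg_0.
have c1 : cvgn (series (fun n => u n.+1 - u n)).
  apply: normed_cvg; apply: (series_le_cvg _ b0 ub cb) => n.
  exact: normr_ge0.
have -> : u = (fun n => u 0%N + series (fun n => u n.+1 - u n) n).
  apply/funext => n; rewrite /series/= telescope_sumr//.
  by rewrite addrC subrK.
by apply: is_cvgD => //; exact: is_cvg_cst.
Qed.

Lemma summable_int (O : set ((mR * mR) * mR)) (g : nat -> Z -> R) (C : R) : measurable O ->
  (forall n, measurable_fun O (g n)) -> (forall n z, O z -> 0 <= g n z) ->
  (forall n, L3.-integrable O (EFin \o g n)) ->
  (forall N, \sum_(n < N) \int[L3]_(z in O) g n z <= C) ->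
  (\int[L3]_(z in O) (\sum_(n <oo) (g n z)%:E) < +oo)%E.
Proof.
move=> mO mg g0 gi gC.
rewrite integral_nneseries//; last by move=> n; apply/measurable_EFinP; exact: mg.
apply: (@le_lt_trans _ _ C%:E); last exact: ltry.
apply: lime_le.
  by apply: is_cvg_nneseries => n _ _; apply: integral_ge0 => z Oz; rewrite lee_fin; exact: g0.
apply: nearW => N; rewrite big_mkord.
rewrite (eq_bigr (fun n : 'I_N => (\int[L3]_(z in O) g n z)%:E)).
  by rewrite sumEFin lee_fin; exact: gC.
move=> n _; rewrite /Rintegral fineK//.
exact: (integrable_fin_num mO (gi n)).
Qed.

Lemma sum_mesh (mu : nat -> R) N : (forall n, 0 < mu n) -> (forall n, mu n.+1 <= mu n) ->
  forall m, \sum_(n < N) mu (m + n)%N * @mesh R (m + n).+1 <= mu m * mesh m.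
Proof.
move=> mu0 mud; elim: N => [|N IH] m; first by rewrite big_ord0 mulr_ge0// ltW// mesh_gt0.
rewrite big_ord_recl addn0 /=.
rewrite (eq_bigr (fun n : 'I_N => mu (m.+1 + n)%N * @mesh R (m.+1 + n).+1)); last first.
  by move=> n _; rewrite /bump/= add1n addnS.
have := IH m.+1; have : mu m.+1 * @mesh R m.+1 <= mu m * mesh m.+1.
  by rewrite ler_pM2r// mesh_gt0.
rewrite [in mu m * mesh m]meshS.
by move: (\sum_(i < N) _) => x; lra.
Qed.

Lemma ar_half (x y w e : R) : x < e / 2 -> y < e / 2 -> w <= y -> x + w <= e.
Proof. by lra. Qed.

Variables (U M : set st) (d : st -> R) (c K : R).
Hypothesis oc : splittable U M d c K.
Variable L : 'I_5 -> st -> R.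
Hypothesis Lc : forall i P e, 0 < e ->
  exists2 m, 0 < m & forall Q, (forall j k, `|Q j k - P j k| < m) -> `|L i Q - L i P| < e.
Hypothesis L1 : forall i P, U P -> L i P < 1.
Variables (B : R) (Tc : 'I_4 -> 'I_4 -> R).
Hypothesis B0 : 0 < B.
Hypothesis Tc1 : forall i j, `|Tc i j| <= 1.
Variable O : set Z.
Hypothesis oO : open O.
Hypothesis OB : O `<=` (box 0 B : set Z).
Local Notation S := (St B Tc).

Lemma continuous_LSt i W : (forall i, C1 (W i)) -> continuous (fun z => L i (S W z)).
Proof.
move=> CW z; apply/cvg_dist0 => e e0; have [m m0 Hm] := Lc i (S W z) e0.
have /nbhs_ballP[r /= r0 Hr] := near_st z (@continuous_St R B Tc B0 W CW) m0.
exists r => // y yz; apply: Hm; apply: Hr.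
by rewrite -ball_normE/= distrC.
Qed.

Lemma margin W : (forall i, C1 (W i)) -> (forall z, box 0 B z -> U (S W z)) ->
  exists2 m, 0 < m & forall i z, box 0 B z -> L i (S W z) <= 1 - m.
Proof.
move=> CW WU.
have H i : exists2 m, 0 < m & forall z, box 0 B z -> L i (S W z) <= 1 - m.
  have b0 : (box 0 B : set Z) !=set0 by exists 0; apply/box_norm; rewrite subrr normr0 ltW.
  have cL : {within (box 0 B : set Z), continuous (fun z => L i (S W z))}.
    exact/continuous_subspaceT/continuous_LSt.
  have [z zb Hz] := compact_EVT_max b0 (@compact_box R 0 B) cL.
  exists (1 - L i (S W z)); first by rewrite subr_gt0; apply/L1/WU; rewrite -in_setE.
  by move=> y yb; rewrite opprB addrC subrK Hz// in_setE.
have /choice[f Hf] i : exists m, 0 < m /\ forall z, box 0 B z -> L i (S W z) <= 1 - m.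
  by have [m m0 Hm] := H i; exists m.
have [e e0 He] := @seq_min_gt0 R _ (enum 'I_5) f (fun j _ => (Hf j).1).
exists e => // i z zb; apply: le_trans ((Hf i).2 z zb) _.
by rewrite lerD2l lerN2; apply: He; rewrite mem_enum.
Qed.

Local Notation Ms := (Mset M B Tc O).
Local Notation E := (En B Tc O).

(** [mu n] is the current margin of the coordinates [L i] below 1. Every error allowed at stage [n]
    is this margin times [mesh n.+1], so all later changes of the maps add up to at most
    [mu n * mesh n], far less than the margin itself. The proof of nowhere continuity rests on this
    comparison. *)
Record ci (W0 : 'I_4 -> Z -> R) (eps0 : R) (W : nat -> 'I_4 -> Z -> R) (mu : nat -> R) : Prop := Ci {
  ci_0 : W 0%N = W0;
  ci_C1 : forall n i, C1 (W n i);
  ci_U : forall n z, box 0 B z -> U (S (W n) z);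
  ci_mu0 : forall n, 0 < mu n;
  ci_mue : forall n, mu n <= eps0;
  ci_mud : forall n, mu n.+1 <= mu n;
  ci_L : forall n i z, box 0 B z -> L i (S (W n) z) <= 1 - mu n;
  ci_W : forall n i z, `|W n.+1 i z - W n i z| <= mu n * mesh n.+1;
  ci_Wt : forall n i z, `|'D_(dir d2) (W n.+1 i) z - 'D_(dir d2) (W n i) z| <= mu n * mesh n.+1;
  ci_O : forall n i z, ~ O z -> W n.+1 i z = W n i z;
  ci_M : forall n, (L3 (O `\` Ms (W n.+1)) <= (mu n * mesh n.+1)%:E)%E;
  ci_d : forall n, c ^+ 2 * \int[L3]_(z in O) d (S (W n) z) <=
    E (W n.+1) - E (W n) + c ^+ 2 * K * fine (L3 (O `\` Ms (W n))) + mu n * mesh n.+1;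
  ci_S : forall n i k, c * \int[L3]_(z in O) `|S (W n.+1) z i k - S (W n) z i k| <=
    2 * (K * K) * (E (W n.+1) - E (W n)) + mu n * mesh n.+1}.

Lemma iterate W0 eps0 : (forall i, C1 (W0 i)) -> (forall z, box 0 B z -> U (S W0 z)) -> 0 < eps0 ->
  exists W mu, ci W0 eps0 W mu.
Proof.
move=> CW0 WU0 e00.
pose T := (('I_4 -> Z -> R) * R)%type.
pose ok (x : T) := [/\ forall i, C1 (x.1 i), forall z, box 0 B z -> U (S x.1 z), 0 < x.2, x.2 <= eps0 &
  forall i z, box 0 B z -> L i (S x.1 z) <= 1 - x.2].
pose rel (n : nat) (x y : T) := [/\ y.2 <= x.2,
   forall i z, `|y.1 i z - x.1 i z| <= x.2 * mesh n.+1,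
   forall i z, `|'D_(dir d2) (y.1 i) z - 'D_(dir d2) (x.1 i) z| <= x.2 * mesh n.+1 &
   forall i z, ~ O z -> y.1 i z = x.1 i z] /\
   [/\ (L3 (O `\` Ms y.1) <= (x.2 * mesh n.+1)%:E)%E,
     c ^+ 2 * \int[L3]_(z in O) d (S x.1 z) <=
      E y.1 - E x.1 + c ^+ 2 * K * fine (L3 (O `\` Ms x.1)) + x.2 * mesh n.+1 &
     forall i k, c * \int[L3]_(z in O) `|S y.1 z i k - S x.1 z i k| <=
      2 * (K * K) * (E y.1 - E x.1) + x.2 * mesh n.+1].
have okstep n x : ok x -> exists y, ok y /\ rel n x y.
  move=> [Cx Ux x0 xe xL].
  have e0 : 0 < x.2 * @mesh R n.+1 by rewrite mulr_gt0// mesh_gt0.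
  have [W' [[CW' WU' h1 h2 h3] [h4 h5 h6 h7]]] := step oc B0 Tc1 oO OB Cx Ux e0.
  have [m m0 Hm] := margin CW' WU'.
  (* The margin of the new iterate comes from compactness of the box; taking the minimum keeps the
     sequence nonincreasing. *)
  exists (W', Num.min x.2 m); split.
    split => //=; first by rewrite lt_min x0.
      by rewrite ge_min xe.
    move=> i z zb; apply: le_trans (Hm i z zb) _.
    by rewrite lerD2l lerN2 ge_min lexx orbT.
  split; last by split; [exact: h4|exact: h6|exact: h7].
  by split => //=; rewrite ge_min lexx.
have /choice[nx Hnx] (nxx : nat * T) : exists y, ok nxx.2 -> ok y /\ rel nxx.1 nxx.2 y.
  have [okx|nok] := pselect (ok nxx.2); last by exists nxx.2.
  by have [y Hy] := okstep nxx.1 nxx.2 okx; exists y.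
have [m m0 Hm] := margin CW0 WU0.
pose x0 : T := (W0, Num.min eps0 m).
pose x := fix f (n : nat) : T := if n is n'.+1 then nx (n', f n') else x0.
have okx n : ok (x n).
  elim: n => [|n IH]; last by have [] := Hnx (n, x n) IH.
  split => //=; first by rewrite lt_min e00.
    by rewrite ge_min lexx.
  move=> i z zb; apply: le_trans (Hm i z zb) _.
  by rewrite lerD2l lerN2 ge_min lexx orbT.
have relx n : rel n (x n) (x n.+1) by have [] := Hnx (n, x n) (okx n).
exists (fun n => (x n).1), (fun n => (x n).2); split.
- by [].
- by move=> n; have [] := okx n.
- by move=> n; have [] := okx n.
- by move=> n; have [] := okx n.
- by move=> n; have [] := okx n.
- by move=> n; have [[]] := relx n.
- by move=> n; have [] := okx n.
- by move=> n; have [[]] := relx n.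
- by move=> n; have [[]] := relx n.
- by move=> n; have [[]] := relx n.
- by move=> n; have [_ []] := relx n.
- by move=> n; have [_ []] := relx n.
- by move=> n; have [_ []] := relx n.
Qed.

Section with_ci.
Variables (W0 : 'I_4 -> Z -> R) (eps0 : R) (W : nat -> 'I_4 -> Z -> R) (mu : nat -> R).
Hypothesis H : ci W0 eps0 W mu.

(** Finiteness of the sum over [n] at one point forces both the convergence of the states there and
    [d] to tend to 0 along them. *)
Definition gsum (n : nat) (z : Z) : R :=
  \sum_(i < 4) \sum_(k < 2) `|S (W n.+1) z i k - S (W n) z i k| + d (S (W n) z).

Lemma continuous_gsum n : continuous (gsum n).
Proof.
move=> z; apply: cvgD.
  apply: (@continuous_bigsum R _ _ _ (fun i z => \sum_(k < 2) `|S (W n.+1) z i k - S (W n) z i k|)) => i {}z.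
  apply: (@continuous_bigsum R _ _ _ (fun k z => `|S (W n.+1) z i k - S (W n) z i k|)) => k {}z.
  apply: cvg_norm; apply: cvgB; first exact: (@continuous_St R B Tc B0 _ (ci_C1 H n.+1) i k).
  exact: (@continuous_St R B Tc B0 _ (ci_C1 H n) i k).
apply: (continuous_dSt oc); exact: (@continuous_St R B Tc B0 _ (ci_C1 H n)).
Qed.

Lemma gsum_ge0 n z : O z -> 0 <= gsum n z.
Proof.
move=> Oz; apply: addr_ge0.
  by apply: sumr_ge0 => i _; apply: sumr_ge0 => k _.
by have /andP[] := sp_dU oc (ci_U H n (OB Oz)).
Qed.

(** States in [U] are bounded, so the energies are bounded and their increments telescope; the
    measures outside [M] are summable by construction. With the linear estimates of [step] this
    bounds all partial sums. *)
Lemma gsum_int : (\int[L3]_(z in O) (\sum_(n <oo) (gsum n z)%:E) < +oo)%E.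
Proof.
have [c0 K0] := (sp_c oc, sp_K oc).
pose V := fine (L3 O); have V0 : 0 <= V by exact: fine_ge0.
have cS n := @continuous_St R B Tc B0 _ (ci_C1 H n).
have ciO f (cf : continuous f) := cont_O_integrable B0 oO OB cf.
pose D n := \int[L3]_(z in O) d (S (W n) z).
pose X n i k := \int[L3]_(z in O) `|S (W n.+1) z i k - S (W n) z i k|.
have cX n i k : continuous (fun z => `|S (W n.+1) z i k - S (W n) z i k|).
  by move=> z; apply: cvg_norm; apply: cvgB; [exact: (cS n.+1 i k)|exact: (cS n i k)].
have cd n : continuous (fun z => d (S (W n) z)) by apply: (continuous_dSt oc); exact: cS.
have mO' := mO oO.
have gE n : \int[L3]_(z in O) gsum n z = \sum_(i < 4) \sum_(k < 2) X n i k + D n.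
  have c2 i : continuous (fun z => \sum_(k < 2) `|S (W n.+1) z i k - S (W n) z i k|).
    by apply: (@continuous_bigsum R _ _ _ (fun k z => `|S (W n.+1) z i k - S (W n) z i k|)) => k; exact: cX.
  have c4 : continuous (fun z => \sum_(i < 4) \sum_(k < 2) `|S (W n.+1) z i k - S (W n) z i k|).
    by apply: (@continuous_bigsum R _ _ _ (fun i z => \sum_(k < 2) `|S (W n.+1) z i k - S (W n) z i k|)).
  rewrite /gsum (RintegralD mO' (ciO _ c4) (ciO _ (cd n))); congr (_ + _).
  have Rsum (I : Type) (r : seq I) (f : I -> Z -> R) : (forall i, continuous (f i)) ->
      \int[L3]_(z in O) (\sum_(i <- r) f i z) = \sum_(i <- r) \int[L3]_(z in O) f i z.
    move=> cf; elim: r => [|i r IH].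
      by rewrite big_nil; under eq_Rintegral do rewrite big_nil; rewrite Rintegral_cst// mul0r.
    rewrite big_cons -IH; under eq_Rintegral do rewrite big_cons.
    rewrite (RintegralD mO' (ciO _ (cf i)))//; apply: ciO.
    exact: (@continuous_bigsum R _ _ _ f).
  rewrite (Rsum _ _ (fun i z => \sum_(k < 2) `|S (W n.+1) z i k - S (W n) z i k|))//.
  apply: eq_bigr => i _.
  by rewrite (Rsum _ _ (fun k z => `|S (W n.+1) z i k - S (W n) z i k|)).
pose ep n := mu n * @mesh R n.+1.
have ep0 n : 0 < ep n by rewrite mulr_gt0 ?(ci_mu0 H)// mesh_gt0.
have sep N : \sum_(n < N) ep n <= eps0.
  have := @sum_mesh mu N (ci_mu0 H) (ci_mud H) 0; rewrite /mesh expr0 mulr1 => h.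
  by apply: le_trans (ci_mue H 0); apply: le_trans h; apply: ler_sum => n _; rewrite add0n.
have EV n : E (W n) <= 4 * (K * K) * V.
  apply: Rint_le_cst => //; [exact: (L3O B0 oO OB)|exact: (ciO _ (@continuous_en R B Tc B0 (W n) (ci_C1 H n)))|].
  move=> z Oz; apply: (@le_trans _ _ (\sum_(i < 4) (K * K))); last by rewrite sumr_const card_ord mulr_natl.
  apply: ler_sum => i _; rewrite -real_normK ?num_real// expr2.
  by have := sp_bU oc i k1 (ci_U H n (OB Oz)) => h; rewrite ler_pM.
have E0 : 0 <= E (W 0%N).
  by apply: Rintegral_ge0 => z _; apply: sumr_ge0 => i _; exact: sqr_ge0.
have tel N : \sum_(n < N) (E (W n.+1) - E (W n)) <= 4 * (K * K) * V.
  rewrite -(big_mkord predT (fun n => E (W n.+1) - E (W n))) telescope_sumr//.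
  by rewrite lerBlDr (le_trans (EV N))// lerDl.
pose F n := fine (L3 (O `\` Ms (W n))).
have F0V n : F n <= V.
  apply: fine_le; rewrite ?ge0_fin_numE//; last 2 first.
  - exact: (L3O B0 oO OB).
  - apply: le_measure; rewrite ?inE; [|exact: mO'|exact: subDsetl].
    by apply: measurableD => //; apply: open_measurable3; exact: (open_Mset oc B0 oO (ci_C1 H n)).
  apply: (L3_subO B0 oO OB); last exact: subDsetl.
  by apply: measurableD => //; apply: open_measurable3; exact: (open_Mset oc B0 oO (ci_C1 H n)).
have sF N : \sum_(n < N) F n <= V + eps0.
  have e00 : 0 <= eps0 by have := sep 0%N; rewrite big_ord0.
  case: N => [|N]; first by rewrite big_ord0 addr_ge0.
  rewrite big_ord_recl/=; apply: lerD => //; apply: le_trans (sep N).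
  apply: ler_sum => n _; apply: le_fine => //; exact: ci_M H n.
have hX N i k : c * \sum_(n < N) X n i k <= 2 * (K * K) * (4 * (K * K) * V) + eps0.
  rewrite mulr_sumr; apply: (@le_trans _ _ (\sum_(n < N) (2 * (K * K) * (E (W n.+1) - E (W n)) + ep n))).
    by apply: ler_sum => n _; exact: ci_S H n i k.
  rewrite big_split/= -mulr_sumr; apply: lerD; last exact: sep.
  by apply: ler_wpM2l; [rewrite mulr_ge0// mulr_ge0// ltW|exact: tel].
have hD N : c ^+ 2 * \sum_(n < N) D n <= 4 * (K * K) * V + c ^+ 2 * K * (V + eps0) + eps0.
  rewrite mulr_sumr; apply: (@le_trans _ _ (\sum_(n < N) (E (W n.+1) - E (W n) + c ^+ 2 * K * F n + ep n))).
    by apply: ler_sum => n _; exact: ci_d H n.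
  rewrite big_split/= (big_split _ _ _ (fun n : 'I_N => E (W n.+1) - E (W n)))/= -mulr_sumr.
  apply: lerD; last exact: sep.
  apply: lerD; first exact: tel.
  by apply: ler_wpM2l; [rewrite mulr_ge0 ?sqr_ge0// ltW|exact: sF].
apply: (@summable_int O gsum (8 * ((2 * (K * K) * (4 * (K * K) * V) + eps0) / c) +
  (4 * (K * K) * V + c ^+ 2 * K * (V + eps0) + eps0) / c ^+ 2)) => //.
- by move=> n; apply: measurable_funTS; apply: continuous_measurable3; exact: continuous_gsum.
- by move=> n z; exact: gsum_ge0.
- by move=> n; apply: ciO; exact: continuous_gsum.
move=> N; under eq_bigr do rewrite gE.
rewrite big_split/=; apply: lerD; last first.
  by rewrite ler_pdivlMr ?exprn_gt0// [leLHS]mulrC; exact: hD.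
rewrite exchange_big/=; apply: (@le_trans _ _ (\sum_(i < 4) 2 * ((2 * (K * K) * (4 * (K * K) * V) + eps0) / c))).
  apply: ler_sum => i _; rewrite exchange_big/=.
  apply: (@le_trans _ _ (\sum_(k < 2) ((2 * (K * K) * (4 * (K * K) * V) + eps0) / c))).
    by apply: ler_sum => k _; rewrite ler_pdivlMr// [leLHS]mulrC; exact: hX.
  by rewrite sumr_const card_ord -[leLHS]mulr_natl.
by rewrite sumr_const card_ord -[leLHS]mulr_natl [leLHS]mulrA -natrM.
Qed.

Definition Gd : set ((mR * mR) * mR) := [set z | O z /\ (\sum_(n <oo) (gsum n z)%:E < +oo)%E].

Definition Sl (z : Z) : st := fun i k => limn (fun n => S (W n) z i k).

Lemma Gd_cvg z : Gd z -> (forall i k, (fun n => S (W n) z i k) @ \oo --> Sl z i k) /\ d (Sl z) = 0.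
Proof.
move=> [Oz fz].
have g0 n : 0 <= gsum n z by exact: gsum_ge0.
have dU n : 0 <= d (S (W n) z) by have /andP[] := sp_dU oc (ci_U H n (OB Oz)).
have ub i k n : `|S (W n.+1) z i k - S (W n) z i k| <= gsum n z.
  rewrite /gsum (bigD1 i)//= (bigD1 k)//= -!addrA lerDl; apply: addr_ge0; first exact: sumr_ge0.
  by apply: addr_ge0 => //; apply: sumr_ge0 => j _; exact: sumr_ge0.
have cv i k : (fun n => S (W n) z i k) @ \oo --> Sl z i k by have [] := summable_cvg g0 (ub i k) fz.
split => //.
have [_ g_0] := summable_cvg g0 (ub (@Ordinal 4 0 isT) k0) fz.
apply/eqP; rewrite -normr_le0; apply/ler_addgt0Pr => e e0.
have e2 : 0 < e / 2 by rewrite divr_gt0.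
have [m m0 Hm] := sp_d oc (Sl z) e2.
have : \forall n \near \oo, (forall i k, `|S (W n) z i k - Sl z i k| < m) /\ `|gsum n z| < e / 2.
  apply: filterI; last first.
    by have /cvgrPdist_lt/(_ _ e2) := g_0; apply: filterS => n; rewrite sub0r normrN.
  apply: (@filter_forall nat 'I_4 (fun i n => forall k, `|S (W n) z i k - Sl z i k| < m) eventually _) => i.
  apply: (@filter_forall nat 'I_2 (fun k n => `|S (W n) z i k - Sl z i k| < m) eventually _) => k.
  by have /cvgrPdist_lt/(_ _ m0) := cv i k; apply: filterS => n; rewrite distrC.
move=> [n _ /(_ n (leqnn n))[/Hm h1 h2]].
have h3 : d (S (W n) z) <= gsum n z.
  by rewrite /gsum lerDr; apply: sumr_ge0 => i _; exact: sumr_ge0.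
rewrite (ger0_norm (g0 n)) in h2.
rewrite add0r -[d (Sl z)](subrK (d (S (W n) z))) (le_trans (ler_normD _ _))//.
rewrite distrC [`|d (S (W n) z)|]ger0_norm//.
exact: (ar_half h1 h2 h3).
Qed.

Lemma measurable_Gd : measurable Gd.
Proof.
have mG : measurable_fun (O : set ((mR * mR) * mR)) (fun z => \sum_(n <oo) (gsum n z)%:E)%E.
  apply: ge0_emeasurable_sum.
    by move=> n z Oz _; rewrite lee_fin; exact: gsum_ge0.
  by move=> n _; apply/measurable_EFinP; apply: measurable_funTS; apply: continuous_measurable3; exact: continuous_gsum.
have := mG (mO oO) _ (emeasurable_itv `]-oo, +oo%E[).
by rewrite (_ : _ `&` _ = Gd).
Qed.

Lemma Gd_ae : L3 (O `\` Gd) = 0%E.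
Proof.
have mG : measurable_fun (O : set ((mR * mR) * mR)) (fun z => \sum_(n <oo) (gsum n z)%:E)%E.
  apply: ge0_emeasurable_sum.
    by move=> n z Oz _; rewrite lee_fin; exact: gsum_ge0.
  by move=> n _; apply/measurable_EFinP; apply: measurable_funTS; apply: continuous_measurable3; exact: continuous_gsum.
have G0 z : O z -> (0 <= \sum_(n <oo) (gsum n z)%:E)%E.
  by move=> Oz; apply: nneseries_ge0 => n _ _; rewrite lee_fin; exact: gsum_ge0.
have iG : L3.-integrable O (fun z => \sum_(n <oo) (gsum n z)%:E)%E.
  apply/integrableP; split => //.
  under eq_integral => z /set_mem Oz do rewrite gee0_abs ?G0//.
  exact: gsum_int.
have [N [mN N0 HN]] := integrable_ae (mO oO) iG.
apply/eqP; rewrite eq_le measure_ge0 andbT -N0; apply: le_measure; rewrite ?inE//.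
  by apply: measurableD; [exact: mO|exact: measurable_Gd].
move=> z [Oz nG]; apply: HN => /= /(_ Oz) fz; apply: nG; split => //.
by move: fz; rewrite ge0_fin_numE// G0.
Qed.

Lemma Sl_bound z i k : Gd z -> `|Sl z i k| <= K.
Proof.
move=> Gz; have [cv _] := Gd_cvg Gz.
have cn : (fun n => `|S (W n) z i k|) @ \oo --> `|Sl z i k| by apply: cvg_norm; exact: cv.
rewrite -(cvg_lim _ cn)//; apply: limr_le; first by apply/cvg_ex; exists `|Sl z i k|.
by apply: nearW => n; exact: (sp_bU oc i k (ci_U H n (OB Gz.1))).
Qed.

End with_ci.
End iteration.

(** * Null sets and derivatives detected on lines *)

Section sections_null.
Context d1 d2 (T1 : measurableType d1) (T2 : measurableType d2) {R : realType}.
Variable m1 : {sigma_finite_measure set T1 -> \bar R}.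
Variable m2 : {sigma_finite_measure set T2 -> \bar R}.
Variables (G : T1 * T2 -> \bar R) (X : set (T1 * T2)).
Hypothesis mG : measurable_fun setT G.
Hypothesis G0 : forall z, (0 <= G z)%E.
Hypothesis fG : (\int[(m1 \x m2)%E]_z G z < +oo)%E.
Hypothesis mX : measurable X.

(** Tonelli makes the integral of [G] finite on almost every section, so only those sections need to
    be examined. *)
Lemma sections_null1 : (forall x, (\int[m2]_y G (x, y) < +oo)%E -> m2 (xsection X x) = 0%E) ->
  (m1 \x m2)%E X = 0%E.
Proof.
move=> H; pose F := fubini_F m2 G.
have F0 x : (0 <= F x)%E by apply: integral_ge0 => y _; exact: G0.
have mF : measurable_fun setT F by exact: measurable_fun_fubini_tonelli_F.
have iF : m1.-integrable setT F.
  apply/integrableP; split => //; under eq_integral do rewrite gee0_abs//.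
  by rewrite /F -fubini_tonelli1.
have [N [mN N0 HN]] := integrable_ae measurableT iF.
rewrite /product_measure1 /= (ae_eq_integral (cst 0%E))//.
- by rewrite integral0.
- exact: measurable_fun_xsection.
exists N; split => // x /= nx; apply: HN => /= Fx; apply: nx => _.
by apply: H; have := Fx I; rewrite ge0_fin_numE.
Qed.

Lemma sections_null2 : (forall y, (\int[m1]_x G (x, y) < +oo)%E -> m1 (ysection X y) = 0%E) ->
  (m1 \x m2)%E X = 0%E.
Proof.
move=> H; pose F := fubini_G m1 G.
have F0 x : (0 <= F x)%E by apply: integral_ge0 => y _; exact: G0.
have mF : measurable_fun setT F by exact: measurable_fun_fubini_tonelli_G.
have iF : m2.-integrable setT F.
  apply/integrableP; split => //; under eq_integral do rewrite gee0_abs//.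
  by rewrite /F -fubini_tonelli2.
have [N [mN N0 HN]] := integrable_ae measurableT iF.
have -> : (m1 \x m2)%E X = (\int[m2]_y m1 (ysection X y))%E.
  have := indic_fubini_tonelli m1 m2 mX.
  by rewrite indic_fubini_tonelli_FE// indic_fubini_tonelli_GE.
rewrite (ae_eq_integral (cst 0%E))//.
- by rewrite integral0.
- exact: measurable_fun_ysection.
exists N; split => // x /= nx; apply: HN => /= Fx; apply: nx => _.
by apply: H; have := Fx I; rewrite ge0_fin_numE.
Qed.

End sections_null.

Section lines.
Context {R : realType}.
Notation Z := ((R * R) * R)%type.
Notation mR := (measurableTypeR R).
Notation L3 := (@L3 R).
Notation L2 := (@L2 R).
Notation d0 := (@Ordinal 3 0 isT).
Notation d1 := (@Ordinal 3 1 isT).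
Notation d2 := (@Ordinal 3 2 isT).

(** The section lemmas are used twice, first for the time slices and then inside a horizontal plane,
    leaving only lines of direction [k] with finite integral. *)
Lemma line_null (k : 'I_3) (G : (mR * mR) * mR -> \bar R) (X : set ((mR * mR) * mR)) : (k < 2)%N ->
  measurable_fun setT G -> (forall z, (0 <= G z)%E) -> (\int[L3]_z G z < +oo)%E -> measurable X ->
  (forall z, (\int[mu1]_s G (upd k z s) < +oo)%E -> mu1 [set s | X (upd k z s)] = 0%E) ->
  L3 X = 0%E.
Proof.
move=> k2 mG G0 fG mX H.
apply: (@sections_null2 _ _ _ _ R (@L2s R) (@lebesgue_measure R) G X mG G0 fG mX) => t ft.
have mGt : measurable_fun setT (fun x : mR * mR => G (x, t)) by exact: measurableT_comp.
have mXt : measurable (ysection X t) by exact: measurable_ysection.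
case: k k2 H => -[|[|//]] ik _ H.
- apply: (@sections_null2 _ _ _ _ R (@lebesgue_measure R) (@lebesgue_measure R) (fun x => G (x, t)) _ mGt _ ft mXt) => // x2 fx.
  have := H ((0, x2), t) fx; rewrite (_ : [set s | _] = ysection (ysection X t) x2)//.
  by apply/seteqP; split=> s; rewrite /ysection /upd/= !inE/= ?inE.
- apply: (@sections_null1 _ _ _ _ R (@lebesgue_measure R) (@lebesgue_measure R) (fun x => G (x, t)) _ mGt _ ft mXt) => // x1 fx.
  have := H ((x1, 0), t) fx; rewrite (_ : [set s | _] = xsection (ysection X t) x1)//.
  by apply/seteqP; split=> s; rewrite /ysection /xsection /upd/= !inE/= ?inE.
Qed.

Lemma is_deriveP (V : normedModType R) (f : V -> R) (z v : V) (l : R) :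
  is_derive z v f l <-> forall e, 0 < e -> exists2 d, 0 < d &
    forall h, h != 0 -> `|h| < d -> `|h^-1 * (f (h *: v + z) - f z) - l| <= e.
Proof.
split=> [[df Dl] e e0|H].
  have : (h^-1 *: ((f \o shift z) (h *: v) - f z)) @[h --> 0^'] --> l by rewrite -Dl.
  move=> /cvgrPdist_le/(_ _ e0) [d /= dp Hd]; exists d => // h h0 hd.
  by rewrite distrC; apply: (Hd h) => //=; rewrite sub0r normrN.
have cv : (h^-1 *: ((f \o shift z) (h *: v) - f z)) @[h --> 0^'] --> l.
  apply/cvgrPdist_le => e e0; have [d dp Hd] := H e e0.
  exists d => //= h /=; rewrite sub0r normrN => hd h0.
  by rewrite distrC; exact: Hd.
apply: DeriveDef; first by apply/cvg_ex; exists l.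
exact: cvg_lim.
Qed.

(* The derivative along [v] is detected on rational increments, a countable condition. *)
Definition dset (f hh : Z -> R) (v : Z) : set ((mR * mR) * mR) :=
  \bigcap_(m : nat) \bigcup_(n : nat) \bigcap_(q : rat)
    [set z | q != 0 -> `|ratr q : R| < mesh n ->
       `|(ratr q)^-1 * (f (ratr q *: v + z) - f z) - hh z| <= mesh m].

Lemma measurable_dset f hh v : continuous f -> measurable_fun [set: (mR * mR) * mR] (hh : _ -> mR) ->
  measurable (dset f hh v).
Proof.
move=> cf mh; apply: bigcap_measurableType => m _.
apply: bigcup_measurable => n _.
rewrite -[X in measurable X]setCK setC_bigcap; apply: measurableC.
apply: countable_bigcupT_measurable => [|q]; first exact: countableP.
apply: measurableC.
have [->|q0] := eqVneq q 0.
  by rewrite (_ : [set _ | _] = setT)//; apply/seteqP; split=> // z _ /=.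
have [qn|qn] := ltP `|ratr q : R| (mesh n); last first.
  by rewrite (_ : [set _ | _] = setT)//; apply/seteqP; split=> // z _ /=.
have mg : measurable_fun [set: (mR * mR) * mR]
    (fun z => `|(ratr q)^-1 * (f (ratr q *: v + z) - f z) - hh z| : mR).
  apply: measurableT_comp => //; apply: measurable_funB => //.
  apply: continuous_measurable3 => z; apply: cvgM; first exact: cvg_cst.
  apply: cvgB; last exact: cf.
  apply: (@continuous_comp Z Z R (fun z => ratr q *: v + z) f); last exact: cf.
  by apply: cvgD; [exact: cvg_cst|exact: cvg_id].
have := mg measurableT _ (measurable_itv `]-oo, mesh m]).
rewrite setTI; congr measurable; apply/seteqP; split=> z /=; rewrite in_itv/=; first by [].
by apply.
Qed.

(** A strict violation at a real increment persists at nearby increments by continuity of [f], hence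
    occurs at a rational one. *)
Lemma dsetP f hh v z : continuous f -> dset f hh v z <-> is_derive z v f (hh z).
Proof.
move=> cf; rewrite is_deriveP; split=> [H e e0|H m _]; last first.
  have [d dp Hd] := H (mesh m) (mesh_gt0 m).
  have [n nd] := mesh_small dp; exists n => // q _ /= q0 qn.
  by apply: Hd; [rewrite fmorph_eq0|exact: lt_trans nd].
have [m me] := mesh_small e0; have [n _ Hn] := H m I.
exists (mesh n); first exact: mesh_gt0.
move=> h h0 hn; apply: le_trans (ltW me).
rewrite leNgt; apply/negP => hm.
pose g (r : R) := `|r^-1 * (f (r *: v + z) - f z) - hh z|.
have cg : {for h, continuous g}.
  apply: cvg_norm; apply: cvgB; last exact: cvg_cst.
  apply: cvgM; first exact: cvgV.
  apply: cvgB; last exact: cvg_cst.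
  apply: (@continuous_comp R Z R (fun r => r *: v + z) f); last exact: cf.
  by apply: cvgD; [apply: cvgZr_tmp; exact: cvg_id|exact: cvg_cst].
have : \forall r \near h, [/\ r != 0, `|r| < mesh n & mesh m < g r].
  near=> r; split; near: r.
  - by apply: cvgr_neq0 h0; exact: cvg_id.
  - by apply: (cvgr_lt `|h|) => //; apply: cvg_norm; exact: cvg_id.
  - exact: (cvgr_gt (g h)).
move=> /nbhs_ballP[d /= dp Hd].
have [q /[!in_itv]/= /andP[q1 q2]] := @rat_in_itvoo R (h - d) (h + d) ltac:(lra).
have [|r0 rn gr] := Hd (ratr q).
  by rewrite -ball_normE/= ltr_norml; apply/andP; split; move: q1 q2; clear; lra.
have := Hn q I; rewrite /= -(fmorph_eq0 (@ratr R)) => /(_ r0 rn).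
by rewrite leNgt gr.
Unshelve. all: by end_near.
Qed.

(** Lebesgue differentiation is applied to the primitive of [h] truncated to a bounded interval. On
    each small interval inside [A] that primitive and [f] differ by a constant. *)
Lemma line_ftc (f h : R -> R) (A : set R) (B K : R) : 0 <= B -> open A -> (forall s, A s -> `|s| <= B) ->
  measurable_fun [set: mR] (h : mR -> mR) -> (forall s, `|h s| <= K) ->
  (forall a b, a <= b -> `[a, b] `<=` A -> f b - f a = \int[mu1]_(s in `[a, b]) h s) ->
  mu1.-negligible [set s : mR | A s /\ ~ is_derive s 1 f (h s)].
Proof.
move=> B0 oA AB mh hK Hf.
pose I0 : set mR := cseg 0 B.
pose h' (s : R) := h s * \1_I0 s.
have mI0 : measurable I0 by exact: measurable_cseg.
have mh' : measurable_fun [set: mR] (h' : mR -> mR) by apply: measurable_funM => //.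
have K0 : 0 <= K by exact: le_trans (hK 0).
have ih' : mu1.-integrable setT (EFin \o h').
  have : mu1.-integrable I0 (EFin \o h).
    apply: (@bounded_integrable _ _ R mu1 I0 h K) => //; last exact: measurable_funTS.
    have h0 : (@lebesgue_measure R (cseg 0 B) < +oo)%E by rewrite lebesgue_cseg// ltry.
    exact: h0.
  move=> /(integrable_mkcond _ mI0); congr (_.-integrable _ _); apply/funext => s.
  by rewrite /h' /= patchE indicE; case: ifP => _; rewrite ?mulr1 ?mulr0.
have iS (y : R) : (@lebesgue_measure R).-integrable `]-oo, y] (EFin \o h').
  by apply: integrableS ih' => //; exact: measurable_itv.
have [N [mN N0 HN]] := FTC1Ny iS (open_integrable_locally openT ih').
exists N; split => // s [As nd]; apply: HN => /= -[dF F's]; apply: nd.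
have hs : h' s = h s.
  by rewrite /h' indicE mem_set ?mulr1//; apply/csegE; rewrite subr0; exact: AB.
pose F x := \int[mu1]_(t in [set` `]-oo, x]]) h' t.
have : nbhs s A by rewrite nbhsE; exists A.
move=> /nbhs_ballP[d /= dp dA].
have FE a b : a <= b -> `[a, b] `<=` A -> F b - F a = f b - f a.
  move=> ab abA; rewrite Hf// /F Rintegral_itvB//.
    rewrite Rintegral_itv_obnd_cbnd; last first.
      apply: integrableS ih' => //; exact: measurable_itv.
    apply: eq_Rintegral => t /set_mem/abA/AB tB.
    by rewrite /h' indicE mem_set ?mulr1//; apply/csegE; rewrite subr0.
have FE' a b : ball s d a -> ball s d b -> F b - F a = f b - f a.
  have sub x y : ball s d x -> ball s d y -> `[x, y] `<=` A.
    move=> bx b_y t /=; rewrite in_itv/= => /andP[xt ty]; apply: dA.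
    move: bx b_y; rewrite -!ball_normE/= !ltr_norml => /andP[? ?] /andP[? ?].
    by apply/andP; split; lra.
  move=> ba bb; have [ab|ba'] := leP a b; first exact: FE (sub _ _ ba bb).
  by rewrite -[LHS]opprB -[RHS]opprB; congr (- _); apply: FE (sub _ _ bb ba); exact: ltW.
have dFs : is_derive s 1 F (h s).
  by apply: DeriveDef => //; rewrite -hs -F's derive1E.
apply: (@is_derive_near R f (fun r => F r + (f s - F s)) s (h s)); last first.
  by apply: is_derive_eq; rewrite addr0.
apply/nbhs_ballP; exists d => //= r br.
have := FE' s r (ballxx _ dp) br; clear; lra.
Qed.

End lines.

(** * The limit map and its spatial derivatives *)

Section limit.
Context {R : realType}.
Notation Z := ((R * R) * R)%type.
Notation mR := (measurableTypeR R).
Notation L3 := (@L3 R).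
Notation d0 := (@Ordinal 3 0 isT).
Notation d1 := (@Ordinal 3 1 isT).
Notation d2 := (@Ordinal 3 2 isT).
Notation st := ('I_4 -> 'I_2 -> R).

Lemma geometric_cvg (a mu : nat -> R) : (forall n, 0 < mu n) -> (forall n, mu n.+1 <= mu n) ->
  (forall n, `|a n.+1 - a n| <= mu n * mesh n.+1) ->
  a @ \oo --> limn a /\ forall n, `|limn a - a n| <= mu n * mesh n.
Proof.
move=> mu0 mud Ha.
have dist n N : `|a (n + N)%N - a n| <= mu n * mesh n.
  apply: le_trans (sum_mesh N mu0 mud n).
  elim: N => [|N IH]; first by rewrite addn0 subrr normr0 big_ord0.
  rewrite big_ord_recr/= addnS.
  rewrite -[a (n + N).+1](subrK (a (n + N)%N)) -addrA.
  by apply: (le_trans (ler_normD _ _)); rewrite [leRHS]addrC; apply: lerD.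
have ca : cvgn a.
  apply: (summable_cvg (b := fun n => mu n * mesh n.+1) _ Ha _).1.
    by move=> n; rewrite mulr_ge0// ltW// mesh_gt0.
  apply: (@le_lt_trans _ _ (mu 0%N)%:E); last exact: ltry.
  apply: lime_le.
    by apply: is_cvg_nneseries => n _ _; rewrite lee_fin mulr_ge0// ltW// mesh_gt0.
  apply: nearW => N; rewrite big_mkord sumEFin lee_fin.
  have := sum_mesh N mu0 mud 0; rewrite {2}/mesh expr0 mulr1.
  by apply: le_trans; apply: ler_sum => n _; rewrite add0n.
split => // n.
have cn : (fun N => `|a (n + N)%N - a n|) @ \oo --> `|limn a - a n|.
  apply: cvg_norm; apply: cvgB; last exact: cvg_cst.
  under eq_fun do rewrite addnC.
  by move: ca; rewrite -(cvg_shiftn n).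
rewrite -(cvg_lim _ cn)//; apply: limr_le; first by apply/cvg_ex; exists `|limn a - a n|.
by apply: nearW => N.
Qed.

Lemma measurable_upd k (z : Z) : measurable_fun [set: mR] (upd k z : mR -> (mR * mR) * mR).
Proof.
case: k => -[|[|[|//]]] ik; rewrite /upd/=.
- by apply: measurable_fun_pair => //; apply: measurable_fun_pair.
- by apply: measurable_fun_pair => //; apply: measurable_fun_pair.
- by apply: measurable_fun_pair.
Qed.

Variables (U M : set st) (d : st -> R) (c K : R).
Hypothesis oc : splittable U M d c K.
Variable L : 'I_5 -> st -> R.
Variables (B : R) (Tc : 'I_4 -> 'I_4 -> R).
Hypothesis B0 : 0 < B.
Variable O : set Z.
Hypothesis oO : open O.
Hypothesis OB : O `<=` (box 0 B : set Z).
Local Notation S := (St B Tc).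
Variables (W0 : 'I_4 -> Z -> R) (eps0 : R) (W : nat -> 'I_4 -> Z -> R) (mu : nat -> R).
Hypothesis H : ci U M d c K L B Tc O W0 eps0 W mu.
Local Notation G := (Gd d B Tc O W).
Local Notation Sl := (Sl B Tc W).

Definition ul (i : 'I_4) (z : Z) : R := limn (fun n => W n i z).

Lemma ul_cvg i z : (fun n => W n i z) @ \oo --> ul i z.
Proof. exact: (geometric_cvg (ci_mu0 H) (ci_mud H) (fun n => ci_W H n i z)).1. Qed.

Lemma ul_close i z n : `|ul i z - W n i z| <= mu n * mesh n.
Proof. exact: (geometric_cvg (ci_mu0 H) (ci_mud H) (fun n => ci_W H n i z)).2. Qed.

Lemma mu_mesh_small e : 0 < e -> exists n, mu n * mesh n < e.
Proof.
move=> e0; have m0 := ci_mu0 H 0%N.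
have [n nh] := mesh_small (divr_gt0 e0 m0); exists n.
have mun : mu n <= mu 0%N.
  by elim: n {nh} => // n IH; exact: le_trans (ci_mud H n) IH.
by apply: (@le_lt_trans _ _ (mu 0%N * mesh n)); [rewrite ler_pM2r// mesh_gt0|rewrite mulrC -ltr_pdivlMr].
Qed.

Lemma continuous_ul i : continuous (ul i).
Proof.
move=> z; apply/cvg_dist0 => e e0.
have e3 : 0 < e / 3 by rewrite divr_gt0.
have [n ne] := mu_mesh_small e3.
have [r r0 Hr] := (cvg_dist0 (W n i) z).1 (@C1c R _ (ci_C1 H n i) z) _ e3.
exists r => // y yz.
rewrite (_ : ul i y - ul i z = (ul i y - W n i y) + (W n i y - W n i z) - (ul i z - W n i z)); last by ring.
apply: (le_lt_trans (ler_normB _ _)).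
have h1 := le_lt_trans (ul_close i y n) ne; have h2 := le_lt_trans (ul_close i z n) ne.
have h3 := Hr y yz; have := ler_normD (ul i y - W n i y) (W n i y - W n i z).
move: h1 h2 h3; move: `|_ + _| `|_ - _| `|_ - _| `|_ - _| => x1 x2 x3 x4.
by lra.
Qed.

Lemma ul_off i z : ~ O z -> ul i z = W0 i z.
Proof.
move=> nO; have E n : W n i z = W0 i z.
  by elim: n => [|n IH]; [rewrite (ci_0 H)|rewrite (ci_O H)].
by rewrite /ul (_ : (fun n => W n i z) = fun=> W0 i z) ?lim_cst//; apply/funext.
Qed.

(** The limit state set to zero off the convergence set, so that it is measurable and bounded
    everywhere and can be integrated along any line. *)
Definition hh i k (z : Z) : R := Sl z i k * \1_G z.

Lemma hhE i k z : G z -> hh i k z = Sl z i k.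
Proof. by move=> Gz; rewrite /hh indicE mem_set// mulr1. Qed.

Lemma hh_cvg i k z : G z -> (fun n => S (W n) z i k) @ \oo --> hh i k z.
Proof. by move=> Gz; rewrite hhE//; exact: (Gd_cvg oc OB H Gz).1. Qed.

Lemma hh_bound i k z : `|hh i k z| <= K.
Proof.
have [Gz|nG] := pselect (G z); first by rewrite hhE//; exact: (Sl_bound oc OB H).
by rewrite /hh indicE memNset// mulr0 normr0 ltW// (sp_K oc).
Qed.

Lemma measurable_hh i k : measurable_fun [set: (mR * mR) * mR] (hh i k : _ -> mR).
Proof.
apply: (@measurable_fun_cvg _ _ _ setT (fun n z => S (W n) z i k * \1_G z)).
  move=> n; apply: measurable_funM.
    by apply: continuous_measurable3; exact: (@continuous_St R B Tc B0 _ (ci_C1 H n) i k).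
  by apply: measurable_indic; exact: (measurable_Gd oc B0 oO OB H).
move=> z _; have [Gz|nG] := pselect (G z).
  by rewrite hhE// indicE mem_set//; under eq_fun do rewrite mulr1; exact: (Gd_cvg oc OB H Gz).1.
by rewrite /hh indicE memNset// mulr0; under eq_fun do rewrite mulr0; exact: cvg_cst.
Qed.

Let GG (z : (mR * mR) * mR) : \bar R := ((fun z => \sum_(n <oo) (gsum d B Tc W n z)%:E) \_ O)%E z.

Let GG0 z : (0 <= GG z)%E.
Proof.
rewrite /GG patchE; case: ifP => // /set_mem Oz.
by apply: nneseries_ge0 => n _ _; rewrite lee_fin; exact: (gsum_ge0 oc OB H).
Qed.

Let mGG : measurable_fun setT GG.
Proof.
apply/(measurable_restrictT _ (mO oO)); apply: ge0_emeasurable_sum.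
  by move=> n z Oz _; rewrite lee_fin; exact: (gsum_ge0 oc OB H).
move=> n _; apply/measurable_EFinP; apply: measurable_funTS; apply: continuous_measurable3.
exact: (continuous_gsum oc B0 H).
Qed.

Let iGG : (\int[L3]_z GG z < +oo)%E.
Proof. by rewrite /GG -integral_mkcond; exact: (gsum_int oc B0 oO OB H). Qed.

(** On almost every line the states converge almost everywhere and boundedly, so the fundamental
    theorem of calculus for [W n] passes to the limit by dominated convergence; [line_ftc] then
    differentiates. The hypothesis on [Tc] says that row [i] of the state is a pure gradient. *)
Lemma ul_derive_ae i k : (forall j, Tc i j = 0) ->
  L3 (O `\` dset (ul i) (hh i k) (dir (wd k))) = 0%E.
Proof.
move=> Tc0.
have SD W' z : S W' z i k = 'D_(dir (wd k)) (W' i) z.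
  by rewrite /St /qs; case: ifP => _; rewrite ?addr0// big1 ?addr0// => j _; rewrite Tc0 mul0r.
have mD : measurable (O `\` dset (ul i) (hh i k) (dir (wd k))).
  apply: measurableD; first exact: mO.
  by apply: measurable_dset; [exact: continuous_ul|exact: measurable_hh].
have k2 : (wd k < 2)%N by exact: (ltn_ord k).
apply: (line_null k2 mGG GG0 iGG mD) => z fz.
set kk := wd k.
pose A : set R := [set s | O (upd kk z s)].
have oA : open A by apply: open_comp => // s _; exact: continuous_upd.
have AB s : A s -> `|s| <= B.
  by move=> /OB/boxP/(_ kk); rewrite co_upd (_ : co kk 0 = 0) ?subr0//; case: (kk) => -[|[|[|//]]].
have mupd := @measurable_upd kk z.
have mh : measurable_fun [set: mR] (fun s => hh i k (upd kk z s) : mR).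
  exact: (measurableT_comp (@measurable_hh i k) mupd).
have fin : mu1.-negligible [set s : mR | A s /\ ~ G (upd kk z s)].
  have iG1 : mu1.-integrable setT (fun s => GG (upd kk z s)).
    apply/integrableP; split; first exact: (measurableT_comp mGG mupd).
    by under eq_integral do rewrite gee0_abs//.
  have [N [mN N0 HN]] := integrable_ae measurableT iG1.
  exists N; split => // s [As nG]; apply: HN => /= /(_ I) fs; apply: nG; split => //.
  by move: fs; rewrite ge0_fin_numE// /GG patchE mem_set.
have main : mu1.-negligible [set s : mR | A s /\ ~ is_derive s 1 (fun r => ul i (upd kk z r)) (hh i k (upd kk z s))].
  apply: (line_ftc (ltW B0) oA AB mh (fun s => hh_bound i k _)) => a b ab abA.
  pose fn n (s : R) := S (W n) (upd kk z s) i k.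
  have cfn n : continuous (fn n).
    move=> s; apply: (@continuous_comp R Z R (upd kk z) (fun w => S (W n) w i k)).
      exact: continuous_upd.
    exact: (@continuous_St R B Tc B0 _ (ci_C1 H n) i k).
  have E n : \int[mu1]_(s in `[a, b]) fn n s = W n i (upd kk z b) - W n i (upd kk z a).
    by rewrite -FTC_upd//; [apply: eq_Rintegral => s _; exact: SD|exact: ci_C1 H n i].
  have c1 : (fun n => \int[mu1]_(s in `[a, b]) fn n s) @ \oo --> ul i (upd kk z b) - ul i (upd kk z a).
    by under eq_fun do rewrite E; apply: cvgB; exact: ul_cvg.
  have mab : measurable (`[a, b] : set mR) by exact: measurable_itv.
  have iK : mu1.-integrable `[a, b] (EFin \o (fun=> K)).
    by apply: continuous_compact_integrable; [exact: segment_compact|apply: continuous_subspaceT; exact: cst_continuous].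
  have mfn n : measurable_fun (`[a, b] : set mR) (EFin \o fn n).
    apply/measurable_EFinP; apply: measurable_funTS; exact: continuous_measurable_fun.
  have mhE : measurable_fun (`[a, b] : set mR) (EFin \o (fun s => hh i k (upd kk z s))).
    by apply/measurable_EFinP; apply: measurable_funTS.
  have [| |ih _ c2] := dominated_convergence mab mfn mhE _ iK.
  - case: fin => N [mN N0 HN]; exists N; split => // s /= ns; apply: HN; split.
      by apply: contrapT => nA; apply: ns => /abA.
    move=> Gs; apply: ns => _; apply: cvg_EFin; first exact: nearW.
    have hc := @hh_cvg i k (upd kk z s) Gs; exact: hc.
  - apply: aeW => s n sab; rewrite lee_fin.
    exact: (sp_bU oc i k (ci_U H n (OB (abA _ sab)))).
  have fh := integrable_fin_num mab ih.
  move: c2; rewrite -(fineK fh) => /fine_cvg c2.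
  exact: (cvg_unique (@Rhausdorff R) c1 c2).
have mX : measurable [set s : mR | (O `\` dset (ul i) (hh i k) (dir kk)) (upd kk z s)].
  by have := mupd measurableT _ mD; rewrite setTI.
case: main => N [mN N0 HN].
apply/eqP; rewrite eq_le measure_ge0 andbT -N0; apply: le_measure; rewrite ?inE//.
move=> s [Os nd]; apply: HN; split => //= ds; apply: nd.
by apply/dsetP; [exact: continuous_ul|apply/is_derive_upd].
Qed.

End limit.

(** * The weak equation *)

Section weak.
Context {R : realType}.
Notation Z := ((R * R) * R)%type.
Notation mR := (measurableTypeR R).
Notation L3 := (@L3 R).
Notation L2 := (@L2 R).
Notation d0 := (@Ordinal 3 0 isT).
Notation d1 := (@Ordinal 3 1 isT).
Notation d2 := (@Ordinal 3 2 isT).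
Notation k0 := (@Ordinal 2 0 isT).
Notation k1 := (@Ordinal 2 1 isT).

Lemma ar_eta (g1 g2 e x y a b a' b' : R) : g1 = e * x + b * a' -> g2 = e * y + a * b' -> y = x ->
  a' * b - b' * a = g1 - g2.
Proof. by move=> -> -> ->; ring. Qed.

Lemma norm_dir k : `|dir k : Z| <= 1.
Proof.
apply: normZ_le => l; case: k l => -[|[|[|//]]] ik [[|[|[|//]]] il]; rewrite /co /dir/= ?normr0 ?normr1//.
Qed.

Lemma is_derive_locally_cst (f : Z -> R) z k : (\forall y \near z, f y = 0) -> is_derive z (dir k) f 0.
Proof.
move=> nf; apply/is_deriveP => e e0.
have /nbhs_ballP[r /= r0 Hr] := nf.
have fz : f z = 0 by apply: Hr; exact: ballxx.
exists r => // h _ hr; rewrite fz (Hr (h *: dir k + z)) ?subrr ?mulr0 ?subrr ?normr0 ?ltW//.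
rewrite -ball_normE/= distrC addrK normrZ.
by apply: le_lt_trans hr; rewrite ler_piMr// norm_dir.
Qed.

Lemma updC (k l : 'I_3) (z : Z) (s t : R) : k != l -> upd k (upd l z s) t = upd l (upd k z t) s.
Proof. by case: k l => -[|[|[|//]]] ik [[|[|[|//]]] il]. Qed.

(* Both mixed derivatives are the limit of the same double difference quotient. *)
Lemma schwarz (f : Z -> R) k l z : k != l -> C1 f -> C1 (fun z => 'D_(dir k) f z) -> C1 (fun z => 'D_(dir l) f z) ->
  'D_(dir l) (fun z => 'D_(dir k) f z) z = 'D_(dir k) (fun z => 'D_(dir l) f z) z.
Proof.
move=> kl Cf Ck Cl.
have mixed m n : m != n -> C1 (fun z => 'D_(dir m) f z) -> forall h, 0 < h -> exists s t,
    [/\ co m z < s < co m z + h, co n z < t < co n z + h &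
    f (upd m (upd n z (co n z + h)) (co m z + h)) - f (upd m (upd n z (co n z + h)) (co m z)) -
    (f (upd m (upd n z (co n z)) (co m z + h)) - f (upd m (upd n z (co n z)) (co m z))) =
    'D_(dir n) (fun z => 'D_(dir m) f z) (upd m (upd n z t) s) * h * h].
  move=> mn Cm h h0.
  pose g (s : R) := f (upd m (upd n z (co n z + h)) s) - f (upd m (upd n z (co n z)) s).
  have dg (s : R) : is_derive s 1 g ('D_(dir m) f (upd m (upd n z (co n z + h)) s) -
      'D_(dir m) f (upd m (upd n z (co n z)) s)).
    by apply: is_deriveB; apply: derive_upd; exact: C1d.
  have lt1 : co m z < co m z + h by rewrite ltrDl.
  have [s sab E1] := MVT lt1 (fun s _ => dg s) (continuous_subspaceT (is_derive_continuous dg)).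
  pose p (t : R) := 'D_(dir m) f (upd n (upd m z s) t).
  have dp (t : R) : is_derive t 1 p ('D_(dir n) (fun z => 'D_(dir m) f z) (upd n (upd m z s) t)).
    by apply: derive_upd; exact: C1d.
  have lt2 : co n z < co n z + h by rewrite ltrDl.
  have [t tab E2] := MVT lt2 (fun s _ => dp s) (continuous_subspaceT (is_derive_continuous dp)).
  exists s, t; split; [by move: sab; rewrite in_itv|by move: tab; rewrite in_itv|].
  transitivity (g (co m z + h) - g (co m z)); first by rewrite /g; ring.
  rewrite E1 [in X in _ * X]addrC addKr; congr (_ * _).
  rewrite !(@updC m n)// -/(p _) -/(p _) E2 [in X in _ * X]addrC addKr.
  by [].
have sym (h : R) : f (upd k (upd l z (co l z + h)) (co k z + h)) - f (upd k (upd l z (co l z + h)) (co k z)) -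
    (f (upd k (upd l z (co l z)) (co k z + h)) - f (upd k (upd l z (co l z)) (co k z))) =
    f (upd l (upd k z (co k z + h)) (co l z + h)) - f (upd l (upd k z (co k z + h)) (co l z)) -
    (f (upd l (upd k z (co k z)) (co l z + h)) - f (upd l (upd k z (co k z)) (co l z))).
  by rewrite !(@updC k l)//; ring.
have c1 := @C1Dc R (fun z => 'D_(dir k) f z) l Ck.
have c2 := @C1Dc R (fun z => 'D_(dir l) f z) k Cl.
apply/eqP; rewrite -subr_eq0 -normr_le0; apply/ler_addgt0Pr => e e0; rewrite add0r.
have e2 : 0 < e / 2 by rewrite divr_gt0.
have [r1 r10 H1] := (cvg_dist0 _ z).1 (c1 z) _ e2; have [r2 r20 H2] := (cvg_dist0 _ z).1 (c2 z) _ e2.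
pose h := Num.min r1 r2 / 2.
have h0 : 0 < h by rewrite divr_gt0// lt_min r10.
have hr1 : h < r1.
  by apply: (@lt_le_trans _ _ (Num.min r1 r2)); [rewrite ltr_pdivrMr// ltr_pMr ?ltr1n// lt_min r10|rewrite ge_min lexx].
have hr2 : h < r2.
  by apply: (@lt_le_trans _ _ (Num.min r1 r2)); [rewrite ltr_pdivrMr// ltr_pMr ?ltr1n// lt_min r10|rewrite ge_min lexx orbT].
have near m n s t : m != n -> co m z < s < co m z + h -> co n z < t < co n z + h ->
    `|upd m (upd n z t) s - z| <= h.
  move=> mn /andP[s1 s2] /andP[t1 t2]; apply: normZ_le => j; rewrite coB.
  have [->|jm] := eqVneq j m.
    by rewrite co_upd ger0_norm; lra.
  rewrite co_upd_neq//; have [->|jn] := eqVneq j n.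
    by rewrite co_upd ger0_norm; lra.
  by rewrite co_upd_neq// subrr normr0 ltW.
have [s [t [sb tb E1]]] := mixed k l kl Ck h h0.
have lk : l != k by rewrite eq_sym.
have [s' [t' [sb' tb' E2]]] := mixed l k lk Cl h h0.
have E : 'D_(dir l) (fun z => 'D_(dir k) f z) (upd k (upd l z t) s) =
    'D_(dir k) (fun z => 'D_(dir l) f z) (upd l (upd k z t') s').
  apply: (mulIf (lt0r_neq0 h0)); apply: (mulIf (lt0r_neq0 h0)).
  exact: (etrans (esym E1) (etrans (sym h) E2)).
have a1 := H1 _ (le_lt_trans (near k l s t kl sb tb) hr1).
have a2 := H2 _ (le_lt_trans (near l k s' t' lk sb' tb') hr2).
move: a1 a2; rewrite E.
move: ('D_(dir k) (fun z => 'D_(dir l) f z) (upd l (upd k z t') s')) ('D_(dir l) _ z) ('D_(dir k) _ z) => x y w.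
clear; rewrite !ltr_norml ler_norml => /andP[? ?] /andP[? ?]; apply/andP; split; lra.
Qed.

Variables (Om : set (R * R)) (T B : R).
Hypothesis OmB : forall x, Om x -> `|x.1| < B /\ `|x.2| < B.
Hypothesis B0 : 0 < B.
Hypothesis T0 : 0 < T.
Hypothesis TB : T <= B.

Definition bsq : set (mR * mR) := cseg 0 B `*` cseg 0 B.
Definition slab : set ((mR * mR) * mR) := bsq `*` [set` `]0, T[].

Lemma m_bsq : measurable bsq. Proof. by apply: measurableX; exact: measurable_cseg. Qed.
Lemma mI : measurable ([set` `]0, T[] : set mR). Proof. exact: measurable_itv. Qed.
Lemma mslab : measurable slab. Proof. exact: measurableX m_bsq mI. Qed.
Hint Resolve m_bsq mI mslab : core.

Lemma slab_box : slab `<=` box 0 B.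
Proof.
move=> z [Qz]; rewrite /= in_itv/= => /andP[z0 zT]; split => //.
by apply/csegE; rewrite subr0 gtr0_norm//; move: zT TB; lra.
Qed.

Lemma slab_integrable (g : Z -> R) : continuous g -> L3.-integrable slab (EFin \o g).
Proof. by move=> cg; apply: (cont_box_subset_integrable mslab slab_box (ltW B0)). Qed.

Lemma bsq_integrable (g : R * R -> R) : continuous g -> L2.-integrable bsq (EFin \o g).
Proof.
move=> cg; have cg' : continuous (fun z : Z => g z.1).
  by move=> z; apply: (@continuous_comp Z (R * R)%type R fst g); [exact: cvg_fst|exact: cg].
have [C HC] := cont_box_bounded 0 B cg'.
apply: (@bounded_integrable _ _ R L2 bsq g C) => //.
- rewrite /bsq L2E; [|exact: measurable_cseg|exact: measurable_cseg].
  by rewrite !lebesgue_cseg ?(ltW B0)// -EFinM ltry.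
- by apply: measurable_funTS; exact: continuous_measurable2.
- move=> x Qx; apply: (HC (x, 0)); split => //; apply/csegE.
  by rewrite subrr normr0 ltW.
Qed.

Lemma slab_zero (g : Z -> R) (k : 'I_3) : (k < 2)%N -> continuous g ->
  (forall z, 0 < z.2 < T -> \int[mu1]_(s in cseg 0 B) g (upd k z s) = 0) ->
  (\int[L3]_(z in slab) (g z)%:E = 0)%E.
Proof.
move=> k2 cg H.
rewrite integral_L3_21//; last exact: slab_integrable.
apply: integral0_eq => t; rewrite /= in_itv/= => tT.
have cgt : continuous (fun x : R * R => g (x, t)).
  move=> x; apply: (@continuous_comp (R * R)%type Z R (fun x => (x, t)) g); last exact: cg.
  by apply: continuous_pairf; [exact: cvg_id|exact: cvg_cst].
have line0 z : 0 < z.2 < T -> (\int[mu1]_(s in cseg 0 B) (g (upd k z s))%:E = 0)%E.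
  move=> zT; have cz : continuous (fun s => g (upd k z s)).
    by move=> s; apply: (@continuous_comp R Z R (upd k z) g); [exact: continuous_upd|exact: cg].
  have fi := integrable_fin_num (@measurable_cseg R 0 B) (cont_cseg_integrable 0 B cz).
  by rewrite -(fineK fi); congr EFin; exact: H.
case: k k2 H line0 => -[|[|//]] ik _ H line0.
- rewrite integral_L2_21//; last exact: bsq_integrable.
  by apply: integral0_eq => x2 _; exact: (line0 ((0, x2), t)).
- rewrite integral_L2_12//; last exact: bsq_integrable.
  by apply: integral0_eq => x1 _; exact: (line0 ((x1, 0), t)).
Qed.

(** One component of a test function, with the regularity that integration by parts consumes: the
    spatial derivatives are again C^1, as the symmetry of mixed derivatives requires. *)
Record tst (f : Z -> R) (K : set (R * R)) : Prop := Tst {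
  ts_C1 : C1 f;
  ts_Ck : forall k : 'I_2, C1 (fun z => 'D_(dir (wd k)) f z);
  ts_K : compact K;
  ts_KO : K `<=` Om;
  ts_0 : forall z, ~ K z.1 -> 0 <= z.2 <= T -> f z = 0}.

Variables (f : Z -> R) (K : set (R * R)).
Hypothesis tf : tst f K.

Lemma tst_near z : ~ K z.1 -> 0 < z.2 < T -> \forall y \near z, f y = 0.
Proof.
move=> nK /andP[z0 zT].
have cK : closed K by apply: compact_closed; [exact: norm_hausdorff|exact: ts_K tf].
have : \forall y \near z, ~ K y.1 /\ 0 < y.2 < T.
  have n1 : \forall y \near z, ~ K y.1.
    have : nbhs z.1 (~` K) by rewrite nbhsE; exists (~` K) => //; split => //; exact: closed_openC.
    have c1 : (fst : Z -> R * R) @ z --> z.1 by exact: cvg_fst.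
    by move=> /c1.
  have n2 : \forall y \near z, 0 < y.2 < T.
    have : nbhs z.2 [set t : R | 0 < t < T].
      rewrite nbhsE; exists [set t | 0 < t < T]; last by [].
      split; last by rewrite /= z0.
      rewrite (_ : [set t | _] = [set` `]0, T[]); first exact: interval_open.
      by apply/seteqP; split=> t /=; rewrite in_itv.
    have c1 : (snd : Z -> R) @ z --> z.2 by exact: cvg_snd.
    by move=> /c1.
  by near=> y; split; near: y.
apply: filterS => y [nKy /andP[y0 yT]].
by apply: (ts_0 tf) => //; rewrite !ltW.
Unshelve. all: by end_near.
Qed.

Lemma tst_D z k : ~ K z.1 -> 0 < z.2 < T -> 'D_(dir k) f z = 0.
Proof. by move=> nK zT; have [_] := is_derive_locally_cst k (tst_near nK zT). Qed.

(** Compact support allows the domain to be replaced by a square, on which Fubini along coordinate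
    lines is available whatever the shape of [Om]. *)
Lemma O_slab (g : Z -> R) : (forall z, ~ K z.1 -> 0 < z.2 < T -> g z = 0) ->
  (\int[L3]_(z in OmT Om T) (g z)%:E = \int[L3]_(z in slab) (g z)%:E)%E.
Proof.
move=> g0; rewrite [LHS]integral_mkcond [RHS]integral_mkcond; congr (integral _ _ _).
apply/funext => z; rewrite !patchE; case: ifPn => [/set_mem[Oz zT]|nO].
  rewrite mem_set//; split; last by rewrite /= in_itv.
  by have [h1 h2] := OmB Oz; split; apply/csegE; rewrite subr0 ltW.
case: ifPn => // /set_mem[_]; rewrite /= in_itv/= => zT.
rewrite g0// => /(ts_KO tf) Oz; move/negP: nO; apply; exact/mem_set.
Qed.

Lemma Om_bsq (g : R * R -> R) : (forall x, ~ K x -> g x = 0) ->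
  (\int[L2]_(z in Om) (g z)%:E = \int[L2]_(z in bsq) (g z)%:E)%E.
Proof.
move=> g0; rewrite [LHS]integral_mkcond [RHS]integral_mkcond; congr (integral _ _ _).
apply/funext => z; rewrite !patchE; case: ifPn => [/set_mem Oz|nO].
  by rewrite mem_set//; have [h1 h2] := OmB Oz; split; apply/csegE; rewrite subr0 ltW.
case: ifPn => // _; rewrite g0// => /(ts_KO tf) Oz; move/negP: nO; apply; exact/mem_set.
Qed.

Lemma tst_face (k : 'I_3) z s : (k < 2)%N -> 0 < z.2 < T -> B <= `|s| -> f (upd k z s) = 0.
Proof.
move=> k2 /andP[z0 zT] Bs; apply: (ts_0 tf).
  move=> /(ts_KO tf)/OmB[h1 h2]; case: k k2 h1 h2 => -[|[|//]] ik _ /=; rewrite /upd/= => h1 h2.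
    by move: Bs; rewrite leNgt h1.
  by move: Bs; rewrite leNgt h2.
by case: k k2 => -[|[|//]] ik _; rewrite /upd/= !ltW.
Qed.

Lemma tst_face_D (k : 'I_3) (l : 'I_2) z s : (k < 2)%N -> 0 < z.2 < T -> B <= `|s| ->
  'D_(dir (wd l)) f (upd k z s) = 0.
Proof.
move=> k2 zT Bs; apply: tst_D.
  move=> /(ts_KO tf)/OmB[h1 h2]; case: k k2 h1 h2 => -[|[|//]] ik _ /=; rewrite /upd/= => h1 h2.
    by move: Bs; rewrite leNgt h1.
  by move: Bs; rewrite leNgt h2.
by case: k k2 => -[|[|//]] ik _; rewrite /upd/=.
Qed.

Variables (u eta : Z -> R).
Hypothesis Cu : C1 u.
Hypothesis Ce : C1 eta.

Let csE : cseg 0 B = [set` `[- B, B]] :> set R.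
Proof. by rewrite /cseg sub0r add0r. Qed.

(** A rotated gradient is divergence free: by symmetry of mixed derivatives the integrand is the
    [d0] derivative of [eta] times ['D_(dir d1) f] minus the [d1] derivative of [eta] times
    ['D_(dir d0) f], and each integrates to zero along lines. *)
Lemma weak_eta :
  (\int[L3]_(z in slab) ('D_(dir d0) eta z * 'D_(dir d1) f z - 'D_(dir d1) eta z * 'D_(dir d0) f z)%:E = 0)%E.
Proof.
have C0 : C1 (fun z => 'D_(dir d0) f z) by have := ts_Ck tf k0; rewrite wd0.
have C1' : C1 (fun z => 'D_(dir d1) f z) by have := ts_Ck tf k1; rewrite wd1.
pose g1 z := 'D_(dir d0) (fun z => eta z * 'D_(dir d1) f z) z.
pose g2 z := 'D_(dir d1) (fun z => eta z * 'D_(dir d0) f z) z.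
have Cg1 := C1M Ce C1'; have Cg2 := C1M Ce C0.
have BB : - B <= B by move: B0; lra.
have z1 : (\int[L3]_(z in slab) (g1 z)%:E = 0)%E.
  apply: (@slab_zero g1 d0 isT (@C1Dc R _ d0 Cg1)).
  move=> z zT; rewrite csE; apply: (etrans (@FTC_upd R _ d0 z (- B) B Cg1 BB)).
  have := @tst_face_D d0 k1 z; rewrite wd1 => h.
  by rewrite !h ?mulr0 ?subrr// ?normrN gtr0_norm.
have z2 : (\int[L3]_(z in slab) (g2 z)%:E = 0)%E.
  apply: (@slab_zero g2 d1 isT (@C1Dc R _ d1 Cg2)).
  move=> z zT; rewrite csE; apply: (etrans (@FTC_upd R _ d1 z (- B) B Cg2 BB)).
  have := @tst_face_D d1 k0 z; rewrite wd0 => h.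
  by rewrite !h ?mulr0 ?subrr// ?normrN gtr0_norm.
rewrite -[RHS]sube0 -{1}z1 -z2 -integralB_EFin//; first last.
- exact: (slab_integrable (@C1Dc R _ d1 Cg2)).
- exact: (slab_integrable (@C1Dc R _ d0 Cg1)).
apply: eq_integral => z _; rewrite -EFinB; congr EFin.
have E1 : g1 z = _ := @deriveMC1 R eta _ d0 z Ce C1'.
have E2 : g2 z = _ := @deriveMC1 R eta _ d1 z Ce C0.
have E3 := @schwarz f d0 d1 z isT (ts_C1 tf) C0 C1'.
exact: (ar_eta E1 E2 E3).
Qed.

(** On each line the integrand is the derivative of [q] times [f], because the [x_2] derivative of
    [q] is the time derivative of [u]. Differentiability holds only above [- B], so the fundamental
    theorem is used on the open interval. *)
Lemma weak_q :
  (\int[L3]_(z in slab) (qq B u z * 'D_(dir d1) f z + 'D_(dir d2) u z * f z)%:E = 0)%E.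
Proof.
have Cf := ts_C1 tf.
have cqq : continuous (qq B u) by exact: continuous_qq.
apply: (@slab_zero _ d1) => //.
  by move=> z; apply: cvgD; apply: cvgM; [exact: cqq|exact: C1Dc|exact: C1Dc|exact: C1c].
move=> z zT.
pose h (s : R) := qq B u (upd d1 z s) * f (upd d1 z s).
pose h' (s : R) := qq B u (upd d1 z s) * 'D_(dir d1) f (upd d1 z s) + 'D_(dir d2) u (upd d1 z s) * f (upd d1 z s).
have dh (s : R) : - B < s -> is_derive s 1 h (h' s).
  move=> Bs; have d1q := qq_derive z Cu Bs.
  have d1f : is_derive s 1 (fun r => f (upd d1 z r)) ('D_(dir d1) f (upd d1 z s)).
    by apply: derive_upd; exact: C1d.
  by apply: is_derive_eq; rewrite /h' /GRing.scale/=; ring.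
have ch : continuous h.
  move=> s; apply: cvgM.
    by apply: (@continuous_comp R Z R (upd d1 z) (qq B u)); [exact: continuous_upd|exact: cqq].
  by apply: (@continuous_comp R Z R (upd d1 z) f); [exact: continuous_upd|exact: C1c].
have ch' : continuous h'.
  move=> s; apply: (@continuous_comp R Z R (upd d1 z) (fun z => qq B u z * 'D_(dir d1) f z + 'D_(dir d2) u z * f z)).
    exact: continuous_upd.
  by apply: cvgD; apply: cvgM; [exact: cqq|exact: C1Dc|exact: C1Dc|exact: C1c].
rewrite csE /Rintegral (@continuous_FTC2 _ h' h).
- by rewrite /= /h !tst_face ?mulr0 ?subrr// ?normrN gtr0_norm.
- by move: B0; lra.
- exact: continuous_subspaceT.
- split => [s||].
  + by rewrite in_itv/= => /andP[/dh[]].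
  + by apply: cvg_at_right_filter; exact: ch.
  + by apply: cvg_at_left_filter; exact: ch.
- by move=> s; rewrite in_itv/= => /andP[/dh[_ <-] _]; rewrite derive1E.
Qed.

Lemma weak_t :
  (\int[L3]_(z in slab) (u z * 'D_(dir d2) f z + 'D_(dir d2) u z * f z)%:E =
   \int[L2]_(x in bsq) (u (x, T) * f (x, T) - u (x, 0) * f (x, 0))%:E)%E.
Proof.
have Cf := ts_C1 tf; have Cuf := C1M Cu Cf.
have E z : u z * 'D_(dir d2) f z + 'D_(dir d2) u z * f z = 'D_(dir d2) (fun z => u z * f z) z.
  by rewrite deriveMC1//; ring.
under eq_integral do rewrite E.
rewrite integral_L3_12//; last by apply: slab_integrable; exact: C1Dc.
apply: eq_integral => x _.
have cD : continuous (fun t : R => 'D_(dir d2) (fun z => u z * f z) (x, t)).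
  move=> t; apply: (@continuous_comp R Z R (fun t => (x, t)) (fun z => 'D_(dir d2) (fun z => u z * f z) z)).
    by apply: continuous_pairf; [exact: cvg_cst|exact: cvg_id].
  exact: C1Dc.
have i1 : (@lebesgue_measure R).-integrable `[0, T] (EFin \o (fun t : R => 'D_(dir d2) (fun z => u z * f z) (x, t))).
  by apply: continuous_compact_integrable; [exact: segment_compact|exact: continuous_subspaceT].
have := @FTC_upd R (fun z => u z * f z) d2 (x, 0) 0 T Cuf (ltW T0).
rewrite /upd/= => <-.
rewrite /Rintegral fineK; last exact: integrable_fin_num.
rewrite [RHS]integral_itv_bndoo//; apply/measurable_EFinP; apply: measurable_funTS; exact: continuous_measurable_fun.
Qed.

End weak.

Section integral_off_null.
Context d (T : measurableType d) {R : realType} (m : {measure set T -> \bar R}).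
Variables (N : set T).
Hypotheses (mN : measurable N) (N0 : m N = 0%E).
Local Open Scope ereal_scope.
Import HBNNSimple.

Let ge0_integral_off_null (f g : T -> \bar R) : (forall x, 0 <= f x) -> (forall x, 0 <= g x) ->
  measurable_fun setT g -> (forall x, ~ N x -> f x = g x) -> \int[m]_x f x = \int[m]_x g x.
Proof.
move=> f0 g0 mg fg.
have mNc : measurable (~` N) by exact: measurableC.
have off (h : T -> \bar R) : measurable_fun setT h -> (forall x, 0 <= h x) ->
    \int[m]_x h x = \int[m]_x (h \_ (~` N)) x.
  move=> mh h0; apply: ge0_ae_eq_integral => //.
  - by apply/(measurable_restrictT _ mNc); exact: measurable_funTS.
  - by move=> x _; rewrite patchE; case: ifP.
  - by exists N; split => // x /= nx; apply: contrapT => xN; apply: nx => _; rewrite patchE mem_set.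
apply/eqP; rewrite eq_le; apply/andP; split.
  rewrite ge0_integralTE//; apply: ub_ereal_sup => _ [h /= hf <-].
  have mh : measurable_fun setT (EFin \o h) by exact/measurable_EFinP.
  have h0 x : 0 <= (EFin \o h) x by rewrite lee_fin.
  rewrite -(integralT_nnsfun m h).
  have E : \int[m]_x (h x)%:E = \int[m]_x ((EFin \o h) \_ (~` N)) x := off _ mh h0.
  rewrite E; apply: ge0_le_integral => //.
  - by move=> x _; rewrite patchE; case: ifP.
  - by apply/(measurable_restrictT _ mNc); exact: measurable_funTS.
  - move=> x _; rewrite patchE; case: ifPn => // /set_mem xN.
    by rewrite -fg//; exact: hf.
rewrite off// !ge0_integralTE//; last by move=> x; rewrite patchE; case: ifP.
apply: le_ereal_sup => _ [h /= hg <-]; exists h => // x /=.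
apply: le_trans (hg x) _; rewrite patchE; case: ifPn => // /set_mem xN.
by rewrite fg.
Qed.

(** Measurability is asked of [g] alone, since the integrand of the weak equation contains [Dx u],
    whose values where the derivatives fail are arbitrary. Simple functions below either integrand
    compare the two. *)
Lemma integral_off_null (D : set T) (f g : T -> \bar R) : measurable D -> measurable_fun D g ->
  (forall x, D x -> ~ N x -> f x = g x) -> \int[m]_(x in D) f x = \int[m]_(x in D) g x.
Proof.
move=> mD mg fg; rewrite [LHS]integralE [RHS]integralE.
congr (_ - _); rewrite [LHS]integral_mkcond [RHS]integral_mkcond; apply: ge0_integral_off_null.
- by move=> x; rewrite patchE; case: ifP.
- by move=> x; rewrite patchE; case: ifP.
- by apply/(measurable_restrictT _ mD); exact: measurable_funepos.
- by move=> x nx; rewrite !patchE; case: ifPn => // /set_mem Dx; rewrite !funepos.unlock /= fg.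
- by move=> x; rewrite patchE; case: ifP.
- by move=> x; rewrite patchE; case: ifP.
- by apply/(measurable_restrictT _ mD); exact: measurable_funeneg.
- by move=> x nx; rewrite !patchE; case: ifPn => // /set_mem Dx; rewrite !funeneg.unlock /= fg.
Qed.

End integral_off_null.

Section weak_system.
Context {R : realType}.
Notation Z := ((R * R) * R)%type.
Notation mR := (measurableTypeR R).
Notation L3 := (@L3 R).
Notation L2 := (@L2 R).
Notation d0 := (@Ordinal 3 0 isT).
Notation d1 := (@Ordinal 3 1 isT).
Notation d2 := (@Ordinal 3 2 isT).
Notation k0 := (@Ordinal 2 0 isT).
Notation k1 := (@Ordinal 2 1 isT).

Definition lo (i : 'I_2) : 'I_4 := @lshift 2 2 i.
Definition hi (i : 'I_2) : 'I_4 := @rshift 2 2 i.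
Definition Tcs (i j : 'I_4) : R := (i == j.+2 :> nat)%:R.

Lemma Tcs1 i j : `|Tcs i j| <= 1.
Proof. by rewrite /Tcs; case: eqP; rewrite ?normr1 ?normr0. Qed.

Lemma Tcs_lo i j : Tcs (lo i) j = 0.
Proof. by rewrite /Tcs/=; case: eqP => // ij; have := ltn_ord i; rewrite ij. Qed.

Lemma qs_hi B W (z : Z) i : qs B Tcs W z (hi i) = qq B (W (lo i)) z.
Proof.
rewrite /qs (bigD1 (lo i))//= big1 ?addr0; first by rewrite /Tcs/= eqxx mul1r.
move=> j ji; rewrite /Tcs/=; case: eqP => [E|_]; last by rewrite mul0r.
case/eqP: ji; apply/val_inj => /=; move: E; rewrite add2n => -[].
by move=> ->.
Qed.

Lemma St_lo B W (z : Z) i k : St B Tcs W z (lo i) k = 'D_(dir (wd k)) (W (lo i)) z.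
Proof.
rewrite /St; case: ifP => _; rewrite ?addr0// /qs big1 ?addr0// => j _.
by rewrite Tcs_lo mul0r.
Qed.

Lemma St_hi0 B W (z : Z) i : St B Tcs W z (hi i) k0 = 'D_(dir d0) (W (hi i)) z + qq B (W (lo i)) z.
Proof. by rewrite /St eqxx qs_hi wd0. Qed.

Lemma St_hi1 B W (z : Z) i : St B Tcs W z (hi i) k1 = 'D_(dir d1) (W (hi i)) z.
Proof. by rewrite /St/= addr0 wd1. Qed.

Lemma dir_ex k : dir (wd k) = ex R k :> Z.
Proof. by case: k => -[|[|//]] ik; rewrite /dir /ex /e2/=. Qed.

Lemma dir_et : dir d2 = et R :> Z.
Proof. by []. Qed.

Variables (Om : set (R * R)) (T B : R).
Hypothesis OmB : forall x, Om x -> `|x.1| < B /\ `|x.2| < B.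
Hypothesis B0 : 0 < B.
Hypothesis T0 : 0 < T.
Hypothesis TB : T <= B.

Lemma test_fun_tst (phi : Z -> 'rV[R]_2) : test_fun Om T phi ->
  exists K, forall i, tst Om T (fun z => phi z 0 i) K.
Proof.
move=> [H [K [cK [KO K0]]]]; exists K => i.
have entry (psi : Z -> 'rV[R]_2) : continuous psi -> (forall k z, derivable psi z (ex R k)) ->
    (forall z, derivable psi z (et R)) -> continuous (fun z => 'D_(et R) psi z) ->
    (forall k, continuous (fun z => 'D_(ex R k) psi z)) -> C1 (fun z => psi z 0 i).
  move=> cpsi dex det cdet cdex; split=> [z|k].
    by apply: (@continuous_comp _ _ _ psi (fun M : 'rV[R]_2 => M 0 i)); [exact: cpsi|exact: coord_continuous].
  have [v [-> dv cv]] : exists v, [/\ dir k = v :> Z, forall z, derivable psi z v & continuous (fun z => 'D_v psi z)].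
    case: k => -[|[|[|//]]] ik.
    - exists (ex R k0); split; [|exact: dex|exact: cdex].
      by rewrite -dir_ex; congr dir; exact: val_inj.
    - exists (ex R k1); split; [|exact: dex|exact: cdex].
      by rewrite -dir_ex; congr dir; exact: val_inj.
    - exists (et R); split; [|exact: det|exact: cdet].
      by rewrite -dir_et; congr dir; exact: val_inj.
  split=> [z|]; first by have /derivable_mxP := dv z.
  have -> : (fun z => 'D_v (fun z => psi z 0 i) z) = (fun z => ('D_v psi z) 0 i).
    by apply/funext => z; rewrite derive_mx// mxE.
  by move=> z; apply: (@continuous_comp _ _ _ (fun z => 'D_v psi z) (fun M : 'rV[R]_2 => M 0 i)); [exact: cv|exact: coord_continuous].
split => //.
- have [c [de [dt cdt]]] := H [::].
  exact: (entry phi c de dt cdt (fun k => (H [:: k]).1)).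
- move=> k; have -> : (fun z => 'D_(dir (wd k)) (fun z => phi z 0 i) z) = (fun z => 'D_(ex R k) phi z 0 i).
    apply/funext => z; rewrite dir_ex derive_mx ?mxE//.
    by have [_ [de _]] := H [::]; exact: de.
  have [c [de [dt cdt]]] := H [:: k].
  exact: (entry (fun z => 'D_(ex R k) phi z) c de dt cdt (fun l => (H [:: l; k]).1)).
- by move=> z nK zT; rewrite K0// mxE.
Qed.

Variable W : 'I_4 -> Z -> R.
Hypothesis CW : forall i, C1 (W i).

(** The integrand of the weak equation with [sigma] in place of [DF(Du)], where row [i] of [sigma]
    is the quarter turn of row [hi i] of the state. *)
Definition wint (phi : Z -> 'rV[R]_2) (i : 'I_2) (z : Z) : R :=
  W (lo i) z * 'D_(dir d2) (fun z => phi z 0 i) z -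
  (St B Tcs W z (hi i) k0 * 'D_(dir d1) (fun z => phi z 0 i) z -
   St B Tcs W z (hi i) k1 * 'D_(dir d0) (fun z => phi z 0 i) z).

Lemma ar_wint (a b c d e f g h : R) : a * b - ((c + d) * e - f * g) =
  (a * b + h) - (d * e + h) - (c * e - f * g).
Proof. by ring. Qed.

(** Every pair [(u, eta)] satisfies the linear equation exactly, by combining the three integrations
    by parts. Only the relation between [sigma] and [Du] is left to the limit. *)
Lemma weak_scalar (phi : Z -> 'rV[R]_2) K i : tst Om T (fun z => phi z 0 i) K ->
  (\int[L2]_(x in bsq B) (W (lo i) (x, T%R) * phi (x, T%R) 0 i - W (lo i) (x, 0%R) * phi (x, 0%R) 0 i)%:E =
   \int[L3]_(z in slab T B) (wint phi i z)%:E)%E.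
Proof.
move=> tf; have Cf := ts_C1 tf.
have [Cu Ce] := (CW (lo i), CW (hi i)).
have cqq : continuous (qq B (W (lo i))) by exact: continuous_qq.
have cD f k (C : C1 f) := @C1Dc R f k C.
have c1 : continuous (fun z => W (lo i) z * 'D_(dir d2) (fun z => phi z 0 i) z + 'D_(dir d2) (W (lo i)) z * phi z 0 i).
  by move=> z; apply: cvgD; apply: cvgM; [exact: (@C1c R _ Cu)|exact: cD|exact: cD|exact: (@C1c R _ Cf)].
have c2 : continuous (fun z => qq B (W (lo i)) z * 'D_(dir d1) (fun z => phi z 0 i) z + 'D_(dir d2) (W (lo i)) z * phi z 0 i).
  by move=> z; apply: cvgD; apply: cvgM; [exact: cqq|exact: cD|exact: cD|exact: (@C1c R _ Cf)].
have c3 : continuous (fun z => 'D_(dir d0) (W (hi i)) z * 'D_(dir d1) (fun z => phi z 0 i) z -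
    'D_(dir d1) (W (hi i)) z * 'D_(dir d0) (fun z => phi z 0 i) z).
  by move=> z; apply: cvgB; apply: cvgM; exact: cD.
have c12 : continuous (fun z => W (lo i) z * 'D_(dir d2) (fun z => phi z 0 i) z + 'D_(dir d2) (W (lo i)) z * phi z 0 i -
    (qq B (W (lo i)) z * 'D_(dir d1) (fun z => phi z 0 i) z + 'D_(dir d2) (W (lo i)) z * phi z 0 i)).
  by move=> z; apply: cvgB; [exact: c1|exact: c2].
have i1 := slab_integrable B0 TB c1; have i2 := slab_integrable B0 TB c2.
have i3 := slab_integrable B0 TB c3; have i12 := slab_integrable B0 TB c12.
have E1 := weak_t B0 T0 TB tf Cu.
have E2 := weak_q OmB B0 TB tf Cu.
have E3 := weak_eta OmB B0 TB tf Ce.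
have ms := @mslab R T B.
apply: (etrans (esym E1)); apply: (etrans (esym (sube0 _))); apply: (etrans (congr2 (fun a b => a - b)%E (esym (sube0 _)) (esym E3))).
apply: (etrans (congr1 (fun a => _ - a - _)%E (esym E2))).
rewrite -(integralB_EFin ms i1 i2).
rewrite -(integralB_EFin ms i12 i3).
apply: eq_integral => z _; congr EFin; rewrite /wint St_hi0 St_hi1.
exact/esym/ar_wint.
Qed.

End weak_system.

(** * The limit is a Lipschitz weak solution *)

Section solution.
Context {R : realType}.
Notation Z := ((R * R) * R)%type.
Notation mR := (measurableTypeR R).
Notation L3 := (@L3 R).
Notation L2 := (@L2 R).
Notation d0 := (@Ordinal 3 0 isT).
Notation d1 := (@Ordinal 3 1 isT).
Notation d2 := (@Ordinal 3 2 isT).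
Notation k0 := (@Ordinal 2 0 isT).
Notation k1 := (@Ordinal 2 1 isT).
Notation st := ('I_4 -> 'I_2 -> R).

Lemma sum2 (V : nmodType) (f : 'I_2 -> V) : \sum_(i < 2) f i = f k0 + f k1.
Proof. by rewrite !big_ord_recl big_ord0 addr0; congr (f _ + f _); exact: val_inj. Qed.

Lemma mdotE (A C : 'M[R]_2) : mdot A C = \sum_(i < 2) (A i k0 * C i k0 + A i k1 * C i k1).
Proof.
rewrite /mdot /mxtrace; under eq_bigr do rewrite mxE.
rewrite exchange_big/=; apply: eq_bigr => i _.
by rewrite sum2 !mxE.
Qed.

Lemma rV_norm_le (v : 'rV[R]_2) C : 0 <= C -> (forall i, `|v 0 i| <= C) -> `|v| <= C.
Proof.
move=> C0 H; rewrite [leLHS]/Num.Def.normr/= mx_normrE (bigmax_le _ C0)//= => -[i j] _.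
by rewrite ord1.
Qed.

Lemma ar_lip (a b c x y w C D : R) : a <= C * x -> b <= C * y -> c <= D * w -> 0 <= C -> 0 <= D ->
  forall n, x <= n -> y <= n -> w <= n -> a + b + c <= (2 * C + D) * n.
Proof. by move=> *; nra. Qed.

Lemma ar_prod (a b c e A C D E : R) : `|a| <= A -> `|b| <= C -> `|c| <= D -> `|e| <= E ->
  `|a * b - c * e| <= A * C + D * E.
Proof.
move=> h1 h2 h3 h4; apply: (le_trans (ler_normB _ _)); rewrite !normrM.
by apply: lerD; apply: ler_pM.
Qed.

Lemma ar_sgn (x a b e f : R) : x - (- a * b + e * f) = x - (e * f - a * b).
Proof. by ring. Qed.

Lemma box_lipschitz (f : Z -> R) B C D : C1 f -> 0 <= C -> 0 <= D ->
  (forall z, box 0 B z -> [/\ `|'D_(dir d0) f z| <= C, `|'D_(dir d1) f z| <= C & `|'D_(dir d2) f z| <= D]) ->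
  forall z w, box 0 B z -> box 0 B w -> `|f z - f w| <= (2 * C + D) * `|z - w|.
Proof.
move=> Cf C0 D0 H z w zb wb.
have inb k (x : Z) (s : R) : box 0 B x -> Num.min (co k z) (co k w) <= s <= Num.max (co k z) (co k w) -> box 0 B (upd k x s).
  move=> xb; rewrite ge_min le_max => sb; apply/boxP => l.
  have [->|lk] := eqVneq l k; last by rewrite co_upd_neq//; move/boxP: xb; apply.
  rewrite co_upd; move/boxP: zb => /(_ k); move/boxP: wb => /(_ k).
  rewrite (_ : co k 0 = 0) ?subr0; last by case: (k) => -[|[|[|//]]].
  rewrite !ler_norml => /andP[w1 w2] /andP[z1 z2]; apply/andP.
  by split; case/andP: sb => /orP[?|?] /orP[?|?]; lra.
pose z1 := upd d0 z (co d0 w); pose z2 := upd d1 z1 (co d1 w).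
have self x : upd d0 x (co d0 x) = x by exact: upd_co.
have z1b : box 0 B z1 by apply: inb => //; rewrite ge_min le_max !lexx !orbT.
have z2b : box 0 B z2 by apply: inb => //; rewrite ge_min le_max !lexx !orbT.
have zw : w = upd d2 z2 (co d2 w) by exact: Z_eq.
have dd k (x : Z) := @C1d R f k x Cf.
have h1 : `|f z - f z1| <= C * `|co d0 z - co d0 w|.
  rewrite -{1}[z](upd_co d0) /z1 distrC [X in _ * X]distrC; apply: upd_lipschitz => // s sb.
  by have [] := H _ (inb d0 z s zb sb).
have h2 : `|f z1 - f z2| <= C * `|co d1 z - co d1 w|.
  rewrite -{1}[z1](upd_co d1) /z2 distrC [X in _ * X]distrC (_ : co d1 z1 = co d1 z)//.
  by apply: upd_lipschitz => // s sb; have [] := H _ (inb d1 z1 s z1b sb).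
have h3 : `|f z2 - f w| <= D * `|co d2 z - co d2 w|.
  have := @upd_lipschitz R f d2 z2 (co d2 z) (co d2 w) D (dd d2) (fun s sb => let: And3 _ _ h := H _ (inb d2 z2 s z2b sb) in h).
  by rewrite -zw (_ : upd d2 z2 (co d2 z) = z2) ?[`|_ - f z2|]distrC ?[`|co d2 w - _|]distrC//; exact: Z_eq.
rewrite (_ : f z - f w = (f z - f z1) + (f z1 - f z2) + (f z2 - f w)); last by ring.
apply: (le_trans (ler_normD _ _)); apply: (@le_trans _ _ (`|f z - f z1| + `|f z1 - f z2| + `|f z2 - f w|)).
  by rewrite lerD2r ler_normD.
by apply: (ar_lip h1 h2 h3) => //; rewrite -coB; exact: co_norm.
Qed.

Variable F : 'M[R]_2 -> R.
Variables (U M : set st) (d : st -> R) (c K : R).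
Hypothesis oc : splittable U M d c K.
Variable L : 'I_5 -> st -> R.

Definition st_closure (P : st) := forall e, 0 < e -> exists2 Q, U Q & forall i k, `|Q i k - P i k| < e.
Definition upper (P : st) : 'M[R]_2 := \matrix_(i, k) P (lo i) k.

Hypothesis FU : forall P, st_closure P -> d P = 0 -> forall i,
  DF F (upper P) i k0 = - P (hi i) k1 /\ DF F (upper P) i k1 = P (hi i) k0.

Variables (Om : set (R * R)) (T B : R).
Hypothesis oOm : open Om.
Hypothesis OmB : forall x, Om x -> `|x.1| < B /\ `|x.2| < B.
Hypothesis B0 : 0 < B.
Hypothesis T0 : 0 < T.
Hypothesis TB : T <= B.
Local Notation O := (OmT Om T).
Local Notation S := (St B Tcs).

Lemma open_OmT : open O.
Proof.
have -> : O = fst @^-1` Om `&` snd @^-1` [set` `]0, T[].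
  by apply/seteqP; split=> z [Oz zT]; split => //; move: zT; rewrite /= in_itv.
apply: openI.
  by apply: open_comp => // z _; exact: cvg_fst.
by apply: open_comp; [move=> z _; exact: cvg_snd|exact: interval_open].
Qed.

Lemma OmT_box : O `<=` (box 0 B : set Z).
Proof.
move=> z [Oz /andP[z0 zT]]; have [h1 h2] := OmB Oz.
by split; [split|]; apply/csegE; rewrite subr0 ?(ltW h1) ?(ltW h2)// (gtr0_norm z0) (le_trans (ltW zT)).
Qed.

Variables (W0 : 'I_4 -> Z -> R) (eps0 : R) (W : nat -> 'I_4 -> Z -> R) (mu : nat -> R).
Hypothesis H : ci U M d c K L B Tcs O W0 eps0 W mu.
Local Notation G := (Gd d B Tcs O W).
Local Notation Sl := (Sl B Tcs W).
Local Notation hh := (hh d B Tcs O W).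
Local Notation ul := (ul W).

Definition usol (z : Z) : 'rV[R]_2 := \row_i ul (lo i) z.

Let oO := open_OmT.
Let OB := OmT_box.
Let K0 : 0 < K. Proof. exact: sp_K oc. Qed.

Lemma Sl_closure z : G z -> st_closure (Sl z).
Proof.
move=> Gz e e0; have [cv _] := Gd_cvg oc OB H Gz.
have : \forall n \near \oo, forall i k, `|S (W n) z i k - Sl z i k| < e.
  apply: (@filter_forall nat 'I_4 (fun i n => forall k, `|S (W n) z i k - Sl z i k| < e) eventually _) => i.
  apply: (@filter_forall nat 'I_2 (fun k n => `|S (W n) z i k - Sl z i k| < e) eventually _) => k.
  by have /cvgrPdist_lt/(_ _ e0) := cv i k; apply: filterS => n; rewrite distrC.
move=> [n _ /(_ n (leqnn n)) Hn]; exists (S (W n) z) => //.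
exact: (ci_U H n (OB Gz.1)).
Qed.

Lemma mu_mesh_le n : mu n * mesh n <= eps0.
Proof.
apply: le_trans (ci_mue H n); rewrite ler_piMr ?(ltW (ci_mu0 H n))//.
by rewrite /mesh exprn_ile1// invf_le1// ler1n.
Qed.

Lemma usol_close i z : `|ul (lo i) z - W0 (lo i) z| <= eps0.
Proof.
have := ul_close H (lo i) z 0; rewrite (ci_0 H) => /le_trans; apply.
exact: (mu_mesh_le 0).
Qed.

Lemma Dt_close i z n : `|'D_(dir d2) (W n i) z - 'D_(dir d2) (W0 i) z| <= eps0 + eps0.
Proof.
have [_ h] := geometric_cvg (ci_mu0 H) (ci_mud H) (fun n => ci_Wt H n i z).
have h1 := le_trans (h n) (mu_mesh_le n); have h2 := le_trans (h 0%N) (mu_mesh_le 0).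
rewrite (ci_0 H) in h2; set l := limn _ in h1 h2.
rewrite (_ : _ - _ = (l - 'D_(dir d2) (W0 i) z) - (l - 'D_(dir d2) (W n i) z)); last by ring.
by apply: (le_trans (ler_normB _ _)); exact: lerD.
Qed.

(** The states are kept in [U] on the whole cube and not just on the domain. The cube contains
    axis-parallel paths between its points, so derivative bounds give a Lipschitz bound whatever the
    shape of [Om]. *)
Lemma usol_lipschitz : Defs.lipschitz_on (closure O) usol.
Proof.
have cD i : exists C : R, forall z, box 0 B z -> `|'D_(dir d2) (W0 (lo i)) z| <= C.
  apply: cont_box_bounded; apply: C1Dc; have := ci_C1 H 0 (lo i); by rewrite (ci_0 H).
have /choice[C HC] := cD.
pose D := `|C k0| + `|C k1| + (eps0 + eps0).
have Cle i : `|C i| <= `|C k0| + `|C k1|.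
  case: i => -[|[|//]] ik.
    by rewrite (_ : Ordinal ik = k0) ?lerDl//; exact: val_inj.
  by rewrite (_ : Ordinal ik = k1) ?lerDr//; exact: val_inj.
have e00 : 0 <= eps0 by apply: le_trans (ci_mue H 0); rewrite ltW// (ci_mu0 H).
have D0 : 0 <= D by rewrite !addr_ge0.
have WL n i z w : box 0 B z -> box 0 B w -> `|W n (lo i) z - W n (lo i) w| <= (2 * K + D) * `|z - w|.
  apply: box_lipschitz => //; [exact: ci_C1 H n _|exact: ltW|move=> y yb].
  have Uy := ci_U H n yb.
  have h k : `|'D_(dir (wd k)) (W n (lo i)) y| <= K.
    by have := sp_bU oc (lo i) k Uy; rewrite St_lo.
  split; [by have := h k0; rewrite wd0|by have := h k1; rewrite wd1|].
  rewrite -['D_(dir d2) (W n (lo i)) y](subrK ('D_(dir d2) (W0 (lo i)) y)).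
  apply: (le_trans (ler_normD _ _)); rewrite /D addrC; apply: lerD; last exact: Dt_close.
  apply: (le_trans (HC i y yb)); apply: (le_trans (ler_norm _)).
  exact: Cle.
have clb : closure O `<=` (box 0 B : set Z).
  have cb : closed (box 0 B : set Z) by apply: compact_closed; [exact: norm_hausdorff|exact: compact_box].
  by rewrite ((closure_id (box 0 B : set Z)).1 cb); exact: closure_subset.
exists (2 * K + D) => z w /clb zb /clb wb.
have KD : 0 <= 2 * K + D by rewrite addr_ge0// mulr_ge0// ltW.
apply: rV_norm_le => [|i]; first by rewrite mulr_ge0.
rewrite !mxE.
have cn : (fun n => `|W n (lo i) z - W n (lo i) w|) @ \oo --> `|ul (lo i) z - ul (lo i) w|.
  by apply: cvg_norm; apply: cvgB; exact: (ul_cvg H).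
rewrite -(cvg_lim _ cn)//; apply: limr_le; first by apply/cvg_ex; exists `|ul (lo i) z - ul (lo i) w|.
by apply: nearW => n; exact: WL.
Qed.

(* Off this null set the limit is differentiable in space and solves the inclusion. *)
Definition Nset : set ((mR * mR) * mR) := (O `\` G) `|`
  \bigcup_(ik in [set: 'I_2 * 'I_2]) (O `\` dset (ul (lo ik.1)) (hh (lo ik.1) ik.2) (dir (wd ik.2))).

Lemma Nset_null : measurable Nset /\ L3 Nset = 0%E.
Proof.
have mOG : measurable (O `\` G : set ((mR * mR) * mR)).
  by apply: measurableD; [exact: mO|exact: (measurable_Gd oc B0 oO OB H)].
have mX (ik : 'I_2 * 'I_2) : measurable (O `\` dset (ul (lo ik.1)) (hh (lo ik.1) ik.2) (dir (wd ik.2))).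
  apply: measurableD; first exact: mO.
  by apply: measurable_dset; [exact: (continuous_ul H)|exact: (measurable_hh oc B0 oO OB H)].
have mU : measurable (\bigcup_(ik in [set: 'I_2 * 'I_2]) (O `\` dset (ul (lo ik.1)) (hh (lo ik.1) ik.2) (dir (wd ik.2)))).
  by apply: fin_bigcup_measurable => [|ik _]; [exact: finite_finset|exact: mX].
split; first exact: measurableU.
rewrite null_set_setU//; first exact: (Gd_ae oc B0 oO OB H).
apply/eqP; rewrite eq_le measure_ge0 andbT.
have -> : \bigcup_(ik in [set: 'I_2 * 'I_2]) (O `\` dset (ul (lo ik.1)) (hh (lo ik.1) ik.2) (dir (wd ik.2))) =
   \bigcup_(ik in [set` enum (('I_2 * 'I_2)%type : finType)]) (O `\` dset (ul (lo ik.1)) (hh (lo ik.1) ik.2) (dir (wd ik.2))).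
  by apply/seteqP; split=> z [ik _ zik]; exists ik => //=; rewrite mem_enum.
have [_] := @seq_union_le R _ (enum (('I_2 * 'I_2)%type : finType))
  (fun ik => O `\` dset (ul (lo ik.1)) (hh (lo ik.1) ik.2) (dir (wd ik.2))) (fun=> 0)
  (fun ik _ => conj (mX ik) (eq_ind_r (fun x => (x <= 0%:E)%E) (lexx _)
     (ul_derive_ae oc B0 oO OB H ik.2 (@Tcs_lo R ik.1)))).
by rewrite big1.
Qed.

Lemma Nset_good z : O z -> ~ Nset z -> G z /\ Dx usol z = upper (Sl z).
Proof.
move=> Oz nN; have Gz : G z by apply: contrapT => nG; apply: nN; left.
split => //; apply/matrixP => i k; rewrite !mxE.
have dz : dset (ul (lo i)) (hh (lo i) k) (dir (wd k)) z.
  by apply: contrapT => nd; apply: nN; right; exists (i, k).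
have [_] := (dsetP (hh (lo i) k) (dir (wd k)) z (@continuous_ul _ _ _ _ _ _ _ _ _ _ _ _ _ _ H (lo i))).1 dz.
rewrite hhE// dir_ex => <-; congr ('D_ _ _ _).
by apply/funext => w; rewrite mxE.
Qed.

(** The boundary terms are the same for all iterates, the volume terms converge by dominated
    convergence, and off a null set the limit state lies on the graph, where [sigma] is [DF(Du)]. *)
Lemma usol_weak phi : test_fun Om T phi ->
    ((\int[L2]_(x in Om) (dotv (usol (x, T)) (phi (x, T)))%:E)
     - (\int[L2]_(x in Om) (dotv (usol (x, 0)) (phi (x, 0)))%:E))%E
    = (\int[L3]_(z in O)
          (dotv (usol z) ('D_(et R) phi z) - mdot (DF F (Dx usol z)) (Dx (fun w => phi w) z))%:E)%E.
Proof.
move=> tphi; have [KK tf] := test_fun_tst tphi.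
have mO' := mO oO.
pose f i z := phi z 0 i.
have Cf i := ts_C1 (tf i).
have cDf i k := @C1Dc R (f i) k (Cf i).
pose gn n z := \sum_(i < 2) wint B (W n) phi i z.
have cgn n : continuous (gn n).
  apply: (@continuous_bigsum R _ _ _ (fun i z => wint B (W n) phi i z)) => i z.
  have cS := @continuous_St R B Tcs B0 _ (ci_C1 H n).
  apply: cvgB; first by apply: cvgM; [exact: (@C1c R _ (ci_C1 H n (lo i)))|exact: cDf].
  by apply: cvgB; apply: cvgM; [exact: (cS (hi i) k0)|exact: cDf|exact: (cS (hi i) k1)|exact: cDf].
pose ginf z := \sum_(i < 2) (ul (lo i) z * 'D_(dir d2) (f i) z -
  (hh (hi i) k0 z * 'D_(dir d1) (f i) z - hh (hi i) k1 z * 'D_(dir d0) (f i) z)).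
set LHS := (X in X = _).
(* Perturbations vanish off the open set [O], in particular at times [0] and [T], so the limit and
   every iterate have the same values there. *)
have En n : LHS = (\int[L3]_(z in O) (gn n z)%:E)%E.
  have nO x t : t = 0 \/ t = T -> ~ O (x, t) by move=> [->|->] [_ /=]; rewrite ltxx ?andbF.
  have WE i x t : t = 0 \/ t = T -> usol (x, t) 0 i = W n (lo i) (x, t).
    move=> tt; rewrite mxE (ul_off H); last exact: nO.
    by elim: n => [|n IH]; [rewrite (ci_0 H)|rewrite (ci_O H) ?IH//; exact: nO].
  have cT i t : continuous (fun x => W n (lo i) (x, t) * f i (x, t)).
    have cp : continuous (fun x : R * R => (x, t)).
      by move=> x; apply: continuous_pairf; [exact: cvg_id|exact: cvg_cst].
    move=> x; apply: cvgM.
      by apply: (@continuous_comp (R * R)%type Z R (fun x => (x, t))); [exact: cp|exact: (@C1c R _ (ci_C1 H n (lo i)))].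
    by apply: (@continuous_comp (R * R)%type Z R (fun x => (x, t))); [exact: cp|exact: (@C1c R _ (Cf i))].
  have cS t : continuous (fun x => \sum_(i < 2) W n (lo i) (x, t) * f i (x, t)).
    by apply: (@continuous_bigsum R _ _ _ (fun i x => W n (lo i) (x, t) * f i (x, t))) => i; exact: cT.
  have E1 t : t = 0 \/ t = T -> (\int[L2]_(x in Om) (dotv (usol (x, t)) (phi (x, t)))%:E =
      \int[L2]_(x in bsq B) (\sum_(i < 2) W n (lo i) (x, t) * f i (x, t))%:E)%E.
    move=> tt; rewrite -(Om_bsq OmB (tf k0)).
      by apply: eq_integral => x _; congr EFin; apply: eq_bigr => i _; rewrite WE.
    move=> x nK; apply: big1 => i _; rewrite /f (ts_0 (tf i)) ?mulr0//=.
    by case: tt => ->; rewrite lexx ltW.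
  rewrite /LHS (E1 T (or_intror erefl)) (E1 0 (or_introl erefl)).
  rewrite -(integralB_EFin (@m_bsq R B) (bsq_integrable B0 (cS T)) (bsq_integrable B0 (cS 0))).
  transitivity (\int[L2]_(x in bsq B) \sum_(i < 2) (W n (lo i) (x, T%R) * f i (x, T%R) - W n (lo i) (x, 0%R) * f i (x, 0%R))%:E)%E.
    by apply: eq_integral => x _; rewrite -EFinB -sumrB sumEFin.
  have cB i : continuous (fun x => W n (lo i) (x, T) * f i (x, T) - W n (lo i) (x, 0) * f i (x, 0)).
    by move=> x; apply: cvgB; exact: cT.
  rewrite (integral_sum (@m_bsq R B) (fun i => bsq_integrable B0 (cB i))).
  rewrite (eq_bigr (fun i => \int[L3]_(z in slab T B) (wint B (W n) phi i z)%:E)%E); last first.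
    by move=> i _; exact: (weak_scalar OmB B0 T0 TB (ci_C1 H n) (tf i)).
  have cw i : continuous (wint B (W n) phi i).
    have cS' := @continuous_St R B Tcs B0 _ (ci_C1 H n); move=> z.
    apply: cvgB; first by apply: cvgM; [exact: (@C1c R _ (ci_C1 H n (lo i)))|exact: cDf].
    by apply: cvgB; apply: cvgM; [exact: (cS' (hi i) k0)|exact: cDf|exact: (cS' (hi i) k1)|exact: cDf].
  rewrite -(integral_sum (@mslab R T B) (fun i => slab_integrable B0 TB (cw i))).
  rewrite (O_slab OmB (tf k0)).
    by apply: eq_integral => z _; rewrite sumEFin.
  move=> z nK zT; apply: big1 => i _; rewrite /wint.
  by rewrite (tst_D (tf i) d2 nK zT) (tst_D (tf i) d1 nK zT) (tst_D (tf i) d0 nK zT) !mulr0 !subr0.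
have mhh i k : measurable_fun (O : set ((mR * mR) * mR)) (hh i k : _ -> mR).
  by apply: measurable_funTS; exact: (measurable_hh oc B0 oO OB H).
have mc (g : Z -> R) : continuous g -> measurable_fun (O : set ((mR * mR) * mR)) (g : _ -> mR).
  by move=> cg; apply: measurable_funTS; exact: continuous_measurable3.
have mg : measurable_fun (O : set ((mR * mR) * mR)) (EFin \o ginf).
  apply/measurable_EFinP; apply: (@measurable_sum _ _ _ O _ (index_enum 'I_2)
    (fun i z => (ul (lo i) z * 'D_(dir d2) (f i) z -
      (hh (hi i) k0 z * 'D_(dir d1) (f i) z - hh (hi i) k1 z * 'D_(dir d0) (f i) z)) : mR)) => i.
  apply: measurable_funB; first by apply: measurable_funM; apply: mc; [exact: (continuous_ul H)|exact: cDf].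
  by apply: measurable_funB; apply: measurable_funM; [exact: mhh|apply: mc; exact: cDf|exact: mhh|apply: mc; exact: cDf].
have fin : (fun n => \int[L3]_(z in O) (gn n z)%:E)%E @ \oo --> (\int[L3]_(z in O) (ginf z)%:E)%E.
  have bd (g : Z -> R) : continuous g -> exists C : R, forall z, box 0 B z -> `|g z| <= C by exact: cont_box_bounded.
  have /choice[C HC] (ik : 'I_2 * 'I_3) := bd _ (cDf ik.1 ik.2).
  have CW0 i : C1 (W0 i) by have := ci_C1 H 0 i; rewrite (ci_0 H).
  have /choice[C' HC'] i := bd _ (@C1c R _ (CW0 i)).
  pose Kb := \sum_(i < 2) ((C' (lo i) + eps0 + eps0) * C (i, d2) + (K * C (i, d1) + K * C (i, d0))).
  have Wb n i z : box 0 B z -> `|W n i z| <= C' i + eps0 + eps0.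
    move=> zb; rewrite -[W n i z](subrK (ul i z)) (le_trans (ler_normD _ _))// addrC; apply: lerD.
      rewrite -[ul i z](subrK (W0 i z)) (le_trans (ler_normD _ _))// addrC; apply: lerD; first exact: HC'.
      by have := ul_close H i z 0; rewrite (ci_0 H) => /le_trans; apply; exact: (mu_mesh_le 0).
    by rewrite distrC; exact: le_trans (ul_close H i z n) (mu_mesh_le n).
  have gb n z : O z -> `|gn n z| <= Kb.
    move=> Oz; have zb := OB Oz; apply: (le_trans (ler_norm_sum _ _ _)); apply: ler_sum => i _.
    apply: (le_trans (ler_normB _ _)); apply: lerD.
      by rewrite normrM; apply: ler_pM => //; [exact: Wb|exact: (HC (i, d2))].
    exact: (ar_prod (sp_bU oc (hi i) k0 (ci_U H n zb)) (HC (i, d1) z zb) (sp_bU oc (hi i) k1 (ci_U H n zb)) (HC (i, d0) z zb)).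
  have mgn n : measurable_fun (O : set ((mR * mR) * mR)) (EFin \o gn n).
    by apply/measurable_EFinP; apply: measurable_funTS; exact: continuous_measurable3.
  have iK := integrable_cst Kb mO' (L3O B0 oO OB).
  have [] := @dominated_convergence _ _ _ L3 O mO' (fun n => EFin \o gn n) (EFin \o ginf) (EFin \o (fun=> Kb)) mgn mg _ iK _.
  - exists (O `\` G); split.
    + by apply: measurableD => //; exact: (measurable_Gd oc B0 oO OB H).
    + exact: (Gd_ae oc B0 oO OB H).
    + move=> z /= nz; have Oz : O z by apply: contrapT => nO; apply: nz => /nO.
      split => // Gz; apply: nz => _; apply: cvg_EFin; first exact: nearW.
      rewrite /ginf sum2 (_ : fine \o _ = (fun n => wint B (W n) phi k0 z + wint B (W n) phi k1 z)); last first.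
        by apply/funext => n; rewrite /= /gn sum2.
      suff ci i : (fun n => wint B (W n) phi i z) @ \oo --> ul (lo i) z * 'D_(dir d2) (f i) z -
          (hh (hi i) k0 z * 'D_(dir d1) (f i) z - hh (hi i) k1 z * 'D_(dir d0) (f i) z).
        by apply: cvgD; [exact: (ci k0)|exact: (ci k1)].
      apply: cvgB; first by apply: cvgM; [exact: (ul_cvg H)|exact: cvg_cst].
      have hc k := @hh_cvg R U M d c K oc L B Tcs O OB W0 eps0 W mu H (hi i) k z Gz.
      by apply: cvgB; apply: cvgM; [exact: (hc k0)|exact: cvg_cst|exact: (hc k1)|exact: cvg_cst].
  - by apply: aeW => z n Oz; rewrite lee_fin; exact: gb.
  - by move=> _ _.
have -> : LHS = (\int[L3]_(z in O) (ginf z)%:E)%E.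
  apply: (cvg_unique (@ereal_hausdorff R) _ fin).
  by have <- : (fun=> LHS) = (fun n => \int[L3]_(z in O) (gn n z)%:E)%E; [apply/funext => n; exact: En|exact: cvg_cst].
have [mN N0] := Nset_null.
apply/esym; apply: (integral_off_null mN N0 mO'); first exact: mg.
move=> z Oz nN; congr EFin.
have [Gz DE] := Nset_good Oz nN.
have [_ dS] := Gd_cvg oc OB H Gz.
rewrite DE mdotE /dotv -sumrB; apply: eq_bigr => i _.
have [-> ->] := FU (Sl_closure Gz) dS i.
have -> : 'D_(et R) phi z 0 i = 'D_(dir d2) (f i) z.
  rewrite derive_mx ?mxE//; have [Hp _] := tphi; have [_ [_ [dt _]]] := Hp [::]; exact: dt.
rewrite !mxE !hhE// -!dir_ex wd0 wd1 -/(f i).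
exact: ar_sgn.
Qed.

End solution.

(** * Nowhere continuity *)

Section nowhere.
Context {R : realType}.
Notation Z := ((R * R) * R)%type.
Notation mR := (measurableTypeR R).
Notation L3 := (@L3 R).
Notation d0 := (@Ordinal 3 0 isT).
Notation d1 := (@Ordinal 3 1 isT).
Notation d2 := (@Ordinal 3 2 isT).
Notation k0 := (@Ordinal 2 0 isT).
Notation st := ('I_4 -> 'I_2 -> R).

Lemma box_Rsum (c : Z) (r : R) (I : Type) (s : seq I) (f : I -> Z -> R) : 0 <= r -> (forall i, continuous (f i)) ->
  \int[L3]_(z in box c r) (\sum_(i <- s) f i z) = \sum_(i <- s) \int[L3]_(z in box c r) f i z.
Proof.
move=> r0 cf; have mb := @measurable_box R c r; elim: s => [|i s IH].
  by rewrite big_nil; under eq_Rintegral do rewrite big_nil; rewrite Rintegral_cst// mul0r.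
rewrite big_cons -IH; under eq_Rintegral do rewrite big_cons.
rewrite (RintegralD mb (cont_box_integrable c r0 (cf i)))//; apply: cont_box_integrable => //.
exact: (@continuous_bigsum R _ _ _ f).
Qed.

Lemma ar_contra (v C m t : R) : 0 < m -> v - (1 - m) * v <= C * (m * t) -> v <= C * t.
Proof.
by move=> m0 h; rewrite -(ler_pM2l m0); apply: le_trans (le_trans h _); lra.
Qed.

Lemma mx_entry_close (A0 A1 A2 P Q : 'M[R]_2) e : P = A1 -> Q = A2 -> `|A0 - A1| < e / 2 -> `|A0 - A2| < e / 2 ->
  forall j k, `|P j k - Q j k| < e.
Proof.
move=> -> -> h1 h2 j k.
have ent (A : 'M[R]_2) : `|A j k| <= `|A|.
  by rewrite [leRHS]/Num.Def.normr/= mx_normrE; exact: (le_bigmax _ (fun ij => `|A ij.1 ij.2|) (j, k)).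
have -> : A1 j k - A2 j k = (A0 - A2) j k - (A0 - A1) j k by rewrite !mxE; ring.
apply: (le_lt_trans (ler_normB _ _)); rewrite [ltRHS]splitr.
by apply: ltrD; [exact: le_lt_trans (ent _) h2|exact: le_lt_trans (ent _) h1].
Qed.

Lemma ar_cancel (a b t : R) : a + b - a = t + (b - t).
Proof. by ring. Qed.

Lemma ar_tri (a b v e : R) : `|v - a| <= e -> `|v - b| <= e -> `|a + -1 * b| <= e * 2.
Proof. by rewrite !ler_norml => /andP[? ?] /andP[? ?]; apply/andP; split; lra. Qed.

Variables (U M : set st) (d : st -> R) (c K : R).
Hypothesis oc : splittable U M d c K.
Variable L : 'I_5 -> st -> R.
Variable l : 'I_5 -> 'I_4 -> 'I_2 -> R.
Hypothesis La : forall i P Q, L i P - L i Q = \sum_(j < 4) \sum_(k < 2) l i j k * (P j k - Q j k).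
Hypothesis L1 : forall P, d P = 0 -> exists i, L i P = 1.
Variable r0 : R.
Hypothesis r00 : 0 < r0.
Hypothesis Lr : forall i P Q, st_closure U P -> st_closure U Q -> d P = 0 -> d Q = 0 ->
  (forall j k, `|upper P j k - upper Q j k| < r0) -> L i P = 1 -> L i Q = 1.

Let lam i := \sum_(j < 4) \sum_(k < 2) `|l i j k|.

Lemma L_lipschitz i P Q e : (forall j k, `|P j k - Q j k| <= e) -> `|L i P - L i Q| <= lam i * e.
Proof.
move=> h; rewrite La /lam mulr_suml; apply: (le_trans (ler_norm_sum _ _ _)); apply: ler_sum => j _.
rewrite mulr_suml; apply: (le_trans (ler_norm_sum _ _ _)); apply: ler_sum => k _.
by rewrite normrM; apply: ler_wpM2l.
Qed.

Lemma lam_ge0 i : 0 <= lam i.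
Proof. by apply: sumr_ge0 => j _; exact: sumr_ge0. Qed.

Lemma L_near i P e : 0 < e -> exists2 m, 0 < m & forall Q, (forall j k, `|Q j k - P j k| < m) -> `|L i Q - L i P| < e.
Proof.
move=> e0; have l1 : 0 < lam i + 1 by rewrite ltr_pwDr// lam_ge0.
exists (e / (lam i + 1)); first exact: divr_gt0.
move=> Q h; apply: (@le_lt_trans _ _ (lam i * (e / (lam i + 1)))).
  by apply: L_lipschitz => j k; exact: ltW.
by rewrite mulrA ltr_pdivrMr// mulrC ltr_pM2l// ltrDl.
Qed.

Variables (Om : set (R * R)) (T B : R).
Hypothesis oOm : open Om.
Hypothesis OmB : forall x, Om x -> `|x.1| < B /\ `|x.2| < B.
Hypothesis B0 : 0 < B.
Hypothesis T0 : 0 < T.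
Hypothesis TB : T <= B.
Local Notation O := (OmT Om T).
Local Notation S := (St B Tcs).
Variables (W0 : 'I_4 -> Z -> R) (eps0 : R) (W : nat -> 'I_4 -> Z -> R) (mu : nat -> R).
Hypothesis H : ci U M d c K L B Tcs O W0 eps0 W mu.
Local Notation Sl := (Sl B Tcs W).
Local Notation ul := (ul W).
Let oO : open O := open_OmT oOm.
Let OB := OmT_box OmB TB.

Lemma mu_mesh_mono n m : mu (n + m) * mesh (n + m) <= mu n * mesh n.
Proof.
elim: m => [|m IH]; first by rewrite addn0.
rewrite addnS; apply: le_trans IH; apply: ler_pM.
- by rewrite ltW// (ci_mu0 H).
- by rewrite ltW// mesh_gt0.
- exact: ci_mud H _.
by rewrite /mesh exprS ler_piMl ?exprn_ge0// invf_le1// ler1n.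
Qed.

Section on_box.
Variables (z0 : Z) (r : R).
Hypothesis rgt0 : 0 < r.
Hypothesis bB : box z0 r `<=` box 0 B.
Let bx := box z0 r.
Let mb : measurable bx := @measurable_box R z0 r.
Let Cb := 2 * 2 * (2 * r) ^+ 2 + 8 * B * 2 * (2 * r) ^+ 3.

(** The difference of two iterates is uniformly small together with its time derivative. The local
    part of the change of state is a spatial derivative and integrates to boundary terms; the
    nonlocal part is bounded pointwise. *)
Lemma S_average n m j k :
  `|\int[L3]_(z in bx) (S (W (n + m)) z j k - S (W n) z j k)| <= Cb * (mu n * mesh n).
Proof.
set e := mu n * mesh n.
have e0 : 0 <= e by rewrite ltW// mulr_gt0 ?(ci_mu0 H)// mesh_gt0.
pose V i z := W (n + m) i z + -1 * W n i z.
have CN i : C1 (fun z => -1 * W n i z) by apply: C1Z; exact: ci_C1 H n i.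
have CV i : C1 (V i) by apply: C1D; [exact: ci_C1 H _ i|exact: CN].
have WV : W (n + m)%N = (fun i z => W n i z + V i z).
  by apply/funext => i; apply/funext => z; rewrite /V mulN1r addrCA subrr addr0.
have Vb i z : `|V i z| <= e * 2.
  apply: (@ar_tri _ _ (ul i z)); last exact: (ul_close H).
  by apply: le_trans (ul_close H i z (n + m)) _; exact: mu_mesh_mono.
have Vt i z : `|'D_(dir d2) (V i) z| <= e * 2.
  have -> := @deriveDC1 R _ _ d2 z (ci_C1 H (n + m)%N i) (CN i).
  have -> := @deriveZC1 R (-1) _ d2 z (ci_C1 H n i).
  have [_ h] := geometric_cvg (ci_mu0 H) (ci_mud H) (fun n => ci_Wt H n i z).
  apply: (@ar_tri _ _ (limn (fun n => 'D_(dir d2) (W n i) z))); last exact: h.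
  by apply: le_trans (h (n + m)%N) _; exact: mu_mesh_mono.
have -> : \int[L3]_(z in bx) (S (W (n + m)) z j k - S (W n) z j k) =
    \int[L3]_(z in bx) ('D_(dir (wd k)) (V j) z + (S V z j k - 'D_(dir (wd k)) (V j) z)).
  apply: eq_Rintegral => z _; rewrite WV.
  have -> := @StD R B Tcs (W n) V z j k (ci_C1 H n) CV.
  exact: ar_cancel.
have cD : continuous (fun z => 'D_(dir (wd k)) (V j) z) by exact: (@C1Dc R _ (wd k) (CV j)).
have cS := @continuous_St R B Tcs B0 V CV j k.
have cB : continuous (fun z => S V z j k - 'D_(dir (wd k)) (V j) z) by move=> z; apply: cvgB; [exact: cS|exact: cD].
rewrite (RintegralD mb (cont_box_integrable z0 (ltW rgt0) cD) (cont_box_integrable z0 (ltW rgt0) cB)).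
have h1 := @box_integral_derive R (V j) z0 r (wd k) (e * 2) (ltn_ord k) rgt0 (CV j) (Vb j).
have h2 : `|\int[L3]_(z in bx) (S V z j k - 'D_(dir (wd k)) (V j) z)| <= 8 * B * (e * 2) * (2 * r) ^+ 3.
  apply: box_integral_bound => // z /bB zb; apply: (St_bound B0 (@Tcs1 R)) => //.
  by move/boxP: zb => /(_ d1); rewrite subr0 => /ler_normlW.
apply: (le_trans (ler_normD _ _)); apply: (le_trans (lerD h1 h2)).
by rewrite /Cb; move: (r) (e) (B) => r' e' B'; lra.
Qed.

Let cLS i n : continuous (fun z => L i (S (W n) z)).
Proof.
move=> z; apply/cvgrPdist_lt => e e0.
have [m m0 Hm] := L_near i (S (W n) z) e0.
have := near_st (f := fun z => S (W n) z) z (fun i k => @continuous_St R B Tcs B0 _ (ci_C1 H n) i k) m0.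
by apply: filterS => z' hz; rewrite distrC; apply: Hm.
Qed.

Lemma L_average i n m :
  `|\int[L3]_(z in bx) (L i (S (W (n + m)) z) - L i (S (W n) z))| <= lam i * (Cb * (mu n * mesh n)).
Proof.
have cd j k : continuous (fun z => l i j k * (S (W (n + m)) z j k - S (W n) z j k)).
  move=> z; apply: cvgM; first exact: cvg_cst.
  by apply: cvgB; [exact: (@continuous_St R B Tcs B0 _ (ci_C1 H (n + m)) j k)|exact: (@continuous_St R B Tcs B0 _ (ci_C1 H n) j k)].
under eq_Rintegral do rewrite La.
rewrite (box_Rsum _ _ (f := fun j z => \sum_(k < 2) l i j k * (S (W (n + m)) z j k - S (W n) z j k))) ?(ltW rgt0)//; last first.
  by move=> j; apply: (@continuous_bigsum R _ _ _ (fun k z => l i j k * (S (W (n + m)) z j k - S (W n) z j k))).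
rewrite /lam mulr_suml; apply: (le_trans (ler_norm_sum _ _ _)); apply: ler_sum => j _.
rewrite (box_Rsum _ _ (f := fun k z => l i j k * (S (W (n + m)) z j k - S (W n) z j k))) ?(ltW rgt0)//.
rewrite mulr_suml; apply: (le_trans (ler_norm_sum _ _ _)); apply: ler_sum => k _.
rewrite RintegralZl//; last first.
  apply: (cont_box_integrable z0 (ltW rgt0)) => z.
  by apply: cvgB; [exact: (@continuous_St R B Tcs B0 _ (ci_C1 H (n + m)) j k)|exact: (@continuous_St R B Tcs B0 _ (ci_C1 H n) j k)].
by rewrite normrM; apply: ler_wpM2l => //; exact: S_average.
Qed.

(** If [L i] were 1 almost everywhere on a box, its integral would have to rise from stage [n] on by
    at least [mu n] times the volume, whereas all later changes of this integral are at most a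
    constant times [mu n * mesh n]. *)
Lemma L_not_one i (N : set ((mR * mR) * mR)) : measurable N -> L3 N = 0%E ->
  ~ (forall z, bx z -> ~ N z -> Gd d B Tcs O W z /\ L i (Sl z) = 1).
Proof.
move=> mN N0 HN; set v := (2 * r) ^+ 3.
have v0 : 0 < v by rewrite exprn_gt0// mulr_gt0.
pose I n := \int[L3]_(z in bx) L i (S (W n) z).
have iI n := cont_box_integrable z0 (ltW rgt0) (@cLS i n).
have Iv : I @ \oo --> v.
  have gb n z : bx z -> `|L i (S (W n) z)| <= `|L i (fun _ _ => 0)| + lam i * K.
    move=> /bB zb; rewrite -[L i (S (W n) z)](subrK (L i (fun _ _ => 0))) (le_trans (ler_normD _ _))// addrC lerD2l.
    by apply: L_lipschitz => j k; rewrite subr0; exact: (sp_bU oc j k (ci_U H n zb)).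
  have [] := @dominated_convergence _ _ _ L3 bx mb (fun n z => (L i (S (W n) z))%:E) (fun=> 1%:E)
     (EFin \o (fun=> `|L i (fun _ _ => 0)| + lam i * K)).
  - by move=> n; apply/measurable_EFinP; apply: measurable_funTS; apply: continuous_measurable3; exact: cLS.
  - exact: measurable_cst.
  - exists N; split => // z /= nz; apply: contrapT => nN; apply: nz => zb.
    have [Gz Lz] := HN _ zb nN; have [cv _] := Gd_cvg oc OB H Gz.
    apply: cvg_EFin; first exact: nearW.
    rewrite -Lz; apply/cvgrPdist_lt => e e0; have [m m0 Hm] := L_near i (Sl z) e0.
    have : \forall n \near \oo, forall j k, `|S (W n) z j k - Sl z j k| < m.
      apply: (@filter_forall nat 'I_4 (fun j n => forall k, `|S (W n) z j k - Sl z j k| < m) eventually _) => j.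
      apply: (@filter_forall nat 'I_2 (fun k n => `|S (W n) z j k - Sl z j k| < m) eventually _) => k.
      by have /cvgrPdist_lt/(_ _ m0) := cv j k; apply: filterS => n; rewrite distrC.
    by apply: filterS => n hn; rewrite distrC; apply: Hm.
  - by apply: integrable_cst => //; exact: leb_box_lty (ltW rgt0).
  - by apply: aeW => z n zb; rewrite lee_fin; exact: gb.
  move=> _ _; rewrite integral_cst// mul1e leb_box ?(ltW rgt0)// => /fine_cvg.
  by apply: cvg_trans; apply: near_eq_cvg; exact: nearW.
pose C := lam i * Cb.
(* The margin [mu n] cancels, leaving a lower bound for [mesh n] that does not depend on [n]. *)
have key n : v <= C * mesh n.
  have m0 := ci_mu0 H n.
  apply: (ar_contra m0).
  have In : I n <= (1 - mu n) * v.
    apply: (@le_trans _ _ ((1 - mu n) * fine (L3 bx))); last by rewrite leb_box ?(ltW rgt0).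
    apply: (Rint_le_cst mb (leb_box_lty z0 (ltW rgt0)) (iI n)).
    by move=> z /bB zb; exact: (ci_L H n i zb).
  rewrite lerBlDl -[v in v <= _](cvg_lim _ Iv)//; apply: limr_le; first by apply/cvg_ex; exists v.
  near=> m; have nm : (n <= m)%N by near: m; exists n.
  have := L_average i n (m - n); rewrite subnKC// (RintegralB mb (iI m) (iI n)).
  by move=> /ler_normlW; rewrite lerBlDl => /le_trans; apply; rewrite -mulrA; apply: lerD.
have C1p : 0 < `|C| + 1 by rewrite ltr_pwDr.
have [n hn] := @mesh_small R (v / (`|C| + 1)) (divr_gt0 v0 C1p).
have := key n; apply/negP; rewrite -ltNge.
move: hn; rewrite ltr_pdivlMr// => hn; apply: le_lt_trans hn.
apply: (@le_trans _ _ (`|C| * mesh n)); first by apply: ler_wpM2r; [rewrite ltW// mesh_gt0|exact: ler_norm].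
by rewrite mulrC; apply: ler_wpM2l; [rewrite ltW// mesh_gt0|rewrite lerDl].
Unshelve. all: by end_near.
Qed.

End on_box.

(** A representative continuous at [z0] would keep [Du] within [r0] on a small box, so by [Lr] the
    states there would all lie on one and the same piece, contradicting [L_not_one]. *)
Lemma usol_nowhere : Du_nowhere_continuous Om T (usol W).
Proof.
move=> g [N [mN N0 HN]] z0 Oz0 cg.
have [mN' N0'] := Nset_null oc oOm OmB B0 TB H.
have r2 : 0 < r0 / 2 by rewrite divr_gt0.
have /nbhs_ballP[r1 /= r10 Hr] : nbhs z0 (O `&` [set z | `|g z0 - g z| < r0 / 2]).
  by apply: filterI; [exact: open_nbhs_nbhs|move/cvgrPdist_lt: cg; exact].
pose r := r1 / 2; have rgt0 : 0 < r by rewrite divr_gt0.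
have br : box z0 r `<=` O `&` [set z | `|g z0 - g z| < r0 / 2].
  move=> z /box_norm zr; apply: Hr; rewrite -ball_normE/= distrC; apply: le_lt_trans zr _.
  by rewrite /r ltr_pdivrMr// ltr_pMr// ltr1n.
have bB : box z0 r `<=` box 0 B by move=> z /br[/OB].
pose N' := N `|` Nset d Om T B W.
have mNN : measurable N' by exact: measurableU.
have N'0 : L3 N' = 0%E by rewrite null_set_setU.
have good z : box z0 r z -> ~ N' z -> Gd d B Tcs O W z /\ upper (Sl z) = g z.
  move=> zb nz; have [Oz _] := br _ zb.
  have [Gz Dz] : Gd d B Tcs O W z /\ Dx (usol W) z = upper (Sl z).
    by apply: (Nset_good H Oz) => h; apply: nz; right.
  split => //; rewrite -Dz; apply/esym; apply: contrapT => h; apply: nz; left.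
  by apply: HN => /= /(_ Oz).
have [z1 z1b nz1] : exists2 z, box z0 r z & ~ N' z.
  apply: contrapT => h.
  have sub : box z0 r `<=` N' by move=> z zb; apply: contrapT => nz; apply: h; exists z.
  have : (L3 (box z0 r) <= L3 N')%E by apply: le_measure; rewrite ?inE.
  rewrite N'0 leb_box ?(ltW rgt0)// lee_fin leNgt exprn_gt0//.
  by rewrite mulr_gt0.
have [Gz1 u1] := good _ z1b nz1; have [_ dz1] := Gd_cvg oc OB H Gz1.
have [i Li] := L1 dz1.
apply: (L_not_one rgt0 bB mNN N'0 (i := i)) => z zb nz.
have [Gz uz] := good _ zb nz; have [_ dz] := Gd_cvg oc OB H Gz.
split; first exact: Gz.
have c1 := Sl_closure oc OmB TB H Gz1; have c2 := Sl_closure oc OmB TB H Gz.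
apply: (@Lr i (Sl z1) (Sl z) c1 c2 dz1 dz _ Li) => j k.
exact: (mx_entry_close u1 uz (br _ z1b).2 (br _ zb).2 j k).
Qed.

End nowhere.

(** * Infinitely many solutions *)

Section assembly.
Context {R : realType}.
Notation Z := ((R * R) * R)%type.
Notation d0 := (@Ordinal 3 0 isT).
Notation d1 := (@Ordinal 3 1 isT).
Notation d2 := (@Ordinal 3 2 isT).
Notation k0 := (@Ordinal 2 0 isT).
Notation k1 := (@Ordinal 2 1 isT).
Notation st := ('I_4 -> 'I_2 -> R).

(** The interface between the geometric and the analytic halves. The functions [L i] are barycentric
    coordinates, one of which equals 1 on the graph, and [Lr] says that nearby values of [Du] select
    the same piece. [P0] is a state with [Du = 0] from which the construction starts. *)
Record inclusion (F : 'M[R]_2 -> R) (U M : set st) (d : st -> R) (c K : R)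
    (L : 'I_5 -> st -> R) (l : 'I_5 -> 'I_4 -> 'I_2 -> R) (r0 : R) (P0 : st) : Prop := Inclusion {
  in_split : splittable U M d c K;
  in_La : forall i P Q, L i P - L i Q = \sum_(j < 4) \sum_(k < 2) l i j k * (P j k - Q j k);
  in_L1 : forall i P, U P -> L i P < 1;
  in_Ld : forall P, d P = 0 -> exists i, L i P = 1;
  in_r0 : 0 < r0;
  in_Lr : forall i P Q, st_closure U P -> st_closure U Q -> d P = 0 -> d Q = 0 ->
    (forall j k, `|upper P j k - upper Q j k| < r0) -> L i P = 1 -> L i Q = 1;
  in_F : forall P, st_closure U P -> d P = 0 -> forall i,
    DF F (upper P) i k0 = - P (hi i) k1 /\ DF F (upper P) i k1 = P (hi i) k0;
  in_P0 : U P0;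
  in_P0lo : forall i k, P0 (lo i) k = 0}.

Lemma C1_fst (g : R * R -> R) : continuous g -> (forall k x, derivable g x (e2 R k)) ->
  (forall k, continuous (fun x => 'D_(e2 R k) g x)) ->
  C1 (fun z => g z.1) /\ forall z, 'D_(dir d2) (fun z : Z => g z.1) z = 0.
Proof.
move=> cg dg cDg.
have E v z : 'D_v (fun z : Z => g z.1) z = 'D_(v.1) g z.1 by [].
have D2 : (dir d2 : Z).1 = 0 by [].
have Dz x : is_derive x (0 : R * R) g 0.
  have h : (fun h : R => h^-1 *: ((g \o shift x) (h *: (0 : R * R)) - g x)) @ 0^' --> (0 : R).
    apply: cvg_near_cst; apply: nearW => h.
    by rewrite /= scaler0 add0r subrr scaler0.
  by split; [apply/cvg_ex; exists 0|exact: cvg_lim h].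
have c1 : continuous (fun z : Z => g z.1).
  by move=> z; apply: (@continuous_comp _ _ _ fst g); [exact: cvg_fst|exact: cg].
split; last by move=> z; rewrite E D2; have [_ ->] := Dz z.1.
split => // -[[|[|[|//]]] ik]; set k := Ordinal ik.
- have -> : dir k = (e2 R k0, 0) :> Z by [].
  split=> [z|z]; first exact: (dg k0 z.1).
  by apply: (@continuous_comp _ _ _ fst (fun x => 'D_(e2 R k0) g x)); [exact: cvg_fst|exact: cDg].
- have -> : dir k = (e2 R k1, 0) :> Z by [].
  split=> [z|z]; first exact: (dg k1 z.1).
  by apply: (@continuous_comp _ _ _ fst (fun x => 'D_(e2 R k1) g x)); [exact: cvg_fst|exact: cDg].
have -> : dir k = ((0 : R * R), 1) :> Z by [].
split=> [z|]; first by have [] := Dz z.1.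
have -> : (fun z : Z => 'D_((0 : R * R), 1) (fun z : Z => g z.1) z) = (fun=> 0).
  by apply/funext => z; have [_] := Dz z.1.
exact: cst_continuous.
Qed.

Lemma ar_bg (a p b q B e C D m : R) : `|a - p| <= 8 * B * 0 -> `|b - q| <= 8 * B * (e * C) -> `|q| <= e * D ->
  e * (D + 8 * B * C + 1) < m -> 0 <= e -> `|a + b - p| < m.
Proof.
rewrite mulr0 => /ler_normlP[a1 a2] /ler_normlP[b1 b2] /ler_normlP[q1 q2] em e0.
by rewrite ltr_norml; apply/andP; split; nra.
Qed.

Section problem.
Variables (F : 'M[R]_2 -> R) (U M : set st) (d : st -> R) (c K : R).
Variables (L : 'I_5 -> st -> R) (l : 'I_5 -> 'I_4 -> 'I_2 -> R) (r0 : R) (P0 : st).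
Hypothesis inc : inclusion F U M d c K L l r0 P0.
Variables (Om : set (R * R)) (T : R).
Hypothesis bOm : bounded_domain Om.
Hypothesis T0 : 0 < T.
Variable phi : R * R -> 'rV[R]_2.
Hypothesis Cphi : C1_0 Om phi.

(** The starting map: an affine map with state [P0], which contributes nothing to [u], plus
    [eps * t / T * phi], which has the required initial, lateral and final values. *)
Definition background (eps : R) (j : 'I_4) (z : Z) : R :=
  lin (fun k : 'I_3 => if k == 0%N :> nat then P0 j k0 else if k == 1%N :> nat then P0 j k1 else 0) z +
  eps * (if @fintype.split 2 2 j is inl i then lin (e_ d2) z * (T^-1 * phi z.1 0 i) else 0).

Lemma background_lo eps i z : background eps (lo i) z = eps * (z.2 / T * phi z.1 0 i).
Proof.
rewrite /background (_ : @fintype.split 2 2 (lo i) = inl i); last exact: (unsplitK (inl i)).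
set x := lin _ z; have -> : x = 0 by rewrite /x !(in_P0lo inc) /lin /= !mul0r !addr0.
by rewrite add0r lin_e /co /= -mulrA.
Qed.

Let phi_C1 i : C1 (fun z : Z => phi z.1 0 i) /\ forall z, 'D_(dir d2) (fun z : Z => phi z.1 0 i) z = 0.
Proof.
have [c0 [dphi _]] := Cphi.
apply: (@C1_fst (fun x => phi x 0 i)).
- by move=> x; apply: (@continuous_comp _ _ _ phi (fun M : 'rV[R]_2 => M 0 i)); [exact: c0|exact: coord_continuous].
- by move=> k x; have /derivable_mxP := (dphi k).1 x.
move=> k; rewrite (_ : (fun x => _) = (fun x => ('D_(e2 R k) phi x) 0 i)).
  move=> x; apply: (@continuous_comp _ _ _ (fun x => 'D_(e2 R k) phi x) (fun M : 'rV[R]_2 => M 0 i)); last exact: coord_continuous.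
  exact: (dphi k).2.
by apply/funext => x; rewrite derive_mx ?mxE//; exact: (dphi k).1.
Qed.

Let v (j : 'I_4) (z : Z) : R :=
  if @fintype.split 2 2 j is inl i then lin (e_ d2) z * (T^-1 * phi z.1 0 i) else 0.
Let al (j : 'I_4) (k : 'I_3) : R := if k == 0%N :> nat then P0 j k0 else if k == 1%N :> nat then P0 j k1 else 0.

Let is_derive_lin1 a k (z : Z) : is_derive z (dir k) (lin a) (a k).
Proof.
by have := @is_derive_lin R (fun s => s) (fun=> 1) a k z; rewrite mulr1; apply.
Qed.

Let C1_lin1 a : C1 (lin a : Z -> R).
Proof. by apply: (@C1_lin R (fun s => s) (fun=> 1))  => s; exact: cvg_cst. Qed.

Let Cv j : C1 (v j).
Proof.
rewrite /v; case: (@fintype.split 2 2 j) => [i|_]; last exact: C1_cst.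
by apply: C1M; [exact: C1_lin1|apply: C1Z; have [] := phi_C1 i].
Qed.

Let phi_bound i : exists C : R, 0 <= C /\ forall x, `|phi x 0 i| <= C.
Proof.
have [_ [_ [_ [M0 HM]]]] := bOm; have [_ [_ [KK [_ [KO K0]]]]] := Cphi.
have [C HC] := @cont_box_bounded R (fun z : Z => phi z.1 0 i) 0 `|M0| (@C1c R _ (phi_C1 i).1).
have C0 : 0 <= C.
  apply: le_trans (HC 0 _) => //; apply/boxP => k; by rewrite subrr normr0.
exists C; split => // x; have [xO|xO] := pselect (Om x); last first.
  by rewrite K0 ?mxE ?normr0// => /KO.
have [h1 h2] := HM x xO; apply: (HC (x, 0)); split; [split|]; apply/csegE; rewrite /= subr0.
- exact: le_trans h1 (ler_norm _).
- exact: le_trans h2 (ler_norm _).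
- by rewrite normr0.
Qed.

Let vt_bound j : exists C : R, forall z, `|'D_(dir d2) (v j) z| <= C.
Proof.
rewrite /v; case: (@fintype.split 2 2 j) => [i|_]; last first.
  exists 0 => z; have [_ ->] := @is_derive_cst R _ _ (0 : R) z (dir d2 : Z).
  by rewrite normr0.
have [C [C0 HC]] := phi_bound i; have [Cp Dp] := phi_C1 i.
exists (T^-1 * C) => z.
have -> := @deriveMC1 R _ _ d2 z (C1_lin1 (e_ d2)) (C1Z T^-1 Cp).
have -> := @deriveZC1 R T^-1 _ d2 z Cp.
have [_ ->] := is_derive_lin1 (e_ d2) d2 z.
rewrite Dp !mulr0 add0r mulr1 normrM (gtr0_norm (_ : 0 < T^-1)) ?invr_gt0//.
by apply: ler_wpM2l; rewrite ?invr_ge0 ?(ltW T0).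
Qed.

Lemma C1_background eps j : C1 (background eps j).
Proof. by apply: C1D; [exact: C1_lin1|apply: C1Z; exact: Cv]. Qed.

Lemma background_in B : 0 < B -> exists2 eps0, 0 < eps0 &
  forall eps, `|eps| < eps0 -> forall z, box 0 B z -> U (St B Tcs (background eps) z).
Proof.
move=> B0; have oc := in_split inc.
have [m m0 Hm] := sp_oU oc (in_P0 inc).
have /choice[C HC] := vt_bound.
have /choice[D HD] (jk : 'I_4 * 'I_2) := @cont_box_bounded R _ 0 B (@C1Dc R (v jk.1) (wd jk.2) (Cv jk.1)).
pose Cs := \sum_(j < 4) `|C j|; pose Ds := \sum_(j < 4) \sum_(k < 2) `|D (j, k)|.
have CC j z : `|'D_(dir d2) (v j) z| <= Cs.
  apply: (le_trans (HC j z)); apply: (le_trans (ler_norm _)).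
  by rewrite /Cs (bigD1 j)//= lerDl sumr_ge0.
have DD j k z : box 0 B z -> `|'D_(dir (wd k)) (v j) z| <= Ds.
  move=> zb; apply: (le_trans (HD (j, k) z zb)); apply: (le_trans (ler_norm _)).
  rewrite /Ds (bigD1 j)//= (bigD1 k)//= -addrA lerDl addr_ge0// sumr_ge0// => *.
  exact: sumr_ge0.
have Cs0 : 0 <= Cs by exact: sumr_ge0.
have Ds0 : 0 <= Ds by apply: sumr_ge0 => *; exact: sumr_ge0.
pose Q := Ds + 8 * B * Cs + 1.
have Q0 : 0 < Q by rewrite ltr_pwDr// addr_ge0// !mulr_ge0// ltW.
exists (m / Q); first exact: divr_gt0.
move=> eps he z zb; apply: Hm => j k.
have CL j' : C1 (lin (al j') : Z -> R) by exact: C1_lin1.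
have CV j' : C1 (fun z => eps * v j' z) by apply: C1Z; exact: Cv.
have zB : co d1 z <= B by move/boxP: zb => /(_ d1); rewrite subr0 => /ler_normlW.
have -> : St B Tcs (background eps) z j k = St B Tcs (fun j => lin (al j)) z j k + St B Tcs (fun j z => eps * v j z) z j k.
  exact: (@StD R B Tcs (fun j => lin (al j)) (fun j z => eps * v j z) z j k CL CV).
have h1 : `|St B Tcs (fun j => lin (al j)) z j k - 'D_(dir (wd k)) (lin (al j)) z| <= 8 * B * 0.
  apply: (St_bound B0 (@Tcs1 R)) => // i z'.
  by have [_ ->] := is_derive_lin1 (al i) d2 z'; rewrite normr0.
have h2 : `|St B Tcs (fun j z => eps * v j z) z j k - 'D_(dir (wd k)) (fun z => eps * v j z) z| <= 8 * B * (`|eps| * Cs).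
  apply: (St_bound B0 (@Tcs1 R)) => // i z'.
  have -> := @deriveZC1 R eps _ d2 z' (Cv i).
  by rewrite normrM; apply: ler_wpM2l.
have h3 : `|'D_(dir (wd k)) (fun z => eps * v j z) z| <= `|eps| * Ds.
  have -> := @deriveZC1 R eps _ (wd k) z (Cv j).
  by rewrite normrM; apply: ler_wpM2l => //; exact: DD.
have h4 : 'D_(dir (wd k)) (lin (al j)) z = P0 j k.
  have [_ ->] := is_derive_lin1 (al j) (wd k) z; rewrite /al.
  by case: k {h1 h2 h3} => -[|[|//]] ik /=; congr (P0 j _); exact: val_inj.
rewrite h4 in h1.
have h5 : `|eps| * Q < m by rewrite -ltr_pdivlMr.
exact: (ar_bg h1 h2 h3 h5 (normr_ge0 eps)).
Qed.

Definition parabolic_solution (eps : R) (u : Z -> 'rV[R]_2) : Prop :=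
  lip_weak_solution F Om T u /\ zero_on_parabolic_boundary Om T u /\
  (forall x, Om x -> u (x, T) = eps *: phi x) /\ Du_nowhere_continuous Om T u.

Lemma solutions_exist : exists2 eps0, 0 < eps0 & forall eps, `|eps| < eps0 -> forall e, 0 < e ->
  exists u, parabolic_solution eps u /\ forall i z, `|u z 0 i - background eps (lo i) z| <= e.
Proof.
have oc := in_split inc; have [oOm [_ [_ [M0 HM]]]] := bOm.
pose B := `|M0| + T + 1.
have B0 : 0 < B by rewrite ltr_pwDr// addr_ge0// ltW.
have TB : T <= B by rewrite /B [`|M0| + T]addrC -addrA lerDl addr_ge0.
have OmB x : Om x -> `|x.1| < B /\ `|x.2| < B.
  move=> /HM[h1 h2]; have h : M0 < B by rewrite /B -addrA (le_lt_trans (ler_norm _))// ltrDl addr_gt0.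
  by split; [exact: le_lt_trans h1 h|exact: le_lt_trans h2 h].
have [eps0 e00 He] := background_in B0.
exists eps0 => // eps /He Hin e e0.
have oO : open (OmT Om T) by exact: open_OmT.
have OB := OmT_box OmB TB.
have [W [mu H]] := iterate oc (L_near (in_La inc)) (in_L1 inc) B0 (@Tcs1 R) oO OB (C1_background eps) Hin e0.
exists (usol W); split; last by move=> i z; rewrite mxE; exact: (usol_close H).
have off z i : ~ OmT Om T z -> usol W z 0 i = eps * (z.2 / T * phi z.1 0 i).
  by move=> nO; rewrite mxE (ul_off H _ nO) background_lo.
have [_ [_ [KK [_ [KO K0]]]]] := Cphi.
split; [|split; [split|split]].
- split; first exact: (usol_lipschitz oc OmB TB H).
  by move=> psi tpsi; exact: (usol_weak oc (in_F inc) oOm OmB B0 T0 TB H tpsi).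
- move=> x Ox; apply/rowP => i; rewrite off /= ?mul0r ?mul0r ?mulr0 ?mxE//.
  by move=> [_ /=]; rewrite ltxx.
- move=> x t [_ nx] _; apply/rowP => i; rewrite off /=; last by move=> [].
  by rewrite K0 ?mxE ?mulr0// => /KO.
- move=> x Ox; apply/rowP => i; rewrite off /= ?mxE ?divff ?mul1r ?gt_eqF//.
  by move=> [_ /=]; rewrite ltxx andbF.
- exact: (usol_nowhere oc (in_La inc) (in_Ld inc) (in_r0 inc) (in_Lr inc) oOm OmB B0 TB H).
Qed.

(** The background has a continuous spatial gradient, which a solution cannot have. *)
Lemma solution_neq_background eps u : parabolic_solution eps u ->
  exists z, OmT Om T z /\ exists i, u z 0 i <> background eps (lo i) z.
Proof.
move=> [_ [_ [_ nw]]]; apply: contrapT => h.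
have E z i : OmT Om T z -> u z 0 i = background eps (lo i) z.
  by move=> Oz; apply: contrapT => ne; apply: h; exists z; split => //; exists i.
have [oOm [_ [[x Ox] _]]] := bOm.
have Oz : OmT Om T (x, T / 2) by split => //=; rewrite divr_gt0//= ltr_pdivrMr// ltr_pMr// ltr1n.
pose g z : 'M[R]_2 := \matrix_(i, k) 'D_(dir (wd k)) (background eps (lo i)) z.
apply: (nw g _ _ Oz).
  apply: aeW => z Oz'; apply/matrixP => i k; rewrite !mxE dir_ex.
  apply: near_eq_derive; have oO : open (OmT Om T) by exact: open_OmT.
  have : nbhs z (OmT Om T) by exact: open_nbhs_nbhs.
  by apply: filterS => y Oy; rewrite E.
apply/cvgrPdist_lt => e e0; set z0 := (x, T / 2).
have : \forall z \near z0, forall i k, `|g z0 i k - g z i k| < e.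
  apply: (@filter_forall Z 'I_2 (fun i z => forall k, `|g z0 i k - g z i k| < e) (nbhs z0) _) => i.
  apply: (@filter_forall Z 'I_2 (fun k z => `|g z0 i k - g z i k| < e) (nbhs z0) _) => k.
  have := @C1Dc R _ (wd k) (C1_background eps (lo i)) z0 => /cvgrPdist_lt/(_ _ e0).
  by apply: filterS => z; rewrite !mxE.
apply: filterS => z hz; rewrite [ltLHS]/Num.Def.normr/= mx_normrE; apply: bigmax_lt => //= -[i k] _ /=.
have -> : (g z0 - g z) i k = g z0 i k - g z i k by rewrite !mxE.
exact: hz.
Qed.

Lemma infinitely_many_solutions : exists2 eps0, 0 < eps0 & forall eps, `|eps| < eps0 ->
  exists u : nat -> Z -> 'rV[R]_2, (forall n, parabolic_solution eps (u n)) /\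
    forall m n, m <> n -> exists z, OmT Om T z /\ u m z <> u n z.
Proof.
have [eps0 e00 He] := solutions_exist; exists eps0 => // eps /He {}He.
have /choice[f Hf] (e : R) : exists uzi : (Z -> 'rV[R]_2) * Z * 'I_2, 0 < e ->
    [/\ parabolic_solution eps uzi.1.1, forall i z, `|uzi.1.1 z 0 i - background eps (lo i) z| <= e,
      OmT Om T uzi.1.2 & 0 < `|uzi.1.1 uzi.1.2 0 uzi.2 - background eps (lo uzi.2) uzi.1.2| ].
  have [e0|ne] := ltP 0 e; last by exists ((fun=> 0), 0, k0).
  have [u [pu hu]] := He e e0; have [z [Oz [i ne]]] := solution_neq_background pu.
  by exists (u, z, i) => _; split => //=; rewrite normr_gt0 subr_eq0; apply/eqP.
pose gap e := `|(f e).1.1 (f e).1.2 0 (f e).2 - background eps (lo (f e).2) (f e).1.2|.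
(* Each solution differs from the background by [gap] at some point; the later ones are chosen
   within half of that gap of the background, hence differ from it at the same point. *)
pose es := fix es n : R := if n is n'.+1 then Num.min (es n') (gap (es n') / 2) else 1.
have es0 n : 0 < es n.
  elim: n => [|n IH]//=; rewrite lt_min IH/= divr_gt0//.
  by have [] := Hf _ IH.
exists (fun n => (f (es n)).1.1); split=> [n|]; first by have [] := Hf _ (es0 n).
have lt m n : (m < n)%N -> exists z, OmT Om T z /\ (f (es m)).1.1 z <> (f (es n)).1.1 z.
  move=> mn; have [_ _ Oz gm] := Hf _ (es0 m).
  exists (f (es m)).1.2; split => // Euv.
  have [_ cl _ _] := Hf _ (es0 n).
  have := cl (f (es m)).2 (f (es m)).1.2; rewrite -Euv; apply/negP; rewrite -ltNge.
  have em : es n <= gap (es m) / 2.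
    elim: n mn {Euv cl} => // n IH; rewrite ltnS leq_eqVlt => /orP[/eqP<-|/IH h] /=.
      by rewrite ge_min lexx orbT.
    by rewrite ge_min h.
  by apply: (le_lt_trans em); rewrite ltr_pdivrMr// ltr_pMr// ltr1n.
move=> m n; have [mn _|nm _|->//] := ltngtP m n; first exact: lt.
by have [z [Oz h]] := lt _ _ nm; exists z; split => // E; apply: h.
Qed.

End problem.
End assembly.

(** * The set of states generated by a T_5 configuration *)

Lemma cvg_bigsum {R : realType} {T I : Type} (F : set_system T) {FF : Filter F} (r : seq I) (f : I -> T -> R) (l : I -> R) :
  (forall i, f i @ F --> l i) -> (fun x => \sum_(i <- r) f i x) @ F --> \sum_(i <- r) l i.
Proof.
move=> H; elim: r => [|i r IH].
  rewrite big_nil; under eq_fun do rewrite big_nil; exact: cvg_cst.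
rewrite big_cons; under eq_fun do rewrite big_cons; exact: cvgD.
Qed.

Lemma zmod_swap (V : zmodType) (t1 t2 a b : V) : t1 - b - (t2 - a) = t1 - t2 - (b - a).
Proof. by rewrite !opprB addrACA [RHS]addrACA [- b + _]addrC. Qed.

Lemma ar_hk (R : realType) (e m r : R) : 0 < e -> m < r / (2 * e) -> e * m <= r / 2.
Proof. by move=> e0; rewrite ltr_pdivlMr ?mulr_gt0// => h; rewrite ler_pdivlMr//; lra. Qed.

Lemma mesh_le (R : realType) k : mesh k.+1 <= mesh k :> R.
Proof. by rewrite [leRHS]meshS; have := @mesh_gt0 R k.+1; lra. Qed.

Lemma mesh_half (R : realType) (a e : R) k : a <= e * mesh k.+1 -> 2^-1 * a <= e * mesh k.+2.
Proof. by move=> h; rewrite /mesh exprS mulrCA ler_wpM2l. Qed.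

(** * Zero sets that persist under perturbation *)

Section local_solve.
Context {R : realType}.
Variables (m n : nat).
Notation Vm := 'rV[R]_m.+1.
Notation Vn := 'rV[R]_n.+1.

Lemma rV_entry_le (p : nat) (v : 'rV[R]_p) j : `|v 0 j| <= `|v|.
Proof.
rewrite [leRHS]/Num.Def.normr/= mx_normrE.
exact: (le_bigmax _ (fun ij : 'I_1 * 'I_p => `|v ij.1 ij.2|) (0, j)).
Qed.

Lemma rV_le (p : nat) (v : 'rV[R]_p) C : 0 <= C -> (forall j, `|v 0 j| <= C) -> `|v| <= C.
Proof.
move=> C0 H; rewrite [leLHS]/Num.Def.normr/= mx_normrE (bigmax_le _ C0)//= => -[i j] _.
by rewrite ord1.
Qed.

Lemma mulmx_le (v : Vn) (Q : 'M[R]_n.+1) e : (forall i j, `|Q i j| <= e) -> `|v *m Q| <= n.+1%:R * e * `|v|.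
Proof.
move=> Qe; have e0 : 0 <= e by apply: le_trans (Qe 0 0).
apply: rV_le => [|j]; first by rewrite !mulr_ge0.
rewrite mxE; apply: (le_trans (ler_norm_sum _ _ _)).
apply: (@le_trans _ _ (\sum_(i < n.+1) `|v| * e)).
  by apply: ler_sum => i _; rewrite normrM ler_pM// rV_entry_le.
by rewrite sumr_const card_ord -[leLHS]mulr_natl [`|v| * e]mulrC mulrA.
Qed.

Variables (Phi : Vm -> Vn -> Vn) (S : Vm -> Vn -> Vn -> 'M[R]_n.+1) (y0 : Vm) (t0 : Vn).
Hypothesis PhiS : forall y t t', Phi y t - Phi y t' = (t - t') *m S y t t'.
Hypothesis cS : forall i j, {for (y0, t0, t0), continuous (fun p : Vm * Vn * Vn => S p.1.1 p.1.2 p.2 i j)}.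
Hypothesis uS : S y0 t0 t0 \in unitmx.

(* The zero set of Phi is locally a graph over y: the Newton map t - Phi(y,t) S0^-1 contracts. *)
Lemma local_solve : exists2 dl, 0 < dl & forall y t, `|y - y0| < dl -> `|t - t0| < dl ->
  Phi y t = 0 -> (forall j, {for y, continuous (fun y => Phi y t 0 j)}) ->
  forall e, 0 < e -> exists2 dl', 0 < dl' & forall y', `|y' - y| < dl' ->
    exists2 t', `|t' - t| < e & Phi y' t' = 0.
Proof.
pose S0 := S y0 t0 t0; pose Q p := 1%:M - S p.1.1 p.1.2 p.2 *m invmx S0 : 'M[R]_n.+1.
(* By [mulmx_le] a matrix of size [n.+1] with entries at most [k] halves norms, so the Newton map
   contracts by 1/2. *)
pose k := (2 * n.+1%:R)^-1 : R.
have k0 : 0 < k by rewrite invr_gt0 mulr_gt0// ltr0n.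
have nQ : \forall p \near (y0, t0, t0), forall i j, `|Q p i j| <= k.
  apply: (@filter_forall (Vm * Vn * Vn)%type 'I_n.+1 (fun i p => forall j, `|Q p i j| <= k) (nbhs (y0, t0, t0)) _) => i.
  apply: (@filter_forall (Vm * Vn * Vn)%type 'I_n.+1 (fun j p => `|Q p i j| <= k) (nbhs (y0, t0, t0)) _) => j.
  have c : (fun p => Q p i j) @ (y0, t0, t0) --> (1%:M - S0 *m invmx S0) i j.
    rewrite !mxE (_ : (fun p => _) = (fun p => (i == j)%:R - \sum_l S p.1.1 p.1.2 p.2 i l * invmx S0 l j)).
      apply: cvgB; first exact: cvg_cst.
      apply: cvg_bigsum => l; apply: cvgM; [exact: cS|exact: cvg_cst].
    by apply/funext => p; rewrite !mxE.
  rewrite mulmxV// subrr mxE in c.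
  have /cvgrPdist_le/(_ _ k0) := c; apply: filterS => p; by rewrite sub0r normrN.
have /nbhs_ballP[d1 /= d10 Hd] := nQ.
pose dl := d1 / 2; have dl0 : 0 < dl by rewrite divr_gt0.
have dd : d1 = dl + dl by rewrite /dl -splitr.
exists dl => // y t yd td Py cy e e0.
pose e1 := Num.min e dl / 2.
have m0 : 0 < Num.min e dl by rewrite lt_min e0.
have e10 : 0 < e1 by rewrite divr_gt0.
have e1m : e1 < Num.min e dl by rewrite ltr_pdivrMr// ltr_pMr// ltr1n.
have [e1e e1d] : e1 < e /\ e1 < dl by move: e1m; rewrite lt_min => /andP[].
pose C := \big[Order.max/0]_(ij : 'I_n.+1 * 'I_n.+1) `|invmx S0 ij.1 ij.2|.
have iC i j : `|invmx S0 i j| <= C.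
  exact: (le_bigmax _ (fun ij : 'I_n.+1 * 'I_n.+1 => `|invmx S0 ij.1 ij.2|) (i, j)).
have C0 : 0 <= C by apply: le_trans (iC 0 0).
have q0 : 0 < n.+1%:R * C + 1 by rewrite ltr_pwDr// mulr_ge0.
have e12 : 0 < e1 / 2 by rewrite divr_gt0.
pose r1 := e1 / 2 / (n.+1%:R * C + 1).
have r10 : 0 < r1 by rewrite divr_gt0.
have nP : \forall y' \near y, forall j, `|Phi y' t 0 j| <= r1.
  apply: (@filter_forall Vm 'I_n.+1 (fun j y' => `|Phi y' t 0 j| <= r1) (nbhs y) _) => j.
  have /cvgrPdist_le/(_ _ r10) := cy j; rewrite Py mxE.
  by apply: filterS => y'; rewrite sub0r normrN.
have /nbhs_ballP[d2 /= d20 Hd2] := nP.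
exists (Num.min dl d2); first by rewrite lt_min dl0.
move=> y'; rewrite lt_min => /andP[yy1 yy2].
have P1 : `|Phi y' t *m invmx S0| <= e1 / 2.
  apply: (le_trans (mulmx_le _ iC)); apply: (@le_trans _ _ (n.+1%:R * C * r1)).
    apply: ler_wpM2l; first by rewrite mulr_ge0.
    by apply: rV_le; [exact: ltW|apply: Hd2; rewrite -ball_normE/= distrC].
  rewrite /r1 mulrA ler_pdivrMr// [leLHS]mulrC; apply: ler_wpM2l; first exact: ltW.
  by rewrite lerDl.
have nk : n.+1%:R * k = 2^-1 by rewrite /k invfM mulrCA divff ?mulr1// pnatr_eq0.
pose U := [set t' : Vn | `|t' - t| <= e1].
pose N t' := t' - Phi y' t' *m invmx S0.
have inQ t' : U t' -> `|t' - t0| < d1.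
  move=> tU; rewrite -(subrK t t') -addrA dd (le_lt_trans (ler_normD _ _))//.
  by apply: ltrD => //; exact: le_lt_trans tU e1d.
have yd1 : `|y' - y0| < d1.
  rewrite -(subrK y y') -addrA dd (le_lt_trans (ler_normD _ _))//.
  exact: ltrD.
have NQ t1 t2 : U t1 -> U t2 -> `|N t1 - N t2| <= 2^-1 * `|t1 - t2|.
  move=> u1 u2.
  have -> : N t1 - N t2 = (t1 - t2) *m Q (y', t1, t2).
    rewrite mulmxBr mulmx1 mulmxA -PhiS mulmxBl; exact: zmod_swap.
  have Qk : forall i j, `|Q (y', t1, t2) i j| <= k.
    apply: Hd; rewrite -ball_normE/= -[`|_|]/(Num.max _ _) -[`|_.1|]/(Num.max _ _) /= !gt_max.
    by apply/andP; split; [apply/andP; split|]; rewrite distrC; [exact: yd1|exact: inQ|exact: inQ].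
  by rewrite -nk; exact: mulmx_le.
have Ut : U t by rewrite /U/= subrr normr0 ltW.
have NU t' : U t' -> U (N t').
  move=> u; rewrite /U/= -(subrK (N t) (N t')) -addrA (le_trans (ler_normD _ _))//.
  rewrite [leRHS]splitr; apply: lerD; last by rewrite /N addrAC subrr sub0r normrN.
  by rewrite (le_trans (NQ _ _ u Ut))// mulrC ler_wpM2r.
have [x x0 xS] : exists2 x : nat -> Vn, x 0%N = t & forall k, x k.+1 = N (x k).
  by exists (fun k => iter k N t).
have xU k' : U (x k') by elim: k' => [|k' IH]; [rewrite x0|rewrite xS; exact: NU].
have xx k' : `|x k'.+1 - x k'| <= e1 * mesh k'.+1.
  elim: k' => [|k' IH].
    by rewrite xS x0 /N addrAC subrr sub0r normrN /mesh expr1.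
  apply: (@le_trans _ _ (2^-1 * `|x k'.+1 - x k'|)).
    have := NQ _ _ (xU k'.+1) (xU k'); rewrite -(xS k'.+1) -(xS k'); exact.
  exact: mesh_half.
have xc j k' : `|x k'.+1 0 j - x k' 0 j| <= e1 * mesh k'.+1.
  by apply: le_trans (xx k'); have := rV_entry_le (x k'.+1 - x k') j; rewrite !mxE.
have xj j := @geometric_cvg R (fun k => x k 0 j) (fun=> e1) (fun=> e10) (fun=> lexx _) (xc j).
pose t' : Vn := \row_j limn (fun k => x k 0 j).
have tx k' : `|t' - x k'| <= e1 * mesh k'.
  apply: rV_le => [|j]; first by rewrite mulr_ge0// ltW// mesh_gt0.
  by rewrite !mxE; have [_] := xj j; apply.
have Ut' : U t' by have := tx 0%N; rewrite x0 /mesh expr0 mulr1.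
exists t'; first exact: le_lt_trans Ut' e1e.
have Nt : N t' - t' = 0.
  apply/eqP; rewrite -normr_le0; apply/ler_addgt0Pr => r r0; rewrite add0r.
  have [k' hk] := @mesh_small R (r / (2 * e1)) (divr_gt0 r0 (mulr_gt0 (ltr0Sn _ 1) e10)).
  have hk2 : e1 * mesh k' <= r / 2 by exact: ar_hk.
  rewrite -(subrK (x k'.+1) (N t')) -addrA (le_trans (ler_normD _ _))// [leRHS]splitr; apply: lerD.
    rewrite xS; apply: (le_trans (NQ _ _ Ut' (xU k'))); apply: le_trans hk2; apply: le_trans (tx k').
    by rewrite ler_piMl// invf_le1// ler1n.
  rewrite distrC; apply: (le_trans (tx _)); apply: le_trans hk2; apply: ler_wpM2l; first exact: ltW.
  exact: mesh_le.
have E : Phi y' t' *m invmx S0 = 0.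
  by apply/eqP; rewrite -oppr_eq0; apply/eqP; rewrite -[RHS]Nt /N addrAC subrr sub0r.
by rewrite -[LHS](mulmxKV uS) E mul0mx.
Qed.

End local_solve.

(** * The perturbed loops and the open set they sweep out *)

Section geometry.
Context {R : realType}.
Notation k0 := (@Ordinal 2 0 isT).
Notation k1 := (@Ordinal 2 1 isT).
Notation st := ('I_4 -> 'I_2 -> R).
Notation mt := ('I_2 -> 'I_2 -> R).
Notation V5 := 'rV[R]_5.
Variables (Bv : 'I_5 -> mt) (g mm : R).

(* Homogeneous coordinates of the i-th corner of the loop: passing the segment towards [Bv i] multiplies the
   i-th weight by [g], so that the loop closes up to a common factor. *)
Definition wt (i : nat) (Y : V5) (j : 'I_5) : R := (if (j < i)%N then g else 1) * Y 0 j.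
Definition Nn (i : nat) (Y : V5) : R := \sum_j wt i Y j.
Definition wn (i : nat) (Y : V5) (j : 'I_5) : R := wt i Y j / Nn i Y.
(** The parameter at which the segment from corner [i] towards [Bv i] reaches corner [i + 1], where
    the loop turns; see [sw_lam]. *)
Definition lam (i : 'I_5) (Y : V5) : R := (g - 1) * Y 0 i / Nn i.+1 Y.
Definition sw (i : 'I_5) (s : R) (Y : V5) (j : 'I_5) : R := (1 - s) * wn i Y j + s * (j == i)%:R.
Definition comb (w : 'I_5 -> R) (r k : 'I_2) : R := \sum_j w j * Bv j r k.
Definition Vv (i : 'I_5) (Y : V5) (r k : 'I_2) : R := Bv i r k - comb (wn i Y) r k.
Definition xi (t : R) (k : 'I_2) : R := if k == k0 then t else 1.
(** Orthogonal projection of each row of [v] onto the wave vector [(t, 1)]. *)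
Definition proj (v : mt) (t : R) (r k : 'I_2) : R := (v r k0 * t + v r k1) * xi t k / (1 + t ^+ 2).
(** The divided difference of [proj] in the slope, in closed form, so that it is continuous across
    [t = t'] and serves both as exact difference and as derivative. *)
Definition dproj (v : mt) (t t' : R) (r k : 'I_2) : R :=
  (if k == k0 then v r k0 * (t + t') + v r k1 * (1 - t * t')
   else v r k0 * (1 - t * t') - v r k1 * (t + t')) / ((1 + t ^+ 2) * (1 + t' ^+ 2)).
(** A wave-cone motion changes [sigma] orthogonally to the wave vector, so the part of [Vv i] along
    the wave vector has to come from [- mm * A]; this fixes the change of [A] along the segment. *)
Definition Ast (i : 'I_5) (Y t : V5) (r k : 'I_2) : R := - (mm^-1 * proj (Vv i Y) (t 0 i) r k).
Definition Aof (i : nat) (Y t : V5) (r k : 'I_2) : R := \sum_(j < 5 | (j < i)%N) lam j Y * Ast j Y t r k.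
(* [sigma - mm A], where row [r] of [sigma] is [(- N r 1, N r 0)] *)
Definition tau (P : st) (r k : 'I_2) : R := (if k == k0 then - P (hi r) k1 else P (hi r) k0) - mm * P (lo r) k.

Lemma sqr1_gt0 (t : R) : 0 < 1 + t ^+ 2.
Proof. by rewrite ltr_pwDl// sqr_ge0. Qed.
Let sqr1_neq0 (t : R) : 1 + t ^+ 2 != 0.
Proof. by rewrite gt_eqF// sqr1_gt0. Qed.

Lemma ord2P (k : 'I_2) : {k = k0} + {k = k1}.
Proof. by case: k => -[|[|//]] ik; [left|right]; exact: val_inj. Qed.

Lemma dprojP v t t' r k : proj v t r k - proj v t' r k = (t - t') * dproj v t t' r k.
Proof.
have h1 := sqr1_neq0 t; have h2 := sqr1_neq0 t'.
by rewrite /proj /dproj /xi; case: (ord2P k) => -> /=; field; rewrite h1 h2.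
Qed.

Hypothesis g1 : 1 < g.
Hypothesis mm0 : 0 < mm.
Definition pos (Y : V5) := forall j, 0 < Y 0 j.

Lemma sum_delta (i : 'I_5) (f : 'I_5 -> R) : \sum_j (j == i)%:R * f j = f i.
Proof. by rewrite (bigD1 i)//= eqxx mul1r big1 ?addr0// => j /negbTE ->; rewrite mul0r. Qed.

Section at_point.
Variable Y : V5.
Hypothesis pY : pos Y.

Lemma wt_gt0 i j : 0 < wt i Y j.
Proof. by rewrite mulr_gt0 ?pY//; case: ifP => // _; exact: lt_trans g1. Qed.

Lemma Nn_gt0 i : 0 < Nn i Y.
Proof.
rewrite /Nn (bigD1 ord0)//= ltr_pwDl ?wt_gt0// sumr_ge0// => j _.
by rewrite ltW// wt_gt0.
Qed.

Lemma wn_gt0 i j : 0 < wn i Y j.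
Proof. by rewrite divr_gt0 ?wt_gt0 ?Nn_gt0. Qed.

Lemma sum_wn i : \sum_j wn i Y j = 1.
Proof. by rewrite /wn -mulr_suml divff// gt_eqF// Nn_gt0. Qed.

Lemma wtS (i : 'I_5) j : wt i.+1 Y j = wt i Y j + (j == i)%:R * ((g - 1) * Y 0 i).
Proof.
rewrite /wt ltnS leq_eqVlt; have [->|ji] := eqVneq j i; first by rewrite eqxx ltnn/=; ring.
by rewrite (_ : (nat_of_ord j == i) = false) ?mul0r ?addr0//; exact/negbTE.
Qed.

Lemma NnS (i : 'I_5) : Nn i.+1 Y = Nn i Y + (g - 1) * Y 0 i.
Proof.
rewrite /Nn; under eq_bigr do rewrite wtS.
by rewrite big_split/= (sum_delta i (fun=> (g - 1) * Y 0 i)).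
Qed.

Lemma lam_gt0 i : 0 < lam i Y.
Proof. by rewrite divr_gt0 ?Nn_gt0// mulr_gt0 ?pY// subr_gt0. Qed.

Lemma lam_lt1 i : lam i Y < 1.
Proof. by rewrite ltr_pdivrMr ?Nn_gt0// mul1r NnS ltrDr Nn_gt0. Qed.

Lemma sum_sw i s : \sum_j sw i s Y j = 1.
Proof.
rewrite /sw big_split/= -!mulr_sumr sum_wn (eq_bigr (fun j => (j == i)%:R * 1)) ?(sum_delta i (fun=> 1)); last by move=> j _; rewrite mulr1.
by ring.
Qed.

Lemma sw_lam (i : 'I_5) j : sw i (lam i Y) Y j = wn i.+1 Y j.
Proof.
have h1 : Nn i Y != 0 by rewrite gt_eqF// Nn_gt0.
have h2 : Nn i Y + (g - 1) * Y 0 i != 0 by rewrite -NnS gt_eqF// Nn_gt0.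
rewrite /sw /wn wtS /lam NnS; case: (j == i) => /=; field; by rewrite h1 h2.
Qed.

Lemma wn5 j : wn 5 Y j = wn 0 Y j.
Proof.
have E j' : wt 5 Y j' = g * wt 0 Y j' by rewrite /wt ltn_ord ltn0 mul1r.
rewrite /wn /Nn (eq_bigr _ (fun j' _ => E j')) -mulr_sumr E invfM mulrACA divff ?mul1r//.
by rewrite gt_eqF// (lt_trans _ g1).
Qed.

Lemma comb_sw i s r k : comb (sw i s Y) r k = comb (wn i Y) r k + s * Vv i Y r k.
Proof.
rewrite /Vv /comb (eq_bigr (fun j => (1 - s) * (wn i Y j * Bv j r k) + s * ((j == i)%:R * Bv j r k))).
  by rewrite big_split/= -!mulr_sumr (sum_delta i (fun j => Bv j r k)); ring.
by move=> j _; rewrite /sw; ring.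
Qed.

End at_point.

Lemma Aof0 Y t r k : Aof 0 Y t r k = 0.
Proof. by rewrite /Aof big1. Qed.

Lemma AofS (i : 'I_5) Y t r k : Aof i.+1 Y t r k = Aof i Y t r k + lam i Y * Ast i Y t r k.
Proof.
rewrite /Aof (bigD1 i)//= addrC; congr (_ + _); apply: eq_bigl => j.
have [->|ji] := eqVneq j i; first by rewrite ltnn andbF.
by rewrite andbT ltnS leq_eqVlt (_ : (nat_of_ord j == i) = false)//; exact/negbTE.
Qed.

Notation c0 := (@Ordinal 5 0 isT).
Notation c1 := (@Ordinal 5 1 isT).
Notation c2 := (@Ordinal 5 2 isT).
Notation c3 := (@Ordinal 5 3 isT).
Notation c4 := (@Ordinal 5 4 isT).

Definition er (j : 'I_5) : 'I_2 := if (j < 2)%N then k0 else k1.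
Definition ek (j : 'I_5) : 'I_2 := if odd j then k1 else k0.
Definition idx (r k : 'I_2) : 'I_5 := if r == k0 then (if k == k0 then c0 else c1) else (if k == k0 then c2 else c3).
Definition crow (v : mt) (x : R) : V5 := \row_c (if c == c4 then x else v (er c) (ek c)).

Lemma crow_idx v x r k : crow v x 0 (idx r k) = v r k.
Proof. by rewrite mxE; case: (ord2P r) (ord2P k) => -> [] ->. Qed.

Lemma crow4 v x : crow v x 0 c4 = x.
Proof. by rewrite mxE. Qed.

Lemma crow_ext v x v' x' : (forall r k, v r k = v' r k) -> x = x' -> crow v x = crow v' x'.
Proof. by move=> E ->; apply/rowP => c; rewrite !mxE E. Qed.

Lemma sum5 (f : 'I_5 -> R) : \sum_j f j = f c0 + f c1 + f c2 + f c3 + f c4.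
Proof.
rewrite !big_ord_recl big_ord0 addr0 !addrA.
by congr (f _ + f _ + f _ + f _ + f _); exact: val_inj.
Qed.

Lemma sum_crow v x (h : 'I_5 -> R) :
  \sum_c crow v x 0 c * h c = \sum_r \sum_k v r k * h (idx r k) + x * h c4.
Proof. by rewrite sum5 !sum2 crow4 -!(crow_idx v x) /=; ring. Qed.

Lemma unit_ker (A : 'M[R]_5) : (forall v : V5, v *m A = 0 -> v = 0) -> A \in unitmx.
Proof.
move=> H; rewrite -row_free_unit -kermx_eq0; apply/rowV0P => v /sub_kermxP.
exact: H.
Qed.

Definition Bm : 'M[R]_5 := \matrix_(j, c) crow (Bv j) 1 0 c.

Lemma mulBm (w : V5) : w *m Bm = crow (comb (fun j => w 0 j)) (\sum_j w 0 j).
Proof.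
apply/rowP => c; rewrite mxE [RHS]mxE /comb.
have [->|c4N] := eqVneq c c4; apply: eq_bigr => j _; rewrite !mxE ?eqxx ?mulr1//.
by rewrite (negbTE c4N).
Qed.

Hypothesis Baff : forall w : 'I_5 -> R, (forall r k, comb w r k = 0) -> \sum_j w j = 0 -> forall j, w j = 0.

Lemma unit_Bm : Bm \in unitmx.
Proof.
apply: unit_ker => w; rewrite mulBm => E; apply/rowP => j; rewrite mxE.
apply: (Baff (w := fun j => w 0 j)) => [r k|].
  by have := crow_idx (comb (fun j => w 0 j)) (\sum_j w 0 j) r k; rewrite E mxE.
by have := crow4 (comb (fun j => w 0 j)) (\sum_j w 0 j); rewrite E mxE.
Qed.

(** Barycentric coordinates of [tau P] with respect to the five affinely independent matrices [Bv j]
    of a space of dimension 4. *)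
Definition Lb (i : 'I_5) (P : st) : R := (crow (tau P) 1 *m invmx Bm) 0 i.

Lemma Lb_eq (w : 'I_5 -> R) P i : (forall r k, tau P r k = comb w r k) -> \sum_j w j = 1 -> Lb i P = w i.
Proof.
move=> E w1; rewrite /Lb.
have -> : crow (tau P) 1 = (\row_j w j) *m Bm.
  rewrite mulBm; apply: crow_ext => [r k|]; last by rewrite -w1; apply: eq_bigr => j _; rewrite mxE.
  by rewrite E /comb; apply: eq_bigr => j _; rewrite mxE.
by rewrite mulmxK ?unit_Bm// mxE.
Qed.

Lemma Lb_sum P : \sum_i Lb i P = 1.
Proof.
have := mulBm (crow (tau P) 1 *m invmx Bm); rewrite mulmxKV ?unit_Bm// => E.
by have := crow4 (tau P) 1; rewrite E crow4.
Qed.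

Lemma Lb_comb P r k : comb (fun i => Lb i P) r k = tau P r k.
Proof.
have := mulBm (crow (tau P) 1 *m invmx Bm); rewrite mulmxKV ?unit_Bm// => E.
by have := crow_idx (tau P) 1 r k; rewrite E crow_idx.
Qed.

Definition lb (i : 'I_5) (j : 'I_4) (k : 'I_2) : R :=
  match @fintype.split 2 2 j with
  | inl r => - mm * invmx Bm (idx r k) i
  | inr r => if k == k0 then invmx Bm (idx r k1) i else - invmx Bm (idx r k0) i
  end.

Lemma Lb_affine i P Q : Lb i P - Lb i Q = \sum_(j < 4) \sum_(k < 2) lb i j k * (P j k - Q j k).
Proof.
rewrite /Lb !mxE !(sum_crow _ _ (fun c => invmx Bm c i)).
rewrite (@big_split_ord _ _ _ 2 2)/= /lb.
under [X in _ = X + _]eq_bigr => r _ do rewrite (unsplitK (inl r)).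
under [X in _ = _ + X]eq_bigr => r _ do rewrite (unsplitK (inr r)).
by rewrite !sum2 /tau /hi /lo /=; ring.
Qed.

(** A continuous substitute for the distance to the graph: it vanishes exactly when some barycentric
    coordinate is 1. *)
Definition dd (P : st) : R := \prod_i (1 - Lb i P).

Definition ctn (f : st -> R) := forall P e, 0 < e -> exists2 m, 0 < m &
  forall Q, (forall j k, `|Q j k - P j k| < m) -> `|f Q - f P| < e.

Lemma ctnM f h : ctn f -> ctn h -> ctn (fun P => f P * h P).
Proof.
move=> cf ch P e e0; pose C := 1 + `|f P| + `|h P|.
have C0 : 0 < C by rewrite /C -addrA ltr_pwDl// addr_ge0.
pose e1 := Num.min 1 (e / C).
have e10 : 0 < e1 by rewrite lt_min ltr01 divr_gt0.
have [m1 m10 H1] := cf P e1 e10; have [m2 m20 H2] := ch P e1 e10.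
exists (Num.min m1 m2); first by rewrite lt_min m10.
move=> Q hQ; have h1 : `|f Q - f P| < e1 by apply: H1 => j k; have := hQ j k; rewrite lt_min => /andP[].
have h2 : `|h Q - h P| < e1 by apply: H2 => j k; have := hQ j k; rewrite lt_min => /andP[].
have -> : f Q * h Q - f P * h P = (f Q - f P) * (h Q - h P) + (f Q - f P) * h P + f P * (h Q - h P) by ring.
apply: (@lt_le_trans _ _ (e1 * 1 + e1 * `|h P| + `|f P| * e1 + 0)); last first.
  rewrite addr0 (_ : e1 * 1 + e1 * `|h P| + `|f P| * e1 = e1 * C); last by rewrite /C; ring.
  by rewrite -ler_pdivlMr// ge_min lexx orbT.
rewrite addr0; apply: (le_lt_trans (ler_normD _ _)); apply: ltr_leD; last first.
  by rewrite normrM ler_wpM2l// ltW.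
apply: (le_lt_trans (ler_normD _ _)); apply: ltr_leD; last by rewrite normrM ler_wpM2r// ltW.
rewrite normrM; apply: ltr_pM => //; apply: lt_le_trans h2 _.
by rewrite ge_min lexx.
Qed.

Lemma ctn_dd : ctn dd.
Proof.
have c1L i : ctn (fun P => 1 - Lb i P).
  move=> P e e0; have [m m0 Hm] := L_near Lb_affine i P e0; exists m => // Q /Hm.
  by rewrite (_ : 1 - _ - _ = - (Lb i Q - Lb i P)) ?normrN//; ring.
rewrite /dd; elim: (index_enum _) => [|i r IH].
  by move=> P e e0; exists 1 => // Q _; rewrite !big_nil subrr normr0.
by move=> P e e0; have [m m0 Hm] := ctnM (c1L i) IH P e0; exists m => // Q /Hm; rewrite !big_cons.
Qed.

Section continuity.
Variables (T : Type) (F : set_system T).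
Context {FF : ProperFilter F}.
Variables (y t t' : T -> V5) (Y t0 t1 : V5).
Hypothesis cy : forall j, (fun p => y p 0 j) @ F --> Y 0 j.
Hypothesis ct : forall j, (fun p => t p 0 j) @ F --> t0 0 j.
Hypothesis ct' : forall j, (fun p => t' p 0 j) @ F --> t1 0 j.
Hypothesis pY : pos Y.

Lemma cvg_wt i j : (fun p => wt i (y p) j) @ F --> wt i Y j.
Proof. by apply: cvgM; [exact: cvg_cst|exact: cy]. Qed.

Lemma cvg_Nn i : (fun p => Nn i (y p)) @ F --> Nn i Y.
Proof. by apply: (cvg_bigsum (f := fun j p => wt i (y p) j)) => j; exact: cvg_wt. Qed.

Lemma cvg_wn i j : (fun p => wn i (y p) j) @ F --> wn i Y j.
Proof. by apply: cvgM; [exact: cvg_wt|apply: cvgV; [rewrite gt_eqF// Nn_gt0|exact: cvg_Nn]]. Qed.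

Lemma cvg_lam i : (fun p => lam i (y p)) @ F --> lam i Y.
Proof.
apply: cvgM; last by apply: cvgV; [rewrite gt_eqF// Nn_gt0|exact: cvg_Nn].
by apply: cvgM; [exact: cvg_cst|exact: cy].
Qed.

Lemma cvg_Vv i r k : (fun p => Vv i (y p) r k) @ F --> Vv i Y r k.
Proof.
apply: cvgB; first exact: cvg_cst.
apply: (cvg_bigsum (f := fun j p => wn i (y p) j * Bv j r k)) => j.
by apply: cvgM; [exact: cvg_wn|exact: cvg_cst].
Qed.

Let cvg_sqr1 (u : T -> R) (l : R) : u @ F --> l -> (fun p => 1 + u p ^+ 2) @ F --> 1 + l ^+ 2.
Proof. by move=> cu; apply: cvgD; [exact: cvg_cst|rewrite expr2; under eq_fun do rewrite expr2; exact: cvgM]. Qed.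

Lemma cvg_proj i r k : (fun p => proj (Vv i (y p)) (t p 0 i) r k) @ F --> proj (Vv i Y) (t0 0 i) r k.
Proof.
apply: cvgM; last by apply: cvgV; [exact: sqr1_neq0|exact: cvg_sqr1].
apply: cvgM; last by rewrite /xi; case: (k == k0); [exact: ct|exact: cvg_cst].
apply: cvgD; last exact: cvg_Vv.
by apply: cvgM; [exact: cvg_Vv|exact: ct].
Qed.

Lemma cvg_loop r k : (fun p => \sum_i lam i (y p) * proj (Vv i (y p)) (t p 0 i) r k) @ F -->
  \sum_i lam i Y * proj (Vv i Y) (t0 0 i) r k.
Proof.
apply: (cvg_bigsum (f := fun i p => lam i (y p) * proj (Vv i (y p)) (t p 0 i) r k)) => i.
by apply: cvgM; [exact: cvg_lam|exact: cvg_proj].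
Qed.

Lemma cvg_dproj i r k :
  (fun p => dproj (Vv i (y p)) (t p 0 i) (t' p 0 i) r k) @ F --> dproj (Vv i Y) (t0 0 i) (t1 0 i) r k.
Proof.
apply: cvgM; last first.
  apply: cvgV; first by rewrite mulf_neq0.
  by apply: cvgM; exact: cvg_sqr1.
have h : (fun p => t p 0 i + t' p 0 i) @ F --> t0 0 i + t1 0 i by apply: cvgD; [exact: ct|exact: ct'].
have h' : (fun p => 1 - t p 0 i * t' p 0 i) @ F --> 1 - t0 0 i * t1 0 i.
  by apply: cvgB; [exact: cvg_cst|apply: cvgM; [exact: ct|exact: ct']].
case: (k == k0).
  by apply: cvgD; apply: cvgM => //; exact: cvg_Vv.
by apply: cvgB; apply: cvgM => //; exact: cvg_Vv.
Qed.

Lemma cvg_Ast i r k : (fun p => Ast i (y p) (t p) r k) @ F --> Ast i Y t0 r k.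
Proof. by apply: cvgN; apply: cvgM; [exact: cvg_cst|exact: cvg_proj]. Qed.

Lemma cvg_Aof i r k : (fun p => Aof i (y p) (t p) r k) @ F --> Aof i Y t0 r k.
Proof.
rewrite /Aof big_mkcond; under eq_fun do rewrite big_mkcond.
apply: (@cvg_bigsum R T 'I_5 F FF _ (fun j p => if (j < i)%N then lam j (y p) * Ast j (y p) (t p) r k else 0)
  (fun j => if (j < i)%N then lam j Y * Ast j Y t0 r k else 0)) => j.
by case: ifP => _; [apply: cvgM; [exact: cvg_lam|exact: cvg_Ast]|exact: cvg_cst].
Qed.

End continuity.

Variables (Y0 t0 : V5).
Hypothesis pY0 : pos Y0.

(** Closing is four scalar equations for five slopes; freezing the first slope makes the system
    square. *)
Definition closed_loop (Y t : V5) := (forall r k, Aof 5 Y t r k = 0) /\ t 0 c0 = t0 0 c0.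

Definition Phi (Y t : V5) : V5 := crow (fun r k => \sum_i lam i Y * proj (Vv i Y) (t 0 i) r k) (t 0 c0 - t0 0 c0).
Definition Sm (Y t t' : V5) : 'M[R]_5 :=
  \matrix_(i, c) crow (fun r k => lam i Y * dproj (Vv i Y) (t 0 i) (t' 0 i) r k) (i == c0)%:R 0 c.

Lemma mulSm (v : V5) Y t t' : v *m Sm Y t t' =
  crow (fun r k => \sum_i v 0 i * (lam i Y * dproj (Vv i Y) (t 0 i) (t' 0 i) r k)) (v 0 c0).
Proof.
apply/rowP => c; rewrite mxE [RHS]mxE; have [->|nc] := eqVneq c c4.
  by under eq_bigr do rewrite !mxE eqxx mulrC; exact: sum_delta.
by apply: eq_bigr => i _; rewrite !mxE (negbTE nc).
Qed.

Lemma PhiS Y t t' : Phi Y t - Phi Y t' = (t - t') *m Sm Y t t'.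
Proof.
rewrite mulSm; apply/rowP => c; rewrite !mxE; case: ifP => _; first by ring.
rewrite -sumrB; apply: eq_bigr => i _; rewrite !mxE.
by rewrite -mulrBr dprojP mulrCA.
Qed.

Lemma closed_loopP Y t : closed_loop Y t <-> Phi Y t = 0.
Proof.
have E r k : Aof 5 Y t r k = - (mm^-1 * \sum_i lam i Y * proj (Vv i Y) (t 0 i) r k).
  rewrite /Aof mulr_sumr -sumrN; apply: eq_big => [i|i _]; first by rewrite ltn_ord.
  by rewrite /Ast; ring.
split=> [[h1 h2]|h].
  apply/rowP => c; rewrite !mxE h2 subrr; case: ifP => // _.
  by have /eqP := h1 (er c) (ek c); rewrite E oppr_eq0 mulf_eq0 invr_eq0 gt_eqF//= => /eqP.
split=> [r k|].
  by have := crow_idx (fun r k => \sum_i lam i Y * proj (Vv i Y) (t 0 i) r k) (t 0 c0 - t0 0 c0) r k;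
    rewrite -/(Phi Y t) h mxE E => <-; rewrite mulr0 oppr0.
by have := crow4 (fun r k => \sum_i lam i Y * proj (Vv i Y) (t 0 i) r k) (t 0 c0 - t0 0 c0);
  rewrite -/(Phi Y t) h mxE => /esym/eqP; rewrite subr_eq0 => /eqP.
Qed.

Hypothesis ker0 : forall v : 'I_5 -> R, v c0 = 0 ->
  (forall r k, \sum_i v i * (lam i Y0 * dproj (Vv i Y0) (t0 0 i) (t0 0 i) r k) = 0) -> forall i, v i = 0.

Lemma coord_cvg (v : V5) j : (fun w : V5 => w 0 j) @ v --> v 0 j.
Proof. exact: coord_continuous. Qed.

Lemma loop_solve : exists2 dl, 0 < dl & forall Y t, `|Y - Y0| < dl -> `|t - t0| < dl -> pos Y ->
  closed_loop Y t -> forall e, 0 < e -> exists2 dl', 0 < dl' & forall Y', `|Y' - Y| < dl' ->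
    exists2 t', `|t' - t| < e & closed_loop Y' t'.
Proof.
have [||dl dl0 H] := @local_solve R 4 4 Phi Sm Y0 t0 PhiS.
- move=> i j; rewrite /prop_for /=.
  have cY l : (fun p : V5 * V5 * V5 => p.1.1 0 l) @ (Y0, t0, t0) --> Y0 0 l.
    apply: (cvg_comp (fun p : V5 * V5 * V5 => p.1.1) (fun w : V5 => w 0 l)); last exact: coord_cvg.
    by apply: (cvg_comp fst fst); [exact: cvg_fst|exact: cvg_fst].
  have c1 l : (fun p : V5 * V5 * V5 => p.1.2 0 l) @ (Y0, t0, t0) --> t0 0 l.
    apply: (cvg_comp (fun p : V5 * V5 * V5 => p.1.2) (fun w : V5 => w 0 l)); last exact: coord_cvg.
    by apply: (cvg_comp fst snd); [exact: cvg_fst|exact: cvg_snd].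
  have c2 l : (fun p : V5 * V5 * V5 => p.2 0 l) @ (Y0, t0, t0) --> t0 0 l.
    apply: (cvg_comp (fun p : V5 * V5 * V5 => p.2) (fun w : V5 => w 0 l)); last exact: coord_cvg.
    exact: cvg_snd.
  have [->|nj] := eqVneq j c4.
    rewrite (_ : (fun p : V5 * V5 * V5 => Sm p.1.1 p.1.2 p.2 i c4) = (fun=> Sm Y0 t0 t0 i c4)).
      exact: cvg_cst.
    by apply/funext => p; rewrite !mxE.
  rewrite (_ : (fun p : V5 * V5 * V5 => Sm p.1.1 p.1.2 p.2 i j) =
    (fun p => lam i p.1.1 * dproj (Vv i p.1.1) (p.1.2 0 i) (p.2 0 i) (er j) (ek j))); last first.
    by apply/funext => p; rewrite !mxE (negbTE nj).
  rewrite /continuous_at /=; apply: cvgM; first exact: (cvg_lam (y := fun p => p.1.1) cY pY0).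
  exact: (cvg_dproj (y := fun p => p.1.1) cY c1 c2 pY0).
- apply: unit_ker => v; rewrite mulSm => E; apply/rowP => i; rewrite [RHS]mxE.
  set w := (fun r k => _) in E.
  apply: (ker0 (v := fun i => v 0 i)).
    by have := crow4 w (v 0 c0); rewrite E mxE.
  by move=> r k; have := crow_idx w (v 0 c0) r k; rewrite E mxE => h; apply: etrans (esym h).
exists dl => // Y t Yd td pY /closed_loopP cl e e0.
have [] := H Y t Yd td cl _ e e0.
  move=> j; have [->|nj] := eqVneq j c4.
    have -> : (fun Y' => Phi Y' t 0 c4) = (fun=> t 0 c0 - t0 0 c0) by apply/funext => Y'; rewrite crow4.
    exact: cst_continuous.
  rewrite (_ : (fun Y' => Phi Y' t 0 j) = (fun Y' => \sum_i lam i Y' * proj (Vv i Y') (t 0 i) (er j) (ek j))); last first.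
    by apply/funext => Y'; rewrite mxE (negbTE nj).
  exact: (@cvg_loop V5 (nbhs Y) (nbhs_pfilter Y) (fun Y' => Y') (fun=> t) Y t (@coord_cvg Y) (fun l => cvg_cst _) pY).
move=> dl' dl'0 H'; exists dl' => // Y' /H'[t' tt' cl']; exists t' => //.
exact/closed_loopP.
Qed.

Lemma fin_lb (I : finType) (f : I -> R) : (forall i, 0 < f i) -> exists2 m, 0 < m & forall i, m <= f i.
Proof.
move=> f0; exists (\big[Num.min/1]_i f i); first by apply: lt_bigmin.
by move=> i; exact: bigmin_le.
Qed.

Lemma fin_ub (I : finType) (f : I -> R) : exists2 C, 0 <= C & forall i, f i <= C.
Proof.
exists (\big[Num.max/0]_i f i); last by move=> i; exact: le_bigmax.
exact: bigmax_ge_id.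
Qed.

Lemma Lb_near P e : 0 < e -> exists2 m, 0 < m & forall Q, (forall j k, `|Q j k - P j k| < m) ->
  forall i, `|Lb i Q - Lb i P| < e.
Proof.
move=> e0; have /choice[m Hm] i : exists m, 0 < m /\ forall Q, (forall j k, `|Q j k - P j k| < m) -> `|Lb i Q - Lb i P| < e.
  by have [m m0 Hm] := L_near Lb_affine i P e0; exists m.
have [m' m'0 Hm'] := fin_lb (fun i => (Hm i).1); exists m' => // Q hQ i.
by apply: (Hm i).2 => j k; exact: lt_le_trans (hQ j k) (Hm' i).
Qed.

Record near_at (Y t : V5) (e : R) (Y' t' : V5) : Prop := NearAt {
  na_pos : pos Y';
  na_wn : forall i j : 'I_5, `|wn i Y' j - wn i Y j| < e;
  na_lam : forall i, `|lam i Y' - lam i Y| < e;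
  na_Aof : forall (i : 'I_5) r k, `|Aof i Y' t' r k - Aof i Y t r k| < e;
  na_Ast : forall i r k, `|Ast i Y' t' r k - Ast i Y t r k| < e;
  na_Vv : forall i r k, `|Vv i Y' r k - Vv i Y r k| < e}.

Lemma near_params Y t (e : R) : pos Y -> 0 < e -> exists2 de, 0 < de &
  forall Y' t', `|Y' - Y| < de -> `|t' - t| < de -> near_at Y t e Y' t'.
Proof.
move=> pY e0; pose F := nbhs ((Y, t) : V5 * V5).
have FF : ProperFilter F by exact: nbhs_pfilter.
have cY l : (fun p : V5 * V5 => p.1 0 l) @ F --> Y 0 l.
  by apply: (cvg_comp fst (fun w : V5 => w 0 l)); [exact: cvg_fst|exact: coord_cvg].
have ct l : (fun p : V5 * V5 => p.2 0 l) @ F --> t 0 l.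
  by apply: (cvg_comp snd (fun w : V5 => w 0 l)); [exact: cvg_snd|exact: coord_cvg].
have close (I : finType) (f : I -> V5 * V5 -> R) (l : I -> R) : (forall i, f i @ F --> l i) ->
    \forall p \near F, forall i, `|f i p - l i| < e.
  move=> cf; apply: (@filter_forall (V5 * V5)%type I (fun i p => `|f i p - l i| < e) F _) => i.
  by have /cvgrPdist_lt/(_ _ e0) := cf i; apply: filterS => p; rewrite distrC.
have n0 : \forall p \near F, pos p.1.
  apply: (@filter_forall (V5 * V5)%type 'I_5 (fun i p => 0 < p.1 0 i) F _) => i.
  have /cvgrPdist_lt/(_ _ (pY i)) := cY i; apply: filterS => p; rewrite ltr_distl => /andP[_].
  by rewrite ltrDr.
have n1 := close ('I_5 * 'I_5)%type _ _ (fun ij => @cvg_wn _ F FF (fun p => p.1) Y cY pY ij.1 ij.2).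
have n2 := close _ _ _ (fun i => @cvg_lam _ F FF (fun p => p.1) Y cY pY i).
have n3 := close ('I_5 * ('I_2 * 'I_2))%type _ _ (fun ij => @cvg_Aof _ F FF (fun p => p.1) (fun p => p.2) Y t cY ct pY ij.1 ij.2.1 ij.2.2).
have n4 := close ('I_5 * ('I_2 * 'I_2))%type _ _ (fun ij => @cvg_Ast _ F FF (fun p => p.1) (fun p => p.2) Y t cY ct pY ij.1 ij.2.1 ij.2.2).
have n5 := close ('I_5 * ('I_2 * 'I_2))%type _ _ (fun ij => @cvg_Vv _ F FF (fun p => p.1) Y cY pY ij.1 ij.2.1 ij.2.2).
have nA : \forall p \near F, near_at Y t e p.1 p.2.
  near=> p; split.
  - exact: (near n0 p).
  - by move=> i j; exact: (near n1 p _ (i, j)).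
  - exact: (near n2 p).
  - by move=> i r k; exact: (near n3 p _ (i, (r, k))).
  - by move=> i r k; exact: (near n4 p _ (i, (r, k))).
  - by move=> i r k; exact: (near n5 p _ (i, (r, k))).
have /nbhs_ballP[de /= de0 Hd] := nA.
exists de => // Y' t' hY ht; apply: (Hd (Y', t')).
rewrite -ball_normE/= -[`|_|]/(Num.max _ _) /= gt_max.
by apply/andP; split; rewrite distrC.
Unshelve. all: by end_near.
Qed.

Lemma ar_A (p a o o' v v' q s eta de : R) : p = a + o + s * v -> `|o' - o| < eta / 4 -> `|v' - v| < eta / 4 ->
  `|q - p| < eta / 4 -> eta <= de - `|a| -> 0 < s -> s < 1 -> `|q - o' - s * v'| < de.
Proof.
move=> -> h1 h2 h3 h4 s0 s1.
have -> : q - o' - s * v' = a + ((q - (a + o + s * v)) - (o' - o) - s * (v' - v)) by ring.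
apply: (le_lt_trans (ler_normD _ _)).
have : `|s * (v' - v)| <= `|v' - v| by rewrite normrM (gtr0_norm s0) ler_piMl// ltW.
have := ler_normB (q - (a + o + s * v) - (o' - o)) (s * (v' - v)).
have := ler_normB (q - (a + o + s * v)) (o' - o).
have := normr_ge0 (o' - o); lra.
Qed.

(** [P] sits at parameter [s] of the [i]-th segment of the loop with weights [Y] and slopes [t], the
    whole loop being translated by [A] in the first two rows. *)
Definition rep (i : 'I_5) (s : R) (Y t : V5) (A : mt) (P : st) :=
  (forall r k, P (lo r) k = A r k + Aof i Y t r k + s * Ast i Y t r k) /\
  (forall r k, tau P r k = comb (sw i s Y) r k).

Definition dom (de : R) (Y t : V5) (A : mt) :=
  [/\ `|Y - Y0| < de, `|t - t0| < de, closed_loop Y t & forall r k, `|A r k| < de].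

Definition UU (de smin : R) : set st :=
  [set P | exists i s Y t A, [/\ smin < s < 1, dom de Y t A & rep i s Y t A P]].

(** With the segment [i] and the parameter [s] kept fixed, a nearby state prescribes its barycentric
    coordinates, which determine new weights [Y'] explicitly; new slopes closing the loop exist by
    hypothesis, and the translation [A] absorbs what remains of the first two rows. *)
Lemma UU_open de smin : 0 <= smin -> (forall Y t, `|Y - Y0| < de -> `|t - t0| < de -> pos Y) ->
  (forall Y t, `|Y - Y0| < de -> `|t - t0| < de -> closed_loop Y t -> forall e, 0 < e ->
    exists2 dl', 0 < dl' & forall Y', `|Y' - Y| < dl' -> exists2 t', `|t' - t| < e & closed_loop Y' t') ->
  st_open (UU de smin).
Proof.
move=> smin0 Hpos Hsol P [i [s [Y [t [A [/andP[s0 s1] [Yd td cl Ad] [PA Pt]]]]]]].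
have pY := Hpos _ _ Yd td.
have [eta eta0 Heta] : exists2 eta, 0 < eta & forall rk : 'I_2 * 'I_2, eta <= de - `|A rk.1 rk.2|.
  by apply: fin_lb => rk; rewrite subr_gt0.
have eta4 : 0 < eta / 4 by rewrite divr_gt0.
have [e1 e10 He1] := near_params t pY eta4.
pose e2 := Num.min e1 (Num.min (de - `|Y - Y0|) (de - `|t - t0|)).
have e20 : 0 < e2 by rewrite !lt_min e10 !subr_gt0 Yd.
have [dl dl0 Hdl] := Hsol Y t Yd td cl e2 e20.
have s1' : 0 < 1 - s by rewrite subr_gt0.
(* The factor converting a change of barycentric coordinates at parameter [s] into a change of the
   weights, the normalisation [Nn i Y] being preserved since coordinates sum to 1. *)
pose C := Nn i Y / (1 - s).
have C0 : 0 < C by rewrite divr_gt0// Nn_gt0.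
pose e3 := Num.min e2 dl / C / 2.
have e30 : 0 < e3 by apply: divr_gt0 => //; apply: divr_gt0 => //; rewrite lt_min e20.
have [m m0 Hm] := Lb_near P e30.
exists (Num.min m (eta / 4)); first by rewrite lt_min m0.
move=> Q hQ; have hL : forall j, `|Lb j Q - Lb j P| < e3.
  by apply: Hm => j k; have := hQ j k; rewrite lt_min => /andP[].
have hQ4 j k : `|Q j k - P j k| < eta / 4 by have := hQ j k; rewrite lt_min => /andP[].
(* Compensates the factor [g] which [wt i] puts on the indices before [i]. *)
pose gi (j : 'I_5) : R := if (j < i)%N then g^-1 else 1.
have gi1 j : `|gi j| <= 1.
  rewrite /gi; case: ifP => _; last by rewrite normr1.
  by rewrite ger0_norm ?invr_ge0 ?invf_le1 ?(ltW g1) ?(lt_trans _ g1)// ltW// (lt_trans _ g1).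
pose Y' : V5 := \row_j (Y 0 j + gi j * (C * (Lb j Q - Lb j P))).
have YY : `|Y' - Y| < Num.min e2 dl.
  apply: (@le_lt_trans _ _ (C * e3)); last first.
    have -> : C * e3 = Num.min e2 dl / 2 by rewrite /e3; field; rewrite gt_eqF.
    by rewrite ltr_pdivrMr// ltr_pMr ?ltr1n// lt_min e20.
  apply: rV_le => [|j]; first by rewrite mulr_ge0// ltW.
  rewrite !mxE addrAC subrr add0r normrM [`|C * _|]normrM (gtr0_norm C0) -[leRHS]mul1r; apply: ler_pM => //.
    by rewrite mulr_ge0// ltW.
  by apply: ler_wpM2l; [exact: ltW|exact: ltW].
have [YY1 YY2] : `|Y' - Y| < e2 /\ `|Y' - Y| < dl by move: YY; rewrite lt_min => /andP[].
have [t' tt' cl'] := Hdl Y' YY2.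
have g0 : g != 0 by rewrite gt_eqF// (lt_trans _ g1).
have wtE j : wt i Y' j = wt i Y j + C * (Lb j Q - Lb j P).
  by rewrite /wt mxE mulrDr /gi; congr (_ + _); case: ifP => _; rewrite ?mul1r// mulrA divff// mul1r.
have NE : Nn i Y' = Nn i Y.
  rewrite /Nn; under eq_bigr do rewrite wtE.
  by rewrite big_split/= -mulr_sumr sumrB !Lb_sum subrr mulr0 addr0.
have LP j : Lb j P = sw i s Y j by apply: Lb_eq => //; exact: sum_sw.
have swE j : sw i s Y' j = Lb j Q.
  have n1 : Nn i Y != 0 by rewrite gt_eqF// Nn_gt0.
  have n2 : 1 - s != 0 by rewrite gt_eqF.
  rewrite /sw /wn NE wtE LP /sw /wn /C.
  by field; rewrite n1 n2.
have [YD tD] : `|Y' - Y0| < de /\ `|t' - t0| < de.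
  move: YY1 tt'; rewrite !lt_min => /and3P[_ h1 _] /and3P[_ _ h2]; split.
    by rewrite -(subrK Y Y') -addrA (le_lt_trans (ler_normD _ _))// -ltrBrDr.
  by rewrite -(subrK t t') -addrA (le_lt_trans (ler_normD _ _))// -ltrBrDr.
have near' : near_at Y t (eta / 4) Y' t'.
  by apply: He1; [move: YY1|move: tt']; rewrite lt_min => /andP[].
exists i, s, Y', t', (fun r k => Q (lo r) k - Aof i Y' t' r k - s * Ast i Y' t' r k).
split; [by rewrite s0|split => // r k|split=> r k].
- have h1 := na_Aof near' i r k; have h2 := na_Ast near' i r k; have h3 := hQ4 (lo r) k.
  have h4 := Heta (r, k); rewrite /= in h4.
  exact: (ar_A (PA r k) h1 h2 h3 h4 (le_lt_trans smin0 s0) s1).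
- by ring.
- rewrite -Lb_comb /comb; apply: eq_bigr => j _; by rewrite swE.
Qed.

Lemma UU_le de s1 s2 : s1 <= s2 -> UU de s2 `<=` UU de s1.
Proof.
move=> s12 P [i [s [Y [t [A [/andP[h1 h2] h3 h4]]]]]]; exists i, s, Y, t, A; split => //.
by rewrite h2 (le_lt_trans s12).
Qed.

(** The column of the wave-cone direction of segment [i]. The rows of [u] receive the part of [Vv i]
    along the wave vector, divided by [- mm]; the rows of [eta] receive the orthogonal part, turned
    back by a quarter turn. *)
Definition dirA (i : 'I_5) (Y t : V5) (j : 'I_4) : R :=
  match @fintype.split 2 2 j with
  | inl r => - (mm^-1 * ((Vv i Y r k0 * t 0 i + Vv i Y r k1) / (1 + t 0 i ^+ 2)))
  | inr r => (Vv i Y r k1 * t 0 i - Vv i Y r k0) / (1 + t 0 i ^+ 2)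
  end.

Lemma rep_move i s h Y t A P : pos Y -> rep i s Y t A P ->
  rep i (s + h) Y t A (fun j k => P j k + h * (dirA i Y t j * xi (t 0 i) k)).
Proof.
move=> pY [PA Pt]; split=> r k.
  rewrite PA /dirA (_ : @fintype.split 2 2 (lo r) = inl r); last exact: (unsplitK (inl r)).
  by rewrite /Ast /proj; ring.
rewrite comb_sw// mulrDl addrA -comb_sw// -Pt /tau /dirA.
rewrite (_ : @fintype.split 2 2 (lo r) = inl r); last exact: (unsplitK (inl r)).
rewrite (_ : @fintype.split 2 2 (hi r) = inr r); last exact: (unsplitK (inr r)).
have h1 := sqr1_neq0 (t 0 i); have h2 : mm != 0 by rewrite gt_eqF.
by rewrite /xi; case: (ord2P k) => -> /=; field; rewrite h1 h2.
Qed.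

(** The start of a segment is the turning point of the previous one; for the first segment this is
    where the closing of the loop is used. *)
Lemma rep0 (i : 'I_5) Y t A P : pos Y -> closed_loop Y t -> rep i 0 Y t A P ->
  exists i' : 'I_5, rep i' (lam i' Y) Y t A P.
Proof.
move=> pY [cl _] [PA Pt].
have comb0 r k : comb (sw i 0 Y) r k = comb (wn i Y) r k by rewrite comb_sw// mul0r addr0.
case: i PA Pt comb0 => -[|i] iP PA Pt comb0; set i0 := Ordinal iP in PA Pt comb0.
  exists c4; split=> r k.
    by rewrite PA -[RHS]addrA -AofS /= (cl r k) Aof0 mul0r addr0.
  by rewrite Pt comb0 /comb; apply: eq_bigr => j _; rewrite sw_lam//= wn5.
exists (Ordinal (ltnW iP)); split=> r k.
  by rewrite PA mul0r addr0 -[RHS]addrA -AofS.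
by rewrite Pt comb0 /comb; apply: eq_bigr => j _; rewrite sw_lam.
Qed.

Hypothesis mm1 : 1 <= mm.
Hypothesis loop0 : closed_loop Y0 t0.
Definition Xv (i : 'I_5) (r k : 'I_2) : R := Aof i Y0 t0 r k + Ast i Y0 t0 r k.

Lemma other_ord (i : 'I_5) : exists j : 'I_5, j != i.
Proof. by have [->|h0] := eqVneq i c0; [exists c1|exists c0; rewrite eq_sym]. Qed.

(** A degenerate segment would give [Bv i] a second barycentric representation with all weights
    positive, against affine independence. *)
Lemma Vv_neq0 i : exists rk : 'I_2 * 'I_2, Vv i Y0 rk.1 rk.2 != 0.
Proof.
apply: contrapT => h.
have V0 r k : Vv i Y0 r k = 0.
  by apply/eqP; apply: contrapT => /negP hn; apply: h; exists (r, k).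
pose w j := (j == i)%:R - wn i Y0 j.
have [j ji] := other_ord i.
have w0 : w j = 0.
  apply: Baff => [r k|].
    rewrite /comb; under eq_bigr do rewrite mulrBl.
    by rewrite sumrB (sum_delta i (fun j => Bv j r k)); exact: V0.
  rewrite sumrB sum_wn// (eq_bigr (fun j => (j == i)%:R * 1)) ?(sum_delta i (fun=> 1)) ?subrr//.
  by move=> j' _; rewrite mulr1.
move/eqP: w0; rewrite /w (negbTE ji) sub0r oppr_eq0 gt_eqF//.
exact: wn_gt0.
Qed.

Lemma wn_le1 Y i j : pos Y -> wn i Y j < 1.
Proof.
move=> pY; have [j' jj] := other_ord j.
rewrite -(sum_wn pY i) (bigD1 j)//= (bigD1 j')//= ltrDl ltr_pwDl ?wn_gt0// sumr_ge0// => l _.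
by rewrite ltW// wn_gt0.
Qed.

Lemma wn_other Y i (j j' : 'I_5) : pos Y -> j' != j -> wn i Y j' <= 1 - wn i Y j.
Proof.
move=> pY jj; rewrite lerBrDr -(sum_wn pY i) (bigD1 j)//= (bigD1 j')//= [leLHS]addrC lerD2l lerDl sumr_ge0// => l _.
by rewrite ltW// wn_gt0.
Qed.

Variables (F : 'M[R]_2 -> R) (rho : R).
Hypothesis rho0 : 0 < rho.
Hypothesis XF : forall i (A : 'M[R]_2), (forall r k, `|A r k - Xv i r k| < rho) ->
  forall r k, DF F A r k = mm * A r k + Bv i r k.
Hypothesis Xsep : forall i j, i <> j -> exists r k, 3 * rho <= `|Xv i r k - Xv j r k|.

(** Corner 0 of the unperturbed loop with [A = 0]. Since the loop closes, it is also the end point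
    reached on the fifth segment. *)
Definition base_state : st := fun j k =>
  match @fintype.split 2 2 j with
  | inl _ => 0
  | inr r => if k == k0 then comb (wn 0 Y0) r k1 else - comb (wn 0 Y0) r k0
  end.

Lemma tau_base r k : tau base_state r k = comb (wn 0 Y0) r k.
Proof.
rewrite /tau /base_state (_ : @fintype.split 2 2 (lo r) = inl r); last exact: (unsplitK (inl r)).
rewrite (_ : @fintype.split 2 2 (hi r) = inr r); last exact: (unsplitK (inr r)).
by case: (ord2P k) => -> /=; rewrite mulr0 subr0 ?opprK.
Qed.

Lemma base_lo r k : base_state (lo r) k = 0.
Proof. by rewrite /base_state (_ : @fintype.split 2 2 (lo r) = inl r)//; exact: (unsplitK (inl r)). Qed.

Lemma base_rep : rep c4 (lam c4 Y0) Y0 t0 (fun _ _ => 0) base_state.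
Proof.
split=> r k; first by rewrite base_lo add0r -AofS /= loop0.1.
rewrite tau_base /comb; apply: eq_bigr => j _; by rewrite sw_lam//= wn5.
Qed.

Lemma rep_Lb i s Y t A P : pos Y -> rep i s Y t A P -> forall j, Lb j P = sw i s Y j.
Proof. by move=> pY [_ h] j; apply: Lb_eq => //; exact: sum_sw. Qed.

Lemma sw_itv i s Y j : pos Y -> 0 < s < 1 -> 0 < sw i s Y j < 1.
Proof.
move=> pY /andP[s0 s1]; have := wn_gt0 pY i j; have := wn_le1 i j pY.
have h3 : 0 < 1 - s by rewrite subr_gt0.
rewrite /sw; case: (j == i) => h1 h2; rewrite ?mulr1 ?mulr0 ?addr0; have := mulr_gt0 h3 h2;
  have : (1 - s) * wn i Y j < 1 - s by rewrite gtr_pMr.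
  by move=> *; apply/andP; split; lra.
by move=> *; apply/andP; split; lra.
Qed.

Lemma rep_dd i s Y t A P : pos Y -> 0 < s < 1 -> rep i s Y t A P -> 0 <= dd P <= 1 /\ dd P <= 1 - s.
Proof.
move=> pY sb rP; have LP := rep_Lb pY rP.
have b j : 0 <= 1 - Lb j P <= 1 by rewrite LP; have /andP[? ?] := sw_itv i j pY sb; lra.
rewrite /dd; split.
  apply/andP; split; first by apply: prodr_ge0 => j _; have /andP[] := b j.
  by apply: prodr_ile1 => j _; exact: b.
rewrite (bigD1 i)//=; apply: (@le_trans _ _ (1 - Lb i P)).
  rewrite ler_piMr//; first by have /andP[] := b i.
  by apply: prodr_ile1 => j _; exact: b.
case/andP: sb => s0 s1; have h3 : 0 < 1 - s by rewrite subr_gt0.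
by rewrite LP /sw eqxx mulr1; have := mulr_gt0 h3 (wn_gt0 pY i i); lra.
Qed.

Lemma ar_dir (v w t C : R) : `|v| <= C -> `|w| <= C ->
  `|(v * t + w) / (1 + t ^+ 2)| <= 2 * C /\ `|(v * t - w) / (1 + t ^+ 2)| <= 2 * C.
Proof.
move=> vC wC; have q0 := sqr1_gt0 t; have C0 : 0 <= C := le_trans (normr_ge0 _) vC.
have tq : `|t| <= 1 + t ^+ 2.
  by rewrite -real_normK ?num_real//; have := sqr_ge0 (`|t| - 1); have := normr_ge0 t; nra.
have h u : `|u| <= C -> `|(v * t + u) / (1 + t ^+ 2)| <= 2 * C.
  move=> uC; rewrite normrM normfV (gtr0_norm q0) ler_pdivrMr//.
  apply: (le_trans (ler_normD _ _)); rewrite normrM.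
  have : `|v| * `|t| <= C * (1 + t ^+ 2) by exact: ler_pM.
  have : C <= C * (1 + t ^+ 2) by rewrite ler_peMr// lerDl sqr_ge0.
  by move: uC; lra.
by split; [exact: h|apply: h; rewrite normrN].
Qed.

(** Pythagoras for the parts along and across the wave vector; only the first one is shrunk, by the
    factor [m^-1]. *)
Lemma ar_len (v w t m : R) : 1 <= m ->
  m^-1 ^+ 2 * ((v ^+ 2 + w ^+ 2) / (1 + t ^+ 2)) <=
  (- (m^-1 * ((v * t + w) / (1 + t ^+ 2)))) ^+ 2 + ((w * t - v) / (1 + t ^+ 2)) ^+ 2.
Proof.
move=> m1; have q0 := sqr1_gt0 t; set q := 1 + t ^+ 2 in q0 *.
have i1 : m^-1 ^+ 2 <= 1 by rewrite expr_le1// ?invr_ge0 ?invf_le1// ?(lt_le_trans ltr01)// (le_trans ler01).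
have -> : (v ^+ 2 + w ^+ 2) / q = ((v * t + w) / q) ^+ 2 + ((w * t - v) / q) ^+ 2.
  by rewrite /q; field; exact: sqr1_neq0.
by rewrite sqrrN [(m^-1 * _) ^+ 2]exprMn mulrDr lerD2l ler_piMl// sqr_ge0.
Qed.

Lemma ar_lo (a o o' v v' s de e CO CA : R) : `|a| < de -> de <= 1 -> `|o' - o| < e -> `|v' - v| < e -> e <= 1 ->
  `|o| <= CO -> `|v| <= CA -> 0 < s < 1 -> `|a + o' + s * v'| <= CO + CA + 3.
Proof.
move=> h1 h2 h3 h4 h5 h6 h7 /andP[s0 s1].
have sv : `|s * v'| <= `|v'| by rewrite normrM (gtr0_norm s0) ler_piMl// ltW.
have := ler_normD (a + o') (s * v'); have := ler_normD a o'.
have := ler_normD (o' - o) o; have := ler_normD (v' - v) v; rewrite !subrK.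
by move: sv h1 h2 h3 h4 h5 h6 h7; lra.
Qed.

Lemma dirA_len i (Y t : V5) : mm^-1 ^+ 2 * ((\sum_r \sum_k Vv i Y r k ^+ 2) / (1 + t 0 i ^+ 2)) <= \sum_(j < 4) dirA i Y t j ^+ 2.
Proof.
rewrite (@big_split_ord _ _ _ 2 2)/= -big_split/= mulr_suml mulr_sumr; apply: ler_sum => r _.
rewrite sum2 /dirA (unsplitK (inl r)) (unsplitK (inr r)).
exact: ar_len.
Qed.

Lemma dirA_le i (Y t : V5) j C : (forall r k, `|Vv i Y r k| <= C) -> `|dirA i Y t j| <= 2 * C.
Proof.
move=> h; rewrite /dirA; case: (@fintype.split 2 2 j) => r.
  have [h1 _] := ar_dir (t 0 i) (h r k0) (h r k1).
  rewrite normrN normrM; apply: le_trans h1; rewrite ler_piMl// ger0_norm ?invr_ge0 ?(le_trans ler01)//.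
  by rewrite invf_le1// (lt_le_trans ltr01).
by have [_] := ar_dir (t 0 i) (h r k1) (h r k0).
Qed.

(** For [p = 2 * s / (1 + s)] the variance is [2 * s * (1 - s) / (1 + s) ^+ 2], comparable to
    [1 - s] once [s] stays away from 0. *)
Lemma ar_pp (c' c s d : R) : 0 < s < 1 -> c' < s -> 0 <= c -> c <= c' / 2 -> 0 <= d -> d <= 1 - s ->
  c * d <= 2 * s / (1 + s) * (1 - 2 * s / (1 + s)).
Proof.
move=> /andP[s0 s1] cs c0 cc d0 ds.
have q : 0 < 1 + s by rewrite addr_gt0.
have -> : 2 * s / (1 + s) * (1 - 2 * s / (1 + s)) = 2 * s * (1 - s) / (1 + s) ^+ 2.
  by field; rewrite gt_eqF.
rewrite ler_pdivlMr ?exprn_gt0//.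
have h1 : c * d <= s / 2 * (1 - s) by apply: ler_pM => //; lra.
have h2 : (1 + s) ^+ 2 <= 4 by nra.
have h3 : 0 <= s / 2 * (1 - s) by rewrite mulr_ge0//; lra.
apply: (@le_trans _ _ (s / 2 * (1 - s) * 4)); last by lra.
by apply: ler_pM => //; [rewrite mulr_ge0|rewrite exprn_ge0// ltW].
Qed.

Lemma ar_mid (s h : R) : 0 < s < 1 -> - (2 * s / (1 + s)) <= h <= 1 - 2 * s / (1 + s) ->
  0 <= s + h * ((1 + s) / 2) < 1.
Proof.
move=> /andP[s0 s1] /andP[g1' g2]; have q : 0 < (1 + s) / 2 by rewrite divr_gt0// addr_gt0.
have q' : 0 < 1 + s by rewrite addr_gt0.
have h1 : - (2 * s / (1 + s)) * ((1 + s) / 2) <= h * ((1 + s) / 2) by rewrite ler_pM2r.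
have h2 : h * ((1 + s) / 2) <= (1 - 2 * s / (1 + s)) * ((1 + s) / 2) by rewrite ler_pM2r.
have E : 2 * s / (1 + s) * ((1 + s) / 2) = s by field; rewrite gt_eqF.
by move: h1 h2; rewrite mulNr mulrBl E mul1r => h1 h2; apply/andP; split; lra.
Qed.

Lemma ar_vertex (q a o o0 v v0 s p de e e2 w CA : R) : q = a + o + s * v -> `|a| < de -> de <= rho / 6 ->
  `|o - o0| < e -> `|v - v0| < e -> e <= rho / 6 -> e <= 1 -> `|v0| <= CA -> 0 < s < 1 -> 0 < w ->
  (1 - s) * (w / 2) < e2 -> e2 <= w * rho / (12 * (CA + 1)) -> `|q - p| < rho / 6 -> `|p - (o0 + v0)| < rho.
Proof.
move=> -> ha hde ho hv he he1 hv0 /andP[s0 s1] w0 hs he2 hq.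
have C0 : 0 < CA + 1 by rewrite ltr_pwDr// (le_trans _ hv0).
have hs' : (1 - s) * (CA + 1) <= rho / 6.
  have : (1 - s) * (w / 2) <= w * rho / (12 * (CA + 1)) by apply: le_trans (ltW hs) he2.
  rewrite ler_pdivlMr ?mulr_gt0// => h; rewrite -(ler_pM2l w0); move: h; lra.
have vb : `|v| <= CA + 1 by rewrite -(subrK v0 v) (le_trans (ler_normD _ _))//; lra.
have hsv : `|(1 - s) * v| <= rho / 6.
  rewrite normrM ger0_norm ?subr_ge0 ?(ltW s1)//; apply: le_trans hs'; apply: ler_wpM2l => //.
  by rewrite subr_ge0 ltW.
have -> : p - (o0 + v0) = (o - o0) + (v - v0) + a - (1 - s) * v - (a + o + s * v - p) by ring.
have := ler_normB ((o - o0) + (v - v0) + a - (1 - s) * v) (a + o + s * v - p).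
have := ler_normB ((o - o0) + (v - v0) + a) ((1 - s) * v).
have := ler_normD ((o - o0) + (v - v0)) a; have := ler_normD (o - o0) (v - v0).
by move: rho0 ha hde ho hv he hq hsv; lra.
Qed.

Lemma ar_vb (x y v e : R) : v <= `|x| -> `|y - x| < e -> e <= v / 2 -> v / 2 <= `|y|.
Proof. by have := ler_normB y (y - x); rewrite subKr; lra. Qed.

Lemma ar_K (a b b' c d : R) : 0 <= a -> 0 <= b -> b <= b' -> 0 <= c -> 0 <= d ->
  [/\ 0 < a + b' + c + d + 1, b <= a + b' + c + d + 1, a + b' <= a + b' + c + d + 1 &
    [/\ c <= a + b' + c + d + 1, d <= a + b' + c + d + 1 & 1 <= a + b' + c + d + 1]].
Proof. by move=> *; split; [lra|lra|lra|split; lra]. Qed.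

Lemma ar_s (s : R) : 0 < s < 1 -> [/\ 1 / 4 < (1 + s) / 2, (1 + s) / 2 < 1, 2 * s < 1 + s & 2^-1 <= (1 + s) / 2].
Proof. by move=> /andP[? ?]; split; lra. Qed.

Lemma ar_lam (x y e l c' : R) : l <= y -> y - e < x -> e <= l / 2 -> c' <= l / 2 -> c' < x.
Proof. lra. Qed.

Lemma ar_wlow (x y e w : R) : w <= y -> y - e < x -> e <= w / 2 -> w / 2 < x.
Proof. lra. Qed.

Lemma ar_idx (w s a b e2 : R) : e2 <= w / 2 -> a <= 1 - b -> w / 2 < b -> 0 < a -> 0 < s -> (1 - s) * a <= 1 - e2.
Proof. by move=> *; have : 0 < s * a by [exact: mulr_gt0]; lra. Qed.

Lemma ar_hs (s w a b e2 : R) : 0 < s < 1 -> a <= 1 - b -> w / 2 < a -> 1 - e2 < (1 - s) * b + s ->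
  (1 - s) * (w / 2) < e2.
Proof. by move=> /andP[? ?] *; have : (1 - s) * (w / 2) <= (1 - s) * (1 - b) by [apply: ler_wpM2l; lra]; lra. Qed.

Lemma ar_zero (x y : R) : 1 + (x + y) = 1 -> 0 <= y -> x <= 0.
Proof. lra. Qed.

Lemma ar_pos (x y e : R) : 0 < x -> x < y + e -> 0 <= y + e.
Proof. lra. Qed.

Lemma ar_sep (a b p q : R) : 3 * rho <= `|a - b| -> `|p - a| < rho -> `|q - b| < rho -> `|p - q| < rho -> False.
Proof.
move=> h h1 h2 h3; have : `|a - b| < 3 * rho; last by rewrite ltNge h.
have -> : a - b = - (p - a) + (p - q) + (q - b) by ring.
have := ler_normD (- (p - a) + (p - q)) (q - b); have := ler_normD (- (p - a)) (p - q).
by rewrite normrN; move: h1 h2 h3; lra.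
Qed.

(** [U] consists of all states on perturbed loops with parameter [s > 0], and [M] of those with
    [s > c']. Away from [s = 0] the variance of the splitting below is comparable with [1 - s],
    which bounds [dd]. *)
Theorem geometry_inclusion : exists U M d c K L l r0 P0, inclusion F U M d c K L l r0 P0.
Proof.
have [w1 w10 Hw1] := @fin_lb ('I_5 * 'I_5)%type (fun ij => wn ij.1 Y0 ij.2) (fun ij => wn_gt0 pY0 ij.1 ij.2).
have [l1 l10 Hl1] := fin_lb (fun i => lam_gt0 pY0 i).
have /choice[vr Hvr] := Vv_neq0.
have [v1 v10 Hv1] : exists2 m, 0 < m & forall i, m <= `|Vv i Y0 (vr i).1 (vr i).2|.
  by apply: fin_lb => i; rewrite normr_gt0.
have [CA CA0 HCA] := @fin_ub ('I_5 * ('I_2 * 'I_2))%type (fun x => `|Ast x.1 Y0 t0 x.2.1 x.2.2|).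
have [CO CO0 HCO] := @fin_ub ('I_5 * ('I_2 * 'I_2))%type (fun x => `|Aof x.1 Y0 t0 x.2.1 x.2.2|).
have [CV CV0 HCV] := @fin_ub ('I_5 * ('I_2 * 'I_2))%type (fun x => `|Vv x.1 Y0 x.2.1 x.2.2|).
have [CB CB0 HCB] := @fin_ub ('I_5 * ('I_2 * 'I_2))%type (fun x => `|Bv x.1 x.2.1 x.2.2|).
have [Ct Ct0 HCt] := @fin_ub 'I_5 (fun i => `|t0 0 i|).
pose e := Num.min (Num.min (rho / 6) (w1 / 2)) (Num.min (Num.min (l1 / 2) (v1 / 2)) 1).
have e0 : 0 < e by rewrite !lt_min ltr01 !divr_gt0.
have [er_ ew] : e <= rho / 6 /\ e <= w1 / 2 by rewrite /e !ge_min !lexx ?orbT.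
have [el [ev e1]] : e <= l1 / 2 /\ e <= v1 / 2 /\ e <= 1 by rewrite /e !ge_min !lexx ?orbT.
have [d1 d10 Hd1] := near_params t0 pY0 e0.
have [d2 d20 Hd2] := loop_solve.
pose de := Num.min (Num.min d1 d2) (Num.min (rho / 6) 1).
have de0 : 0 < de by rewrite !lt_min d10 d20 ltr01 divr_gt0.
have [ded1 ded2] : de <= d1 /\ de <= d2 by rewrite /de !ge_min !lexx ?orbT.
have [der de1] : de <= rho / 6 /\ de <= 1 by rewrite /de !ge_min !lexx ?orbT.
have na Y t : `|Y - Y0| < de -> `|t - t0| < de -> near_at Y0 t0 e Y t.
  by move=> h1 h2; apply: Hd1; [exact: lt_le_trans h1 _|exact: lt_le_trans h2 _].
have tb (t : V5) i : `|t - t0| < de -> `|t 0 i| <= Ct + 1.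
  move=> h; rewrite -[t 0 i](subrK (t0 0 i)) (le_trans (ler_normD _ _))// addrC lerD//.
  have := rV_entry_le (t - t0) i; rewrite !mxE => /le_trans; apply.
  exact: le_trans (ltW h) de1.
(* Below all turning parameters of nearby loops, so that corners belong to [M], and below the
   parameter [(1 + s) / 2] of the far end of every splitting. *)
pose c' := Num.min (l1 / 2) (1 / 4).
have c'0 : 0 < c' by rewrite lt_min !divr_gt0.
have [c'l c'4] : c' <= l1 / 2 /\ c' <= 1 / 4 by rewrite /c' !ge_min !lexx ?orbT.
pose U := UU de 0; pose M := UU de c'.
have opn s : 0 <= s -> st_open (UU de s).
  move=> s0; apply: UU_open => // [Y t h1 h2|Y t h1 h2].
    exact: na_pos (na Y t h1 h2).
  exact: (Hd2 Y t (lt_le_trans h1 ded2) (lt_le_trans h2 ded2) (na_pos (na Y t h1 h2))).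
have lamc (Y t : V5) i : `|Y - Y0| < de -> `|t - t0| < de -> c' < lam i Y.
  move=> h1 h2; have := na_lam (na Y t h1 h2) i; rewrite ltr_distl => /andP[h _].
  exact: (ar_lam (Hl1 i) h el c'l).
have MP0 : M base_state.
  exists c4, (lam c4 Y0), Y0, t0, (fun _ _ => 0); split; last exact: base_rep.
    by rewrite lam_lt1// andbT (lamc Y0 t0)// subrr normr0.
  by split; rewrite ?subrr ?normr0// => r k; rewrite normr0.
have Ubd P : U P -> (forall r k, `|P (lo r) k| <= CO + CA + 3) /\ (forall r k, `|tau P r k| <= 5 * CB).
  move=> [i [s [Y [t [A [sb [h1 h2 cl hA] rP]]]]]]; have [PA Pt] := rP.
  have N := na Y t h1 h2; have pY := na_pos N; split=> r k.
    rewrite PA; have a1 := na_Aof N i r k; have a2 := na_Ast N i r k.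
    exact: (ar_lo (hA r k) de1 a1 a2 e1 (HCO (i, (r, k))) (HCA (i, (r, k))) sb).
  rewrite Pt /comb (le_trans (ler_norm_sum _ _ _))//.
  apply: (@le_trans _ _ (\sum_(j < 5) CB)); last by rewrite sumr_const card_ord -[leLHS]mulr_natl.
  apply: ler_sum => j _; rewrite normrM -[leRHS]mul1r; apply: ler_pM => //; last exact: (HCB (j, (r, k))).
  have /andP[b1 b2] := sw_itv i j pY sb; by rewrite gtr0_norm// ltW.
pose K := 5 * CB + mm * (CO + CA + 3) + (2 * (CV + 1)) + (Ct + 1) + 1.
have mCOA0 : 0 <= CO + CA + 3 by rewrite !addr_ge0.
have mCOA : CO + CA + 3 <= mm * (CO + CA + 3) by rewrite ler_peMl.
have [K0 hK1 hK2 [hK3 hK4 hK5]] : [/\ 0 < K, CO + CA + 3 <= K, 5 * CB + mm * (CO + CA + 3) <= K &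
    [/\ 2 * (CV + 1) <= K, Ct + 1 <= K & 1 <= K]].
  by apply: ar_K => //; rewrite ?mulr_ge0 ?addr_ge0.
(* The second bound is a quarter of a lower bound for the squared length of the directions [dirA];
   the quarter accounts for splittings at least half as long as the segment. *)
pose c := Num.min (c' / 2) (mm^-1 ^+ 2 * ((v1 / 2) ^+ 2 / (1 + (Ct + 1) ^+ 2)) / 4).
have c0 : 0 < c.
  rewrite lt_min !divr_gt0//= ?mulr_gt0// ?exprn_gt0 ?invr_gt0 ?divr_gt0 ?exprn_gt0//.
    exact: sqr1_gt0.
have [cc' cv] : c <= c' / 2 /\ c <= mm^-1 ^+ 2 * ((v1 / 2) ^+ 2 / (1 + (Ct + 1) ^+ 2)) / 4.
  by rewrite /c !ge_min !lexx ?orbT.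
have vlow Y t i : `|Y - Y0| < de -> `|t - t0| < de ->
    c <= \sum_(j < 4) (dirA i Y t j / 2) ^+ 2 /\ forall r k, `|Vv i Y r k| <= CV + 1.
  move=> h1 h2; have N := na Y t h1 h2; split; last first.
    move=> r k; rewrite -[Vv i Y r k](subrK (Vv i Y0 r k)) (le_trans (ler_normD _ _))// addrC lerD//.
      exact: (HCV (i, (r, k))).
    exact: le_trans (ltW (na_Vv N i r k)) e1.
  apply: (le_trans cv); under eq_bigr do rewrite expr_div_n.
  rewrite -mulr_suml (_ : 2 ^+ 2 = 4 :> R); last by rewrite expr2 -natrM.
  rewrite ler_pM2r ?invr_gt0//; apply: le_trans (dirA_len i Y t).
  apply: ler_wpM2l; first exact: sqr_ge0.
  set rk := vr i; have vb : v1 / 2 <= `|Vv i Y rk.1 rk.2|.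
    exact: (ar_vb (Hv1 i) (na_Vv N i rk.1 rk.2) ev).
  have vb2 : (v1 / 2) ^+ 2 <= \sum_r \sum_k Vv i Y r k ^+ 2.
    apply: (@le_trans _ _ (Vv i Y rk.1 rk.2 ^+ 2)).
      rewrite -[leRHS]real_normK ?num_real// lerXn2r ?nnegrE// ltW// divr_gt0//.
    rewrite (bigD1 rk.1)//= (bigD1 rk.2)//= -addrA lerDl addr_ge0// sumr_ge0// => *; rewrite ?sqr_ge0//.
    by apply: sumr_ge0 => *; exact: sqr_ge0.
  apply: ler_pM => //; first by rewrite exprn_ge0// divr_ge0// ltW.
    by rewrite invr_ge0 ltW// sqr1_gt0.
  rewrite lef_pV2 ?posrE ?sqr1_gt0// lerD2l -[t 0 i ^+ 2]real_normK ?num_real//.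
  by apply: lerXn2r; rewrite ?nnegrE ?addr_ge0//; exact: (tb t i h2).
have MU : M `<=` U by apply: UU_le; exact: ltW.
have inM0 i Y t A P : dom de Y t A -> rep i 0 Y t A P -> M P.
  move=> dA rP; have [h1 h2 cl hA] := dA; have pY := na_pos (na Y t h1 h2).
  have [i' rP'] := rep0 pY cl rP; exists i', (lam i' Y), Y, t, A; split => //.
  by rewrite (lamc Y t)// lam_lt1.
have sp : splittable U M dd c K.
  split => //.
  - exact: opn.
  - by apply: opn; exact: ltW.
  - move=> P j k UP; have [b1 b2] := Ubd P UP.
    rewrite -[j](@splitK 2 2); case: (@fintype.split 2 2 j) => r /=.
      exact: le_trans (b1 r k) hK1.
    apply: le_trans hK2.
    have mb k' : `|mm * P (lo r) k'| <= mm * (CO + CA + 3).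
      by rewrite normrM (gtr0_norm mm0) ler_wpM2l// ltW.
    case: (ord2P k) => ->.
      rewrite (_ : P (rshift 2 r) k0 = tau P r k1 + mm * P (lo r) k1); last by rewrite /tau /= subrK.
      by apply: (le_trans (ler_normD _ _)); apply: lerD.
    rewrite (_ : P (rshift 2 r) k1 = - (tau P r k0 + mm * P (lo r) k0)); last by rewrite /tau /= subrK opprK.
    by rewrite normrN; apply: (le_trans (ler_normD _ _)); apply: lerD.
  - exact: ctn_dd.
  - move=> P [i [s [Y [t [A [sb [h1 h2 cl hA] rP]]]]]].
    have [/andP[d0' d1'] _] := rep_dd (na_pos (na Y t h1 h2)) sb rP.
    by rewrite d0' (le_trans d1').
  move=> P UP.
  have [i [s [Y [t [A [sb dA rP Ms]]]]]] : exists i s Y t A, [/\ 0 < s < 1, dom de Y t A, rep i s Y t A P & M P -> c' < s].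
    have [[i [s [Y [t [A [/andP[h1 h2] h3 h4]]]]]]|nM] := pselect (M P).
      by exists i, s, Y, t, A; split => //; rewrite h2 (lt_trans c'0).
    by have [i [s [Y [t [A [h2 h3 h4]]]]]] := UP; exists i, s, Y, t, A; split.
  have [h1 h2 cl hA] := dA; have N := na Y t h1 h2; have pY := na_pos N.
  have [vl vb] := vlow Y t i h1 h2.
  have /andP[s0 s1] := sb; have [q1 q2 q3 q4] := ar_s sb.
  have q : 0 < 1 + s by rewrite addr_gt0.
  (* The state is split between the parameters [0] and [(1 + s) / 2] of its own segment, and [p] is
     the weight of the far end. Stopping at [(1 + s) / 2] halves the distance to the vertex and
     stays inside the open set, which does not contain [s = 1]. *)
  pose a j := (1 + s) / 2 * dirA i Y t j; pose x := xi (t 0 i); pose p := 2 * s / (1 + s).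
  have mv h : rep i (s + h * ((1 + s) / 2)) Y t A (fun j k => P j k + h * (a j * x k)).
    have := rep_move (h * ((1 + s) / 2)) pY rP.
    rewrite (_ : (fun j k => P j k + h * (a j * x k)) =
      (fun j k => P j k + h * ((1 + s) / 2) * (dirA i Y t j * xi (t 0 i) k)))//.
    by apply/funext => j; apply/funext => k; rewrite /a /x; ring.
  have e_lo : s + (- p) * ((1 + s) / 2) = 0 by rewrite /p; field; rewrite gt_eqF.
  have e_hi : s + (1 - p) * ((1 + s) / 2) = (1 + s) / 2 by rewrite /p; field; rewrite gt_eqF.
  have Mlo : M (fun j k => P j k + (- p) * (a j * x k)).
    by apply: (inM0 i Y t A _ dA); have := mv (- p); rewrite e_lo.
  have Mhi : M (fun j k => P j k + (1 - p) * (a j * x k)).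
    exists i, ((1 + s) / 2), Y, t, A; split => //; last by have := mv (1 - p); rewrite e_hi.
    by rewrite q2 (le_lt_trans c'4).
  exists a, x, p; split; split => //.
  - move=> j; apply: (@le_trans _ _ (2 * (CV + 1))); last exact: hK3.
    rewrite /a normrM; apply: le_trans (dirA_le t j vb); rewrite ler_piMl//.
    by rewrite ger0_norm ?divr_ge0 ?(ltW q)// ltW.
  - move=> k; rewrite /x /xi; case: ifP => _; last by rewrite normr1.
    exact: le_trans (tb t i h2) hK4.
  - by rewrite /x /xi /= oner_eq0.
  - apply: (le_trans vl); apply: ler_sum => j _; rewrite /a /x /xi /= mulr1 -[leRHS]real_normK ?num_real//.
    rewrite -[leLHS]real_normK ?num_real//; apply: lerXn2r; rewrite ?nnegrE// !normrM mulrC.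
    by apply: ler_wpM2r => //; rewrite normfV normr_nat ger0_norm ?divr_ge0 ?(ltW q).
  - apply/andP; split; first by rewrite divr_gt0// mulr_gt0.
    by rewrite ltr_pdivrMr// mul1r.
  - move=> h hb; have /andP[m1 m2] := ar_mid sb hb.
    move: m1; rewrite le_eqVlt => /orP[/eqP E|m1].
      by apply: MU; apply: (inM0 i Y t A _ dA); have := mv h; rewrite -E.
    by exists i, (s + h * ((1 + s) / 2)), Y, t, A; split => //; rewrite m1.
  - move=> /Ms cs; have [/andP[d0' _] ds] := rep_dd pY sb rP.
    exact: (ar_pp sb cs (ltW c0) cc' d0' ds).
(* A state of [U] close to [P] has its [i]-th coordinate near 1. All weights are bounded below, so
   it must lie on segment [i] with parameter near 1, whence [A] is near the vertex. The coordinates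
   of [P] are nonnegative and sum to 1, so the others vanish and [tau] equals [Bv i]. *)
have cl_vertex P i : st_closure U P -> Lb i P = 1 ->
    (forall r k, `|P (lo r) k - Xv i r k| < rho) /\ (forall r k, tau P r k = Bv i r k).
  move=> cP Li; split.
    pose e2 := Num.min (w1 / 2) (w1 * rho / (12 * (CA + 1))).
    have e20 : 0 < e2 by rewrite lt_min !divr_gt0// !mulr_gt0// ltr_pwDr.
    have [m m0 Hm] := Lb_near P e20.
    have [Q UQ hQ] := cP (Num.min m (rho / 6)) ltac:(by rewrite lt_min m0 divr_gt0).
    have hL : `|Lb i Q - Lb i P| < e2 by apply: Hm => j k; have := hQ j k; rewrite lt_min => /andP[].
    have hQ6 j k : `|Q j k - P j k| < rho / 6 by have := hQ j k; rewrite lt_min => /andP[].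
    have [i' [s [Y [t [A [sb [h1 h2 cl hA] rQ]]]]]] := UQ.
    have N := na Y t h1 h2; have pY := na_pos N; have /andP[s0 s1] := sb.
    have wlow (j j' : 'I_5) : w1 / 2 < wn j Y j'.
      have := na_wn N j j'; rewrite ltr_distl => /andP[h _].
      exact: (ar_wlow (Hw1 (j, j')) h ew).
    have e2w : e2 <= w1 / 2 by rewrite /e2 ge_min lexx.
    have L1 : 1 - e2 < sw i' s Y i.
      by rewrite -(rep_Lb pY rQ); move: hL; rewrite Li ltr_distl => /andP[].
    have ii : i' = i.
      apply/eqP; apply: contrapT => /negP ni; move: L1; apply/negP; rewrite -leNgt.
      rewrite /sw eq_sym (negbTE ni) mulr0 addr0.
      have h3 := wn_other i' pY (j := i') (j' := i); rewrite eq_sym in h3.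
      exact: (ar_idx e2w (h3 ni) (wlow i' i') (wn_gt0 pY i' i) s0).
    rewrite ii in rQ L1; have [QA _] := rQ.
    have hs : (1 - s) * (w1 / 2) < e2.
      have [j' jj] := other_ord i.
      move: L1; rewrite /sw eqxx mulr1 => L1.
      exact: (ar_hs sb (wn_other i pY jj) (wlow i j') L1).
    have e2r : e2 <= w1 * rho / (12 * (CA + 1)) by rewrite /e2 ge_min lexx orbT.
    move=> r k; exact: (ar_vertex (QA r k) (hA r k) der (na_Aof N i r k) (na_Ast N i r k) er_ e1 (HCA (i, (r, k))) sb w10 hs e2r (hQ6 (lo r) k)).
  have L0 j : 0 <= Lb j P.
    apply/ler_addgt0Pr => e2 e20; have [m m0 Hm] := Lb_near P e20.
    have [Q UQ hQ] := cP m m0; have := Hm Q hQ j.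
    have [i' [s [Y [t [A [sb [h1 h2 cl hA] rQ]]]]]] := UQ.
    have pY := na_pos (na Y t h1 h2); rewrite (rep_Lb pY rQ).
    have /andP[b1 _] := sw_itv i' j pY sb; rewrite ltr_distl => /andP[_ b2].
    exact: (ar_pos b1 b2).
  have Lz j : j != i -> Lb j P = 0.
    move=> ji; apply/eqP; rewrite eq_le L0 andbT.
    have := Lb_sum P; rewrite (bigD1 i)//= Li (bigD1 j)//= => h.
    apply: (ar_zero h); exact: sumr_ge0.
  move=> r k; rewrite -Lb_comb /comb (bigD1 i)//= Li mul1r big1 ?addr0// => j ji.
  by rewrite Lz// mul0r.
have cl_d P : dd P = 0 -> exists i, Lb i P = 1.
  move=> /eqP; rewrite prodf_seq_eq0 => /hasP[i _ /=]; rewrite subr_eq0 => /eqP h.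
  by exists i.
exists U, M, dd, c, K, Lb, lb, rho, base_state; split => //.
- exact: Lb_affine.
- move=> i P [i' [s [Y [t [A [sb [h1 h2 cl hA] rP]]]]]].
  have pY := na_pos (na Y t h1 h2); rewrite (rep_Lb pY rP).
  by have /andP[] := sw_itv i' i pY sb.
- move=> i P Q cP cQ dP dQ hPQ LP; have [j LQ] := cl_d Q dQ.
  have [<-//|/eqP ij] := eqVneq j i.
  have [r [k h]] := Xsep (fun E => ij (esym E)).
  have [/(_ r k) h1 _] := cl_vertex P i cP LP; have [/(_ r k) h2 _] := cl_vertex Q j cQ LQ.
  have := hPQ r k; rewrite !mxE => h3.
  exfalso; exact: (ar_sep h h1 h2 h3).
- move=> P cP dP i; have [j Lj] := cl_d P dP; have [h1 h2] := cl_vertex P j cP Lj.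
  have hX := @XF j (upper P); rewrite !hX; try by move=> r k; rewrite mxE.
  rewrite !mxE -!h2 /tau /=; split; ring.
- exact: MU.
- exact: base_lo.
Qed.

End geometry.

(** * Smooth functions *)

Section smooth_functions.
Context {R : realType}.

(** The order is peeled off one derivative at a time in arbitrary directions, as in [iter_deriv], so
    the product and chain rules go by induction on [n]. *)
Fixpoint Ck (V : normedModType R) (n : nat) (f : V -> R) : Prop :=
  continuous f /\
  if n is n'.+1 then forall v, (forall x, derivable f x v) /\ Ck n' (fun x => 'D_v f x) else True.

Definition Cinf (V : normedModType R) (f : V -> R) := forall n, Ck n f.

Lemma Ck_continuous (V : normedModType R) n (f : V -> R) : Ck n f -> continuous f.
Proof. by case: n => [|n] []. Qed.

Lemma CkS (V : normedModType R) n (f : V -> R) (df : V -> V -> R) : continuous f ->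
  (forall v x, is_derive x v f (df v x)) -> (forall v, Ck n (df v)) -> Ck n.+1 f.
Proof.
move=> cf dff Cdf; split => // v; split=> [x|]; first by have [] := dff v x.
rewrite (_ : (fun x => _) = df v); first exact: Cdf.
by apply/funext => x; have [_ ->] := dff v x.
Qed.

Lemma Ck_is_derive (V : normedModType R) n (f : V -> R) v x : Ck n.+1 f -> is_derive x v f ('D_v f x).
Proof. by move=> [_ /(_ v)[d _]]; apply: DeriveDef. Qed.

Lemma Ck_derive (V : normedModType R) n (f : V -> R) v : Ck n.+1 f -> Ck n (fun x => 'D_v f x).
Proof. by move=> [_ /(_ v)[]]. Qed.

Lemma Ck_le (V : normedModType R) n (f : V -> R) : Ck n.+1 f -> Ck n f.
Proof.
elim: n f => [f [cf _]//|n IH f Cf]; have cf := Ck_continuous Cf.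
apply: (CkS (df := fun v x => 'D_v f x)) => // [v x|v]; first exact: Ck_is_derive Cf.
by apply: IH; exact: Ck_derive Cf.
Qed.

Lemma Ck_iter_deriv (V : normedModType R) n (f : V -> R) vs : Ck (n + size vs) f -> Ck n (iter_deriv f vs).
Proof.
elim: vs n => [|v vs IH] n; first by rewrite addn0.
by rewrite /= addnS -addSn => /IH h; exact: Ck_derive h.
Qed.

Lemma Cinf_smooth (V : normedModType R) (f : V -> R) : Cinf f -> smooth f.
Proof.
move=> Cf vs; have C1 := Ck_iter_deriv (Cf (1 + size vs)%N).
by split=> [|v x]; [exact: Ck_continuous C1|have [] := Ck_is_derive v x C1].
Qed.

Lemma Ck_cst (V : normedModType R) n (c : R) : Ck n (fun _ : V => c).
Proof.
elim: n c => [|n IH] c; first by split => //; exact: cst_continuous.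
exact: (@CkS V n (fun=> c) (fun _ _ => 0) (@cst_continuous _ _ c) (fun v x => is_derive_cst c x v) (fun v => IH 0)).
Qed.

Lemma CkD (V : normedModType R) n (f g : V -> R) : Ck n f -> Ck n g -> Ck n (fun x => f x + g x).
Proof.
elim: n f g => [|n IH] f g Cf Cg; have cf := Ck_continuous Cf; have cg := Ck_continuous Cg;
  have cD : continuous (fun x => f x + g x) by move=> x; apply: cvgD; [exact: cf|exact: cg].
  by split.
apply: (@CkS V n _ (fun v x => 'D_v f x + 'D_v g x) cD) => [v x|v].
  by apply: is_deriveD; [exact: (Ck_is_derive v x Cf)|exact: (Ck_is_derive v x Cg)].
by apply: IH; [exact: (Ck_derive v Cf)|exact: (Ck_derive v Cg)].
Qed.

Lemma CkM (V : normedModType R) n (f g : V -> R) : Ck n f -> Ck n g -> Ck n (fun x => f x * g x).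
Proof.
elim: n f g => [|n IH] f g Cf Cg; have cf := Ck_continuous Cf; have cg := Ck_continuous Cg;
  have cD : continuous (fun x => f x * g x) by move=> x; apply: cvgM; [exact: cf|exact: cg].
  by split.
apply: (@CkS V n _ (fun v x => f x * 'D_v g x + g x * 'D_v f x) cD) => [v x|v].
  by apply: is_deriveM; [exact: (Ck_is_derive v x Cf)|exact: (Ck_is_derive v x Cg)].
by apply: CkD; apply: IH; [exact: Ck_le|exact: (Ck_derive v Cg)|exact: Ck_le|exact: (Ck_derive v Cf)].
Qed.

Lemma line_derive (V : normedModType R) (f : V -> R) (x v : V) (l : R) :
  is_derive x v f l <-> is_derive (0 : R) 1 (fun s : R => f (s *: v + x)) l.
Proof.
have E h : (h *: (1 : R) + 0 : R) = h by rewrite addr0 -[h *: _]/(h * 1) mulr1.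
split=> /is_deriveP H; apply/is_deriveP => e e0; have [d d0 Hd] := H e e0; exists d => // h h0 hd;
  by have := Hd h h0 hd; rewrite /= E scale0r add0r.
Qed.

Lemma is_derive_comp (V : normedModType R) (h : R -> R) (f : V -> R) x v a b :
  is_derive (f x) 1 h a -> is_derive x v f b -> is_derive x v (fun x => h (f x)) (a * b).
Proof.
move=> dh /line_derive df; apply/line_derive.
apply: (@is_derive1_comp R h (fun s : R => f (s *: v + x))) => //.
by rewrite scale0r add0r.
Qed.

Lemma is_derive_dir (h : R -> R) (x v a : R) : is_derive x 1 h a -> is_derive x v h (v * a).
Proof.
move=> dh; apply/line_derive; rewrite mulrC.
apply: (@is_derive1_comp R h (fun s : R => s *: v + x)); first by rewrite scale0r add0r.
apply/is_deriveP => e e0; exists 1 => // r r0 _.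
have -> : r^-1 * ((r *: 1 + 0) *: v + x - (0 *: v + x)) - v = 0; last by rewrite normr0 ltW.
by rewrite -![_ *: _]/(_ * _); field.
Qed.

Lemma Ck_comp (V : normedModType R) n (h : R -> R) (f : V -> R) : Ck n (h : R -> R) -> Ck n f -> Ck n (fun x => h (f x)).
Proof.
elim: n h f => [|n IH] h f Ch Cf; have cf := Ck_continuous Cf; have ch := Ck_continuous Ch;
  have cD : continuous (fun x => h (f x)) by move=> x; apply: (@continuous_comp _ _ _ f h); [exact: cf|exact: ch].
  by split.
apply: (@CkS V n _ (fun v x => 'D_(1 : R) h (f x) * 'D_v f x) cD) => [v x|v].
  by apply: is_derive_comp; [exact: (Ck_is_derive (1 : R) (f x) Ch)|exact: (Ck_is_derive v x Cf)].
apply: CkM; last exact: (Ck_derive v Cf).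
by apply: (IH (fun y => 'D_(1 : R) h y) f); [exact: (Ck_derive (1 : R) Ch)|exact: Ck_le].
Qed.

Lemma Ck1S n (h h' : R -> R) : (forall x : R, is_derive x 1 h (h' x)) -> Ck n (h' : R -> R) -> Ck n.+1 (h : R -> R).
Proof.
move=> dh Ch'; apply: (@CkS R n h (fun v x => v * h' x)) => [|v x|v].
- exact: is_derive_continuous dh.
- exact: is_derive_dir.
- by apply: CkM => //; exact: Ck_cst.
Qed.

Lemma Cinf1S (h h' : R -> R) : (forall x : R, is_derive x 1 h (h' x)) -> Cinf (h' : R -> R) -> Cinf (h : R -> R).
Proof. by move=> dh Ch' n; apply: Ck_le; apply: (Ck1S dh). Qed.

Lemma Cinf_id : Cinf (fun x : R => x).
Proof. by apply: (Cinf1S (h' := fun=> 1)) =>  n; exact: Ck_cst. Qed.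

Lemma Cinf_cst (V : normedModType R) c : Cinf (fun _ : V => c). Proof. by move=> n; exact: Ck_cst. Qed.
Lemma CinfD (V : normedModType R) (f g : V -> R) : Cinf f -> Cinf g -> Cinf (fun x => f x + g x).
Proof. by move=> Cf Cg n; apply: CkD. Qed.
Lemma CinfM (V : normedModType R) (f g : V -> R) : Cinf f -> Cinf g -> Cinf (fun x => f x * g x).
Proof. by move=> Cf Cg n; apply: CkM. Qed.
Lemma CinfN (V : normedModType R) (f : V -> R) : Cinf f -> Cinf (fun x => - f x).
Proof.
move=> Cf; rewrite (_ : (fun x => - f x) = (fun x => -1 * f x)); last by apply/funext => x; rewrite mulN1r.
by apply: CinfM => //; exact: Cinf_cst.
Qed.
Lemma Cinf_comp (V : normedModType R) (h : R -> R) (f : V -> R) : Cinf (h : R -> R) -> Cinf f -> Cinf (fun x => h (f x)).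
Proof. by move=> Ch Cf n; apply: Ck_comp. Qed.

Lemma Cinf_entry (i k : 'I_2) : Cinf (fun A : 'M[R]_2 => A i k).
Proof.
case=> [|n]; first by split => //; exact: coord_continuous.
apply: (@CkS _ n _ (fun (v : 'M[R]_2) _ => v i k)) => [|v x|v]; [exact: coord_continuous| |exact: Ck_cst].
apply/is_deriveP => e e0; exists 1 => // h h0 _.
by rewrite !mxE addrK mulrA mulVf// mul1r subrr normr0 ltW.
Qed.

End smooth_functions.

(** * Smooth steps, a softened positive part and a truncated square *)

Section cutoffs.
Context {R : realType}.

Definition flat (p : {poly R}) (x : R) : R := if 0 < x then p.[x^-1] * expR (- x^-1) else 0.

Lemma monomial_exp_le (k : nat) (y : R) : 0 < y -> y ^+ k * expR (- y) <= k.+1`!%:R / y.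
Proof.
move=> y0; have f0 : 0 < k.+1`!%:R :> R by rewrite ltr0n fact_gt0.
have h : y ^+ k.+1 / k.+1`!%:R <= expR y.
  by apply: le_trans (expR_ge1Dxn k (ltW y0)); rewrite lerDr.
rewrite expRN ler_pdivlMr// mulrAC -exprSr ler_pdivrMr ?expR_gt0//.
by rewrite -ler_pdivrMl// mulrC.
Qed.

Lemma flat_le p : exists2 C, 0 <= C & forall x, `|flat p x| <= C * x ^+ 2.
Proof.
pose C := \sum_(i < size p) `|p`_i| * (i.+2`!)%:R; exists C.
  by apply: sumr_ge0 => i _; rewrite mulr_ge0.
move=> x; rewrite /flat; case: ifP => [x0|_]; last first.
  by rewrite normr0 mulr_ge0 ?sqr_ge0// sumr_ge0// => i _; rewrite mulr_ge0.
have y0 : 0 < x^-1 by rewrite invr_gt0.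
rewrite horner_coef mulr_suml; apply: (le_trans (ler_norm_sum _ _ _)); rewrite mulr_suml.
apply: ler_sum => i _; rewrite !normrM -mulrA -mulrA; apply: ler_wpM2l => //.
rewrite normrX (gtr0_norm y0) (gtr0_norm (expR_gt0 _)).
have := monomial_exp_le i.+1 y0; rewrite exprS invrK => h.
rewrite -(ler_pM2l y0) mulrA (le_trans h)// le_eqVlt; apply/orP; left; apply/eqP.
by field; rewrite gt_eqF.
Qed.

(** The functions [p(1/x) * exp(-1/x)] are closed under differentiation, [p] becoming
    [(p - p') * X^2]. At 0 the quadratic bound [flat_le] gives derivative zero. *)
Lemma is_derive_flat p (x : R) : is_derive x 1 (flat p) (flat ((p - p^`()) * 'X^2) x).
Proof.
have [x0|x0|<-] := ltgtP 0 x; last first.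
- have [C C0 HC] := flat_le p; rewrite {2}/flat ltxx; apply/is_deriveP => e e0.
  exists (e / (C + 1)); first by rewrite divr_gt0// ltr_pwDr.
  move=> h h0 hd; rewrite addr0 subr0 -[h *: 1]/(h * 1) mulr1 {2}/flat ltxx subr0 normrM normfV.
  have hp : 0 < `|h| by rewrite normr_gt0.
  rewrite ler_pdivrMl// (le_trans (HC h))// -real_normK ?num_real// expr2 mulrCA.
  apply: ler_wpM2l => //; move: hd; rewrite ltr_pdivlMr ?ltr_pwDr// => /ltW; apply: le_trans.
  by rewrite mulrC ler_wpM2l// lerDl.
- rewrite {2}/flat ltNge (ltW x0)/=.
  apply: (@is_derive_near R _ (fun=> 0) x 0).
  have := lt_nbhsl x0; apply: filterS => y y0; by rewrite /flat ltNge (ltW y0).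
rewrite {2}/flat x0.
apply: (@is_derive_near R _ (fun y => p.[y^-1] * expR (- y^-1)) x).
  have : nbhs x [set y | 0 < y] by apply: open_nbhs_nbhs; split => //; exact: open_gt.
  by apply: filterS => y /= y0; rewrite /flat y0.
have nx : x != 0 by rewrite gt_eqF.
have dV : is_derive x 1 (fun y : R => y^-1) (- x ^- 2).
  have := @is_deriveV R (fun y => y) x 1 1 nx (is_derive_id _ _).
  by rewrite -[_ *: 1]/(_ * 1) mulr1.
have d1 : is_derive x 1 (fun y : R => p.[y^-1]) (p^`().[x^-1] * (- x ^- 2)).
  by apply: (@is_derive1_comp R (horner p) (fun y => y^-1)) => //; exact: is_derive_poly.
have d2 : is_derive x 1 (fun y : R => expR (- y^-1)) (expR (- x^-1) * (x ^- 2)).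
  apply: (@is_derive1_comp R expR (fun y => - y^-1)).
  by rewrite -[x ^- 2]opprK; exact: is_deriveN.
have E : p.[x^-1] *: (expR (- x^-1) * x ^- 2) + expR (- x^-1) *: (p^`().[x^-1] * - x ^- 2) =
    ((p - p^`()) * 'X^2).[x^-1] * expR (- x^-1).
  rewrite hornerM hornerD hornerN hornerXn -exprVn /GRing.scale/=.
  have ar (a b c y : R) : a * (c * y ^+ 2) + c * (b * - y ^+ 2) = (a - b) * y ^+ 2 * c by ring.
  exact: ar.
by rewrite -E; apply: is_deriveM.
Qed.

Lemma Cinf_flat p : Cinf (flat p).
Proof.
move=> n; elim: n p => [|n IH] p; last exact: (Ck1S (is_derive_flat p) (IH _)).
by split => //; exact: is_derive_continuous (is_derive_flat p).
Qed.

Definition bump : R -> R := flat 1.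

Lemma bump_le0 x : x <= 0 -> bump x = 0.
Proof. by move=> x0; rewrite /bump /flat ltNge x0. Qed.

Lemma bump_gt0 x : 0 < x -> 0 < bump x.
Proof. by move=> x0; rewrite /bump /flat x0 hornerC mul1r expR_gt0. Qed.

Lemma bump_ge0 x : 0 <= bump x.
Proof. by have [/bump_le0->|/bump_gt0/ltW] := leP x 0. Qed.

Lemma bump_homo x y : x <= y -> bump x <= bump y.
Proof.
move=> xy; have [x0|x0] := leP x 0; first by rewrite bump_le0// bump_ge0.
have y0 := lt_le_trans x0 xy.
by rewrite /bump /flat x0 y0 !hornerC !mul1r ler_expR lerN2 lef_pV2.
Qed.

Let b1 : R := bump 1.
Let b10 : 0 < b1. Proof. exact: bump_gt0. Qed.
Let b2 : R := bump b1.
Let b20 : 0 < b2. Proof. exact: bump_gt0. Qed.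

(* Composing two copies of exp(-1/x) gives a smooth step without any normalising integral. *)
Definition sstep (x : R) : R := 1 - bump (b1 - bump x) / b2.
Definition sym_step (x : R) : R := (1 + sstep x - sstep (1 - x)) / 2.

Lemma sstep_le0 x : x <= 0 -> sstep x = 0.
Proof. by move=> x0; rewrite /sstep (bump_le0 x0) subr0 divff ?subrr// gt_eqF. Qed.

Lemma sstep_ge1 x : 1 <= x -> sstep x = 1.
Proof. by move=> x1; rewrite /sstep [bump (_ - _)]bump_le0 ?mul0r ?subr0// subr_le0 bump_homo. Qed.

Lemma sstep_homo x y : x <= y -> sstep x <= sstep y.
Proof.
move=> xy; rewrite /sstep lerD2l lerN2 ler_pM2r ?invr_gt0//; apply: bump_homo.
by rewrite lerD2l lerN2 bump_homo.
Qed.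

Lemma sym_step_le0 x : x <= 0 -> sym_step x = 0.
Proof. by move=> x0; rewrite /sym_step sstep_le0// sstep_ge1 ?addr0 ?subrr ?mul0r//; lra. Qed.

Lemma sym_step_ge1 x : 1 <= x -> sym_step x = 1.
Proof. by move=> x1; rewrite /sym_step sstep_ge1// sstep_le0; lra. Qed.

Lemma sym_step_homo x y : x <= y -> sym_step x <= sym_step y.
Proof. 
move=> xy; have h1 := sstep_homo xy.
have h2 : sstep (1 - y) <= sstep (1 - x) by apply: sstep_homo; rewrite lerD2l lerN2.
rewrite /sym_step; move: (sstep x) (sstep y) (sstep (1 - x)) (sstep (1 - y)) h1 h2 => a b e f; lra.
Qed.

Lemma sym_step01 x : 0 <= sym_step x <= 1.
Proof.
have [x0|x0] := leP x 0; first by rewrite sym_step_le0// lexx ler01.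
have [x1|x1] := leP 1 x; first by rewrite sym_step_ge1// lexx ler01.
have := sym_step_homo (ltW x0); rewrite (sym_step_le0 (lexx 0)) => ->.
by have := sym_step_homo (ltW x1); rewrite (sym_step_ge1 (lexx 1)).
Qed.

Lemma sym_stepC x : sym_step x + sym_step (1 - x) = 1.
Proof. by rewrite /sym_step subKr; move: (sstep x) (sstep (1 - x)) => a b; lra. Qed.

Lemma Cinf_sym_step : Cinf sym_step.
Proof.
have Cs : Cinf sstep.
  apply: CinfD; first exact: Cinf_cst.
  apply: CinfN; apply: CinfM; last exact: Cinf_cst.
  apply: (@Cinf_comp R R bump (fun x => b1 - bump x)); first exact: Cinf_flat.
  by apply: CinfD; [exact: Cinf_cst|apply: CinfN; exact: Cinf_flat].
apply: CinfM; last exact: Cinf_cst.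
apply: CinfD; first by apply: CinfD => //; exact: Cinf_cst.
apply: CinfN; apply: (@Cinf_comp R R sstep (fun x => 1 - x)) => //.
by apply: CinfD; [exact: Cinf_cst|apply: CinfN; exact: Cinf_id].
Qed.

Lemma derive_homo (f f' : R -> R) x y : (forall s : R, is_derive s 1 f (f' s)) -> x <= y ->
  exists2 c, x <= c <= y & f y - f x = f' c * (y - x).
Proof.
move=> df; rewrite le_eqVlt => /orP[/eqP->|xy]; first by exists y; rewrite ?lexx// !subrr mulr0.
have [c] := @MVT R f f' x y xy (fun s _ => df s) (continuous_subspaceT (is_derive_continuous df)).
by rewrite in_itv/= => /andP[h1 h2] E; exists c; rewrite ?ltW.
Qed.

Definition convex1 (f : R -> R) := forall x y l : R, 0 <= l <= 1 -> f (l * x + (1 - l) * y) <= l * f x + (1 - l) * f y.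

Lemma convex1_derive (f f' : R -> R) : (forall s : R, is_derive s 1 f (f' s)) ->
  (forall x y, x <= y -> f' x <= f' y) -> convex1 f.
Proof.
move=> df mono x y l /andP[l0 l1].
have tan z w : f z + f' z * (w - z) <= f w.
  have [zw|/ltW wz] := leP z w.
    have [c /andP[c1 _] E] := derive_homo df zw.
    by rewrite -lerBrDl E ler_wpM2r ?subr_ge0// mono.
  have [c /andP[_ c2] E] := derive_homo df wz.
  by have : f' c * (z - w) <= f' z * (z - w) by [rewrite ler_wpM2r ?subr_ge0// mono]; lra.
set z := l * x + (1 - l) * y.
have h1 := tan z x; have h2 := tan z y.
have h3 : l * (f z + f' z * (x - z)) <= l * f x by exact: ler_wpM2l.
have h4 : (1 - l) * (f z + f' z * (y - z)) <= (1 - l) * f y by apply: ler_wpM2l => //; rewrite subr_ge0.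
apply: le_trans (lerD h3 h4); rewrite le_eqVlt; apply/orP; left; apply/eqP.
by move: (f z) (f' z) => a b; rewrite /z; ring.
Qed.

(** A convex smoothing of the positive part, exact outside [[- h, h]]. The derivative is a rescaled
    [sym_step], whose symmetry gives [rho x = x + rho (- x)]; so [rho] equals the identity to the
    right with no constant left over. *)
Lemma soft_plus (h : R) : 0 < h -> exists rho rho' : R -> R, [/\ Cinf rho, (forall x : R, is_derive x 1 rho (rho' x)) /\ (forall x y, x <= y -> rho' x <= rho' y),
  (forall x y, x <= y -> 0 <= rho y - rho x <= y - x),
  (forall x, x <= - h -> rho x = 0) & (forall x, h <= x -> rho x = x)].
Proof.
move=> h0; pose s x := sym_step ((x / h + 1) / 2).
have Cs : Cinf s.
  apply: (@Cinf_comp R R sym_step (fun x => (x / h + 1) / 2)); first exact: Cinf_sym_step.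
  apply: CinfM; last exact: Cinf_cst.
  apply: CinfD; last exact: Cinf_cst.
  by apply: CinfM; [exact: Cinf_id|exact: Cinf_cst].
have [G dG] := antiderivative (Ck_continuous (Cs 0%N)).
pose rho x := G x - G (- h).
have dr (x : R) : is_derive x 1 rho (s x).
  by rewrite -[s x]subr0; apply: is_deriveB.
have smono x y : x <= y -> s x <= s y.
  by move=> xy; apply: sym_step_homo; rewrite ler_pM2r ?invr_gt0// lerD2r ler_pM2r ?invr_gt0.
have r0 x : x <= - h -> rho x = 0.
  move=> xh; have [c /andP[_ c2] E] := derive_homo dr xh.
  have sc : s c = 0.
    apply: sym_step_le0; rewrite pmulr_lle0 ?invr_gt0// -lerBrDr sub0r ler_pdivrMr// mulN1r; exact: c2.
  have rh : rho (- h) = 0 by rewrite /rho subrr.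
  by move: E; rewrite sc mul0r rh sub0r => /eqP; rewrite oppr_eq0 => /eqP.
have incr x y : x <= y -> 0 <= rho y - rho x <= y - x.
  move=> xy; have [c _ ->] := derive_homo dr xy; have /andP[s0 s1] := sym_step01 ((c / h + 1) / 2).
  by rewrite mulr_ge0 ?subr_ge0//= ler_piMl// subr_ge0.
have sC x : s x + s (- x) = 1.
  by rewrite /s (_ : (- x / h + 1) / 2 = 1 - (x / h + 1) / 2) ?sym_stepC//; field; rewrite gt_eqF.
have odd x : rho x = x + rho (- x).
  pose D x := rho x - rho (- x) - x.
  have dD (y : R) : is_derive y 1 D 0.
    have d1 : is_derive y 1 (fun x => rho (- x)) (s (- y) * -1).
      by apply: (@is_derive1_comp R rho (fun x => - x)); exact: dr.
    have -> : 0 = s y - s (- y) * -1 - 1 :> R by rewrite mulrN1 opprK sC subrr.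
    by apply: is_deriveB; apply: is_deriveB.
  have E : D x = D 0.
    have [x0|/ltW x0] := leP 0 x.
      by have [c _ /eqP] := derive_homo dD x0; rewrite mul0r subr_eq0 => /eqP.
    by have [c _ /eqP] := derive_homo dD x0; rewrite mul0r subr_eq0 => /eqP.
  by move: E; rewrite /D oppr0; move: (rho x) (rho (- x)) (rho 0) => a b c; lra.
exists rho, s; split => //.
- exact: (Cinf1S dr).
- by move=> x hx; rewrite odd r0 ?addr0// lerN2.
Qed.

(** The derivative [2 * x] of the square is replaced by a smooth monotone clamp, equal to it on
    [[- e, e]] and bounded by [4 * e]. The small slope at large arguments makes the quadratic part
    of a piece harmless at the other vertices. *)
Lemma soft_square (e : R) : 0 < e -> exists th : R -> R, [/\ Cinf th, convex1 th,
  (forall x, `|x| <= e -> th x = x ^+ 2) & (forall x, th x <= 4 * e * `|x|)].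
Proof.
move=> e0; have [rho [rho' [Cr [dr mr] ir r0 r1]]] := soft_plus (@ltr01 R).
pose k x := rho (x + 2) - rho (x - 2) - 2.
have kb x : `|k x| <= 2.
  have xx : x - 2 <= x + 2 by lra.
  have /andP[h1 h2] := ir _ _ xx; rewrite /k; move: h1 h2; move: (rho (x + 2)) (rho (x - 2)) => a b *.
  by rewrite ler_norml; apply/andP; split; lra.
have dsh (x c : R) : is_derive x 1 (fun x => rho (x + c)) (rho' (x + c)).
  rewrite -[rho' _]mulr1; apply: (@is_derive1_comp R rho (fun x => x + c)).
  by have := is_deriveD (is_derive_id x (1 : R)) (is_derive_cst c x (1 : R)); rewrite addr0.
have dk (x : R) : is_derive x 1 k (rho' (x + 2) - rho' (x - 2)).
  rewrite -[_ - _]subr0; apply: is_deriveB.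
have kmono x y : x <= y -> k x <= k y.
  move=> xy; have [c _ E] := derive_homo dk xy; rewrite -subr_ge0 E mulr_ge0 ?subr_ge0//.
  by apply: mr; lra.
have kid x : `|x| <= 1 -> k x = x.
  rewrite ler_norml => /andP[x1 x2]; rewrite /k (r1 (x + 2)) ?(r0 (x - 2)); lra.
have Ck' : Cinf k.
  have Csh c : Cinf (fun x => rho (x + c)).
    apply: (@Cinf_comp R R rho (fun x => x + c)) => //.
    by apply: CinfD; [exact: Cinf_id|exact: Cinf_cst].
  apply: CinfD; last exact: Cinf_cst.
  by apply: CinfD => //; apply: CinfN.
pose f x := 2 * e * k (x / e).
have Cf : Cinf f.
  apply: CinfM; first exact: Cinf_cst.
  by apply: (@Cinf_comp R R k (fun x => x / e)) => //; apply: CinfM; [exact: Cinf_id|exact: Cinf_cst].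
have [G dG] := antiderivative (Ck_continuous (Cf 0%N)).
pose th x := G x - G 0.
have dt (x : R) : is_derive x 1 th (f x).
  by rewrite -[f x]subr0; apply: is_deriveB.
have th0 : th 0 = 0 by rewrite /th subrr.
exists th; split.
- exact: (Cinf1S dt).
- apply: (convex1_derive dt) => x y xy; apply: ler_wpM2l; first by rewrite mulr_ge0// ltW.
  by apply: kmono; rewrite ler_pM2r ?invr_gt0.
- move=> x xe; pose D y := th y - y ^+ 2.
  have dD (y : R) : is_derive y 1 D (f y - (y * 1 + y * 1)).
    by apply: is_deriveB.
  have fe y : `|y| <= e -> f y - (y * 1 + y * 1) = 0.
    move=> ye; rewrite /f kid; last by rewrite normrM normfV (gtr0_norm e0) ler_pdivrMr ?mul1r.
    by field; rewrite gt_eqF.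
  have D0 : D 0 = 0 by rewrite /D th0 expr0n/= subrr.
  suff : D x = 0 by rewrite /D => /eqP; rewrite subr_eq0 => /eqP.
  move: xe; rewrite ler_norml => /andP[xe1 xe2].
  have [x0|/ltW x0] := leP 0 x.
    have [c /andP[c1 c2]] := derive_homo dD x0; rewrite fe; last by rewrite ler_norml; apply/andP; split; lra.
    by rewrite mul0r D0 subr0.
  have [c /andP[c1 c2]] := derive_homo dD x0; rewrite fe; last by rewrite ler_norml; apply/andP; split; lra.
  by rewrite mul0r D0 sub0r => /eqP; rewrite oppr_eq0 => /eqP.
- move=> x; have := @derive_bound R th f 0 x (4 * e) dt; rewrite th0 !subr0 => h.
  apply: le_trans (ler_norm _) _; apply: h => s _.
  rewrite /f normrM (ger0_norm (_ : 0 <= 2 * e)) ?mulr_ge0 ?(ltW e0)//.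
  by have := kb (s / e); have : 0 < 2 * e by [rewrite mulr_gt0]; move: (`|k (s / e)|) => a *; nra.
Qed.

End cutoffs.

(** * The polyconvex energy *)

Section energy.
Context {R : realType}.
Notation k0 := (@Ordinal 2 0 isT).
Notation k1 := (@Ordinal 2 1 isT).
Notation mt := ('I_2 -> 'I_2 -> R).

Definition dot4 (x y : mt) : R := x k0 k0 * y k0 k0 + x k0 k1 * y k0 k1 + x k1 k0 * y k1 k0 + x k1 k1 * y k1 k1.
Definition det4 (x : mt) : R := x k0 k0 * x k1 k1 - x k0 k1 * x k1 k0.

Lemma det4E (A : 'M[R]_2) : \det A = det4 A.
Proof.
rewrite (expand_det_row _ k0) sum2 /cofactor !det_mx11 !mxE /det4.
rewrite (_ : lift k0 0 = k1 :> 'I_2); last exact: val_inj.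
rewrite (_ : lift k1 0 = k0 :> 'I_2); last exact: val_inj.
by rewrite /= ?addn0 ?expr0 ?expr1; ring.
Qed.

Lemma frob2E (A : 'M[R]_2) : frob2 A = dot4 A A.
Proof. by rewrite /frob2 -/(mdot A A) mdotE sum2 /dot4; ring. Qed.

Lemma Cinf_det4 : Cinf (fun A : 'M[R]_2 => det4 A).
Proof.
by apply: CinfD; [apply: CinfM; exact: Cinf_entry|apply: CinfN; apply: CinfM; exact: Cinf_entry].
Qed.

Section smax.
Variables (h : R) (rho rho' : R -> R).
Hypothesis h0 : 0 < h.
Hypothesis dr : forall x : R, is_derive x 1 rho (rho' x).
Hypothesis mr : forall x y, x <= y -> rho' x <= rho' y.
Hypothesis ir : forall x y, x <= y -> 0 <= rho y - rho x <= y - x.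
Hypothesis r0 : forall x, x <= - h -> rho x = 0.
Hypothesis r1 : forall x, h <= x -> rho x = x.

(** A smoothed maximum, monotone and jointly convex, which equals the larger argument as soon as the
    two differ by at least [h]. *)
Definition smax (s t : R) : R := s + rho (t - s).

Lemma smax_homo s t s' t' : s <= s' -> t <= t' -> smax s t <= smax s' t'.
Proof.
move=> ss tt; rewrite /smax.
have h1 : t - s <= t' - s by rewrite lerD2r.
have h2 : t' - s' <= t' - s by rewrite lerD2l lerN2.
have /andP[a1 _] := ir h1; have /andP[_ a2] := ir h2.
by move: a1 a2; move: (rho _) (rho _) (rho _) => a b c; lra.
Qed.

Lemma smax_convex s t s' t' l : 0 <= l <= 1 ->
  smax (l * s + (1 - l) * s') (l * t + (1 - l) * t') <= l * smax s t + (1 - l) * smax s' t'.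
Proof.
move=> lb; have := convex1_derive dr mr (t - s) (t' - s') lb; rewrite /smax.
rewrite (_ : l * (t - s) + _ = l * t + (1 - l) * t' - (l * s + (1 - l) * s')); last by ring.
by move: (rho _) (rho _) (rho _) => a b c; lra.
Qed.

Lemma smax_left s t : t <= s - h -> smax s t = s.
Proof. by move=> ts; rewrite /smax r0 ?addr0//; lra. Qed.

Lemma smax_right s t : s <= t - h -> smax s t = t.
Proof. by move=> st_; rewrite /smax r1 ?subrKC//; lra. Qed.

Lemma smax_le s t a : s <= a -> t <= a -> smax s t <= a + h.
Proof.
move=> sa ta; apply: (le_trans (smax_homo sa ta)).
rewrite /smax subrr lerD2l; have h1 : - h <= 0 by rewrite oppr_le0 ltW.
by have /andP[_] := ir h1; rewrite (r0 (lexx _)); lra.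
Qed.

Definition smax5 (u : 'I_5 -> R) : R :=
  smax (smax (smax (smax (u (@Ordinal 5 0 isT)) (u (@Ordinal 5 1 isT))) (u (@Ordinal 5 2 isT)))
    (u (@Ordinal 5 3 isT))) (u (@Ordinal 5 4 isT)).

Lemma smax5_homo u u' : (forall i, u i <= u' i) -> smax5 u <= smax5 u'.
Proof. by move=> H; do 4 apply: smax_homo => //. Qed.

Lemma smax5_convex u u' l : 0 <= l <= 1 ->
  smax5 (fun i => l * u i + (1 - l) * u' i) <= l * smax5 u + (1 - l) * smax5 u'.
Proof.
move=> lb; do 3 (apply: le_trans (smax_convex _ _ _ _ lb); apply: smax_homo => //).
exact: smax_convex.
Qed.

Let keep x y : y + 5 * h <= x -> smax x y = x.
Proof. by move=> H; apply: smax_left; move: h0; lra. Qed.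
Let take x y a n : x <= a + n * h -> n <= 3 -> a + 5 * h <= y -> smax x y = y.
Proof. by move=> H n3 ay; apply: smax_right; have : 0 <= (3 - n) * h by [rewrite mulr_ge0 ?subr_ge0// ltW]; move: h0; lra. Qed.
Let grow x y a n : 0 <= n -> x <= a + n * h -> y <= a -> smax x y <= a + (n + 1) * h.
Proof.
move=> n0 H ya; rewrite mulrDl mul1r addrA; apply: smax_le => //.
by apply: le_trans ya _; rewrite lerDl mulr_ge0// ltW.
Qed.

(** A nested maximum of the losers exceeds their common bound by at most [h] per nesting, three
    times at most before the winner enters, so a lead of [5 * h] is enough. *)
Lemma smax5_eq u i : (forall j, j != i -> u j + 5 * h <= u i) -> smax5 u = u i.
Proof.
move=> H; pose a := u i - 5 * h.
have le j : j != i -> u j <= a by move=> /H; rewrite /a; lra.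
have ai : a + 5 * h <= u i by rewrite /a; lra.
have le0 j : j != i -> u j <= a + 0 * h by move=> /le; rewrite mul0r addr0.
rewrite /smax5; case: i H @a le ai le0 => -[|[|[|[|[|//]]]]] iP; rewrite (bool_irrelevance iP isT) => H a le ai le0.
- by rewrite !keep//; exact: H.
- by rewrite (take (le0 (@Ordinal 5 0 isT) isT) _ ai)// !keep//; exact: H.
- rewrite (take (grow _ (le0 (@Ordinal 5 0 isT) isT) (le (@Ordinal 5 1 isT) isT)) _ ai)//; last lra.
  by rewrite !keep//; exact: H.
- rewrite (take (grow _ (grow _ (le0 (@Ordinal 5 0 isT) isT) (le (@Ordinal 5 1 isT) isT)) (le (@Ordinal 5 2 isT) isT)) _ ai)//; try lra.
  by rewrite !keep//; exact: H.
- apply: (take (grow _ (grow _ (grow _ (le0 (@Ordinal 5 0 isT) isT) (le (@Ordinal 5 1 isT) isT)) (le (@Ordinal 5 2 isT) isT))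
    (le (@Ordinal 5 3 isT) isT)) _ ai); lra.
Qed.

End smax.
Variables (X sg : 'I_5 -> mt) (f m : 'I_5 -> R) (mm s0 : R).
Hypothesis s00 : 0 < s0.
Hypothesis mmb : forall i, `|m i| < mm.
(** The supporting function at [X i], of slope [sg i] and determinant coefficient [m i], is affine
    in [A] and its determinant. At every other vertex [X j] it must lie at least [s0] below the
    value [f j]. *)
Hypothesis slack : forall i j, i <> j ->
  s0 <= f j - f i - dot4 (sg i) (fun r k => X j r k - X i r k) - m i * det4 (fun r k => X j r k - X i r k).

Section pieces.
Variables (nu : R) (th : R -> R).

(** When [th] is the square, the two brackets are the squared norm of [H] minus and plus twice its
    determinant, so the sum is [(mm - nu) / 2] times the squared norm minus [m i] times the
    determinant. Writing it with nonnegative coefficients makes it convex and allows each square to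
    be truncated separately. *)
Definition quad (i : 'I_5) (H : mt) : R :=
  (mm - nu + m i) / 4 * (th (H k0 k0 - H k1 k1) + th (H k0 k1 + H k1 k0)) +
  (mm - nu - m i) / 4 * (th (H k0 k0 + H k1 k1) + th (H k0 k1 - H k1 k0)).

(** The determinant of [A - X i] is expanded with [d] in place of the determinant of [A], so the
    expression is affine in [(A, d)]. The [nu] term completes [nu / 2] times the squared norm of [A]
    to that of [A - X i]. *)
Definition aff (i : 'I_5) (A : mt) (d : R) : R :=
  f i + dot4 (sg i) (fun r k => A r k - X i r k) + nu / 2 * (dot4 (X i) (X i) - 2 * dot4 (X i) A) +
  m i * (d - (X i k1 k1 * A k0 k0 + X i k0 k0 * A k1 k1 - X i k1 k0 * A k0 k1 - X i k0 k1 * A k1 k0) + det4 (X i)).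

(* Together with [nu / 2 |A|^2] this is a quadratic with gradient [mm A + sg i - mm X i] near [X i]. *)
Definition piece (i : 'I_5) (A : mt) (d : R) : R := aff i A d + quad i (fun r k => A r k - X i r k).

Lemma piece_convex i : 0 <= mm - nu + m i -> 0 <= mm - nu - m i -> convex1 th ->
  convex_fun2 (fun (A : 'M[R]_2) d => piece i A d).
Proof.
move=> a0 b0 ct A C s t l lb; rewrite /piece.
have affE : aff i (l *: A + (1 - l) *: C : 'M[R]_2) (l * s + (1 - l) * t) = l * aff i A s + (1 - l) * aff i C t.
  by rewrite /aff /dot4 !mxE; ring.
rewrite affE.
have q : quad i (fun r k => (l *: A + (1 - l) *: C : 'M[R]_2) r k - X i r k) <=
    l * quad i (fun r k => A r k - X i r k) + (1 - l) * quad i (fun r k => C r k - X i r k).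
  have c1 (x y z : R) : z = l * x + (1 - l) * y -> th z <= l * th x + (1 - l) * th y by move=> ->; exact: ct.
  rewrite /quad !mxE.
  have h1 := c1 (A k0 k0 - X i k0 k0 - (A k1 k1 - X i k1 k1)) (C k0 k0 - X i k0 k0 - (C k1 k1 - X i k1 k1))
    (l * A k0 k0 + (1 - l) * C k0 k0 - X i k0 k0 - (l * A k1 k1 + (1 - l) * C k1 k1 - X i k1 k1)) ltac:(ring).
  have h2 := c1 (A k0 k1 - X i k0 k1 + (A k1 k0 - X i k1 k0)) (C k0 k1 - X i k0 k1 + (C k1 k0 - X i k1 k0))
    (l * A k0 k1 + (1 - l) * C k0 k1 - X i k0 k1 + (l * A k1 k0 + (1 - l) * C k1 k0 - X i k1 k0)) ltac:(ring).
  have h3 := c1 (A k0 k0 - X i k0 k0 + (A k1 k1 - X i k1 k1)) (C k0 k0 - X i k0 k0 + (C k1 k1 - X i k1 k1))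
    (l * A k0 k0 + (1 - l) * C k0 k0 - X i k0 k0 + (l * A k1 k1 + (1 - l) * C k1 k1 - X i k1 k1)) ltac:(ring).
  have h4 := c1 (A k0 k1 - X i k0 k1 - (A k1 k0 - X i k1 k0)) (C k0 k1 - X i k0 k1 - (C k1 k0 - X i k1 k0))
    (l * A k0 k1 + (1 - l) * C k0 k1 - X i k0 k1 - (l * A k1 k0 + (1 - l) * C k1 k0 - X i k1 k0)) ltac:(ring).
  have a4 : 0 <= (mm - nu + m i) / 4 by rewrite divr_ge0.
  have b4 : 0 <= (mm - nu - m i) / 4 by rewrite divr_ge0.
  have := lerD (ler_wpM2l a4 (lerD h1 h2)) (ler_wpM2l b4 (lerD h3 h4)).
  move/le_trans; apply; rewrite le_eqVlt; apply/orP; left; apply/eqP; ring.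
by move: q; lra.
Qed.

Lemma Cinf_piece i : Cinf th -> Cinf (fun A : 'M[R]_2 => piece i A (det4 A)).
Proof.
move=> Ct; have Ce r k : Cinf (fun A : 'M[R]_2 => A r k - X i r k).
  by apply: CinfD; [exact: Cinf_entry|exact: Cinf_cst].
have Cc (a : R) (u : 'M[R]_2 -> R) : Cinf u -> Cinf (fun A => a * u A) by move=> Cu; apply: CinfM => //; exact: Cinf_cst.
have Cd (x : mt) (u : 'M[R]_2 -> mt) : (forall r k, Cinf (fun A => u A r k)) -> Cinf (fun A => dot4 x (u A)).
  by move=> Cu; rewrite /dot4; do 3 (apply: CinfD; last exact: Cc); exact: Cc.
have Ct' (u : 'M[R]_2 -> R) : Cinf u -> Cinf (fun A => th (u A)) by exact: Cinf_comp.
have Cx r k : Cinf (fun A : 'M[R]_2 => A r k) by exact: Cinf_entry.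
apply: CinfD; first apply: CinfD.
- apply: CinfD; first by apply: CinfD; [exact: Cinf_cst|exact: Cd].
  apply (Cc); apply: CinfD; first exact: Cinf_cst.
  by apply: CinfN; apply (Cc); exact: Cd.
- apply (Cc); apply: CinfD; last exact: Cinf_cst.
  apply: CinfD; first exact: Cinf_det4.
  by apply: CinfN; do 2 (apply: CinfD; last by apply: CinfN; exact: Cc); apply: CinfD; exact: Cc.
apply: CinfD; apply (Cc); apply: CinfD; apply (Ct'); apply: CinfD => //; exact: CinfN.
Qed.

Lemma piece_quad i (A : 'M[R]_2) e : (forall x, `|x| <= e -> th x = x ^+ 2) ->
  (forall r k, `|A r k - X i r k| <= e / 2) ->
  nu / 2 * dot4 A A + piece i A (det4 A) =
  f i + dot4 (sg i) (fun r k => A r k - X i r k) + mm / 2 * dot4 (fun r k => A r k - X i r k) (fun r k => A r k - X i r k).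
Proof.
move=> te hA.
have hD r k r' k' : `|A r k - X i r k + (A r' k' - X i r' k')| <= e.
  by rewrite (le_trans (ler_normD _ _))// [leRHS]splitr lerD.
have hB r k r' k' : `|A r k - X i r k - (A r' k' - X i r' k')| <= e.
  by rewrite (le_trans (ler_normB _ _))// [leRHS]splitr lerD.
rewrite /piece /quad !te// /aff /dot4 /det4.
by field.
Qed.

(** Far from [X i] the truncated squares are of order [e], so up to errors controlled by [nu] and
    [e] the piece is its supporting function, and [slack] decides which piece wins. *)
Lemma piece_le i (A : 'M[R]_2) e C : 0 <= mm - nu + m i -> 0 <= mm - nu - m i -> 0 <= nu -> 0 <= e ->
  (forall x, th x <= 4 * e * `|x|) -> (forall r k, `|A r k - X i r k| <= C) ->
  nu / 2 * dot4 A A + piece i A (det4 A) <=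
  f i + dot4 (sg i) (fun r k => A r k - X i r k) + m i * det4 (fun r k => A r k - X i r k) +
  (2 * nu * C ^+ 2 + 8 * e * C * mm).
Proof.
move=> a0 b0 n0 e0 te hA; have C0 : 0 <= C := le_trans (normr_ge0 _) (hA k0 k0).
have tC x : `|x| <= 2 * C -> th x <= 8 * e * C.
  by move=> xC; apply: (le_trans (te x)); have := ler_wpM2l e0 xC; lra.
have hD r k r' k' : `|A r k - X i r k + (A r' k' - X i r' k')| <= 2 * C.
  by rewrite (le_trans (ler_normD _ _))// mulr_natl mulr2n lerD.
have hB r k r' k' : `|A r k - X i r k - (A r' k' - X i r' k')| <= 2 * C.
  by rewrite (le_trans (ler_normB _ _))// mulr_natl mulr2n lerD.
have hs r k : (A r k - X i r k) ^+ 2 <= C ^+ 2.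
  by rewrite -real_normK ?num_real// lerXn2r ?nnegrE.
have q : quad i (fun r k => A r k - X i r k) <= 8 * e * C * mm.
  rewrite /quad.
  have q1 := lerD (tC _ (hB k0 k0 k1 k1)) (tC _ (hD k0 k1 k1 k0)).
  have q2 := lerD (tC _ (hD k0 k0 k1 k1)) (tC _ (hB k0 k1 k1 k0)).
  have a4 : 0 <= (mm - nu + m i) / 4 by rewrite divr_ge0.
  have b4 : 0 <= (mm - nu - m i) / 4 by rewrite divr_ge0.
  have := lerD (ler_wpM2l a4 q1) (ler_wpM2l b4 q2); move/le_trans; apply.
  have : 0 <= 8 * e * C * nu by rewrite !mulr_ge0.
  have : 0 <= 8 * e * C * mm by rewrite !mulr_ge0//; lra.
  by lra.
have hsum : nu / 2 * ((A k0 k0 - X i k0 k0) ^+ 2 + (A k0 k1 - X i k0 k1) ^+ 2 + (A k1 k0 - X i k1 k0) ^+ 2 +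
    (A k1 k1 - X i k1 k1) ^+ 2) <= nu / 2 * (4 * C ^+ 2).
  apply: ler_wpM2l; first by rewrite divr_ge0.
  by have := hs k0 k0; have := hs k0 k1; have := hs k1 k0; have := hs k1 k1; lra.
have E : nu / 2 * dot4 A A + aff i A (det4 A) = f i + dot4 (sg i) (fun r k => A r k - X i r k) +
    m i * det4 (fun r k => A r k - X i r k) + nu / 2 * ((A k0 k0 - X i k0 k0) ^+ 2 + (A k0 k1 - X i k0 k1) ^+ 2 +
    (A k1 k0 - X i k1 k0) ^+ 2 + (A k1 k1 - X i k1 k1) ^+ 2).
  by rewrite /aff /dot4 /det4; field.
by rewrite /piece addrA E -!addrA !lerD2l; move: q hsum; lra.
Qed.

End pieces.

Lemma quad_derive (c : R) (s x : mt) (A : 'M[R]_2) r k :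
  is_derive A (delta_mx r k : 'M[R]_2) (fun A : 'M[R]_2 => c + dot4 s (fun r k => A r k - x r k) +
     mm / 2 * dot4 (fun r k => A r k - x r k) (fun r k => A r k - x r k)) (s r k + mm * (A r k - x r k)).
Proof.
apply/is_deriveP => e e0; exists (e / (`|mm| / 2 + 1)).
  by rewrite divr_gt0// ltr_pwDr// divr_ge0.
move=> h h0 hd.
set D := (X in `|X| <= _); have -> : D = h * (mm / 2).
  rewrite /D /dot4 !mxE.
  by case: (ord2P r) => ->; case: (ord2P k) => -> /=; rewrite ?mulr1n ?mulr0n; field.
rewrite normrM normrM [`|2^-1|]ger0_norm ?invr_ge0//; move: hd; rewrite ltr_pdivlMr ?ltr_pwDr// => /ltW.
by apply: le_trans; apply: ler_wpM2l => //; rewrite lerDl.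
Qed.

Theorem energy_exists : exists F : 'M[R]_2 -> R, [/\ smooth F, strongly_polyconvex F &
  exists2 rh, 0 < rh & forall i (A : 'M[R]_2), (forall r k, `|A r k - X i r k| < rh) ->
    forall r k, DF F A r k = mm * A r k + (sg i r k - mm * X i r k)].
Proof.
have [C C0 HC] := @fin_ub R ('I_5 * 'I_5 * ('I_2 * 'I_2))%type (fun q => `|X q.1.1 q.2.1 q.2.2 - X q.1.2 q.2.1 q.2.2|).
have mm0 : 0 < mm by apply: le_lt_trans (mmb (@Ordinal 5 0 isT)).
have [nu1 nu10 Hnu1] : exists2 n, 0 < n & forall i, n <= mm - `|m i| by apply: fin_lb => i; rewrite subr_gt0.
(* [nu1] keeps the coefficients of [quad] nonnegative. The other bound, together with the choice of
   [e], limits the error in [piece_le] to [s0 / 4]. *)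
pose nu := Num.min nu1 (s0 / (16 * (C ^+ 2 + 1))).
have C20 : 0 < C ^+ 2 + 1 by rewrite ltr_pwDr// sqr_ge0.
have nu0 : 0 < nu by rewrite lt_min nu10 divr_gt0// mulr_gt0.
have nuC : 2 * nu * C ^+ 2 <= s0 / 8.
  have : nu <= s0 / (16 * (C ^+ 2 + 1)) by rewrite ge_min lexx orbT.
  rewrite ler_pdivlMr ?mulr_gt0//; have := sqr_ge0 C; move: nu0 s00; move: (C ^+ 2) => c2; lra.
have nua i : 0 <= mm - nu + m i.
  have : nu <= nu1 by rewrite ge_min lexx.
  by have := Hnu1 i; have := ler_norm (- m i); rewrite normrN; lra.
have nub i : 0 <= mm - nu - m i.
  have : nu <= nu1 by rewrite ge_min lexx.
  by have := Hnu1 i; have := ler_norm (m i); lra.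
pose e := s0 / (64 * (C * mm + 1)).
have Cm0 : 0 <= C * mm by rewrite mulr_ge0// ltW.
have Cm1 : 0 < C * mm + 1 by rewrite ltr_pwDr.
have e0 : 0 < e by rewrite divr_gt0// mulr_gt0.
have eC : 8 * e * C * mm <= s0 / 8.
  have : e * (64 * (C * mm + 1)) = s0 by rewrite /e divfK// gt_eqF// mulr_gt0.
  by move: e0 Cm0; nra.
have [th [Cth cth thE thl]] := soft_square e0.
(* At [X i] the [i]-th piece leads by at least [s0 / 2], and nearby still by [s0 / 4]; this exceeds
   the lead [5 * h = s0 / 8] that the smoothed maximum asks for. *)
pose h := s0 / 40; have h0 : 0 < h by rewrite divr_gt0.
have [rho [rho' [Cr [dr mr] ir r0 r1]]] := soft_plus h0.
pose G (A : 'M[R]_2) d := smax5 rho (fun i => piece nu th i A d).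
pose F (A : 'M[R]_2) := nu / 2 * frob2 A + G A (\det A).
have Cp i : Cinf (fun A : 'M[R]_2 => piece nu th i A (det4 A)) by exact: Cinf_piece.
have FE A : F A = nu / 2 * dot4 A A + smax5 rho (fun i => piece nu th i A (det4 A)).
  by rewrite /F /G frob2E det4E.
have CF : Cinf F.
  rewrite (_ : F = fun A => nu / 2 * dot4 A A + smax5 rho (fun i => piece nu th i A (det4 A))); last first.
    by apply/funext => A; exact: FE.
  apply: CinfD.
    apply: CinfM; first exact: Cinf_cst.
    by do 3 (apply: CinfD; last by apply: CinfM; exact: Cinf_entry); apply: CinfM; exact: Cinf_entry.
  have Csm (u v : 'M[R]_2 -> R) : Cinf u -> Cinf v -> Cinf (fun A => smax rho (u A) (v A)).
    move=> Cu Cv; apply: CinfD => //; apply: (Cinf_comp (f := fun A => v A - u A) Cr).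
    by apply: CinfD => //; exact: CinfN.
  exact: (Csm _ _ (Csm _ _ (Csm _ _ (Csm _ _ (Cp _) (Cp _)) (Cp _)) (Cp _)) (Cp _)).
exists F; split; first exact: Cinf_smooth.
  exists nu; split => //; exists G; split => //.
  move=> A B s t l lb; apply: le_trans (smax5_convex dr mr ir _ _ lb).
  apply: (smax5_homo ir) => i; exact: (@piece_convex nu th i (nua i) (nub i) cth A B s t l lb).
pose Xm i : 'M[R]_2 := \matrix_(r, k) X i r k.
have dom i : nbhs (Xm i) [set A : 'M[R]_2 | forall j, j != i ->
    piece nu th j A (det4 A) + 5 * h <= piece nu th i A (det4 A)].
  set Xi := Xm i.
  pose D j (A : 'M[R]_2) := piece nu th i A (det4 A) - piece nu th j A (det4 A).
  have CD j : Cinf (D j) by apply: CinfD => //; exact: CinfN.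
  have cD j := Ck_continuous (CD j 0%N).
  have XiE r k : Xi r k = X i r k by rewrite mxE.
  have DX j : j != i -> s0 / 2 <= D j Xi.
    move=> ji; have ji' : j <> i by apply/eqP.
    have h1 : nu / 2 * dot4 Xi Xi + piece nu th i Xi (det4 Xi) = f i.
      rewrite (@piece_quad nu th i Xi e thE) => [|r k].
        by rewrite /dot4 !XiE; ring.
      by rewrite XiE subrr normr0 divr_ge0// ltW.
    have h2 := @piece_le nu th j Xi e C (nua j) (nub j) (ltW nu0) (ltW e0) thl _.
    have {}h2 := h2 (fun r k => eq_ind_r (fun x => `|x - X j r k| <= C) (HC ((i, j), (r, k))) (XiE r k)).
    have h3 := slack ji'.
    have E4 : dot4 (sg j) (fun r k => Xi r k - X j r k) = dot4 (sg j) (fun r k => X i r k - X j r k) by rewrite /dot4 !XiE.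
    have E5 : det4 (fun r k => Xi r k - X j r k) = det4 (fun r k => X i r k - X j r k) by rewrite /det4 !XiE.
    rewrite E4 E5 in h2; rewrite /D; move: h1 h2 h3 nuC eC s00; lra.
  apply: (@filter_forall _ 'I_5 (fun j A => j != i -> piece nu th j A (det4 A) + 5 * h <= piece nu th i A (det4 A)) (nbhs Xi) _) => j.
  have [->|ji] := eqVneq j i; first exact: nearW.
  have s3 : 0 < s0 / 4 by rewrite divr_gt0.
  have /cvgrPdist_lt/(_ _ s3) := cD j Xi; apply: filterS => A; rewrite ltr_distl => /andP[_ hA] _.
  by have := DX j ji; move: hA; rewrite /D /h; move: (piece nu th i _ _) (piece nu th j _ _) => a b; move: s00; lra.
have near_i i : exists2 rh, 0 < rh & forall A : 'M[R]_2, (forall r k, `|A r k - X i r k| < rh) ->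
    F A = f i + dot4 (sg i) (fun r k => A r k - X i r k) + mm / 2 * dot4 (fun r k => A r k - X i r k) (fun r k => A r k - X i r k).
  have /nbhs_ballP[d /= d0 Hd] := dom i.
  have e2 : 0 < e / 2 by exact: divr_gt0.
  have d2 : 0 < d / 2 by exact: divr_gt0.
  exists (Num.min (d / 2) (e / 2)); first by rewrite lt_min d2.
  move=> A hA; rewrite FE (@smax5_eq h rho h0 ir r0 r1 _ i); last first.
    apply: Hd; rewrite -ball_normE/= [ltLHS]/Num.Def.normr/= mx_normrE; apply: bigmax_lt => // -[r k] _ /=.
    rewrite !mxE distrC; have := hA r k; rewrite lt_min => /andP[hr _]; apply: lt_trans hr _.
    by rewrite ltr_pdivrMr// ltr_pMr// ltr1n.
  by apply: (@piece_quad nu th i A e thE) => r k; have := hA r k; rewrite lt_min => /andP[_ /ltW].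
have /choice[rh Hrh] i : exists rh, 0 < rh /\ forall A : 'M[R]_2, (forall r k, `|A r k - X i r k| < rh) ->
    F A = f i + dot4 (sg i) (fun r k => A r k - X i r k) + mm / 2 * dot4 (fun r k => A r k - X i r k) (fun r k => A r k - X i r k).
  by have [x x0 Hx] := near_i i; exists x.
have [rm rm0 Hrm] := fin_lb (fun i => (Hrh i).1).
exists rm => // i A hA r k; rewrite mxE.
have [eta eta0 Heta] : exists2 eta, 0 < eta & forall rk : 'I_2 * 'I_2, eta <= rm - `|A rk.1 rk.2 - X i rk.1 rk.2|.
  by apply: fin_lb => rk; rewrite subr_gt0.
have nF : \forall A' \near A, F A' = f i + dot4 (sg i) (fun r k => A' r k - X i r k) +
    mm / 2 * dot4 (fun r k => A' r k - X i r k) (fun r k => A' r k - X i r k).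
  apply/nbhs_ballP; exists eta => // A' AA'; apply: (Hrh i).2 => r' k'; apply: lt_le_trans (Hrm i).
  have hd : `|A r' k' - A' r' k'| < eta.
    move: AA'; rewrite -ball_normE/= => AA'; apply: le_lt_trans AA'.
    have -> : A r' k' - A' r' k' = (A - A') r' k' by rewrite !mxE.
    rewrite [leRHS]/Num.Def.normr/= mx_normrE.
    exact: (le_bigmax _ (fun ij : 'I_2 * 'I_2 => `|(A - A') ij.1 ij.2|) (r', k')).
  have := Heta (r', k'); rewrite /= => he.
  rewrite -(subrK (A r' k') (A' r' k')) -addrA (le_lt_trans (ler_normD _ _))// distrC.
  by rewrite -ltrBrDr; apply: lt_le_trans hd he.
rewrite (near_eq_derive _ nF); have [_ ->] := quad_derive (f i) (sg i) (X i) A r k.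
by ring.
Qed.

End energy.

(** * A rational T_5 configuration *)

Section data.
Context {R : realType}.
Notation k0 := (@Ordinal 2 0 isT).
Notation k1 := (@Ordinal 2 1 isT).
Notation V5 := 'rV[R]_5.

Definition tab (l : seq R) (i : 'I_5) (r k : 'I_2) : R := nth 0 l (4 * i + 2 * r + k).

(* A T5 configuration with vertices (TX i, TS i) found by a numerical search and rounded to rationals so
   that the loop still closes exactly; the affine supports below it are separated by more than 3. *)
Definition TX := tab [:: 5; - (10 / 3); 65 / 6; - (65 / 9); 3 / 8; 13 / 4; 33 / 4; - (47 / 6);
  21 / 8; - (5 / 4); (2 * 100 + 3) / 32; - ((2 * 100 + 41) / 48); - ((2 * 100 + 9) / 56); - ((2 * 100 + 13) / 28); - ((32 * 100 + 75) / 3 / 112); - ((35 * 100 + 59) / 168);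
  31 / 168; 31 / 21; 61 / 112; 61 / 14].
Definition TS := tab [:: - (5 / 3); - (5 / 2); - (5 / 2); - (15 / 4); - 1; - (3 / 2); - (3 / 2); - (9 / 4);
  - (5 / 2); 7 / 4; - (15 / 4); 21 / 8; - (22 / 21); - (2 / 7); - (11 / 7); - (3 / 7);
  32 / 63; - (4 / 63); 16 / 21; - (2 / 21)].
(** Values of the energy at the five vertices; [Tm] gives the determinant coefficients of the
    supporting functions there. *)
Definition Tf (i : 'I_5) : R := nth 0 [:: - 7; - (43 / 2); - 12; 24; - 1] i.
Definition Tm (i : 'I_5) : R := nth 0 [:: - (15 / 4); 1 / 2; 31 / 4; 1 / 4; 17 / 4] i.
Definition TB (i : 'I_5) (r k : 'I_2) : R := TS i r k - 8 * TX i r k.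
Definition TY : V5 := \row_j nth 0 [:: 3 / 2; 5 / 12; 35 / 6; 35 / 4; 105 / 2] j.
Definition Tt : V5 := \row_j nth 0 [:: - (3 / 2); - (1 / 2); 13 / 6; 1; 1 / 8] j.

Lemma Tm_lt i : `|Tm i| < 8.
Proof. by case: i => -[|[|[|[|[|//]]]]] iP; rewrite /Tm /= ltr_norml; apply/andP; split; lra. Qed.

Lemma TX_slack i j : i <> j ->
  3 <= Tf j - Tf i - dot4 (TS i) (fun r k => TX j r k - TX i r k) - Tm i * det4 (fun r k => TX j r k - TX i r k).
Proof.
case: i => -[|[|[|[|[|//]]]]] iP; case: j => -[|[|[|[|[|//]]]]] jP ij;
  try (by exfalso; apply: ij; exact: val_inj);
  by rewrite /dot4 /det4 /TX /TS /Tf /Tm /tab /=; lra.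
Qed.

Lemma TX_sep i j : i <> j -> 3 / 16 <= `|TX i k0 k0 - TX j k0 k0|.
Proof.
case: i => -[|[|[|[|[|//]]]]] iP; case: j => -[|[|[|[|[|//]]]]] jP ij;
  try (by exfalso; apply: ij; exact: val_inj);
  rewrite /TX /tab /= ler_normr; apply/orP; first [by left; lra|by right; lra].
Qed.

Lemma div_eq (x q y : R) : 0 < q -> x = y * q -> x / q = y.
Proof. by move=> q0 ->; rewrite mulfK// gt_eqF. Qed.

Lemma TY_pos : pos TY.
Proof. by case=> -[|[|[|[|[|//]]]]] iP; rewrite mxE /=; lra. Qed.

Lemma TB_aff (w : 'I_5 -> R) : (forall r k, comb TB w r k = 0) -> \sum_j w j = 0 -> forall j, w j = 0.
Proof.
move=> H; rewrite sum5 => H5.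
have := H k0 k0; have := H k0 k1; have := H k1 k0; have := H k1 k1.
rewrite /comb !sum5 /TB /TX /TS /tab /= => E1 E2 E3 E4.
case=> -[|[|[|[|[|//]]]]] iP; rewrite (bool_irrelevance iP isT);
  move: (w _) (w _) (w _) (w _) (w _) H5 E1 E2 E3 E4 => a b c d e *; lra.
Qed.

Definition TN (i : nat) : R := nth 0 [:: 69; (3 * 100 + 45) / 2; (8 * 100 + 5) / 4; (24 * 100 + 15) / 4; (24 * 100 + 15) / 2; (48 * 100 + 30)] i.

Lemma NnE i : (i < 6)%N -> Nn 70 i TY = TN i.
Proof. by case: i => [|[|[|[|[|[|//]]]]]] _; rewrite /Nn sum5 /wt !mxE /TN /=; lra. Qed.

(** The turning parameters of the loop. The product of the numbers [1 - Tl i] is [1 / 70], which is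
    where the factor [g = 70] comes from: one turn multiplies the normalisation by it. *)
Definition Tl (i : 'I_5) : R := nth 0 [:: 3 / 5; 1 / 7; 2 / 3; 1 / 2; 3 / 4] i.

Lemma lamE i : lam 70 i TY = Tl i.
Proof.
rewrite /lam; apply: div_eq; first by apply: Nn_gt0; [lra|exact: TY_pos].
rewrite (@NnE i.+1 (ltn_ord i)).
by case: i => -[|[|[|[|[|//]]]]] iP; rewrite /TN /Tl mxE /=; lra.
Qed.

Definition TV := tab [:: - (125 / 3); 145 / 6; - ((5 * 100 + 35) / 6); (19 * 100 + 45) / 36; 21; - 42; - 14; 28;
  - (3 / 2); 13 / 4; 1; 51 / 8; (10 * 100 + 88) / 21; (10 * 100 + 48) / 21; (27 * 100 + 56) / 21; (26 * 100 + 96) / 21;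
  - ((2 * 100 + 44) / 63); - ((29 * 100 + 92) / 63); - ((3 * 100 + 2) / 21); - ((29 * 100 + 36) / 21)].

Lemma VvE i r k : Vv TB 70 i TY r k = TV i r k.
Proof.
rewrite /Vv /comb; under eq_bigr do rewrite /wn mulrAC.
rewrite -mulr_suml (div_eq (y := TB i r k - TV i r k)); first by ring.
  by apply: Nn_gt0; [lra|exact: TY_pos].
rewrite sum5 (@NnE i (ltnW (ltn_ord i))).
case: i => -[|[|[|[|[|//]]]]] iP; case: (ord2P r) => ->; case: (ord2P k) => ->;
  by rewrite /TN /wt !mxE /TB /TX /TS /TV /tab /=; lra.
Qed.

Definition TA := tab [:: 5; - (10 / 3); 65 / 6; - (65 / 9); - (21 / 8); 21 / 4; 7 / 4; - (7 / 2);
  0; 0; - (13 / 32); - (3 / 16); - (89 / 14); - (89 / 14); - ((13 * 100 + 63) / 84); - ((13 * 100 + 63) / 84);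
  31 / 42; 124 / 21; 61 / 28; 122 / 7].

Lemma AstE i r k : Ast TB 70 8 i TY Tt r k = TA i r k.
Proof.
rewrite /Ast /proj !VvE (div_eq (y := - 8 * TA i r k)); first by lra.
  exact: sqr1_gt0.
case: i => -[|[|[|[|[|//]]]]] iP; case: (ord2P r) => ->; case: (ord2P k) => ->;
  by rewrite /xi /Tt !mxE /TV /TA /tab /=; lra.
Qed.

Definition TD := tab [:: 70 / 13; 92 / 13; (4 * 100 + 43) / 39; (2 * 100 + 2) / 13; - (24 / 5); - (12 / 5); 16 / 5; 8 / 5;
  - (78 / 5 / 41); - (36 / 5 / 41); - (81 / 5 / 41); - (132 / 5 / 41); (2 * 100 + 72) / 21; - ((2 * 100 + 62) / 21); (6 * 100 + 89) / 21; - ((6 * 100 + 74) / 21);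
  - ((94 * 100 + 72) / 3 / 91); (16 * 100) / 3 / 91; - ((93 * 100 + 44) / 91); (13 * 100 + 76) / 91].

Lemma dprojE i r k : lam 70 i TY * dproj (Vv TB 70 i TY) (Tt 0 i) (Tt 0 i) r k = TD i r k.
Proof.
rewrite lamE /dproj !VvE (div_eq (y := TD i r k / Tl i)).
- rewrite mulrC divfK// gt_eqF//; case: i => -[|[|[|[|[|//]]]]] iP; rewrite /Tl /=; lra.
- by rewrite mulr_gt0// sqr1_gt0.
case: i => -[|[|[|[|[|//]]]]] iP; case: (ord2P r) => ->; case: (ord2P k) => ->;
  by rewrite /Tl /Tt !mxE /TV /TD /tab /=; lra.
Qed.

Lemma T_loop : closed_loop TB 70 8 Tt TY Tt.
Proof.
split=> // r k; rewrite /Aof big_mkcond sum5 /= !lamE !AstE.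
by case: (ord2P r) => ->; case: (ord2P k) => ->; rewrite /Tl /TA /tab /=; lra.
Qed.

(** Nondegeneracy of the loop: once the first slope is frozen, the linearised closing equations have
    only the zero solution, so the loop survives small changes of the weights. *)
Lemma T_ker (v : 'I_5 -> R) : v (@Ordinal 5 0 isT) = 0 ->
  (forall r k, \sum_i v i * (lam 70 i TY * dproj (Vv TB 70 i TY) (Tt 0 i) (Tt 0 i) r k) = 0) -> forall i, v i = 0.
Proof.
move=> v0 H.
have E r k : \sum_i v i * TD i r k = 0 by rewrite -[RHS](H r k); apply: eq_bigr => i _; rewrite dprojE.
have := E k0 k0; have := E k0 k1; have := E k1 k0; have := E k1 k1.
rewrite !sum5 v0 /TD /tab /= => E1 E2 E3 E4.
case=> -[|[|[|[|[|//]]]]] iP; rewrite (bool_irrelevance iP isT) ?v0//;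
  move: (v _) (v _) (v _) (v _) E1 E2 E3 E4 => b c d e *; lra.
Qed.

(** Joins the two halves: the vertices reached by the loop are the matrices at which the energy was
    prescribed. *)
Lemma XvE i r k : Xv TB 70 8 TY Tt i r k = TX i r k.
Proof.
rewrite /Xv /Aof big_mkcond sum5 !lamE !AstE.
case: i => -[|[|[|[|[|//]]]]] iP; case: (ord2P r) => ->; case: (ord2P k) => ->;
  by rewrite /Tl /TA /TX /tab /=; lra.
Qed.

End data.

Theorem theorem1p1 (R : realType) :
  exists F : 'M[R]_2 -> R,
    smooth F /\ strongly_polyconvex F /\
    forall (Om : set (R * R)) (T : R),
      bounded_domain Om -> 0 < T ->
      forall phi : R * R -> 'rV[R]_2, C1_0 Om phi ->
      exists2 eps0 : R, 0 < eps0 &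
        forall eps : R, `|eps| < eps0 ->
          exists U : nat -> (R * R) * R -> 'rV[R]_2,
            (forall n,
               lip_weak_solution F Om T (U n) /\
               zero_on_parabolic_boundary Om T (U n) /\
               (forall x, Om x -> U n (x, T) = eps *: phi x) /\
               Du_nowhere_continuous Om T (U n)) /\
            (forall m n, m <> n ->
               exists z, OmT Om T z /\ U m z <> U n z).
Proof.
have [F [sF pF [rh rh0 HF]]] := @energy_exists R TX TS Tf Tm 8 3 ltac:(lra) Tm_lt TX_slack.
(* The bound [1 / 16] makes [3 * rho] at most the separation [3 / 16] of the upper left entries in
   [TX_sep]. *)
pose rho := Num.min rh (1 / 16).
have rho0 : 0 < rho by rewrite lt_min rh0 divr_gt0.
have rr : rho <= rh by rewrite ge_min lexx.
have r16 : rho <= 1 / 16 by rewrite ge_min lexx orbT.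
have XF i (A : 'M[R]_2) : (forall r k, `|A r k - Xv TB 70 8 TY Tt i r k| < rho) ->
    forall r k, DF F A r k = 8 * A r k + TB i r k.
  by move=> H; apply: HF => r k; rewrite -XvE; exact: lt_le_trans (H r k) rr.
have Xsep i j : i <> j -> exists r k, 3 * rho <= `|Xv TB 70 8 TY Tt i r k - Xv TB 70 8 TY Tt j r k|.
  move=> ij; have h := @TX_sep R i j ij; exists (@Ordinal 2 0 isT), (@Ordinal 2 0 isT); rewrite !XvE; apply: le_trans h.
  by move: r16; move: (rho) => x; lra.
have g1 : 1 < 70 :> R by lra.
have m0 : 0 < 8 :> R by lra.
have m1 : 1 <= 8 :> R by lra.
have [U [M [d [c [K [L [l [r0 [P0 inc]]]]]]]]] :=
  geometry_inclusion g1 m0 (@TB_aff R) (@TY_pos R) (@T_ker R) m1 (@T_loop R) rho0 XF Xsep.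
exists F; split => //; split => // Om T bOm T0 phi Cphi.
have [eps0 e0 H] := infinitely_many_solutions inc bOm T0 Cphi.
by exists eps0.
Qed.
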